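(* Let $D=D_h=\{z\in\mathbb C^n: h(z)<1\}$ be a balanced domain in $\mathbb C^n$. Then the following are equivalent: (1) $D$ is an $L_h^2$-domain of holomorphy; (2) there is a function $f\in L_h^2(D)$ such that $h(z)=h_f^*(z)$ for all $z\in\mathbb C^n$; (3) $h(z)=h_{BK}^*(z)$ for all $z\in\mathbb C^n$.
   Context: A balanced domain is $D=D_h:=\{z\in\mathbb C^n:h(z)<1\}$ where $h:\mathbb C^n\to[0,\infty)$ is upper semicontinuous and homogeneous, i.e. $h(\lambda z)=|\lambda|h(z)$ for $\lambda\in\mathbb C$, $z\in\mathbb C^n$. $L_h^2(D):=L^2(D)\cap\mathcal O(D)$ is the Bergman space (Lebesgue measure). $D$ is an $L_h^2$-domain of holomorphy if there are no domains $D_0,D_1\subset\mathbb C^n$ with $\emptyset\ne D_0\subset D_1\cap D$, $D_1\not\subset D$, such that for every $f\in L_h^2(D)$ there is $\tilde f\in\mathcal O(D_1)$ with $\tilde f\equiv f$ on $D_0$. $\mathcal H^d$ denotes the set of polynomials in $\mathbb C[z_1,\dots,z_n]$ that are homogeneous of degree $d$ or identically $0$, and $\mathcal H^d(D):=\mathcal H^d\cap L^2(D)$. Every $f\in\mathcal O(D)$ has a unique expansion $f=\sum_{d=0}^\infty P_d$ with $P_d\in\mathcal H^d$, converging locally uniformly on $D$; put $h_f(z):=\limsup_{d\to\infty}\sqrt[d]{|P_d(z)|}$, $z\in\mathbb C^n$. One may choose an orthonormal basis $\{P_{d,j}: d=0,1,\dots,\ j\in\mathcal J_d\}$ of $L_h^2(D)$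 with $P_{d,j}\in\mathcal H^d(D)$ (the index sets $\mathcal J_d$ are finite, possibly empty; an empty sum is $0$). Put $h_{BK}(z):=\limsup_{d\to\infty}\sqrt[2d]{\sum_{j\in\mathcal J_d}|P_{d,j}(z)|^2}$, $z\in\mathbb C^n$; this does not depend on the choice of such a basis. $u^*$ denotes the upper semicontinuous regularization of a function $u$. *)

(* Defs.v *)
From HB Require Import structures.
From mathcomp Require Import all_boot all_order all_algebra.
(* The notations of mpoly clash with those of MathComp-Analysis; some of its
   names (isMeasure, ...) are to be shadowed by those of the latter. *)
From mathcomp Require Import -(notations) mpoly.
From mathcomp Require Import all_classical all_reals all_analysis.
From mathcomp Require Import complex.

Set Implicit Arguments.
Unset Strict Implicit.
Unset Printing Implicit Defensive.
Import Order.TTheory GRing.Theory Num.Theory.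
Import numFieldNormedType.Exports.
Local Open Scope classical_set_scope.
Local Open Scope ring_scope.
Local Open Scope complex_scope.
Local Notation normc := ComplexField.Normc.normc.

(* R[i] with the topology of its modulus, as a normed space over itself; this
   makes 'rV[R[i]]_n a normed R[i]-module, whose differentiable functions are
   the complex differentiable ones. *)
HB.instance Definition _ (R : realType) := NormedModule.copy R[i] R[i]^o.

(* The library's sigma-finite structure on m1 \x m2 is only inferred for
   subprobabilities, hence this alias. *)
Section prod_measure.
Context d1 d2 (T1 : measurableType d1) (T2 : measurableType d2) (R : realType).
Variable m1 : {sigma_finite_measure set T1 -> \bar R}.
Variable m2 : {sigma_finite_measure set T2 -> \bar R}.
Local Open Scope ereal_scope.

Definition prod_measure : set (T1 * T2) -> \bar R := m1 \x m2.

HB.instance Definition _ := Measure.copy prod_measure (m1 \x m2).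

Let prod_measure_sigma_finite : sigma_finite setT prod_measure.
Proof.
have /sigma_finiteP[F [TF ndF Foo]] := sigma_finiteT m1.
have /sigma_finiteP[G [TG ndG Goo]] := sigma_finiteT m2.
exists (fun n => F n `*` G n).
  rewrite -setXTT TF TG predeqE => -[x y]; split.
    move=> [/= [n _ Fnx] [k _ Gky]]; exists (maxn n k) => //; split.
    - by move: x Fnx; exact/subsetPset/ndF/leq_maxl.
    - by move: y Gky; exact/subsetPset/ndG/leq_maxr.
  by move=> [n _ []/= ? ?]; split; exists n.
move=> k; have [? ?] := Foo k; have [? ?] := Goo k.
split; first exact: measurableX.
rewrite /prod_measure product_measure1E// lte_mul_pinfty//.
by rewrite ge0_fin_numE.
Qed.

HB.instance Definition _ := Measure_isSigmaFinite.Build _ _ _ prod_measure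
  prod_measure_sigma_finite.

End prod_measure.

Section tuple_measure.
Context d (T : measurableType d) (R : realType).
Local Open Scope ereal_scope.

Definition cons_pair n (p : T * n.-tuple T) : n.+1.-tuple T :=
  [the n.+1.-tuple T of p.1 :: p.2].

Lemma measurable_cons_pair n : measurable_fun setT (@cons_pair n).
Proof. exact: measurable_cons. Qed.

Section cons_measure.
Variables (m : {sigma_finite_measure set T -> \bar R}) (n : nat).
Variable mu : {sigma_finite_measure set (n.-tuple T) -> \bar R}.

Definition cons_measure : set (n.+1.-tuple T) -> \bar R :=
  pushforward (prod_measure m mu) (@cons_pair n).

Let cons_measure0 : cons_measure set0 = 0.
Proof. by rewrite /cons_measure /pushforward preimage_set0 measure0. Qed.

Let cons_measure_ge0 A : 0 <= cons_measure A.
Proof. by rewrite /cons_measure /pushforward measure_ge0. Qed.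

Let cons_measure_sigma_additive : semi_sigma_additive cons_measure.
Proof.
move=> F mF tF mUF; rewrite /cons_measure /pushforward preimage_bigcup.
have mpre A : measurable A -> measurable (@cons_pair n @^-1` A).
  by move=> mA; rewrite -[X in measurable X]setTI; exact: measurable_cons_pair.
apply: measure_semi_sigma_additive.
- by move=> k; exact: mpre.
- apply/trivIsetP => /= i j _ _ ij; rewrite -preimage_setI.
  by move/trivIsetP : tF => /(_ _ _ _ _ ij) ->//; rewrite preimage_set0.
- by rewrite -preimage_bigcup; exact: mpre.
Qed.

HB.instance Definition _ := isMeasure.Build _ _ _ cons_measure
  cons_measure0 cons_measure_ge0 cons_measure_sigma_additive.

Let cons_measure_sigma_finite : sigma_finite setT cons_measure.
Proof.
have [F FT Ffin] := sigma_finiteT (prod_measure m mu).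
pose g (t : n.+1.-tuple T) := (thead t, [tuple of behead t]).
have gK : cancel g (@cons_pair n).
  by move=> t; rewrite /cons_pair /g /= [RHS]tuple_eta; exact: val_inj.
have consK : cancel (@cons_pair n) g.
  move=> [x t]; rewrite /g /cons_pair /=; congr pair.
  by apply: val_inj.
have mg : measurable_fun setT g.
  by apply/measurable_fun_pair; [exact: measurable_tnth|exact: measurable_behead].
exists (fun k => g @^-1` F k).
  by rewrite -preimage_bigcup -FT preimage_setT.
move=> k; have [mF Foo] := Ffin k; split.
  by rewrite -[X in measurable X]setTI; exact: mg.
rewrite /cons_measure /pushforward -comp_preimage.
by rewrite (_ : g \o _ = id) ?preimage_id//; apply/funext => p; exact: consK.
Qed.

HB.instance Definition _ := Measure_isSigmaFinite.Build _ _ _ cons_measure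
  cons_measure_sigma_finite.

End cons_measure.

Fixpoint tuple_measure (m : {sigma_finite_measure set T -> \bar R}) n :
    {sigma_finite_measure set (n.-tuple T) -> \bar R} :=
  match n with
  | 0 => dirac [tuple]
  | n'.+1 => cons_measure m (tuple_measure m n')
  end.

End tuple_measure.

Section Cn.
Context (R : realType) (n : nat).
Local Notation C := R[i].
Implicit Types (D : set 'rV[C]_n) (f g : 'rV[C]_n -> C) (z : 'rV[C]_n).

(* Lebesgue measure on C^n = (R^2)^n. *)
Definition lebesgue_Cn :
    {sigma_finite_measure set (n.-tuple (measurableTypeR R * measurableTypeR R))
       -> \bar R} :=
  tuple_measure (prod_measure lebesgue_measure lebesgue_measure) n.

Definition of_coords (t : n.-tuple (measurableTypeR R * measurableTypeR R)) :
    'rV[C]_n :=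
  \row_k ((tnth t k).1 +i* (tnth t k).2).

Definition integral_Cn D (F : 'rV[C]_n -> \bar R) : \bar R :=
  (\int[lebesgue_Cn]_(t in of_coords @^-1` D) F (of_coords t))%E.

(* Only used for functions that are continuous on the open set D, which are
   automatically measurable. *)
Definition square_integrable D f :=
  (integral_Cn D (fun z => (normc (f z) ^+ 2)%:E) < +oo)%E.

Definition inner D f g : C :=
  let fg z := f z * (g z)^* in
  fine (integral_Cn D (fun z => (complex.Re (fg z))%:E)) +i*
  fine (integral_Cn D (fun z => (complex.Im (fg z))%:E)).

Definition domain D := [/\ D !=set0, open D & connected D].

(* Frechet differentiability over R[i]; values of f outside D are irrelevant. *)
Definition holomorphic D f := forall z, D z -> differentiable f z.

Definition bergman D f := holomorphic D f /\ square_integrable D f.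

Definition L2h_domain_of_holomorphy D :=
  ~ exists D0 D1 : set 'rV[C]_n,
      [/\ domain D0, domain D1, D0 `<=` D1 `&` D, ~ (D1 `<=` D) &
        forall f, bergman D f ->
          exists2 ft, holomorphic D1 ft & forall z, D0 z -> ft z = f z].

Definition balanced_gauge (h : 'rV[C]_n -> R) :=
  [/\ forall z, 0 <= h z,
      forall (l : C) z, h (l *: z) = normc l * h z &
      forall z a, h z < a -> \forall w \near z, h w < a].

Definition balanced_domain (h : 'rV[C]_n -> R) : set 'rV[C]_n :=
  [set z | h z < 1].

Definition usc_reg (u : 'rV[C]_n -> \bar R) z : \bar R := limf_esup u (nbhs z).

Definition peval (p : mpoly n C) z : C := meval (z ord0) p.

(* p is homogeneous of degree d or zero *)
Definition homog_poly d (p : mpoly n C) : bool := p \is ishomog1 d mdeg.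

Definition homog_expansion D f (P : nat -> mpoly n C) :=
  (forall d, homog_poly d (P d)) /\
  forall z, D z -> exists2 U, nbhs z U &
    {uniform U, (fun N w => \sum_(d < N) peval (P d) w) @ \oo --> f}.

(* The expansion of f on a balanced domain D exists and is unique as soon as f
   is holomorphic on D. *)
Definition homog_part D f : nat -> mpoly n C :=
  xget (fun=> 0) [set P | homog_expansion D f P].

Definition h_f D f z : \bar R :=
  limn_esup (fun d => (normc (peval (homog_part D f d) z) `^ d%:R^-1)%:E).

(* B d lists the P_{d,j}, j in J_d. *)
Definition homog_onb D (B : nat -> seq (mpoly n C)) :=
  [/\ forall d p, p \in B d -> homog_poly d p /\ square_integrable D (peval p),
      forall d e i j, (i < size (B d))%N -> (j < size (B e))%N ->
        inner D (peval (B d)`_i) (peval (B e)`_j)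
        = ((d == e) && (i == j))%:R &
      forall f, bergman D f -> forall eps : R, 0 < eps ->
        exists (N : nat) (c : nat -> nat -> C),
          (integral_Cn D (fun z => (normc (f z -
             \sum_(d < N) \sum_(j < size (B d)) c d j * peval (B d)`_j z)
             ^+ 2)%:E) < eps%:E)%E].

(* Such a basis exists for balanced D, and h_BK does not depend on its
   choice. *)
Definition homog_basis D : nat -> seq (mpoly n C) :=
  xget (fun=> [::]) [set B | homog_onb D B].

Definition h_BK D z : \bar R :=
  limn_esup (fun d => ((\sum_(p <- homog_basis D d) normc (peval p z) ^+ 2)
                         `^ (2 * d)%:R^-1)%:E).

End Cn.

(* Main.v *)
(* Let S_d(z) be the sum of the |P_{d,j}(z)|^2, that is, the largest value of |Q(z)|^2 for Q in H^d(D) of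
   norm at most 1. Averaging over rotations by roots of unity gives Bessel's inequality for homogeneous
   expansions, hence |P_d|^2 <= ||f||^2 S_d for f in L_h^2(D); as S_d is locally bounded on D, also
   h_f <= h_BK <= h, which yields (2) => (3).

   (3) => (1): if all f in L_h^2(D) extend from D0 to D1, the uniform boundedness principle, applied to
   the Taylor coefficients of the extensions, bounds the extensions locally on D1 by ||f||. Since
   polynomials extend themselves, S_d is locally bounded on D1, so that h = h_BK^* <= 1 on D1 and, D1
   being open, h < 1 there.

   (1) => (2): the sum of (d+1)^-2 Q_d, for Q_d extremal in S_d at well-chosen points, defines f with
   h_f^* >= h_BK^*. If h_f^*(z0) < h(z0), then Hartogs' lemma shows that all homogeneous expansions converge
   near z0 / h(z0), which is not in D. *)
Require Import Defs.
From HB Require Import structures.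
From mathcomp Require Import all_boot all_order all_algebra.
From mathcomp Require Import -(notations) mpoly.
From mathcomp Require Import all_classical all_reals all_analysis.
From mathcomp Require Import measurable_realfun.
From mathcomp Require Import complex.
From mathcomp Require Import ring lra.
Set Implicit Arguments.
Unset Strict Implicit.
Unset Printing Implicit Defensive.
Import Order.TTheory GRing.Theory Num.Theory.
Import numFieldNormedType.Exports.
Local Open Scope classical_set_scope.
Local Open Scope ring_scope.
Local Open Scope complex_scope.
Local Notation normc := ComplexField.Normc.normc.
Local Notation Re := (@complex.Re _).
Local Notation Im := (@complex.Im _).

(** * Complex moduli and polydiscs *)

Section complex_modulus.
Context (R : realType).
Local Notation C := R[i].
Implicit Types (x y z : C) (r : R).

(** Only complex differentiability is given, so everything analytic rests on one-variable results
    for the closed unit disc, obtained from Goursat's bisection and applied along complex lines.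
    Constants such as the 2 in Cauchy's estimates are never optimised, as only geometric rates
    survive a [d]-th root. Three obstacles shape the rest. Hartogs' lemma concerns the functions
    [log |P_d| / d], which may take the value minus infinity; bounded fractional powers
    [|P_d|^(2^-j)] replace them, and since [2^j] is comparable to [d], the constant of a crude
    sub-mean value inequality is absorbed by a fixed power of a ratio greater than 1. The extension
    of [f] to [D1] is a relation rather than a linear map, so uniform boundedness is proved for
    pairs ([f], extension), a polynomial being paired with itself; the bound then spreads over [D1]
    by connectedness. The function in (2) has to be large at points dense enough for the upper
    regularization, hence a countable family of rational polydiscs, each served by infinitely many
    degrees; the weights [(d+1)^-2] make the series converge and disappear in the roots. *)

Lemma normc_norm z : `|z| = (normc z)%:C. Proof. by []. Qed.

Lemma normc_ge0 z : 0 <= normc z.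
Proof. by rewrite -ler0c -normc_norm. Qed.

Lemma normcM x y : normc (x * y) = normc x * normc y.
Proof. exact: ComplexField.Normc.normcM. Qed.

Lemma normcD x y : normc (x + y) <= normc x + normc y.
Proof. exact: (@le_normcD R x y). Qed.

Lemma normcN z : normc (- z) = normc z.
Proof. exact: (@normcN R z). Qed.

Lemma normc_distC x y : normc (x - y) = normc (y - x).
Proof. by rewrite -normcN opprB. Qed.

Lemma normcB x y : normc (x - y) <= normc x + normc y.
Proof. by rewrite (le_trans (normcD _ _))// normcN. Qed.

Lemma normcB_ge x y : normc x - normc y <= normc (x - y).
Proof. by rewrite lerBlDr (le_trans _ (normcD _ _))// subrK. Qed.

Lemma normc0 : normc (0 : C) = 0. Proof. exact: ComplexField.Normc.normc0. Qed.

Lemma normc1 : normc (1 : C) = 1. Proof. exact: ComplexField.Normc.normc1. Qed.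

Lemma normc_eq0 z : (normc z == 0) = (z == 0).
Proof. by apply/eqP/eqP => [/ComplexField.Normc.eq0_normc|->]//; exact: normc0. Qed.

Lemma normc_gt0 z : (0 < normc z) = (z != 0).
Proof. by rewrite lt_neqAle eq_sym normc_eq0 normc_ge0 andbT. Qed.

Lemma normcV z : normc z^-1 = (normc z)^-1.
Proof. exact: ComplexField.Normc.normcV. Qed.

Lemma normcX z k : normc (z ^+ k) = normc z ^+ k.
Proof. by elim: k => [|k ih]; rewrite ?expr0 ?normc1// !exprS normcM ih. Qed.

Lemma normc_real r : normc r%:C = `|r|.
Proof. by rewrite /= expr0n addr0 sqrtr_sqr. Qed.

Lemma normc_nat k : normc (k%:R : C) = k%:R.
Proof. by rewrite -(rmorph_nat (real_complex R)) normc_real normr_nat. Qed.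

Lemma normc_conj z : normc z^* = normc z.
Proof. by case: z => a b /=; rewrite sqrrN. Qed.

Lemma sqr_normcE z : normc z ^+ 2 = Re z ^+ 2 + Im z ^+ 2.
Proof. by case: z => a b /=; rewrite sqr_sqrtr// addr_ge0 ?sqr_ge0. Qed.

Lemma normc_Re z : `|Re z| <= normc z.
Proof.
by rewrite -(ler_pXn2r (ltn0Sn 1)) ?nnegrE ?normc_ge0// real_normK ?num_real//
  sqr_normcE lerDl sqr_ge0.
Qed.

Lemma normc_Im z : `|Im z| <= normc z.
Proof.
by rewrite -(ler_pXn2r (ltn0Sn 1)) ?nnegrE ?normc_ge0// real_normK ?num_real//
  sqr_normcE lerDr sqr_ge0.
Qed.

Lemma normc_le_ReIm z : normc z <= `|Re z| + `|Im z|.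
Proof.
rewrite -(ler_pXn2r (ltn0Sn 1)) ?nnegrE ?normc_ge0// ?addr_ge0//.
rewrite sqr_normcE -(real_normK (num_real (Re z))) -(real_normK (num_real (Im z))).
by rewrite sqrrD -addrA lerD2l lerDr mulrn_wge0// mulr_ge0.
Qed.

Lemma normc_sum (I : Type) (s : seq I) (P : pred I) (F : I -> C) :
  normc (\sum_(i <- s | P i) F i) <= \sum_(i <- s | P i) normc (F i).
Proof.
elim/big_ind2 : _ => [|x y u v hx hy|//]; first by rewrite normc0.
by rewrite (le_trans (normcD _ _))// lerD.
Qed.

Lemma mulc_conj z : z * z^* = (normc z ^+ 2)%:C.
Proof. by rewrite rmorphXn/= -normc_norm sqr_normc. Qed.

(** Balls of [R[i]] have radii in [R[i]]; a positive one is real, so its real part serves as a real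
    radius. *)
Lemma nbhs_complexP z (U : set C) : nbhs z U <->
  exists2 r : R, 0 < r & forall w, normc (w - z) < r -> U w.
Proof.
split => [/nbhs_ballP[e e0 eU]|[r r0 rU]].
  have er : e = (Re e)%:C by rewrite RRe_real// gtr0_real.
  exists (Re e); first by move: e0; rewrite /= {1}er ltcR.
  move=> w zw; apply: eU; rewrite er -ball_normE/= normc_norm ltcR.
  by rewrite normc_distC.
apply/nbhs_ballP; exists r%:C => /=; first by rewrite ltcR.
move=> w; rewrite -ball_normE/= normc_norm ltcR normc_distC; exact: rU.
Qed.

Lemma cvg_complexP (T : Type) (F : set_system T) (f : T -> C) z : Filter F ->
  f @ F --> z <-> forall e : R, 0 < e -> \forall t \near F, normc (f t - z) < e.
Proof.
move=> FF; split => [fz e e0|H U /nbhs_complexP[e e0 eU]].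
  by apply: (fz [set w | normc (w - z) < e]); apply/nbhs_complexP; exists e.
by apply: filterS (H _ e0) => t; exact: eU.
Qed.

Lemma continuous_Re : continuous (Re : C -> R).
Proof.
move=> z; apply/(@cvgrPdist_lt _ _ _ (nbhs z)) => e e0; apply/nbhs_complexP; exists e => // w.
by apply: le_lt_trans; rewrite normc_distC -raddfB normc_Re.
Qed.

Lemma continuous_Im : continuous (Im : C -> R).
Proof.
move=> z; apply/(@cvgrPdist_lt _ _ _ (nbhs z)) => e e0; apply/nbhs_complexP; exists e => // w.
by apply: le_lt_trans; rewrite normc_distC -raddfB normc_Im.
Qed.

Lemma continuous_normc : continuous (@normc R : C -> R).
Proof.
move=> z; apply/(@cvgrPdist_lt _ _ _ (nbhs z)) => e e0; apply/nbhs_complexP; exists e => // w.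
apply: le_lt_trans; rewrite ler_norml; apply/andP; split.
  by rewrite lerNl opprB normcB_ge.
by rewrite normc_distC normcB_ge.
Qed.

Lemma continuous_conjc : continuous (@conjc R : C -> C).
Proof.
move=> z; apply/(@cvg_complexP _ (nbhs z)) => e e0; apply/nbhs_complexP; exists e => // w.
by rewrite -rmorphB normc_conj.
Qed.

Lemma continuous_real_complex : continuous (real_complex R : R -> C).
Proof.
move=> x; apply/cvg_complexP => e e0; near=> y.
rewrite -rmorphB normc_real; near: y.
by exact: (@cvgr_distC_lt _ _ _ _ _ id).
Unshelve. all: by end_near. Qed.

End complex_modulus.

(** * The sup norm and polydiscs *)

Section polydisc_topology.
Context (R : realType) (n : nat).
Local Notation C := R[i].
Implicit Types (z w : 'rV[C]_n).

(** The sup norm with real values; the norm of ['rV[C]_n] is the same number viewed in [R[i]], as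
    [norm_rowE] shows. Its balls are polydiscs, invariant under rotations about their centre. *)
Definition nrm z : R := \big[Num.max/0]_(k < n) normc (z ord0 k).

Lemma nrm_ge0 z : 0 <= nrm z.
Proof. by rewrite /nrm; elim/big_ind : _ => // [x y hx hy|k _]; rewrite ?le_max ?hx// normc_ge0. Qed.

Lemma nrm_le z r : 0 <= r -> nrm z <= r <-> forall k, normc (z ord0 k) <= r.
Proof.
move=> r0; split=> [h k|h]; first by rewrite (le_trans _ h)// /nrm (bigD1 k)//= le_max lexx.
by rewrite /nrm; elim/big_ind : _ => // x y hx hy; rewrite ge_max hx.
Qed.

Lemma nrm_lt z r : 0 < r -> nrm z < r <-> forall k, normc (z ord0 k) < r.
Proof.
move=> r0; split=> [h k|h]; first by rewrite (le_lt_trans _ h)// /nrm (bigD1 k)//= le_max lexx.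
by rewrite /nrm; elim/big_ind : _ => // x y hx hy; rewrite gt_max hx.
Qed.

Lemma normc_le_nrm z k : normc (z ord0 k) <= nrm z.
Proof. by move: k; apply/nrm_le; rewrite ?nrm_ge0. Qed.

Lemma nrmD z w : nrm (z + w) <= nrm z + nrm w.
Proof.
apply/nrm_le => [|k]; first by rewrite addr_ge0 ?nrm_ge0.
by rewrite mxE (le_trans (normcD _ _))// lerD ?normc_le_nrm.
Qed.

Lemma nrmN z : nrm (- z) = nrm z.
Proof. by apply: eq_bigr => k _; rewrite mxE normcN. Qed.

Lemma nrm_distC z w : nrm (z - w) = nrm (w - z).
Proof. by rewrite -nrmN opprB. Qed.

Lemma nrmZ a z : nrm (a *: z) = normc a * nrm z.
Proof.
rewrite /nrm; elim/big_ind2 : _ => [|x y u v -> ->|k _]; first by rewrite mulr0.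
  by rewrite maxr_pMr ?normc_ge0.
by rewrite mxE normcM.
Qed.

Lemma nrm0 : nrm 0 = 0.
Proof. by apply/le_anti; rewrite nrm_ge0 andbT; apply/nrm_le => // k; rewrite mxE normc0. Qed.

Lemma nrm_eq0 z : nrm z = 0 -> z = 0.
Proof.
move=> z0; apply/rowP => k; rewrite mxE; apply/eqP; rewrite -normc_eq0.
by apply/eqP/le_anti; rewrite normc_ge0 andbT -z0 normc_le_nrm.
Qed.

Lemma nbhs_polydiscP z (U : set 'rV[C]_n) : nbhs z U <->
  exists2 r : R, 0 < r & forall w, nrm (w - z) < r -> U w.
Proof.
split => [/nbhs_ballP[e e0 eU]|[r r0 rU]].
  have er : e = (Re e)%:C by rewrite RRe_real// gtr0_real.
  have e0' : 0 < Re e by move: e0 => /=; rewrite er ltcR.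
  exists (Re e) => // w /nrm_lt => /(_ e0') zw; apply: eU; rewrite er.
  split; first by rewrite ltcR.
  move=> i k; rewrite -ball_normE/= normc_norm ltcR normc_distC ord1.
  by have := zw k; rewrite !mxE.
apply/nbhs_ballP; exists r%:C => /=; first by rewrite ltcR.
move=> w [_ bw]; apply: rU; apply/nrm_lt => // k; have := bw ord0 k.
by rewrite -ball_normE/= normc_norm ltcR normc_distC !mxE.
Qed.

Lemma nbhs_polydisc z r : 0 < r -> nbhs z [set w | nrm (w - z) < r].
Proof. by move=> r0; apply/nbhs_polydiscP; exists r. Qed.

Lemma open_polydiscP (D : set 'rV[C]_n) : open D <-> forall z, D z ->
  exists2 r : R, 0 < r & forall w, nrm (w - z) < r -> D w.
Proof.
rewrite openE; split=> [oD z /oD/nbhs_polydiscP//|H z /H zD].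
exact/nbhs_polydiscP.
Qed.

Lemma polydisc_open z r : open [set w | nrm (w - z) < r].
Proof.
apply/open_polydiscP => w /= wz; exists (r - nrm (w - z)); first by rewrite subr_gt0.
move=> y yw /=; rewrite -(subrKA w) (le_lt_trans (nrmD _ _))//.
by rewrite -ltrBrDr.
Qed.

End polydisc_topology.

(** * Integrals of continuous functions over a segment *)

Section integral_of_continuous.
Context (R : realType).
Local Notation C := R[i].
Implicit Types (a b c : R) (u v : R -> R) (f g : R -> C).
Local Notation mu := (@lebesgue_measure R).

Definition rint a b u : R := \int[mu]_(x in `[a, b]) u x.

Lemma rint_integrable a b u : continuous u -> mu.-integrable `[a, b] (EFin \o u).
Proof.
move=> cu; apply: (@continuous_compact_integrable R u); first exact: segment_compact.
exact: continuous_subspaceT.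
Qed.

Lemma rintD a b u v : continuous u -> continuous v ->
  rint a b (fun x => u x + v x) = rint a b u + rint a b v.
Proof. by move=> cu cv; rewrite /rint RintegralD//; exact: rint_integrable. Qed.

Lemma rintZ a b r u : continuous u -> rint a b (fun x => r * u x) = r * rint a b u.
Proof. by move=> cu; rewrite /rint RintegralZl//; exact: rint_integrable. Qed.

Lemma rint_cst a b r : a <= b -> rint a b (fun=> r) = r * (b - a).
Proof. move=> ab; rewrite /rint Rintegral_cst//= lebesgue_measure_itv/= lte_fin.
by move: ab; rewrite le_eqVlt => /predU1P[->|->//]; rewrite ltxx subrr. Qed.

Lemma eq_rint a b u v : (forall x, a <= x <= b -> u x = v x) -> rint a b u = rint a b v.
Proof. by move=> uv; apply: eq_Rintegral => x; rewrite inE/= in_itv/= => /uv. Qed.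

Lemma le_rint a b u v : continuous u -> continuous v ->
  (forall x, a <= x <= b -> u x <= v x) -> rint a b u <= rint a b v.
Proof.
move=> cu cv uv; apply: le_Rintegral => //; first exact: rint_integrable.
  exact: rint_integrable.
all: by move=> x /=; rewrite in_itv/=; exact: uv.
Qed.

Lemma rint_cat a b c u : a <= b -> b <= c -> continuous u ->
  rint a c u = rint a b u + rint b c u.
Proof.
move=> ab bc cu; rewrite /rint.
have := @Rintegral_itvB R u (BLeft a) (BRight c) b (rint_integrable a c cu).
rewrite !bnd_simp => /(_ ab bc).
by rewrite Rintegral_itv_obnd_cbnd => [<-|]; [rewrite addrC subrK|
  apply: integrableS (rint_integrable b c cu); rewrite //; exact: subset_itv_oc_cc].
Qed.

Lemma le_normr_rint a b u : continuous u -> `|rint a b u| <= rint a b (fun x => `|u x|).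
Proof. by move=> cu; apply: le_normr_Rintegral => //; exact: rint_integrable. Qed.

Lemma rint_FTC a b u (F : R -> R) : a <= b -> continuous u ->
  (forall x : R, is_derive x 1 F (u x)) -> rint a b u = F b - F a.
Proof.
rewrite le_eqVlt => /predU1P[-> cu _|ab cu dF].
  by rewrite subrr /rint set_itv1 Rintegral_set1.
have dFx x : derivable F x 1 by have [] := dF x.
have cF : continuous F by move=> x; apply: differentiable_continuous; exact/derivable1_diffP.
rewrite /rint /Rintegral (@continuous_FTC2 _ u F)//.
- exact: continuous_subspaceT.
- split => //; [exact/cvg_at_right_filter/cF|exact/cvg_at_left_filter/cF].
- by move=> x _; rewrite derive1E; have [] := dF x.
Qed.

Definition cint a b f : C := rint a b (Re \o f) +i* rint a b (Im \o f).

Lemma continuous_ReC f : continuous f -> continuous (Re \o f).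
Proof. by move=> cf x; apply: continuous_comp; [exact: cf|exact: continuous_Re]. Qed.

Lemma continuous_ImC f : continuous f -> continuous (Im \o f).
Proof. by move=> cf x; apply: continuous_comp; [exact: cf|exact: continuous_Im]. Qed.

Lemma continuous_normcC f : continuous f -> continuous (@normc R \o f).
Proof. by move=> cf x; apply: continuous_comp; [exact: cf|exact: continuous_normc]. Qed.

Lemma continuous_cD (T : topologicalType) (f g : T -> C) : continuous f -> continuous g ->
  continuous (fun x => f x + g x).
Proof. by move=> cf cg x; apply: cvgD; [exact: cf|exact: cg]. Qed.

Lemma continuous_cN (T : topologicalType) (f : T -> C) : continuous f ->
  continuous (fun x => - f x).
Proof. by move=> cf x; apply: cvgN; exact: cf. Qed.

Lemma continuous_cB (T : topologicalType) (f g : T -> C) : continuous f -> continuous g ->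
  continuous (fun x => f x - g x).
Proof. by move=> cf cg; exact: (continuous_cD cf (continuous_cN cg)). Qed.

Lemma continuous_cM (T : topologicalType) (f g : T -> C) : continuous f -> continuous g ->
  continuous (fun x => f x * g x).
Proof. by move=> cf cg x; apply: cvgM; [exact: cf|exact: cg]. Qed.

Lemma continuous_cst_ (T S : topologicalType) (r : S) : continuous (fun _ : T => r).
Proof. by move=> x; exact: cvg_cst. Qed.

Lemma cintD a b f g : continuous f -> continuous g ->
  cint a b (fun x => f x + g x) = cint a b f + cint a b g.
Proof.
move=> cf cg; rewrite /cint -[RHS]/((_ + _) +i* (_ + _)) -!rintD;
  try exact: continuous_ReC; try exact: continuous_ImC.
by congr (_ +i* _); apply: eq_rint => x _ /=; rewrite raddfD.
Qed.

Lemma cintZ a b (r : C) f : continuous f ->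
  cint a b (fun x => r * f x) = r * cint a b f.
Proof.
move=> cf; have cR := continuous_ReC cf; have cI := continuous_ImC cf.
case: r => p q; rewrite /cint -[RHS]/((_ - _) +i* (_ + _)).
have cZ (u : R -> R) s : continuous u -> continuous (fun x => s * u x).
  by move=> cu x; apply: cvgM; [exact: cvg_cst|exact: cu].
congr (_ +i* _).
  rewrite -mulNr -(rintZ a b p cR) -(rintZ a b (- q) cI) -rintD; [|exact: cZ|exact: cZ].
  by apply: eq_rint => x _ /=; case: (f x) => s t /=; rewrite mulNr.
rewrite -(rintZ a b p cI) -(rintZ a b q cR) -rintD; [|exact: cZ|exact: cZ].
by apply: eq_rint => x _ /=; case: (f x).
Qed.

Lemma cintN a b f : continuous f -> cint a b (fun x => - f x) = - cint a b f.
Proof.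
move=> cf; rewrite -mulN1r -cintZ//; congr (_ +i* _);
  by apply: eq_rint => x _ /=; rewrite mulN1r.
Qed.

Lemma cintB a b f g : continuous f -> continuous g ->
  cint a b (fun x => f x - g x) = cint a b f - cint a b g.
Proof. by move=> cf cg; rewrite (cintD a b cf (continuous_cN cg)) cintN. Qed.

Lemma eq_cint a b f g : (forall x, a <= x <= b -> f x = g x) -> cint a b f = cint a b g.
Proof. by move=> fg; congr (_ +i* _); apply: eq_rint => x xab /=; rewrite fg. Qed.

Lemma cint_cat a b c f : a <= b -> b <= c -> continuous f ->
  cint a c f = cint a b f + cint b c f.
Proof.
move=> ab bc cf; rewrite /cint -[RHS]/((_ + _) +i* (_ + _)) -!rint_cat//;
  by [exact: continuous_ReC|exact: continuous_ImC].
Qed.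

Lemma cint_cst a b (r : C) : a <= b -> cint a b (fun=> r) = r * (b - a)%:C.
Proof.
by move=> ab; case: r => p q; rewrite /cint !rint_cst//; apply/eqP; rewrite eq_complex/=;
  rewrite !mulr0 subr0 add0r !eqxx.
Qed.

(** The factor 2 comes from bounding real and imaginary parts separately. It is inherited by all
    Cauchy estimates. *)
Lemma normc_cint a b f : continuous f -> normc (cint a b f) <= 2 * rint a b (@normc R \o f).
Proof.
move=> cf; rewrite (le_trans (normc_le_ReIm _))//= mulr_natl mulr2n lerD//.
  rewrite (le_trans (le_normr_rint _ _ _))//; first exact: continuous_ReC.
  apply: le_rint => [x||x _]; last exact: normc_Re.
    by apply: continuous_comp; [exact: continuous_ReC|exact: norm_continuous].
  exact: continuous_normcC.
rewrite (le_trans (le_normr_rint _ _ _))//; first exact: continuous_ImC.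
apply: le_rint => [x||x _]; last exact: normc_Im.
  by apply: continuous_comp; [exact: continuous_ImC|exact: norm_continuous].
exact: continuous_normcC.
Qed.

Lemma normc_cint_le a b f M : a <= b -> continuous f ->
  (forall x, a <= x <= b -> normc (f x) <= M) -> normc (cint a b f) <= 2 * (M * (b - a)).
Proof.
move=> ab cf fM; rewrite (le_trans (normc_cint _ _ cf))// ler_pM2l//.
rewrite -rint_cst//; apply: le_rint => //; first exact: continuous_normcC.
exact: continuous_cst_.
Qed.

Lemma cint_FTC a b f (F : R -> C) : a <= b -> continuous f ->
  (forall x : R, is_derive x 1 (Re \o F) (Re (f x))) ->
  (forall x : R, is_derive x 1 (Im \o F) (Im (f x))) -> cint a b f = F b - F a.
Proof.
move=> ab cf dR dI; rewrite /cint (rint_FTC _ _ dR)// ?(rint_FTC _ _ dI)//;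
  [|exact: continuous_ImC|exact: continuous_ReC].
by apply/eqP; rewrite eq_complex/= !raddfB/= !eqxx.
Qed.

End integral_of_continuous.

(** * Parametrisation of the unit circle *)

Section circle_param.
Context (R : realType).
Local Notation C := R[i].
Implicit Types x : R.

(** The exponential of [2 i pi x]: one turn takes the interval [0, 1], so that means over the circle
    carry no factor. *)
Definition ecirc x : C := cos (2 * pi * x) +i* sin (2 * pi * x).

Lemma normc_ecirc x : normc (ecirc x) = 1.
Proof. by rewrite /= cos2Dsin2 sqrtr1. Qed.

Lemma ecirc_neq0 x : ecirc x != 0.
Proof. by rewrite -normc_gt0 normc_ecirc. Qed.

Lemma ecircD x y : ecirc (x + y) = ecirc x * ecirc y.
Proof. by apply/eqP; rewrite eq_complex/= mulrDr cosD sinD eqxx/=; apply/eqP; ring. Qed.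

Lemma ecirc0 : ecirc 0 = 1.
Proof. by rewrite /ecirc mulr0 cos0 sin0. Qed.

Lemma ecirc1 : ecirc 1 = 1.
Proof. by rewrite /ecirc mulr1 mulrC mulr_natr cos2pi sin2pi. Qed.

Lemma ecirc_conj x : (ecirc x)^* = (ecirc x)^-1.
Proof.
apply: (mulfI (ecirc_neq0 x)); rewrite mulc_conj normc_ecirc expr1n mulfV//.
exact: ecirc_neq0.
Qed.

Lemma ecircMn x k : ecirc (x *+ k) = ecirc x ^+ k.
Proof. by elim: k => [|k ih]; rewrite ?ecirc0// mulrS ecircD ih exprS. Qed.

Lemma is_derive_mull (c x : R) : is_derive x 1 ( *%R c) c.
Proof.
apply/is_derive1_caratheodory; exists (fun=> c); split => //; last exact: cvg_cst.
by move=> z; rewrite -mulrBr.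
Qed.

Lemma is_derive_Re_ecirc c x :
  is_derive x 1 (Re \o (fun x => ecirc (c * x))) (Re ((2 * pi * c)%:C * 'i * ecirc (c * x))).
Proof.
rewrite (_ : Re _ = - sin (2 * pi * c * x) * (2 * pi * c)); last by rewrite /= !mulrA; ring.
have -> : Re \o (fun x => ecirc (c * x)) = cos \o ( *%R (2 * pi * c)).
  by apply/funext => y /=; rewrite mulrA.
by apply: is_derive1_comp; exact: is_derive_mull.
Qed.

Lemma is_derive_Im_ecirc c x :
  is_derive x 1 (Im \o (fun x => ecirc (c * x))) (Im ((2 * pi * c)%:C * 'i * ecirc (c * x))).
Proof.
rewrite (_ : Im _ = cos (2 * pi * c * x) * (2 * pi * c)); last by rewrite /= !mulrA; ring.
have -> : Im \o (fun x => ecirc (c * x)) = sin \o ( *%R (2 * pi * c)).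
  by apply/funext => y /=; rewrite mulrA.
by apply: is_derive1_comp; exact: is_derive_mull.
Qed.

Lemma complex_continuous (f : R -> C) :
  continuous (Re \o f) -> continuous (Im \o f) -> continuous f.
Proof.
move=> cR cI x; apply/(@cvg_complexP _ _ (nbhs x)) => e e0.
have e20 : 0 < e / 2 by rewrite divr_gt0.
move: (cR x) (cI x) => /cvgrPdistC_lt/(_ _ e20) h1 /cvgrPdistC_lt/(_ _ e20) h2.
apply: filterS2 h1 h2 => y h1 h2.
by rewrite (le_lt_trans (normc_le_ReIm _))// [e]splitr ltrD// raddfB.
Qed.

Lemma continuous_ecircM c : continuous (fun x => ecirc (c * x)).
Proof.
apply: complex_continuous => x; apply: differentiable_continuous; apply/derivable1_diffP.
  by have [] := is_derive_Re_ecirc c x.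
by have [] := is_derive_Im_ecirc c x.
Qed.

Lemma continuous_ecirc : continuous ecirc.
Proof.
rewrite (_ : ecirc = (fun x => ecirc (1 * x))); first exact: continuous_ecircM.
by apply/funext => x; rewrite mul1r.
Qed.

Lemma cint_ecircM c a b : a <= b ->
  cint a b (fun x => (2 * pi * c)%:C * 'i * ecirc (c * x)) = ecirc (c * b) - ecirc (c * a).
Proof.
move=> ab; apply: (@cint_FTC _ a b _ (fun x => ecirc (c * x))) => //.
- by apply: continuous_cM; [exact: continuous_cst_|exact: continuous_ecircM].
- exact: is_derive_Re_ecirc.
- exact: is_derive_Im_ecirc.
Qed.

Lemma cint_ecirc a b : a <= b ->
  cint a b (fun x => (2 * pi)%:C * 'i * ecirc x) = ecirc b - ecirc a.
Proof.
move=> ab; have := cint_ecircM 1 ab; rewrite !mul1r => <-.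
by apply: eq_cint => x _; rewrite mulr1 mul1r.
Qed.

(** The difference is the integral of the derivative, of modulus [2 pi]; the other factor 2 is that
    of [normc_cint_le]. *)
Lemma ecirc_lip x y : normc (ecirc x - ecirc y) <= 4 * pi * `|x - y|.
Proof.
wlog yx : x y / y <= x => [H|].
  by case: (leP y x) => [/H//|/ltW/H]; rewrite normc_distC distrC.
rewrite -cint_ecirc// (le_trans (normc_cint_le (M := 2 * pi) yx _ _))//.
- by apply: continuous_cM; [exact: continuous_cst_|exact: continuous_ecirc].
- move=> t _; rewrite normcM normc_ecirc mulr1 normcM normc_real ger0_norm ?mulr_ge0 ?pi_ge0//.
  by rewrite /= expr0n expr1n add0r sqrtr1 mulr1.
- by rewrite ger0_norm ?subr_ge0// !mulrA -natrM.
Qed.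

End circle_param.

(** * One complex variable *)

Section goursat.
Context (R : realType).
Local Notation C := R[i].

Lemma geo_small (c r e : R) : 0 <= r -> r < 1 -> 0 < e ->
  exists N, forall k, (N <= k)%N -> c * r ^+ k < e.
Proof.
move=> r0 r1 e0.
have /cvgrPdist_lt/(_ _ e0)[N _ NP] : c * r ^+ k @[k --> \oo] --> (0 : R).
  rewrite -[X in _ --> X](mulr0 c); apply: cvgM; first exact: cvg_cst.
  by apply: cvg_expr; rewrite ger0_norm.
by exists N => k /NP/=; rewrite sub0r normrN; exact: le_lt_trans (ler_norm _).
Qed.

(** It makes a quantity vanish that is bounded by every remainder of a geometrically convergent
    expansion. *)
Lemma le0_geo (a c r : R) : 0 <= r -> r < 1 -> (forall N, a <= c * r ^+ N) -> a <= 0.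
Proof.
move=> r0 r1 H; rewrite leNgt; apply/negP => a0.
have [N /(_ N (leqnn N))] := geo_small c r0 r1 a0.
by rewrite ltNge H.
Qed.

(** Left endpoints increase and right endpoints decrease, so the supremum of the left endpoints lies
    in all segments. *)
Lemma nested_dyadic (a : nat -> R) (w : R) : 0 <= w ->
  (forall k, a k <= a k.+1) ->
  (forall k, a k.+1 + w / 2 ^+ k.+1 <= a k + w / 2 ^+ k) ->
  exists p, forall k, a k <= p <= a k + w / 2 ^+ k.
Proof.
move=> w0 /nondecreasing_seqP ha hb.
have /nonincreasing_seqP hb' : forall k, (fun k => a k + w / 2 ^+ k) k.+1 <= a k + w / 2 ^+ k.
  by [].
have ub j k : a j <= a k + w / 2 ^+ k.
  have [jk|/ltnW kj] := leqP j k.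
    by rewrite (le_trans (ha _ _ jk))// lerDl divr_ge0// exprn_ge0.
  by rewrite (le_trans _ (hb' _ _ kj))// lerDl divr_ge0// exprn_ge0.
have hs : has_sup (range a).
  split; first by exists (a 0%N); exists 0%N.
  by exists (a 0%N + w / 2 ^+ 0) => _ [j _ <-].
exists (sup (range a)) => k; apply/andP; split; first by apply: sup_upper_bound => //; exists k.
by apply: ge_sup; [case: hs|move=> _ [j _ <-]].
Qed.

(** [F k a c] stands for the integral of a form over the boundary of the rectangle with lower left
    corner [(a, c)] and sides [w / 2^k], [v / 2^k]. If it did not vanish at level 0, one of the four
    quarters would always keep a fourth of its modulus; the rectangles so chosen shrink to a point
    [(p, q)], where the local hypothesis makes the integral too small. *)
Lemma goursat_bisection (F : nat -> R -> R -> C) (w v a0 c0 : R) : 0 <= w -> 0 <= v ->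
  (forall k a c, F k a c = F k.+1 a c + F k.+1 (a + w / 2 ^+ k.+1) c +
     F k.+1 a (c + v / 2 ^+ k.+1) + F k.+1 (a + w / 2 ^+ k.+1) (c + v / 2 ^+ k.+1)) ->
  (forall p q, a0 <= p <= a0 + w -> c0 <= q <= c0 + v -> forall e, 0 < e ->
     exists N, forall k a c, (N <= k)%N ->
       [/\ a0 <= a, a <= p <= a + w / 2 ^+ k & a + w / 2 ^+ k <= a0 + w] ->
       [/\ c0 <= c, c <= q <= c + v / 2 ^+ k & c + v / 2 ^+ k <= c0 + v] ->
       normc (F k a c) <= e / 4 ^+ k) ->
  F 0%N a0 c0 = 0.
Proof.
move=> w0 v0 Fadd Floc; apply/eqP; rewrite -normc_eq0; apply: contrapT => /negP F0.
set e := normc (F 0%N a0 c0) in F0.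
have e0 : 0 < e by rewrite lt_neqAle eq_sym F0 normc_ge0.
pose ok k (s : R * R) := e / 4 ^+ k <= normc (F k s.1 s.2).
pose nx k (s s' : R * R) := [/\ s'.1 = s.1 \/ s'.1 = s.1 + w / 2 ^+ k.+1,
  s'.2 = s.2 \/ s'.2 = s.2 + v / 2 ^+ k.+1 & ok k.+1 s'].
(* The implication stands inside the existential so that [choice] yields a total function on
   rectangles. *)
have step k s : exists s', ok k s -> nx k s s'.
  case: (pselect (ok k s)) => [oks|]; last by exists s.
  apply: contrapT => H.
  have lt4 s' : s'.1 = s.1 \/ s'.1 = s.1 + w / 2 ^+ k.+1 ->
     s'.2 = s.2 \/ s'.2 = s.2 + v / 2 ^+ k.+1 -> normc (F k.+1 s'.1 s'.2) < e / 4 ^+ k.+1.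
    by move=> h1 h2; rewrite ltNge; apply/negP => h3; apply: H; exists s' => _; split.
  have h1 := lt4 s (or_introl erefl) (or_introl erefl).
  have h2 := lt4 (s.1 + w / 2 ^+ k.+1, s.2) (or_intror erefl) (or_introl erefl).
  have h3 := lt4 (s.1, s.2 + v / 2 ^+ k.+1) (or_introl erefl) (or_intror erefl).
  have h4 := lt4 (s.1 + w / 2 ^+ k.+1, s.2 + v / 2 ^+ k.+1) (or_intror erefl) (or_intror erefl).
  move: oks; rewrite /ok Fadd => oks.
  have n1 := normcD (F k.+1 s.1 s.2) (F k.+1 (s.1 + w / 2 ^+ k.+1) s.2).
  have n2 := normcD (F k.+1 s.1 s.2 + F k.+1 (s.1 + w / 2 ^+ k.+1) s.2)
    (F k.+1 s.1 (s.2 + v / 2 ^+ k.+1)).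
  have n3 := normcD (F k.+1 s.1 s.2 + F k.+1 (s.1 + w / 2 ^+ k.+1) s.2 +
    F k.+1 s.1 (s.2 + v / 2 ^+ k.+1)) (F k.+1 (s.1 + w / 2 ^+ k.+1) (s.2 + v / 2 ^+ k.+1)).
  have E4 : e / 4 ^+ k = 4 * (e / 4 ^+ k.+1).
    by rewrite exprS; field; rewrite expf_neq0// pnatr_eq0.
  move: h1 h2 h3 h4 => /=; lra.
have {step}[f fP] := choice (fun ks : nat * (R * R) => step ks.1 ks.2).
pose s := fix s k := if k is j.+1 then f (j, s j) else (a0, c0).
have oks k : ok k (s k).
  elim: k => [|k ih]; first by rewrite /ok/= expr0 divr1.
  by have [] := fP (k, s k) ih.
have nxs k : nx k (s k) (s k.+1) by exact: fP (k, s k) (oks k).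
have half (x : R) k : x / 2 ^+ k = x / 2 ^+ k.+1 + x / 2 ^+ k.+1.
  by rewrite exprS; field; rewrite expf_neq0// pnatr_eq0.
have ge0 (x : R) k : 0 <= x -> 0 <= x / 2 ^+ k by move=> x0; rewrite divr_ge0// exprn_ge0.
have [p pP] : exists p, forall k, (s k).1 <= p <= (s k).1 + w / 2 ^+ k.
  apply: nested_dyadic => // k; have [[->|->] _ _] := nxs k; rewrite ?(half w k) ?lerDl ?ge0//.
  - by rewrite lerD2l lerDl ge0.
  - by rewrite addrA.
have [q qP] : exists q, forall k, (s k).2 <= q <= (s k).2 + v / 2 ^+ k.
  apply: nested_dyadic => // k; have [_ [->|->] _] := nxs k; rewrite ?(half v k) ?lerDl ?ge0//.
  - by rewrite lerD2l lerDl ge0.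
  - by rewrite addrA.
have box1 k : a0 <= (s k).1 /\ (s k).1 + w / 2 ^+ k <= a0 + w.
  elim: k => [|k [ih1 ih2]]; first by rewrite /= expr0 divr1.
  have wk := ge0 w k.+1 w0; rewrite half in ih2.
  by have [[->|->] _ _] := nxs k; split; clear -ih1 ih2 wk; lra.
have box2 k : c0 <= (s k).2 /\ (s k).2 + v / 2 ^+ k <= c0 + v.
  elim: k => [|k [ih1 ih2]]; first by rewrite /= expr0 divr1.
  have vk := ge0 v k.+1 v0; rewrite half in ih2.
  by have [_ [->|->] _] := nxs k; split; clear -ih1 ih2 vk; lra.
have hp : a0 <= p <= a0 + w by have := pP 0%N; rewrite /= expr0 divr1.
have hq : c0 <= q <= c0 + v by have := qP 0%N; rewrite /= expr0 divr1.
(* A bound with [e / 2] contradicts the invariant [ok], which keeps the modulus at least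
   [e / 4^k]. *)
have [N NP] := Floc p q hp hq (e / 2) (divr_gt0 e0 (ltr0Sn R 1)).
have := NP N (s N).1 (s N).2 (leqnn N).
have [h1 h2] := box1 N; have [h3 h4] := box2 N.
have -> : e / 2 / 4 ^+ N = e / 4 ^+ N / 2 by rewrite mulrAC.
have := oks N; rewrite /ok => h5 h6.
have h7 : 0 < e / 4 ^+ N by rewrite divr_gt0// exprn_gt0.
have := h6 (And3 h1 (pP N) h2) (And3 h3 (qP N) h4); lra.
Qed.

End goursat.

(** * Functions on the closed unit disc *)

Section unit_disc.
Context (R : realType).
Local Notation C := R[i].
Implicit Types (z : C) (g : C -> C).

(** The radial retraction onto the closed unit disc. Composing with it makes a function given on the
    disc continuous on all of [C], as the integration lemmas ask for continuity everywhere. *)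
Definition clamp z : C := z / (Num.max 1 (normc z))%:C.

Lemma clamp_id z : normc z <= 1 -> clamp z = z.
Proof. by move=> z1; rewrite /clamp max_l// divr1. Qed.

Lemma max1_gt0 (x : R) : 0 < Num.max 1 x.
Proof. by rewrite lt_max ltr01. Qed.

Lemma normc_clamp z : normc (clamp z) <= 1.
Proof.
rewrite /clamp normcM normcV normc_real gtr0_norm ?max1_gt0// ler_pdivrMr ?max1_gt0//.
by rewrite mul1r le_max lexx orbT.
Qed.

Lemma continuous_clamp : continuous clamp.
Proof.
apply: continuous_cM => z; first exact: cvg_id.
have -> : (fun x => ((Num.max 1 (normc x))%:C)^-1) = GRing.inv \o (real_complex R) \o
   (fun x => (1 + x + `|1 - x|) / 2) \o @normc R.
  by apply/funext => x /=; rewrite maxr_absE.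
apply: continuous_comp; first exact: continuous_normc.
apply: continuous_comp.
  apply: cvgM; last exact: cvg_cst.
  apply: cvgD; first by apply: cvgD; [exact: cvg_cst|exact: cvg_id].
  by apply: cvg_norm; apply: cvgB; [exact: cvg_cst|exact: cvg_id].
apply: continuous_comp; first exact: continuous_real_complex.
apply: (@cvgV _ _ (nbhs _)); last exact: cvg_id.
by rewrite -maxr_absE -(normc_gt0 (_%:C)) normc_real gtr0_norm max1_gt0.
Qed.

(** Complex differentiability relative to the closed disc: at boundary points only increments inside
    the disc count. No continuity of the derivative [b] is available, whence the bisection
    argument. *)
Definition disc_holo g := forall z, normc z <= 1 -> exists b : C, forall e : R, 0 < e ->
  exists2 d : R, 0 < d & forall w, normc w <= 1 -> normc (w - z) < d ->
    normc (g w - g z - b * (w - z)) <= e * normc (w - z).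

Lemma disc_holo_cont g : disc_holo g -> forall z, normc z <= 1 -> forall e, 0 < e ->
  exists2 d, 0 < d & forall w, normc w <= 1 -> normc (w - z) < d -> normc (g w - g z) < e.
Proof.
move=> gh z z1 e e0; have [b bP] := gh z z1; have [d d0 dP] := bP 1 ltr01.
have b1 : 0 < normc b + 1 by rewrite ltr_wpDl ?normc_ge0.
exists (Num.min d (e / (normc b + 1))); first by rewrite lt_min d0 divr_gt0.
move=> w w1; rewrite lt_min ltr_pdivlMr// => /andP[wd we].
have := dP w w1 wd; rewrite mul1r => h.
have := normcD (g w - g z - b * (w - z)) (b * (w - z)); rewrite subrK normcM => h2.
lra.
Qed.

Lemma disc_holo_clamp g : disc_holo g -> continuous (g \o clamp).
Proof.
move=> gh z; apply/(@cvg_complexP _ _ (nbhs z)) => e e0.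
have [d d0 dP] := disc_holo_cont gh (normc_clamp z) e0.
have /cvg_complexP/(_ _ d0) : clamp x @[x --> z] --> clamp z by exact: continuous_clamp.
by apply: filterS => w wd; apply: dP => //; exact: normc_clamp.
Qed.

End unit_disc.

(** * Cauchy's integral formula *)

Section cauchy_formula.
Context (R : realType).
Local Notation C := R[i].
Implicit Types (g : C -> C).

Lemma dist_le_itv (a u p s : R) : a <= p <= a + u -> a <= s <= a + u -> `|s - p| <= u.
Proof. by rewrite ler_norml; lra. Qed.

Lemma continuous_cV (T : topologicalType) (f : T -> C) : continuous f ->
  (forall x, f x != 0) -> continuous (fun x => (f x)^-1).
Proof. by move=> cf f0 x; apply: cvgV => //; exact: cf. Qed.

Lemma continuous_compC (T S U : topologicalType) (f : T -> S) (g : S -> U) :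
  continuous f -> continuous g -> continuous (fun x => g (f x)).
Proof. by move=> cf cg x; apply: continuous_comp; [exact: cf|exact: cg]. Qed.

Lemma continuous_expRC : continuous (fun s : R => (expR s)%:C).
Proof. by move=> s; apply: continuous_comp; [exact: continuous_expR|exact: continuous_real_complex]. Qed.

Lemma expR_lip (s t : R) : s <= 0 -> t <= 0 -> `|expR s - expR t| <= `|s - t|.
Proof.
wlog ts : s t / t <= s => [H|].
  by case: (leP t s) => [/H//|/ltW/H st s0 t0]; rewrite distrC (distrC s) st.
move=> s0 t0; rewrite !ger0_norm ?subr_ge0 ?ler_expR//.
have -> : expR t = expR s * expR (t - s) by rewrite -expRD addrC subrK.
have h1 := expR_ge1Dx (t - s); have h2 := expR_gt0 s.
have h3 : expR s <= 1 by rewrite -expR0 ler_expR.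
rewrite -[X in X - _]mulr1 -mulrBr.
have : 1 - expR (t - s) <= s - t by lra.
have : 0 <= 1 - expR (t - s) by rewrite subr_ge0 -expR0 ler_expR subr_le0.
nra.
Qed.

Lemma cint_expR a b : a <= b -> cint a b (fun s : R => (expR s)%:C) = (expR b - expR a)%:C.
Proof.
move=> ab; rewrite rmorphB; apply: (@cint_FTC _ a b _ (fun s => (expR s)%:C)) => //.
- exact: continuous_expRC.
- by move=> x; exact: is_derive_cst.
Qed.

Variable zeta : C.
Hypothesis zeta1 : normc zeta < 1.

Let eneq x : ecirc x - zeta != 0.
Proof.
rewrite -normc_gt0 (lt_le_trans _ (normcB_ge _ _))// normc_ecirc subr_gt0//.
Qed.

(** The component of dz / (z - zeta) along [x] on the curves [gam s]: the factor exp(s) cancels, so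
    it depends on [x] alone. The component along [s] is 1. *)
Let K x : C := (2 * pi)%:C * 'i * ecirc x / (ecirc x - zeta).
Let kap : R := 2 * pi / (1 - normc zeta).

Let contK : continuous K.
Proof.
apply: continuous_cM; first exact: (continuous_cM (@continuous_cst_ _ _ _) (@continuous_ecirc R)).
exact: (continuous_cV (continuous_cB (@continuous_ecirc R) (@continuous_cst_ _ _ _)) eneq).
Qed.

Let kap_gt0 : 0 < kap.
Proof. by rewrite /kap divr_gt0 ?subr_gt0// mulr_gt0 ?pi_gt0. Qed.

Let Kbound x : normc (K x) <= kap.
Proof.
rewrite /K normcM normcV normcM normc_ecirc mulr1 normcM normc_real.
rewrite ger0_norm ?mulr_ge0 ?pi_ge0// [normc 'i]/= expr0n expr1n add0r sqrtr1 mulr1.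
rewrite ler_pM ?mulr_ge0 ?pi_ge0 ?invr_ge0 ?normc_ge0//.
have z1 : 0 < 1 - normc zeta by rewrite subr_gt0.
rewrite lef_pV2 ?posrE ?normc_gt0//.
by rewrite (le_trans _ (normcB_ge _ _))// normc_ecirc.
Qed.

(** Homotheties with centre zeta and ratio exp(s): the unit circle, at [s = 0], shrinks to zeta as
    [s] tends to minus infinity, without leaving the disc. *)
Let gam (s x : R) : C := zeta + (expR s)%:C * (ecirc x - zeta).

(* The integral over the boundary of [s1,s2] x [x1,x2] of the pullback by gam of the form
   g(z) dz / (z - zeta), which is G ds + G K dx. *)
Let E (G : R -> R -> C) (s1 s2 x1 x2 : R) : C :=
  cint s1 s2 (fun s => G s x1 - G s x2) + cint x1 x2 (fun x => K x * (G s2 x - G s1 x)).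

Let sepcont (G : R -> R -> C) := (forall s, continuous (G s)) /\ (forall x, continuous (G ^~ x)).

Let contKB (f g : R -> C) : continuous f -> continuous g -> continuous (fun x => K x * (f x - g x)).
Proof. by move=> cf cg; exact: (continuous_cM contK (continuous_cB cf cg)). Qed.

Let E_split G s1 s s2 x1 x x2 : sepcont G -> s1 <= s -> s <= s2 -> x1 <= x -> x <= x2 ->
  E G s1 s2 x1 x2 = E G s1 s x1 x + E G s s2 x1 x + E G s1 s x x2 + E G s s2 x x2.
Proof.
move=> [c1 c2] h1 h2 h3 h4; rewrite /E.
have h12 := le_trans h1 h2; have h34 := le_trans h3 h4.
have cK (a b : R) := contKB (c1 a) (c1 b).
have contB (a b : R) := continuous_cB (c2 a) (c2 b).
rewrite (cint_cat h1 h2 (contB x1 x2)) (cint_cat h3 h4 (cK s2 s1)).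
have eK a b : cint a b (fun x => K x * (G s2 x - G s1 x)) =
    cint a b (fun x => K x * (G s2 x - G s x)) + cint a b (fun x => K x * (G s x - G s1 x)).
  rewrite -(cintD a b (cK s2 s) (cK s s1)).
  by apply: eq_cint => y _; ring.
have eG a b : cint a b (fun s => G s x1 - G s x2) =
    cint a b (fun s => G s x1 - G s x) + cint a b (fun s => G s x - G s x2).
  rewrite -(cintD a b (contB x1 x) (contB x x2)).
  by apply: eq_cint => y _; ring.
rewrite !eK !eG; ring.
Qed.

Let ED G H s1 s2 x1 x2 : sepcont G -> sepcont H ->
  E (fun s x => G s x + H s x) s1 s2 x1 x2 = E G s1 s2 x1 x2 + E H s1 s2 x1 x2.
Proof.
move=> [c1 c2] [d1 d2]; rewrite /E.
rewrite addrACA -(cintD _ _ (continuous_cB (c2 x1) (c2 x2)) (continuous_cB (d2 x1) (d2 x2))).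
rewrite -(cintD _ _ (contKB (c1 s2) (c1 s1)) (contKB (d1 s2) (d1 s1))).
by congr (_ + _); apply: eq_cint => y _; ring.
Qed.

Let E_bound G s1 s2 x1 x2 M : sepcont G -> s1 <= s2 -> x1 <= x2 ->
  (forall s x, s1 <= s <= s2 -> x1 <= x <= x2 -> normc (G s x) <= M) ->
  normc (E G s1 s2 x1 x2) <= 4 * M * ((s2 - s1) + kap * (x2 - x1)).
Proof.
move=> [c1 c2] s12 x12 GM; rewrite /E (le_trans (normcD _ _))//.
have lB (a b : C) : normc a <= M -> normc b <= M -> normc (a - b) <= 2 * M.
  by move=> ha hb; rewrite (le_trans (normcB _ _))//; lra.
have xx1 : x1 <= x1 <= x2 by rewrite lexx x12.
have xx2 : x1 <= x2 <= x2 by rewrite lexx x12.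
have ss1 : s1 <= s1 <= s2 by rewrite lexx s12.
have ss2 : s1 <= s2 <= s2 by rewrite lexx s12.
have h1 : normc (cint s1 s2 (fun s => G s x1 - G s x2)) <= 2 * (2 * M * (s2 - s1)).
  apply: (normc_cint_le s12 (continuous_cB (c2 x1) (c2 x2))).
  by move=> s hs; apply: lB; exact: GM.
have h2 : normc (cint x1 x2 (fun x => K x * (G s2 x - G s1 x))) <=
    2 * (kap * (2 * M) * (x2 - x1)).
  apply: (normc_cint_le x12 (contKB (c1 s2) (c1 s1))).
  move=> x hx; rewrite normcM ler_pM ?normc_ge0//.
  by apply: lB; exact: GM.
rewrite (le_trans (lerD h1 h2))// le_eqVlt; apply/orP; left; apply/eqP; ring.
Qed.

Let gam_cont : sepcont gam.
Proof.
split => [s|x]; apply: (continuous_cD (@continuous_cst_ _ _ _)).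
  apply: (continuous_cM (@continuous_cst_ _ _ _)).
  exact: (continuous_cB (@continuous_ecirc R) (@continuous_cst_ _ _ _)).
exact: (continuous_cM continuous_expRC (@continuous_cst_ _ _ _)).
Qed.

(** A constant cancels between opposite sides, and for [gam] itself both integrals are explicit and
    opposite. The first-order part of [g] at the limit point of the bisection thus contributes
    nothing. *)
Let E_affine (A B : C) s1 s2 x1 x2 : s1 <= s2 -> x1 <= x2 ->
  E (fun s x => A + B * gam s x) s1 s2 x1 x2 = 0.
Proof.
move=> s12 x12; rewrite /E.
have -> : cint s1 s2 (fun s => A + B * gam s x1 - (A + B * gam s x2)) =
    B * (ecirc x1 - ecirc x2) * (expR s2 - expR s1)%:C.
  rewrite -cint_expR// -(cintZ _ _ _ continuous_expRC).
  by apply: eq_cint => s _; rewrite /gam; ring.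
have -> : cint x1 x2 (fun x => K x * (A + B * gam s2 x - (A + B * gam s1 x))) =
    B * (expR s2 - expR s1)%:C * (ecirc x2 - ecirc x1).
  rewrite -cint_ecirc// -cintZ; last first.
    exact: (continuous_cM (@continuous_cst_ _ _ _) (@continuous_ecirc R)).
  by apply: eq_cint => x _; rewrite /gam /K rmorphB; field.
ring.
Qed.

Let gam_le1 s x : s <= 0 -> normc (gam s x) <= 1.
Proof.
move=> s0; have -> : gam s x = (1 - expR s)%:C * zeta + (expR s)%:C * ecirc x.
  by rewrite /gam rmorphB rmorph1; ring.
have h1 : expR s <= 1 by rewrite -expR0 ler_expR.
rewrite (le_trans (normcD _ _))// !normcM normc_ecirc mulr1 !normc_real.
rewrite (ger0_norm (expR_ge0 _)) ger0_norm ?subr_ge0//.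
have := expR_gt0 s; have := zeta1; nra.
Qed.

Let gam_lip s x p q : s <= 0 -> p <= 0 ->
  normc (gam s x - gam p q) <= 2 * `|s - p| + 4 * pi * `|x - q|.
Proof.
move=> s0 p0; have -> : gam s x - gam p q =
    (expR s - expR p)%:C * (ecirc x - zeta) + (expR p)%:C * (ecirc x - ecirc q).
  by rewrite /gam rmorphB; ring.
have h1 : expR p <= 1 by rewrite -expR0 ler_expR.
rewrite (le_trans (normcD _ _))// lerD// normcM normc_real.
  rewrite mulrC ler_pM ?normc_ge0 ?expR_lip//.
  by rewrite (le_trans (normcB _ _))// normc_ecirc; have := zeta1; lra.
rewrite (le_trans _ (ecirc_lip _ _))// ler_piMl ?normc_ge0//.
by rewrite ger0_norm ?expR_ge0.
Qed.

(** By Goursat's argument [E] vanishes on the product of [[-S, 0]] and [[0, 1]]; the sides [x = 0]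
    and [x = 1] cancel by periodicity, so the integral over the unit circle equals the one over its
    image under the homothety of ratio exp(-S), where [g] is close to [g zeta]. *)
Lemma cauchy_kernel g : disc_holo g ->
  cint 0 1 (fun x => K x * (g \o @clamp R) (ecirc x)) = g zeta * cint 0 1 K.
Proof.
move=> gh; pose G s x := (g \o @clamp R) (gam s x).
have cg := disc_holo_clamp gh.
have Gc : sepcont G.
  case: gam_cont => c1 c2; split => [s|x].
    exact: (continuous_compC (c1 s) cg).
  exact: (continuous_compC (c2 x) cg).
have E0 S : 0 <= S -> E G (- S) 0 0 1 = 0.
  move=> S0.
  pose F k a c := E G a (a + S / 2 ^+ k) c (c + 1 / 2 ^+ k).
  suff : F 0%N (- S) 0 = 0 by rewrite /F !expr0 !divr1 addNr add0r.
  apply: (@goursat_bisection _ F S 1) => //.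
  - move=> k a c; rewrite /F.
    have h (x : R) : x / 2 ^+ k = x / 2 ^+ k.+1 + x / 2 ^+ k.+1.
      by rewrite exprS; field; rewrite expf_neq0// pnatr_eq0.
    have ge0 (x : R) : 0 <= x -> 0 <= x / 2 ^+ k.+1 by move=> x0; rewrite divr_ge0// exprn_ge0.
    have w10 := ge0 S S0; have v10 := ge0 1 ler01.
    have -> := h S; have -> := h 1; move: w10 v10.
    move: (S / 2 ^+ k.+1) (1 / 2 ^+ k.+1) => w1 v1 w10 v10.
    rewrite (addrA a) (addrA c).
    by apply: (@E_split G _ _ _ _ _ _ Gc); rewrite lerDl.
  - move=> p q hp hq e e0.
    have p0 : p <= 0 by lra.
    (* [L / 2^k] bounds the distance from [gam p q] to the image of a rectangle of level [k] around
       [(p, q)], and [M] gathers the factors of [E_bound]; the local estimate is then exactly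
       [e / 4^k]. *)
    pose L := 2 * S + 4 * pi; pose M := 4 * L * (S + kap).
    have L0 : 0 < L by rewrite /L; have := pi_gt0 R; lra.
    have M0 : 0 < M by rewrite /M !mulr_gt0// ltr_wpDl.
    have gpq1 := gam_le1 q p0.
    have [b bP] := gh _ gpq1.
    have [d d0 dP] := bP (e / M) (divr_gt0 e0 M0).
    have [N NP] : exists N, forall k, (N <= k)%N -> L / 2 ^+ k < d.
      have [||N NP] := geo_small (r := 2^-1) L _ _ d0; rewrite ?invr_ge0 ?invf_lt1 ?ltr1n//.
      by exists N => k /NP; rewrite exprVn.
    exists N => k a c Nk [a1 a2 a3] [c1 c2 c3].
    set w := S / 2 ^+ k in a2 a3; set v := 1 / 2 ^+ k in c2 c3.
    have w0 : 0 <= w by rewrite divr_ge0// exprn_ge0.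
    have v0 : 0 <= v by rewrite divr_ge0// exprn_ge0.
    pose A := g (gam p q) - b * gam p q.
    pose H s x := G s x - (A + b * gam s x).
    have Ac : sepcont (fun s x => A + b * gam s x).
      case: gam_cont => g1 g2; split => [s|x]; apply: (continuous_cD (@continuous_cst_ _ _ _)).
        exact: (continuous_cM (@continuous_cst_ _ _ _) (g1 s)).
      exact: (continuous_cM (@continuous_cst_ _ _ _) (g2 x)).
    have Hc : sepcont H.
      case: Gc Ac => g1 g2 [h1 h2]; split => [s|x].
        exact: (continuous_cB (g1 s) (h1 s)).
      exact: (continuous_cB (g2 x) (h2 x)).
    have -> : F k a c = E H a (a + w) c (c + v).
      rewrite /F -/w -/v -[RHS]addr0 -(E_affine A b (s1 := a) (s2 := a + w) (x1 := c) (x2 := c + v));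
        rewrite ?lerDl//.
      rewrite -(ED _ _ _ _ Hc Ac).
      have -> // : G = (fun s x => H s x + (A + b * gam s x)).
      by apply/funext => s; apply/funext => x; rewrite /H subrK.
    have -> : e / 4 ^+ k = 4 * (e / M * (L / 2 ^+ k)) * ((a + w - a) + kap * (c + v - c)).
      rewrite (_ : 4 ^+ k = 2 ^+ k * 2 ^+ k); last by rewrite -exprMn -natrM.
      rewrite /w /v /M; field; rewrite expf_neq0 ?pnatr_eq0//=.
      by rewrite !gt_eqF// ltr_wpDl.
    apply: E_bound; rewrite ?lerDl// => s x hs hx.
    have s0 : s <= 0 by lra.
    have lip := gam_lip x q s0 p0.
    have lipL : normc (gam s x - gam p q) <= L / 2 ^+ k.
      apply: (le_trans lip); rewrite (_ : L / 2 ^+ k = 2 * w + 4 * pi * v); last first.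
        by rewrite /w /v /L; field; rewrite expf_neq0// pnatr_eq0.
      have h1 : `|s - p| <= w by exact: (@dist_le_itv a).
      have h2 : `|x - q| <= v by exact: (@dist_le_itv c).
      by rewrite lerD// ler_wpM2l// mulr_ge0// pi_ge0.
    have -> : H s x = g (gam s x) - g (gam p q) - b * (gam s x - gam p q).
      by rewrite /H /G /= clamp_id ?gam_le1// /A; ring.
    rewrite (le_trans (dP _ (gam_le1 x s0) _))//.
      by rewrite (le_lt_trans lipL)// NP.
    by rewrite ler_wpM2l// divr_ge0// ltW.
have G01 s : G s 0 = G s 1 by rewrite /G /gam ecirc0 ecirc1.
have G0 x : G 0 x = (g \o @clamp R) (ecirc x).
  by rewrite /G /gam expR0 mul1r addrC subrK.
have cK (a : R) : continuous (fun x => K x * G a x).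
  by case: Gc => g1 _; exact: (continuous_cM contK (g1 a)).
have cgK : continuous (fun x => g zeta * K x).
  exact: (continuous_cM (@continuous_cst_ _ _ _) contK).
have Ieq S : 0 <= S -> cint 0 1 (fun x => K x * G 0 x) = cint 0 1 (fun x => K x * G (- S) x).
  move=> S0; have := E0 S S0; rewrite /E.
  have -> : cint (- S) 0 (fun s => G s 0 - G s 1) = 0.
    rewrite -[RHS](mul0r ((0 - (- S))%:C)) -cint_cst ?oppr_le0//.
    by apply: eq_cint => s _; rewrite G01 subrr.
  rewrite add0r => H0; apply/eqP; rewrite -subr_eq0 -(cintB 0 1 (cK 0) (cK (- S))); apply/eqP; rewrite -[RHS]H0.
  by apply: eq_cint => x _; ring.
rewrite (eq_cint (g := fun x => K x * G 0 x)); last by move=> x _; rewrite G0.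
rewrite -(cintZ 0 1 _ contK); apply/eqP; rewrite -subr_eq0.
rewrite -normc_eq0 eq_le normc_ge0 andbT; apply/ler_addgt0Pr => e e0; rewrite add0r.
have [d d0 dP] := disc_holo_cont gh (ltW zeta1) (divr_gt0 e0 (mulr_gt0 (ltr0Sn R 1) kap_gt0)).
(* [S] is chosen with exp(-S) = [del]; as [|ecirc x - zeta| < 2], the contracted circle stays within
   [d] of zeta. The minimum with 1 keeps [S] nonnegative. *)
pose del := Num.min 1 (d / 4); have del0 : 0 < del by rewrite lt_min ltr01 divr_gt0.
pose S := - ln del.
have S0 : 0 <= S by rewrite oppr_ge0 ln_le0// ge_min lexx.
rewrite (Ieq S S0) -(cintB 0 1 (cK (- S)) cgK).
have ->: e = 2 * (kap * (e / (2 * kap)) * (1 - 0)) by field; rewrite gt_eqF.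
apply: (normc_cint_le ler01 (continuous_cB (cK (- S)) cgK)).
move=> x _; rewrite (mulrC (g zeta)) -mulrBr normcM ler_pM ?normc_ge0//.
have g1 : normc (gam (- S) x) <= 1 by rewrite gam_le1// oppr_le0.
rewrite /G/= clamp_id//; apply/ltW/dP => //.
rewrite /gam addrC addKr normcM normc_real ger0_norm ?expR_ge0// opprK lnK ?posrE//.
have : del <= d / 4 by rewrite ge_min lexx orbT.
have : normc (ecirc x - zeta) < 2.
  by rewrite (le_lt_trans (normcB _ _))// normc_ecirc; have := zeta1; lra.
have := normc_ge0 (ecirc x - zeta); nra.
Qed.

End cauchy_formula.

(** * Taylor expansion on the unit disc *)

Section taylor_disc.
Context (R : realType).
Local Notation C := R[i].
Implicit Types (g : C -> C).

(** On the unit circle the conjugate is the inverse, so [ecj x ^+ k] stands for the power [-k] of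
    the boundary point. *)
Definition ecj (x : R) : C := (ecirc x)^*.

Lemma normc_ecj x : normc (ecj x) = 1.
Proof. by rewrite /ecj normc_conj normc_ecirc. Qed.

Lemma continuous_ecj : continuous ecj.
Proof. exact: (continuous_compC (@continuous_ecirc R) (@continuous_conjc R)). Qed.

Lemma continuous_cX (T : topologicalType) (f : T -> C) k : continuous f ->
  continuous (fun x => f x ^+ k).
Proof.
move=> cf; elim: k => [|k ih]; first exact: (@continuous_cst_ T C 1).
rewrite (_ : (fun x => _) = (fun x => f x * f x ^+ k)); last by apply/funext => x; rewrite exprS.
exact: (continuous_cM cf ih).
Qed.

Lemma ecjX x k : ecj x ^+ k = ecirc (- k%:R * x).
Proof.
rewrite /ecj ecirc_conj exprVn -ecircMn mulNr; apply: (mulfI (ecirc_neq0 (x *+ k))).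
by rewrite mulfV ?ecirc_neq0// -ecircD mulr_natl subrr ecirc0.
Qed.

Lemma ecirc_nat k : ecirc (k%:R : R) = 1.
Proof. by rewrite -[X in ecirc X]mulr1 mulr_natl ecircMn ecirc1 expr1n. Qed.

Lemma cint_ecjX k : cint 0 1 (fun x => ecj x ^+ k) = (k == 0%N)%:R.
Proof.
case: k => [|k]; first by rewrite (cint_cst (1 : C) ler01) subr0 mul1r.
have h := cint_ecircM (- k.+1%:R : R) ler01.
rewrite mulr1 mulr0 ecirc0 (_ : ecirc (- _) = 1) ?subrr in h; last first.
  by rewrite -[LHS]mul1r -[X in X * _](ecirc_nat k.+1) -ecircD subrr ecirc0.
rewrite (cintZ 0 1 ((2 * pi * - k.+1%:R)%:C * 'i) (@continuous_ecircM _ (- k.+1%:R))) in h.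
move/eqP: h; rewrite mulf_eq0 => /orP[|/eqP].
  rewrite mulf_eq0 => /orP[/eqP [] /eqP|]; last by rewrite eq_complex/= oner_eq0 andbF.
  by rewrite mulrN oppr_eq0 mulf_eq0 pnatr_eq0 orbF mulf_eq0 pnatr_eq0/= gt_eqF// pi_gt0.
by move=> h; rewrite -[RHS]h; apply: eq_cint => x _; rewrite ecjX.
Qed.

Lemma geometric_split (q : C) N : 1 - q != 0 ->
  (1 - q)^-1 = \sum_(k < N) q ^+ k + q ^+ N / (1 - q).
Proof.
move=> q1; apply: (mulfI q1); rewrite mulfV// mulrDr -opprB mulNr -subrX1 opprB.
by rewrite mulrCA mulfV// mulr1 opprB subrK.
Qed.

(** Cauchy's integral for the Taylor coefficient at 0. On the circle [clamp] changes nothing, but it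
    makes the integrand continuous by [disc_holo_clamp]. *)
Definition tcoef g k : C := cint 0 1 (fun x => (g \o @clamp R) (ecirc x) * ecj x ^+ k).

Section one_function.
Variables (g : C -> C) (gh : disc_holo g) (zeta : C).
Hypothesis zeta1 : normc zeta < 1.

Let G (x : R) := (g \o @clamp R) (ecirc x).

Let cG : continuous G.
Proof. exact: (continuous_compC (@continuous_ecirc R) (disc_holo_clamp gh)). Qed.

Let q1 x : 1 - zeta * ecj x != 0.
Proof.
rewrite -normc_gt0 (lt_le_trans _ (normcB_ge _ _))// normc1 subr_gt0.
by rewrite normcM normc_ecj mulr1.
Qed.

Let cq : continuous (fun x : R => (1 - zeta * ecj x)^-1).
Proof.
apply: (continuous_cV _ q1); apply: (continuous_cB (@continuous_cst_ _ _ _)).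
exact: (continuous_cM (@continuous_cst_ _ _ _) continuous_ecj).
Qed.

Let normq x : normc (1 - zeta * ecj x)^-1 <= (1 - normc zeta)^-1.
Proof.
have z1 : 0 < 1 - normc zeta by rewrite subr_gt0.
rewrite normcV lef_pV2 ?posrE ?normc_gt0//.
by rewrite (le_trans _ (normcB_ge _ _))// normc1 normcM normc_ecj mulr1.
Qed.

(** The geometric series of the kernel, with its remainder, is integrated term by term; it serves
    for [H = 1] in [J1] and for [H = G] in [taylor_remainder]. *)
Let expand (H : R -> C) (M : R) N : continuous H -> (forall x, normc (H x) <= M) ->
  normc (cint 0 1 (fun x => H x / (1 - zeta * ecj x)) -
         \sum_(k < N) zeta ^+ k * cint 0 1 (fun x => H x * ecj x ^+ k))
  <= 2 * M * normc zeta ^+ N / (1 - normc zeta).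
Proof.
move=> cH HM.
have cHk k : continuous (fun x => zeta ^+ k * (H x * ecj x ^+ k)).
  apply: (continuous_cM (@continuous_cst_ _ _ _)); apply: (continuous_cM cH).
  exact: (continuous_cX continuous_ecj).
have cS m : continuous (fun x => \sum_(k < m) zeta ^+ k * (H x * ecj x ^+ k)) /\
   cint 0 1 (fun x => \sum_(k < m) zeta ^+ k * (H x * ecj x ^+ k)) =
   \sum_(k < m) zeta ^+ k * cint 0 1 (fun x => H x * ecj x ^+ k).
  elim: m => [|m [ih1 ih2]].
    split.
      rewrite (_ : (fun x => _) = (fun=> 0)); first exact: continuous_cst_.
      by apply/funext => x; rewrite big_ord0.
    rewrite big_ord0 (eq_cint (g := fun=> 0)); last by move=> x _; rewrite big_ord0.
    by rewrite cint_cst// mul0r.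
  have E : (fun x => \sum_(k < m.+1) zeta ^+ k * (H x * ecj x ^+ k)) =
    (fun x => \sum_(k < m) zeta ^+ k * (H x * ecj x ^+ k) + zeta ^+ m * (H x * ecj x ^+ m)).
    by apply/funext => x; rewrite big_ord_recr.
  rewrite E; split; first exact: (continuous_cD ih1 (cHk m)).
  rewrite (cintD 0 1 ih1 (cHk m)) ih2 big_ord_recr/=.
  by rewrite (cintZ 0 1 _ (continuous_cM cH (continuous_cX continuous_ecj))).
have [c1 c2] := cS N; rewrite -c2 -(cintB 0 1 _ c1); last exact: (continuous_cM cH cq).
have -> : 2 * M * normc zeta ^+ N / (1 - normc zeta) =
  2 * (M * (normc zeta ^+ N / (1 - normc zeta)) * (1 - 0)) by rewrite subr0 mulr1 !mulrA.
apply: (normc_cint_le ler01); first exact: (continuous_cB (continuous_cM cH cq) c1).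
move=> x _.
have -> : H x / (1 - zeta * ecj x) - \sum_(k < N) zeta ^+ k * (H x * ecj x ^+ k) =
    H x * ((zeta * ecj x) ^+ N / (1 - zeta * ecj x)).
  apply/eqP; rewrite subr_eq; apply/eqP; rewrite {1}(geometric_split N (q1 x)) mulrDr addrC.
  congr (_ + _); rewrite mulr_sumr; apply: eq_bigr => k _.
  by rewrite exprMn mulrCA.
rewrite normcM ler_pM ?normc_ge0// normcM normcX normcM normc_ecj mulr1.
by rewrite ler_wpM2l// exprn_ge0// normc_ge0.
Qed.

Let cK1 : continuous (fun x : R => 1 / (1 - zeta * ecj x)).
Proof. exact: (continuous_cM (@continuous_cst_ _ _ _) cq). Qed.

(** This determines the integral of the Cauchy kernel: in its expansion only the term of degree 0
    has a nonzero integral. *)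
Let J1 : cint 0 1 (fun x : R => 1 / (1 - zeta * ecj x)) = 1.
Proof.
apply/eqP; rewrite -subr_eq0 -normc_eq0 eq_le normc_ge0 andbT.
apply: (@le0_geo _ _ (2 / (1 - normc zeta) * normc zeta) _ (normc_ge0 zeta) zeta1) => N.
have n1 (x : R) : normc (1 : C) <= 1 by rewrite normc1.
have := expand N.+1 (@continuous_cst_ R C 1) n1.
rewrite big_ord_recl expr0 mul1r big1 ?addr0 => [|k _]; last first.
  rewrite (eq_cint (g := fun x => ecj x ^+ (lift ord0 k))) ?cint_ecjX ?mulr0// => x _.
  by rewrite mul1r.
rewrite (eq_cint (f := fun x => 1 * ecj x ^+ 0) (g := fun x => ecj x ^+ 0)) ?cint_ecjX; last first.
  by move=> x _; rewrite mul1r.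
by move=> h; apply: (le_trans h); rewrite exprS le_eqVlt; apply/orP; left; apply/eqP; ring.
Qed.

(** Both sides of [cauchy_kernel] carry the same constant [2 i pi], which cancels. *)
Lemma cauchy_formula : g zeta = cint 0 1 (fun x => G x / (1 - zeta * ecj x)).
Proof.
have eneq x : ecirc x - zeta != 0.
  by rewrite -normc_gt0 (lt_le_trans _ (normcB_ge _ _))// normc_ecirc subr_gt0.
have KE x : (2 * pi)%:C * 'i * ecirc x / (ecirc x - zeta) =
    (2 * pi)%:C * 'i * (1 / (1 - zeta * ecj x)).
  rewrite mul1r -mulrA; congr (_ * _); apply: (mulfI (eneq x)); apply: (mulIf (q1 x)).
  rewrite mulrCA mulfV// mulr1 -mulrA mulVf// mulr1 mulrBr mulr1 mulrCA /ecj ecirc_conj.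
  by rewrite mulfV ?ecirc_neq0// mulr1.
have := cauchy_kernel zeta1 gh.
rewrite (eq_cint (g := fun x => (2 * pi)%:C * 'i * (G x / (1 - zeta * ecj x)))); last first.
  by move=> x _; rewrite KE mul1r -mulrA; congr (_ * _); rewrite mulrC.
rewrite (eq_cint (f := fun x => (2 * pi)%:C * 'i * ecirc x / (ecirc x - zeta))
  (g := fun x => (2 * pi)%:C * 'i * (1 / (1 - zeta * ecj x)))); last by move=> x _; rewrite KE.
rewrite (cintZ _ _ _ cK1) (cintZ _ _ _ (continuous_cM cG cq)) J1 mulr1 mulrC => h.
apply/esym; apply: (mulIf _ h); rewrite mulf_neq0//; last by rewrite eq_complex/= oner_eq0 andbF.
by rewrite -normc_gt0 normc_real normr_gt0 mulf_neq0// gt_eqF// pi_gt0.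
Qed.

Lemma taylor_remainder M N : (forall z, normc z <= 1 -> normc (g z) <= M) ->
  normc (g zeta - \sum_(k < N) zeta ^+ k * tcoef g k)
  <= 2 * M * normc zeta ^+ N / (1 - normc zeta).
Proof. by move=> gM; rewrite cauchy_formula; apply: expand => // x; apply: gM; exact: normc_clamp. Qed.

(** Cauchy's formula with the kernel bounded by [1 / (1 - |zeta|)]. The crude constant, in place of
    a Poisson kernel, is absorbed in [hartogs]. *)
Lemma normc_le_mean :
  normc (g zeta) <= 2 / (1 - normc zeta) * rint 0 1 (fun x => normc (g (ecirc x))).
Proof.
rewrite cauchy_formula (le_trans (normc_cint _ _ (continuous_cM cG cq)))//.
have cn := continuous_normcC cG.
rewrite (eq_rint (u := fun x => normc (g (ecirc x))) (v := @normc R \o G)); last first.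
  by move=> x _; rewrite /G/= clamp_id// normc_ecirc.
rewrite -mulrA ler_pM2l// -(rintZ 0 1 _ cn); apply: le_rint.
- exact: (continuous_normcC (continuous_cM cG cq)).
- by move=> x; apply: cvgM; [exact: cvg_cst|exact: cn].
- by move=> x _; rewrite /= normcM mulrC ler_wpM2r ?normc_ge0.
Qed.

End one_function.

Lemma normc_tcoef g M k : disc_holo g -> (forall z, normc z <= 1 -> normc (g z) <= M) ->
  normc (tcoef g k) <= 2 * M.
Proof.
move=> gh gM; rewrite -[M in 2 * M]mulr1 -[X in M * X]subr0.
apply: (normc_cint_le ler01).
  apply: (continuous_cM _ (continuous_cX continuous_ecj)).
  exact: (continuous_compC (@continuous_ecirc R) (disc_holo_clamp gh)).
move=> x _; rewrite normcM normcX normc_ecj expr1n mulr1; apply: gM; exact: normc_clamp.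
Qed.

End taylor_disc.

(** * Several complex variables *)

Section complex_differentiability.
Context (R : realType) (n : nat).
Local Notation C := R[i].
Implicit Types (f g : 'rV[C]_n -> C) (z w v : 'rV[C]_n).

(** The two norms have the same balls about 0, hence coincide. *)
Lemma norm_rowE v : `|v| = (nrm v)%:C.
Proof.
have vr : `|v| = (Re `|v|)%:C by rewrite RRe_real// normr_real.
rewrite vr; congr (_%:C); set r := Re `|v| in vr *.
have r0 : 0 <= r by rewrite -ler0c -vr.
have H e : 0 < e -> (r < e) = (nrm v < e).
  move=> e0; rewrite -ltcR -vr -[v in LHS]opprK normrN -[in LHS](add0r (- v)).
  have := @mx_norm_ball C 1 n => /(congr1 (fun b => b 0 e%:C v)) /= bE.
  apply/idP/idP => [h|/nrm_lt -/(_ e0) h].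
    have [_ b] : ball 0 e%:C v by rewrite bE.
    apply/nrm_lt => // k.
    by have := b ord0 k; rewrite -ball_normE/= normc_norm !mxE sub0r normcN ltcR.
  suff : ball 0 e%:C v by rewrite bE.
  split; first by rewrite ltcR.
  by move=> i k; rewrite -ball_normE/= normc_norm !mxE sub0r normcN ltcR ord1.
apply/le_anti/andP; split; apply/ler_addgt0Pr => e e0; apply/ltW.
  by rewrite H ?ltr_pwDr ?nrm_ge0// ltrDl.
by rewrite -H ?ltrDl// ltr_pwDr.
Qed.

Definition lform (a : 'I_n -> C) v := \sum_k a k * v ord0 k.

Definition cdiff_with f z (a : 'I_n -> C) := forall e : R, 0 < e -> exists2 d : R, 0 < d &
  forall w, nrm (w - z) < d -> normc (f w - f z - lform a (w - z)) <= e * nrm (w - z).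

Definition cdiff f z := exists a, cdiff_with f z a.

Lemma lformD a v w : lform a (v + w) = lform a v + lform a w.
Proof. by rewrite /lform -big_split; apply: eq_bigr => k _; rewrite mxE mulrDr. Qed.

Lemma lformZ a c v : lform a (c *: v) = c * lform a v.
Proof. by rewrite /lform mulr_sumr; apply: eq_bigr => k _; rewrite mxE mulrCA. Qed.

Lemma lform_is_linear a : linear (lform a : 'rV[C]_n -> C).
Proof. by move=> c v w; rewrite lformD lformZ. Qed.

Lemma normc_lform a v : normc (lform a v) <= (\sum_k normc (a k)) * nrm v.
Proof.
rewrite /lform (le_trans (normc_sum _ _ _))// mulr_suml ler_sum// => k _.
by rewrite normcM ler_wpM2l ?normc_ge0// normc_le_nrm.
Qed.

Lemma row_delta v : v = \sum_k v ord0 k *: delta_mx ord0 k.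
Proof. exact: row_sum_delta. Qed.

(** Passage between Frechet differentiability and the estimate [cdiff], where the differential is
    written in coordinates; the converse relies on the uniqueness of a continuous linear map with
    the little-o expansion. *)
Lemma differentiableE f z : differentiable f z <-> cdiff f z.
Proof.
split.
  move=> /diff_locallyP[_ /eqaddoP H].
  exists (fun k => 'd f z (delta_mx ord0 k)) => e e0.
  have /nbhs_polydiscP[d d0 dP] := H e%:C (eq_ind_r is_true e0 (ltcR 0 e)).
  exists d => // w wd; have := dP (w - z); rewrite subr0 => /(_ wd).
  rewrite norm_rowE -rmorphM/= normc_norm lecR.
  have dE v : 'd f z v = lform (fun k => 'd f z (delta_mx ord0 k)) v.
    rewrite {1}(row_delta v) linear_sum; apply: eq_bigr => k _.
    by rewrite linearZ [LHS]mulrC.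
  rewrite -dE; congr (normc _ <= _).
  by rewrite -[LHS]/(f (w - z + z) - (f z + 'd f z (w - z))) opprD addrA subrK.
move=> [a aP].
pose L : {linear 'rV[C]_n -> C} :=
  HB.pack (lform a) (GRing.isLinear.Build C 'rV[C]_n C *:%R (lform a) (lform_is_linear a)).
have cL : continuous L.
  move=> v; apply/(@cvg_complexP _ _ (nbhs v)) => e e0.
  pose A := \sum_k normc (a k); have A0 : 0 < A + 1.
    by rewrite ltr_wpDl// sumr_ge0// => k _; exact: normc_ge0.
  apply/nbhs_polydiscP; exists (e / (A + 1)); first by rewrite divr_gt0.
  move=> w; rewrite ltr_pdivlMr// => wv.
  rewrite -(linearB L) (le_lt_trans (normc_lform a (w - v)))//.
  by have := nrm_ge0 (w - v); rewrite -/A; nra.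
have U := @diff_unique _ 'rV[C]_n C f L z cL.
match type of U with ?P -> _ => have H : P end.
  apply/eqaddoP => e e0.
  have er : e = (Re e)%:C by rewrite RRe_real// gtr0_real.
  have e0' : 0 < Re e by move: e0; rewrite er ltcR.
  have [d d0 dP] := aP _ e0'.
  apply/nbhs_polydiscP; exists d => // w; rewrite subr0 => wd.
  have := dP (w + z); rewrite addrK => /(_ wd).
  rewrite er norm_rowE -rmorphM/= normc_norm lecR; congr (normc _ <= _).
  by rewrite -[RHS]/(f (w + z) - (f z + lform a w)) opprD addrA.
by apply/diff_locallyP; rewrite (U H).
Qed.

Lemma cdiff_with_cont f z a e : cdiff_with f z a -> 0 < e ->
  exists2 d, 0 < d & forall w, nrm (w - z) < d -> normc (f w - f z) < e.
Proof.
move=> fa e0; have [d d0 dP] := fa 1 ltr01.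
pose A := \sum_k normc (a k); have A0 : 0 < A + 1.
  by rewrite ltr_wpDl// sumr_ge0// => k _; exact: normc_ge0.
exists (Num.min d (e / (A + 1))); first by rewrite lt_min d0 divr_gt0.
move=> w; rewrite lt_min ltr_pdivlMr// => /andP[wd we].
have h1 := dP w wd; have h2 := normc_lform a (w - z).
have h3 := normcD (f w - f z - lform a (w - z)) (lform a (w - z)).
rewrite subrK in h3; rewrite -/A in h2; move: h1; rewrite mul1r => h1; nra.
Qed.

Lemma holomorphic_cont (D : set 'rV[C]_n) f z e : holomorphic D f -> D z -> 0 < e ->
  exists2 d, 0 < d & forall w, nrm (w - z) < d -> normc (f w - f z) < e.
Proof. by move=> fD /fD/differentiableE[a fa]; exact: cdiff_with_cont fa. Qed.

Lemma holomorphic_line (D : set 'rV[C]_n) f z v : holomorphic D f ->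
  (forall c, normc c <= 1 -> D (z + c *: v)) -> disc_holo (fun c => f (z + c *: v)).
Proof.
move=> fD zv c c1; have /differentiableE[a fa] := fD _ (zv c c1).
exists (lform a v) => e e0.
have v0 : 0 < nrm v + 1 by rewrite ltr_wpDl// nrm_ge0.
have [d d0 dP] := fa (e / (nrm v + 1)) (divr_gt0 e0 v0).
have E (w : C) : z + w *: v - (z + c *: v) = (w - c) *: v by rewrite scalerBl opprD addrACA subrr add0r.
exists (d / (nrm v + 1)); first by rewrite divr_gt0.
move=> w w1; rewrite ltr_pdivlMr// => wc; have := dP (z + w *: v).
have n0 := normc_ge0 (w - c); have nv := nrm_ge0 v.
rewrite E nrmZ lformZ (mulrC (lform a v)) => h; rewrite (le_trans (h _))//; first nra.
rewrite mulrAC ler_pdivrMr// -mulrA ler_wpM2l// ?(ltW e0)//; nra.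
Qed.

Lemma disc_holoP f z v : (forall c, normc c <= 1 -> cdiff f (z + c *: v)) ->
  disc_holo (fun c => f (z + c *: v)).
Proof.
move=> h; pose D : set 'rV[C]_n := [set w | exists2 c, normc c <= 1 & w = z + c *: v].
apply: (@holomorphic_line D); last by move=> c c1; exists c.
by move=> _ [c c1 ->]; apply/differentiableE; exact: h.
Qed.

End complex_differentiability.

(** * Taylor coefficients along a complex line *)

Section power_series.
Context (R : realType).
Local Notation C := R[i].
Implicit Types (g : C -> C) (c : nat -> C).

(** [K] does not depend on the order [N], so one hypothesis contains both convergence and all
    asymptotic expansions at 0. On [|l| <= 1/2] the factor [1 / (1 - |l|)] of the Cauchy remainder
    is at most 2. *)
Definition taylor_at0 g c (K : R) := forall N (l : C), normc l <= 1 / 2 ->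
  normc (g l - \sum_(k < N) l ^+ k * c k) <= K * normc l ^+ N.

(** At the first index where the coefficients differ, the two expansions bound their difference by a
    multiple of [x] for all small [x > 0]. *)
Lemma taylor_unique g c1 c2 (K1 K2 : R) : taylor_at0 g c1 K1 -> taylor_at0 g c2 K2 ->
  forall k, c1 k = c2 k.
Proof.
move=> h1 h2; elim/ltn_ind => k ih; apply/eqP; rewrite -subr_eq0 -normc_eq0 eq_le normc_ge0 andbT.
have small (x : R) : 0 < x -> x <= 1 / 2 -> normc (c1 k - c2 k) <= (K1 + K2) * x.
  move=> x0 x2; have nx : normc (x%:C : C) = x by rewrite normc_real gtr0_norm.
  have h1' := h1 k.+1 x%:C; have h2' := h2 k.+1 x%:C; rewrite !nx in h1' h2'.
  have := le_trans (normcB _ _) (lerD (h2' x2) (h1' x2)).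
  rewrite !big_ord_recr/=.
  have -> : \sum_(i < k) x%:C ^+ i * c1 i = \sum_(i < k) x%:C ^+ i * c2 i.
    by apply: eq_bigr => i _; rewrite ih.
  set S := \sum_(_ < _) _.
  rewrite (_ : _ - _ = x%:C ^+ k * (c1 k - c2 k)); last by ring.
  rewrite normcM normcX nx => h; rewrite -(ler_pM2l (exprn_gt0 k x0)) (le_trans h)// exprSr.
  by rewrite le_eqVlt; apply/orP; left; apply/eqP; ring.
have [K0|K0] := leP (K1 + K2) 0.
  rewrite (le_trans (small (1/2) _ _))//; nra.
rewrite leNgt; apply/negP => e0; set e := normc _ in e0 small.
pose x := Num.min (1 / 2) (e / (2 * (K1 + K2))).
have x0 : 0 < x by rewrite lt_min !divr_gt0// mulr_gt0.
have xle : x <= e / (2 * (K1 + K2)) by rewrite ge_min lexx orbT.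
have := small x x0; rewrite ge_min lexx => /(_ isT).
rewrite leNgt => /negP; apply.
rewrite ler_pdivlMr ?mulr_gt0// in xle; nra.
Qed.

Lemma disc_holo_taylor g M : disc_holo g -> (forall z, normc z <= 1 -> normc (g z) <= M) ->
  taylor_at0 g (tcoef g) (4 * M).
Proof.
move=> gh gM N l l2; have l1 : normc l < 1 by lra.
have M0 : 0 <= M by rewrite (le_trans (normc_ge0 (g 0)))// gM// normc0.
rewrite (le_trans (taylor_remainder gh l1 N gM))// ler_pdivrMr; last lra.
have t0 := exprn_ge0 N (normc_ge0 l); have l12 : 0 <= 1 - 2 * normc l by lra.
have := mulr_ge0 (mulr_ge0 M0 t0) l12; lra.
Qed.

Lemma taylor_scale g c K (s : C) : normc s <= 1 -> 0 <= K -> taylor_at0 g c K ->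
  taylor_at0 (fun l => g (s * l)) (fun k => s ^+ k * c k) K.
Proof.
move=> s1 K0 gc N l l2; have sl : normc (s * l) <= normc l by rewrite normcM ler_piMl ?normc_ge0.
rewrite (eq_bigr (fun i : 'I_N => (s * l) ^+ i * c i)); last first.
  by move=> i _; rewrite exprMn mulrA (mulrC (l ^+ _)).
rewrite (le_trans (gc N _ (le_trans sl l2)))// ler_wpM2l// lerXn2r ?nnegrE ?normc_ge0//.
Qed.

(** Compares the coefficients on a disc with those on the smaller disc of relative radius [1 / |L|],
    by uniqueness of the expansion. *)
Lemma taylor_dilation g g1 c c1 (L : C) (K K1 : R) : 1 <= normc L -> 0 <= K ->
  (forall l, g1 l = g (L^-1 * l)) -> taylor_at0 g c K -> taylor_at0 g1 c1 K1 ->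
  forall k, c k = L ^+ k * c1 k.
Proof.
move=> L1 K0 gg Tg Tg1 k; have L0 : 0 < normc L by lra.
have LV : normc L^-1 <= 1 by rewrite normcV invf_le1.
have := taylor_scale LV K0 Tg; have <- : g1 = (fun l => g (L^-1 * l)) by exact/funext.
move=> T; rewrite -(taylor_unique T Tg1) mulrA -exprMn mulfV ?expr1n ?mul1r//.
by rewrite -normc_gt0.
Qed.

Lemma derivative_tcoef1 g M b : disc_holo g -> (forall z, normc z <= 1 -> normc (g z) <= M) ->
  (forall e : R, 0 < e -> exists2 d : R, 0 < d &
     forall w, normc w <= 1 -> normc w < d -> normc (g w - g 0 - b * w) <= e * normc w) ->
  tcoef g 0 = g 0 /\ tcoef g 1 = b.
Proof.
move=> gh gM gb; have T := disc_holo_taylor gh gM.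
have M0 : 0 <= M by rewrite (le_trans (normc_ge0 (g 0)))// gM// normc0.
have c0 : tcoef g 0 = g 0.
  have z2 : normc (0 : C) <= 1 / 2 by rewrite normc0 divr_ge0.
  have := T 1%N 0 z2; rewrite normc0 expr1 mulr0 big_ord1 expr0 mul1r.
  by rewrite le_eqVlt ltNge normc_ge0 orbF normc_eq0 subr_eq0 => /eqP <-.
split=> //; apply/eqP; rewrite -subr_eq0 -normc_eq0 eq_le normc_ge0 andbT.
apply/ler_addgt0Pr => e e0; rewrite add0r.
have e20 : 0 < e / 2 by rewrite divr_gt0.
have [d d0 dP] := gb _ e20.
(* The three bounds serve the Taylor estimate, the differentiability estimate, and the inequality
   [4 * M * x <= e / 2] for the remainder of order 2. *)
pose x := Num.min (1 / 2) (Num.min (d / 2) (e / (8 * (M + 1)))).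
have M1 : 0 < 8 * (M + 1) by nra.
have x0 : 0 < x by rewrite !lt_min !divr_gt0.
have nx : normc (x%:C : C) = x by rewrite normc_real gtr0_norm.
have x2 : x <= 1 / 2 by rewrite ge_min lexx.
have xd : x < d.
  have : x <= d / 2 by rewrite /x !ge_min lexx orbT.
  lra.
have xe : x * (8 * (M + 1)) <= e by rewrite -ler_pdivlMr// /x !ge_min lexx !orbT.
have := T 2%N x%:C; rewrite nx => /(_ x2); rewrite !big_ord_recr big_ord0/= add0r expr0 mul1r c0.
move=> h1; have := dP x%:C; rewrite nx => /(_ _ xd) h2; have {}h2 := h2 ltac:(lra).
have := le_trans (normcB _ _) (lerD h2 h1).
rewrite (_ : _ - _ = x%:C * (tcoef g 1 - b)); last by ring.
rewrite normcM nx expr2 mulrA => h; rewrite -(ler_pM2l x0); nra.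
Qed.

Lemma complex_cauchy (u : nat -> C) :
  (forall e : R, 0 < e -> exists N, forall j k, (N <= j)%N -> (N <= k)%N -> normc (u j - u k) <= e) ->
  exists l, forall e : R, 0 < e -> exists N, forall k, (N <= k)%N -> normc (u k - l) <= e.
Proof.
move=> H.
have cR (v : nat -> R) : (forall j k, `|v j - v k| <= normc (u j - u k)) ->
   exists l, forall e : R, 0 < e -> exists N, forall k, (N <= k)%N -> `|v k - l| <= e.
  move=> vu; have : cvgn v.
    apply/cauchy_cvgP; apply/cauchy_exP => e e0.
    have [N NP] := H (e / 2) (divr_gt0 e0 (ltr0Sn _ _)).
    exists (v N); exists N => //= k Nk; rewrite /ball/= (le_lt_trans (vu _ _))//.
    by rewrite (le_lt_trans (NP _ _ (leqnn N) Nk))// ltr_pdivrMr// ltr_pMr// ltr1n.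
  move=> /cvg_ex[l vl]; exists l => e e0.
  have /cvgrPdist_le/(_ _ e0)[N _ NP] := vl.
  by exists N => k Nk; rewrite distrC; exact: NP.
have [|a aP] := cR (Re \o u).
  by move=> j k; rewrite /= -raddfB; exact: normc_Re.
have [|b bP] := cR (Im \o u).
  by move=> j k; rewrite /= -raddfB; exact: normc_Im.
exists (a +i* b) => e e0.
have [N1 h1] := aP (e / 2) (divr_gt0 e0 (ltr0Sn _ _)).
have [N2 h2] := bP (e / 2) (divr_gt0 e0 (ltr0Sn _ _)).
exists (maxn N1 N2) => k; rewrite geq_max => /andP[k1 k2].
rewrite (le_trans (normc_le_ReIm _))// [e]splitr; move: (h1 k k1) (h2 k k2) => /=.
by case: (u k) => x y /= ? ?; rewrite lerD.
Qed.

End power_series.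

(** * Weierstrass' theorem on uniform limits *)

Section weierstrass.
Context (R : realType) (n : nat).
Local Notation C := R[i].
Implicit Types (f g : 'rV[C]_n -> C) (z w v : 'rV[C]_n) (a : 'I_n -> C).

Lemma cdiff_withD f g z a b : cdiff_with f z a -> cdiff_with g z b ->
  cdiff_with (fun w => f w + g w) z (fun k => a k + b k).
Proof.
move=> fa gb e e0; have e20 : 0 < e / 2 by rewrite divr_gt0.
have [d1 d10 h1] := fa _ e20; have [d2 d20 h2] := gb _ e20.
exists (Num.min d1 d2); first by rewrite lt_min d10.
move=> w; rewrite lt_min => /andP[w1 w2].
have -> : lform (fun k => a k + b k) (w - z) = lform a (w - z) + lform b (w - z).
  by rewrite /lform -big_split; apply: eq_bigr => k _; rewrite mulrDl.
rewrite [e]splitr mulrDl (le_trans _ (lerD (h1 w w1) (h2 w w2)))//.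
by rewrite (le_trans _ (normcD _ _))// le_eqVlt; apply/orP; left; apply/eqP; congr normc; ring.
Qed.

Lemma cdiff_withZ f z a c : cdiff_with f z a ->
  cdiff_with (fun w => c * f w) z (fun k => c * a k).
Proof.
move=> fa e e0; have c0 : 0 < normc c + 1 by rewrite ltr_wpDl// normc_ge0.
have [d d0 h] := fa _ (divr_gt0 e0 c0); exists d => // w wd.
have -> : lform (fun k => c * a k) (w - z) = c * lform a (w - z).
  by rewrite /lform mulr_sumr; apply: eq_bigr => k _; rewrite mulrA.
rewrite -!mulrBr normcM; have := h w wd; rewrite mulrAC ler_pdivlMr//.
have := normc_ge0 c; have := normc_ge0 (f w - f z - lform a (w - z)); nra.
Qed.

Lemma cdiff_withB f g z a b : cdiff_with f z a -> cdiff_with g z b ->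
  cdiff_with (fun w => f w - g w) z (fun k => a k - b k).
Proof.
move=> fa gb; have := cdiff_withD fa (cdiff_withZ (-1) gb).
by under eq_fun do rewrite mulN1r; under [X in cdiff_with _ _ X]eq_fun do rewrite mulN1r.
Qed.

Lemma cdiff_with_cst c z : cdiff_with (fun=> c) z (fun=> 0).
Proof.
move=> e e0; exists 1 => // w _; rewrite subrr sub0r normcN /lform big1 ?normc0; last first.
  by move=> k _; rewrite mul0r.
by rewrite mulr_ge0 ?nrm_ge0// ltW.
Qed.

Lemma cdiff_scale f z c : cdiff f (c *: z) -> cdiff (fun w => f (c *: w)) z.
Proof.
move=> [a fa]; exists (fun k => c * a k) => e e0.
have c0 : 0 < normc c + 1 by rewrite ltr_wpDl// normc_ge0.
have [d d0 h] := fa _ (divr_gt0 e0 c0); exists (d / (normc c + 1)); first by rewrite divr_gt0.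
move=> w; rewrite ltr_pdivlMr// => wd; have := h (c *: w).
have -> : lform (fun k => c * a k) (w - z) = lform a (c *: (w - z)).
  by rewrite lformZ /lform mulr_sumr; apply: eq_bigr => k _; rewrite mulrA.
rewrite -scalerBr nrmZ => H; have nc := normc_ge0 c; have nz := nrm_ge0 (w - z).
by rewrite (le_trans (H _))//; [nra|rewrite mulrAC ler_pdivrMr// -mulrA ler_wpM2l ?(ltW e0)//; nra].
Qed.

(** Cauchy's estimates on each complex line through [z]. Both bounds depend on [f] only through its
    bound [M], so that they tend to 0 for the differences of a uniformly convergent sequence. *)
Lemma cdiff_second_order f z r M a : 0 < r ->
  (forall w, nrm (w - z) <= r -> cdiff f w) -> (forall w, nrm (w - z) <= r -> normc (f w) <= M) ->
  cdiff_with f z a ->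
  (forall v, normc (lform a v) <= 2 * M * nrm v / r) /\
  (forall v, nrm v <= r / 2 -> normc (f (z + v) - f z - lform a v) <= 4 * M * (nrm v / r) ^+ 2).
Proof.
move=> r0 fd fM fa.
have key v : nrm v = r -> (normc (lform a v) <= 2 * M) /\
   (forall t : C, normc t <= 1 / 2 ->
      normc (f (z + t *: v) - f z - t * lform a v) <= 4 * M * normc t ^+ 2).
  move=> vr; pose g c := f (z + c *: v).
  have lin c : normc c <= 1 -> nrm (z + c *: v - z) <= r.
    by move=> c1; rewrite addrAC subrr add0r nrmZ vr ler_piMl// ltW.
  have gh : disc_holo g by apply: disc_holoP => c c1; exact/fd/lin.
  have gM c : normc c <= 1 -> normc (g c) <= M by move=> c1; exact/fM/lin.
  have [] := @derivative_tcoef1 _ g M (lform a v) gh gM.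
    move=> e e0; have [d d0 h] := fa _ (divr_gt0 e0 r0).
    exists (d / r); first by rewrite divr_gt0.
    move=> w _; rewrite ltr_pdivlMr// => wd; have := h (z + w *: v).
    rewrite addrAC subrr add0r nrmZ vr lformZ /g scale0r addr0 [w * _]mulrC => /(_ wd).
    by rewrite (mulrC (normc w)) mulrA divfK ?gt_eqF.
  move=> g0 g1; split; first by rewrite -g1; exact: normc_tcoef.
  move=> t t2; have := disc_holo_taylor gh gM 2 t2.
  by rewrite !big_ord_recr big_ord0/= add0r expr0 mul1r g0 g1 expr1 /g scale0r addr0 opprD addrA.
split=> v.
  have [v0|v0] := eqVneq (nrm v) 0.
    rewrite v0 mulr0 mul0r (nrm_eq0 v0) /lform big1 ?normc0// => k _; by rewrite mxE mulr0.
  have vp : 0 < nrm v by rewrite lt_neqAle eq_sym v0 nrm_ge0.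
  have [|h _] := key ((r / nrm v)%:C *: v).
    by rewrite nrmZ normc_real ger0_norm ?divr_ge0 ?ltW// divfK.
  rewrite lformZ normcM normc_real ger0_norm ?divr_ge0 ?(ltW r0) ?(ltW vp)// in h.
  by rewrite ler_pdivlMr// -ler_pdivrMr// mulrAC mulrC mulrA mulrAC.
move=> v2; have [v0|v0] := eqVneq (nrm v) 0.
  rewrite v0 (nrm_eq0 v0) addr0 subrr sub0r normcN mul0r expr0n mulr0.
  by rewrite /lform big1 ?normc0// => k _; rewrite mxE mulr0.
have vp : 0 < nrm v by rewrite lt_neqAle eq_sym v0 nrm_ge0.
have [|_ h] := key ((r / nrm v)%:C *: v).
  by rewrite nrmZ normc_real ger0_norm ?divr_ge0 ?ltW// divfK.
have := h (nrm v / r)%:C; rewrite normc_real ger0_norm ?divr_ge0 ?(ltW r0) ?(ltW vp)//.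
have E : (nrm v / r)%:C * (r / nrm v)%:C = 1.
  by rewrite -rmorphM/= mulrA divfK ?gt_eqF// mulfV.
rewrite lformZ (mulrA _ _ (lform a v)) scalerA E scale1r (mul1r (lform a v)); apply.
by rewrite ler_pdivrMr//; lra.
Qed.

(** The differentials converge coefficientwise, and the linearisation errors of [F k - F N] are
    uniformly small compared with [|w - z|]; the error of the limit is thus compared with that of
    one fixed [F N]. *)
Lemma cdiff_uniform_limit (F : nat -> 'rV[C]_n -> C) f z r : 0 < r ->
  (forall N w, nrm (w - z) <= r -> cdiff (F N) w) ->
  (forall e, 0 < e -> exists N0, forall N w, (N0 <= N)%N -> nrm (w - z) <= r ->
     normc (F N w - f w) <= e) -> cdiff f z.
Proof.
move=> r0 Fd Ff.
have zz : nrm (z - z) <= r by rewrite subrr nrm0 ltW.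
have [a aP] := choice (fun N => Fd N z zz).
have unif e : 0 < e -> exists N0, forall j k, (N0 <= j)%N -> (N0 <= k)%N ->
    forall w, nrm (w - z) <= r -> normc (F j w - F k w) <= e.
  move=> e0; have [N0 h] := Ff (e / 2) (divr_gt0 e0 (ltr0Sn _ _)).
  exists N0 => j k Nj Nk w wr; rewrite -(subrKA (f w)) [e]splitr (le_trans (normcD _ _))// lerD//.
    exact: h.
  by rewrite normc_distC; exact: h.
have so j k e : (forall w, nrm (w - z) <= r -> normc (F j w - F k w) <= e) ->
  (forall v, normc (lform (a j) v - lform (a k) v) <= 2 * e * nrm v / r) /\
  (forall v, nrm v <= r / 2 -> normc (F j (z + v) - F k (z + v) - (F j z - F k z) -
     (lform (a j) v - lform (a k) v)) <= 4 * e * (nrm v / r) ^+ 2).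
  move=> h.
  have lB v : lform (fun i => a j i - a k i) v = lform (a j) v - lform (a k) v.
    by rewrite /lform -sumrB; apply: eq_bigr => i _; rewrite mulrBl.
  have [] := @cdiff_second_order (fun w => F j w - F k w) z r e (fun i => a j i - a k i) r0.
  - move=> w wr; have [b1 h1] := Fd j w wr; have [b2 h2] := Fd k w wr.
    by eexists; exact: (cdiff_withB h1 h2).
  - by move=> w wr; exact: h.
  - exact: (cdiff_withB (aP j) (aP k)).
  by move=> h1 h2; split=> v; rewrite -lB; [exact: h1|exact: h2].
have lim i : exists l, forall e : R, 0 < e -> exists N, forall k, (N <= k)%N ->
    normc (a k i - l) <= e.
  apply: complex_cauchy => e e0.
  have e1 : 0 < e * r / 2 by rewrite divr_gt0// mulr_gt0.
  have [N0 h] := unif _ e1; exists N0 => j k Nj Nk.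
  have [h1 _] := so j k _ (h j k Nj Nk); have := h1 (delta_mx ord0 i).
  have ld (b : 'I_n -> C) : lform b (delta_mx ord0 i) = b i.
    rewrite /lform (bigD1 i)//= mxE !eqxx mulr1 big1 ?addr0// => k' ki.
    by rewrite mxE (negbTE ki) andbF mulr0.
  rewrite !ld => h2; apply: (le_trans h2).
  have nd : nrm (delta_mx ord0 i : 'rV[C]_n) <= 1.
    by apply/nrm_le => // k'; rewrite mxE; case: (_ && _); rewrite ?normc1 ?normc0.
  rewrite ler_pdivrMr// (_ : 2 * (e * r / 2) = e * r); last by field.
  by rewrite ler_piMr// mulr_ge0// ltW.
have [b bP] := choice lim.
have liml v e : 0 < e -> exists N, forall k, (N <= k)%N -> normc (lform (a k) v - lform b v) <= e.
  move=> e0; have v1 : 0 < n%:R * (nrm v + 1) + 1.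
    by rewrite ltr_wpDl// mulr_ge0// addr_ge0// nrm_ge0.
  have [N NP] := choice (fun i => bP i _ (divr_gt0 e0 v1)).
  exists (\max_i N i)%N => k Nk.
  have -> : lform (a k) v - lform b v = lform (fun i => a k i - b i) v.
    by rewrite /lform -sumrB; apply: eq_bigr => i _; rewrite mulrBl.
  rewrite (le_trans (normc_lform _ _))//.
  have : \sum_i normc (a k i - b i) <= n%:R * (e / (n%:R * (nrm v + 1) + 1)).
    rewrite mulr_natl -[in X in _ *+ X](card_ord n) -sumr_const ler_sum// => i _.
    by rewrite NP// (leq_trans _ Nk)// leq_bigmax.
  move=> h; rewrite (le_trans (ler_wpM2r (nrm_ge0 v) h))// mulrA mulrAC ler_pdivrMr//.
  have := nrm_ge0 v; have : 0 <= n%:R :> R by []; nra.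
exists b => e e0.
(* With this [e1] the second-order bound [4 * e1 * (|w - z| / r)^2] is at most [e / 4 * |w - z|],
   since [|w - z| <= r]. *)
pose e1 := e * r / 16; have e10 : 0 < e1 by rewrite divr_gt0// mulr_gt0.
have [N h] := unif e1 e10.
have e40 : 0 < e / 4 by rewrite divr_gt0.
have [d d0 dP] := aP N _ e40.
exists (Num.min d (r / 2)); first by rewrite lt_min d0 divr_gt0.
move=> w; rewrite lt_min => /andP[wd wr].
have [w0|w0] := eqVneq (nrm (w - z)) 0.
  have -> : w = z by apply/eqP; rewrite -subr_eq0; apply/eqP/nrm_eq0.
  by rewrite !subrr nrm0 mulr0 sub0r normcN /lform big1 ?normc0// => k _; rewrite mxE mulr0.
have wp : 0 < nrm (w - z) by rewrite lt_neqAle eq_sym w0 nrm_ge0.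
(* The index [k] below may depend on [w]: each of the three errors against the limit is made at most
   [e / 12] times the distance. *)
have eta0 : 0 < e * nrm (w - z) / 12 by rewrite divr_gt0// mulr_gt0.
have [N1 h1] := Ff _ eta0; have [N2 h2] := liml (w - z) _ eta0.
pose k := maxn N (maxn N1 N2).
have wr' : nrm (w - z) <= r by have := nrm_ge0 (w - z); lra.
have [_ h3] := so k N e1 (h k N (leq_maxl _ _) (leqnn N)).
have := h3 (w - z) (ltW wr); rewrite (addrC z) subrK => h4.
have h5 := dP w wd.
have h6 : normc (F k w - f w) <= e * nrm (w - z) / 12.
  by apply: h1 => //; rewrite !leq_max leqnn orbT.
have h7 : normc (F k z - f z) <= e * nrm (w - z) / 12.
  by apply: h1 => //; rewrite !leq_max leqnn orbT.
have h8 : normc (lform (a k) (w - z) - lform b (w - z)) <= e * nrm (w - z) / 12.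
  by apply: h2; rewrite !leq_max leqnn !orbT.
have -> : f w - f z - lform b (w - z) =
   (F k w - F N w - (F k z - F N z) - (lform (a k) (w - z) - lform (a N) (w - z)))
   + (F N w - F N z - lform (a N) (w - z)) - (F k w - f w) + (F k z - f z)
   + (lform (a k) (w - z) - lform b (w - z)) by ring.
have h9 : 4 * e1 * (nrm (w - z) / r) ^+ 2 <= e * nrm (w - z) / 4.
  rewrite /e1 (_ : _ * _ = e * nrm (w - z) / 4 * (nrm (w - z) / r)); last by field; rewrite gt_eqF.
  by rewrite ler_piMr ?ler_pdivrMr ?mul1r// divr_ge0// mulr_ge0// ltW.
move: h4 h5 h6 h7 h8 h9.
set A := F k w - _ - _ - _; set B := F N w - _ - _; set G := F k w - f w; set H := F k z - f z.
set I := lform (a k) _ - _ => h4 h5 h6 h7 h8 h9.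
have n1 := normcD (A + B - G + H) I; have n2 := normcD (A + B - G) H.
have n3 := normcB (A + B) G; have n4 := normcD A B.
by lra.
Qed.

End weierstrass.

(** * Polynomial functions *)

Section polynomial_functions.
Context (R : realType) (n : nat).
Local Notation C := R[i].
Implicit Types (z w v : 'rV[C]_n) (p : mpoly.mpoly n C).

Lemma pevalE p z :
  peval p z = \sum_(m <- msupp p) mcoeff m p * \prod_(i < n) z ord0 i ^+ m i.
Proof. exact: mevalE. Qed.

Lemma peval_differentiable p z : differentiable (peval p) z.
Proof.
have -> : peval p = (fun w : 'rV[C]_n =>
    \sum_(m <- msupp p) mcoeff m p * \prod_(i < n) w ord0 i ^+ m i).
  by apply/funext => w; exact: pevalE.
elim: (msupp p) => [|m s ih].
  under eq_fun do rewrite big_nil; exact: differentiable_cst.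
under eq_fun do rewrite big_cons.
apply: differentiableD; last exact: ih.
apply: differentiableM; first exact: differentiable_cst.
elim: (index_enum _) => [|i t iht].
  under eq_fun do rewrite big_nil; exact: differentiable_cst.
under eq_fun do rewrite big_cons.
apply: differentiableM => //; elim: (m i) => [|k ihk].
  under eq_fun do rewrite expr0; exact: differentiable_cst.
under eq_fun do rewrite exprS.
by apply: differentiableM => //; exact: differentiable_coord.
Qed.

Lemma peval_cdiff p z : cdiff (peval p) z.
Proof. by apply/differentiableE; exact: peval_differentiable. Qed.

Lemma homog_polyP d p : homog_poly d p <-> forall m, m \in msupp p -> mdeg m = d.
Proof.
split=> [/allP h m /h /eqP//|h]; apply/allP => m /h /eqP //.
Qed.

Lemma peval_homog d p c z : homog_poly d p -> peval p (c *: z) = c ^+ d * peval p z.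
Proof.
move=> /homog_polyP h; rewrite !pevalE mulr_sumr; apply: eq_big_seq => m /h md.
rewrite mulrCA; congr (_ * _); rewrite -md mdegE -prodrXr -big_split.
by apply: eq_bigr => i _; rewrite mxE exprMn.
Qed.

Lemma poly_infinite_roots (q : {poly C}) : (forall k : nat, q.[k%:R] = 0) -> q = 0.
Proof.
move=> q0; apply/eqP; apply: contraT => qn0.
have := @max_poly_roots _ q [seq (k%:R : C) | k <- iota 0 (size q)] qn0.
rewrite size_map size_iota ltnn; apply.
  by apply/allP => _ /mapP[k _ ->]; apply/eqP.
rewrite map_inj_uniq ?iota_uniq// => i j /eqP; rewrite eqr_nat => /eqP//.
Qed.

(** The witness is the homogeneous part of degree [d]: for fixed [z] both sides are polynomials in
    [c] that agree at all natural numbers, and their coefficients of degree [d] are compared. *)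
Lemma homogeneous_peval d p : (forall c z, peval p (c *: z) = c ^+ d * peval p z) ->
  exists2 q, homog_poly d q & forall z, peval q z = peval p z.
Proof.
move=> ph; exists (pihomog mdeg d p); first exact: pihomogP.
move=> z; pose K := maxn (mmeasure mdeg p) d.+1.
have pE w : peval p w = \sum_(e < K) peval (pihomog mdeg e p) w.
  by rewrite {1}(pihomog_partitionE (leq_maxl (mmeasure mdeg p) d.+1)) /peval raddf_sum.
pose q : {poly C} := \poly_(e < K) peval (pihomog mdeg e p) z - peval p z *: 'X^d.
have : q = 0.
  apply: poly_infinite_roots => k; rewrite hornerD hornerN hornerZ horner_poly hornerXn.
  apply/eqP; rewrite subr_eq0 mulrC -ph pE; apply/eqP; apply: eq_bigr => e _.
  by rewrite (peval_homog _ _ (pihomogP _ _ _)) mulrC.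
move=> /(congr1 (fun r : {poly C} => r`_d)); rewrite coef0 coefB coef_poly coefZ coefXn eqxx mulr1.
by rewrite leq_max ltnSn orbT => /eqP; rewrite subr_eq0 => /eqP.
Qed.

(** [W] is the inverse of the Vandermonde matrix of the nodes 0, ..., d; it does not depend on the
    coefficients. *)
Lemma interpolation d : exists W : 'I_d.+1 -> 'I_d.+1 -> C, forall (c : nat -> C) (k : 'I_d.+1),
  c k = \sum_(j < d.+1) (\sum_(l < d.+1) (j%:R) ^+ l * c l) * W j k.
Proof.
pose V := Vandermonde d.+1 (\row_(j < d.+1) (j%:R : C)).
have Vu : V \in unitmx.
  rewrite unitmxE det_Vandermonde unitfE; apply/prodf_neq0 => i _; apply/prodf_neq0 => j ij.
  rewrite !mxE subr_eq0 eqr_nat; apply: contraTneq ij => /val_inj ->; by rewrite ltnn.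
exists (fun j k => invmx V j k) => c k.
have := congr1 (fun M : 'rV[C]_d.+1 => M ord0 k) (mulmxK Vu (\row_(l < d.+1) c l)).
rewrite !mxE => <-; apply: eq_bigr => j _; congr (_ * _); rewrite mxE; apply: eq_bigr => l _.
by rewrite !mxE mulrC.
Qed.

Definition sep_poly d (F : 'rV[C]_n -> C) := forall z i, exists c : nat -> C, forall x : C,
  F (z + x *: delta_mx ord0 i) = \sum_(k < d.+1) x ^+ k * c k.

Definition setc z i (x : C) := z + (x - z ord0 i) *: delta_mx ord0 i.

Lemma setcE z i x j : setc z i x ord0 j = if j == i then x else z ord0 j.
Proof.
by rewrite !mxE eqxx; case: eqVneq => [->|_]; rewrite ?mulr1 ?mulr0 ?addr0// addrC subrK.
Qed.

(** Induction on the number [m] of variables on which [F] depends: interpolation in the last of them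
    expresses [F] through its restrictions to [d + 1] hyperplanes, which depend on one variable
    less. *)
Lemma sep_poly_mpoly d F : sep_poly d F -> exists p, forall z, F z = peval p z.
Proof.
move=> Fd; suff H m : forall F, sep_poly d F ->
    (forall z w, (forall k : 'I_n, (k < m)%N -> z ord0 k = w ord0 k) -> F z = F w) ->
    exists p, forall z, F z = peval p z.
  by apply: (H n) => // z w zw; congr F; apply/rowP => k; exact: zw.
elim: m {Fd F} => [|m ih] F Fd Fm.
  exists (mpolyC n (F 0)) => z; rewrite /peval mevalC; exact: Fm.
have [nm|mn] := leqP n m.
  by apply: ih => // z w zw; apply: Fm => k _; apply: zw; exact: leq_trans (ltn_ord k) nm.
pose i := Ordinal mn; have [W WP] := interpolation d.
have pP (j : 'I_d.+1) : exists p, forall z, F (setc z i j%:R) = peval p z.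
  apply: ih => [z l|z w zw]; last first.
    apply: Fm => k km; rewrite !setcE; case: eqVneq => // ki; apply: zw.
    move: km; rewrite ltnS leq_eqVlt => /orP[/eqP km|//].
    by case/eqP: ki; apply: val_inj.
  have [->|li] := eqVneq l i.
    exists (fun k => if k == 0%N then F (setc z i j%:R) else 0) => x.
    rewrite big_ord_recl /= mul1r big1 ?addr0; last by move=> k _; rewrite mulr0.
    congr F; apply/rowP => k; rewrite !setcE !mxE eqxx/=.
    by case: eqVneq => // _; rewrite mulr0 addr0.
  have [c cP] := Fd (setc z i j%:R) l; exists c => x; rewrite -cP; congr F.
  apply/rowP => k; rewrite setcE [in RHS]mxE setcE !mxE eqxx/=; case: (eqVneq k i) => // ->.
  by rewrite eq_sym (negbTE li) mulr0 addr0.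
have [p pE] := choice pP.
exists (\sum_(k < d.+1) \sum_j mpolyX C (mnm1 i) ^+ k * (W j k *: p j)) => z.
have [c cP] := Fd (setc z i 0) i.
have FE x : F (setc z i x) = \sum_(k < d.+1) x ^+ k * c k.
  rewrite -cP; congr F; apply/rowP => k; rewrite setcE [in RHS]mxE setcE !mxE eqxx/=.
  by case: eqVneq; rewrite ?mulr1 ?mulr0 ?add0r ?addr0.
have -> : F z = F (setc z i (z ord0 i)).
  by congr F; apply/rowP => k; rewrite setcE; case: eqVneq => [->|].
rewrite FE /peval raddf_sum; apply: eq_bigr => k _.
rewrite raddf_sum (WP c k) mulr_sumr; apply: eq_bigr => j _.
rewrite -[RHS]/(meval (z ord0) (mpolyX C (mnm1 i) ^+ k * (W j k *: p j))).
by rewrite mevalM rmorphXn/= mevalXU mevalZ -FE pE (mulrC (W j k)).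
Qed.

End polynomial_functions.

(** * Homogeneous parts at the origin *)

Section homogeneous_expansion.
Context (R : realType) (n : nat).
Local Notation C := R[i].
Implicit Types (f g : 'rV[C]_n -> C) (z w v : 'rV[C]_n) (p : mpoly.mpoly n C).

(** The Taylor coefficient of degree [d] along the line through 0 and [z]. It is meaningful when the
    unit disc of that line lies where [f] is differentiable; [hext] removes this restriction by
    homogeneity. *)
Definition hpart f d z : C := tcoef (fun l => f (l *: z)) d.

(* z is scaled into the polydisc of radius rho, where f is known *)
Definition hext f (rho : R) d z : C :=
  ((rho / 2 / (nrm z + 1))%:C ^+ d)^-1 * hpart f d ((rho / 2 / (nrm z + 1))%:C *: z).

Section at_origin.
Local Opaque tcoef.
Variables (f : 'rV[C]_n -> C) (rho M : R).
Hypotheses (rho0 : 0 < rho) (fd : forall z, nrm z <= rho -> cdiff f z)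
  (fM : forall z, nrm z <= rho -> normc (f z) <= M).

Let scale_le z c : normc c <= 1 -> nrm z <= rho -> nrm (c *: z) <= rho.
Proof. by move=> c1 zr; rewrite nrmZ (le_trans _ zr)// ler_piMl ?nrm_ge0. Qed.

Let lineh z : nrm z <= rho -> disc_holo (fun l => f (l *: z)).
Proof.
move=> zr; have := @disc_holoP _ _ f 0 z; under eq_fun do rewrite add0r; apply=> c c1.
by rewrite add0r; apply: fd; exact: scale_le.
Qed.

Let lineM z : nrm z <= rho -> forall c, normc c <= 1 -> normc (f (c *: z)) <= M.
Proof. by move=> zr c c1; apply: fM; exact: scale_le. Qed.

Let M0 : 0 <= M.
Proof. by rewrite (le_trans (normc_ge0 (f 0)))// fM// nrm0 ltW. Qed.

Let hpart_taylor z : nrm z <= rho -> taylor_at0 (fun l => f (l *: z)) (hpart f ^~ z) (4 * M).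
Proof. by move=> zr; apply: disc_holo_taylor; [exact: lineh|exact: lineM]. Qed.

Let hpart_bound d z : nrm z <= rho -> normc (hpart f d z) <= 2 * M.
Proof. by move=> zr; apply: normc_tcoef; [exact: lineh|exact: lineM]. Qed.

Local Opaque hpart.

Let hpart_scale d z c : normc c <= 1 -> nrm z <= rho -> hpart f d (c *: z) = c ^+ d * hpart f d z.
Proof.
move=> c1 zr; have T1 := hpart_taylor (scale_le c1 zr).
have M4 : 0 <= 4 * M by rewrite mulr_ge0.
have T2 := taylor_scale c1 M4 (hpart_taylor zr).
have E : (fun l => f ((c * l) *: z)) = (fun l => f (l *: (c *: z))).
  by apply/funext => l; rewrite scalerA mulrC.
by rewrite E in T2; exact: taylor_unique T1 T2 d.
Qed.

(** Once the lower parts are subtracted from [f (t *: z)], division by [t^d] gives the part of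
    degree [d] up to an error of order [t], uniformly in [z], and Weierstrass' theorem applies. *)
Let hpart_cdiff d z : nrm z < rho -> cdiff (hpart f d) z.
Proof.
elim/ltn_ind : d z => d ih z zr.
(* The shift by 2 keeps [t N] in the range [|l| <= 1/2] of [taylor_at0]. *)
pose t (N : nat) : R := (N.+2)%:R^-1.
have t0 N : 0 < t N by rewrite invr_gt0.
have t2 N : t N <= 1 / 2 by rewrite div1r lef_pV2 ?posrE// ler_nat.
pose F N w := ((t N)%:C ^+ d)^-1 * (f ((t N)%:C *: w) - \sum_(k < d) (t N)%:C ^+ k * hpart f k w).
have r0 : 0 < (rho - nrm z) / 2 by rewrite divr_gt0// subr_gt0.
have near_z w : nrm (w - z) <= (rho - nrm z) / 2 -> nrm w < rho.
  by move=> wz; have := nrmD (w - z) z; rewrite subrK; lra.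
apply: (@cdiff_uniform_limit _ _ F _ z _ r0).
  move=> N w /near_z wr; have nt : normc (t N)%:C <= 1.
    by rewrite normc_real ger0_norm ?ltW//; have := t2 N; lra.
  have [a aP] : cdiff (fun w => f ((t N)%:C *: w)) w.
    by apply: cdiff_scale; apply: fd; apply: scale_le => //; exact: ltW.
  have [b bP] : cdiff (fun w => \sum_(k < d) (t N)%:C ^+ k * hpart f k w) w.
    have H m : (m <= d)%N -> cdiff (fun w => \sum_(k < m) (t N)%:C ^+ k * hpart f k w) w.
      elim: m => [|m ihm] md.
        by under eq_fun do rewrite big_ord0; eexists; exact: cdiff_with_cst.
      under eq_fun do rewrite big_ord_recr.
      have [b bP] := ihm (ltnW md); have [c cP] := ih m md w wr.
      by eexists; exact: (cdiff_withD bP (cdiff_withZ _ cP)).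
    exact: H.
  by eexists; exact: (cdiff_withZ _ (cdiff_withB aP bP)).
move=> e e0.
have [N0 N0P] : exists N0, forall N, (N0 <= N)%N -> 4 * M * t N <= e.
  exists (Num.trunc (4 * M / e)) => N hN.
  rewrite /t ler_pdivrMr// -ler_pdivrMl// mulrC; apply/ltW.
  have := truncnS_gt (4 * M / e) => h; rewrite (lt_le_trans h)// ler_nat.
  by rewrite ltnS (leq_trans hN).
exists N0 => N w /N0P hN /near_z wr; apply: le_trans hN.
have tn0 : (t N)%:C ^+ d != 0 by rewrite expf_neq0// -normc_gt0 normc_real normr_gt0 gt_eqF.
have -> : F N w - hpart f d w = ((t N)%:C ^+ d)^-1 *
   (f ((t N)%:C *: w) - \sum_(k < d.+1) (t N)%:C ^+ k * hpart f k w).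
  by rewrite /F big_ord_recr/= opprD addrA [RHS]mulrBr mulKf.
have nt : normc (t N)%:C = t N by rewrite normc_real gtr0_norm.
rewrite normcM normcV normcX nt ler_pdivrMl ?exprn_gt0// mulrCA -exprSr.
by have := @hpart_taylor w (ltW wr) d.+1 (t N)%:C; rewrite nt => /(_ (t2 N)).
Qed.

Let Q := hext f rho.

(** Independence of [hext] from the scale, which allows one scale to serve on a whole disc of a
    line. *)
Let QE d z (s : R) : 0 < s -> s * nrm z <= rho -> Q d z = (s%:C ^+ d)^-1 * hpart f d (s%:C *: z).
Proof.
have main s1 s2 : 0 < s1 -> s1 <= s2 -> s2 * nrm z <= rho ->
   (s1%:C ^+ d)^-1 * hpart f d (s1%:C *: z) = (s2%:C ^+ d)^-1 * hpart f d (s2%:C *: z).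
  move=> s10 s12 s2r; have s20 := lt_le_trans s10 s12.
  have E : s1%:C = (s1 / s2)%:C * s2%:C :> C by rewrite -rmorphM/= divfK// gt_eqF.
  have d0 (x : R) : 0 < x -> x%:C != 0 :> C by move=> ?; rewrite -normc_gt0 normc_real normr_gt0 gt_eqF.
  rewrite {2}E -scalerA hpart_scale; first last.
  - by rewrite nrmZ normc_real gtr0_norm.
  - by rewrite normc_real ger0_norm ?ler_pdivrMr ?mul1r// divr_ge0// ltW.
  move: (hpart f d (s2%:C *: z)) (d0 _ s10) E => H.
  move: (s1%:C) (s2%:C) ((s1 / s2)%:C) => a b t a0 E; rewrite E in a0 *.
  have t0 : t ^+ d != 0 by apply/expf_neq0; apply: contraNneq a0 => ->; rewrite mul0r.
  by rewrite exprMn invfM (mulrC (t ^+ d)^-1) -mulrA mulKf.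
move=> s0 sr; rewrite /Q /hext; set s' := rho / 2 / _.
have z1 : 0 < nrm z + 1 by rewrite ltr_wpDl// nrm_ge0.
have s'0 : 0 < s' by rewrite !divr_gt0.
have s'r : s' * nrm z <= rho.
  rewrite /s' mulrAC ler_pdivrMr//; have := nrm_ge0 z; nra.
have [ss'|/ltW s's] := leP s s'.
  exact: esym (main s s' s0 ss' s'r).
exact: main s' s s'0 s's sr.
Qed.

Local Opaque hext.

(** Liouville's argument: on lines [Q d] is entire and grows at most like the power [d] of the
    radius, so Cauchy's estimates on discs of radius [L] kill its coefficients of higher degree. A
    separately polynomial function is a polynomial, and by homogeneity its part of degree [d]
    suffices. *)
Let Q_poly d : exists2 p, homog_poly d p & forall z, peval p z = Q d z.
Proof.
have r20 : 0 < rho / 2 by rewrite divr_gt0.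
have Qline z v (L : R) : 0 < L -> let s := rho / 2 / (nrm z + L * nrm v + 1) in
    disc_holo (fun c => Q d (z + (L%:C * c) *: v)) /\
    forall c, normc c <= 1 -> normc (Q d (z + (L%:C * c) *: v)) <= 2 * M / s ^+ d.
  move=> L0 s; have den : 0 < nrm z + L * nrm v + 1.
    by have := nrm_ge0 z; have := mulr_ge0 (ltW L0) (nrm_ge0 v); lra.
  have s0 : 0 < s by rewrite divr_gt0.
  have arg c : normc c <= 1 -> s * nrm (z + (L%:C * c) *: v) <= rho / 2.
    move=> c1; rewrite /s mulrAC ler_pdivrMr// ler_wpM2l ?(ltW r20)//.
    have := nrmD z ((L%:C * c) *: v); rewrite nrmZ normcM normc_real gtr0_norm// => h.
    have : L * normc c * nrm v <= L * nrm v by rewrite ler_wpM2r ?nrm_ge0// ler_piMr// ltW.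
    lra.
  clearbody s.
  have QE' c : normc c <= 1 -> Q d (z + (L%:C * c) *: v) =
      (s%:C ^+ d)^-1 * hpart f d (s%:C *: z + c *: ((s * L)%:C *: v)).
    move=> c1; rewrite (@QE d _ s s0); last by have := arg c c1; lra.
    rewrite (scalerDr s%:C z) (scalerA s%:C) (scalerA c).
    have -> // : s%:C * (L%:C * c) = c * (s * L)%:C by rewrite rmorphM/=; ring.
  have arg2 c : normc c <= 1 -> nrm (s%:C *: z + c *: ((s * L)%:C *: v)) < rho.
    move=> c1; have -> : s%:C *: z + c *: ((s * L)%:C *: v) = s%:C *: (z + (L%:C * c) *: v).
      by rewrite scalerDr !scalerA; congr (_ + _ *: _); rewrite rmorphM/=; ring.
    by rewrite nrmZ normc_real gtr0_norm//; have := arg c c1; lra.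
  split.
    have h : disc_holo (fun c => (fun w => (s%:C ^+ d)^-1 * hpart f d w)
        (s%:C *: z + c *: ((s * L)%:C *: v))).
      apply: (@disc_holoP _ _ (fun w => (s%:C ^+ d)^-1 * hpart f d w)) => c c1.
      by have [a aP] := @hpart_cdiff d _ (arg2 c c1); eexists; exact: cdiff_withZ aP.
    move=> c c1; have [b bP] := h c c1; exists b => e e0; have [dl dl0 dP] := bP e e0.
    exists dl; first exact: dl0.
    by move=> w w1 wc; rewrite (QE' w w1) (QE' c c1); exact: dP.
  move=> c c1; rewrite (QE' c c1) normcM normcV normcX normc_real gtr0_norm//.
  by rewrite mulrC ler_wpM2r ?invr_ge0 ?exprn_ge0 ?(ltW s0)// hpart_bound// ltW// arg2.
have Qsep : sep_poly d (Q d).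
  move=> z i; set v := delta_mx ord0 i.
  have nv : nrm v <= 1.
    by apply/nrm_le => // k; rewrite mxE; case: (_ && _); rewrite ?normc1 ?normc0.
  have [h1 b1] := Qline z v 1 ltr01.
  pose c := tcoef (fun c => Q d (z + (1%:C * c) *: v)).
  have cL (L : R) k : 1 <= L -> tcoef (fun c => Q d (z + (L%:C * c) *: v)) k = L%:C ^+ k * c k.
    move=> L1; have L0 : 0 < L by lra.
    have [hL bL] := Qline z v L L0.
    have L1C : 1 <= normc L%:C by rewrite normc_real gtr0_norm.
    set K := 2 * M / _ in bL; have K0 : 0 <= 4 * K.
      by rewrite mulr_ge0// (le_trans (normc_ge0 _) (bL 0 _))// normc0.
    have LC : L%:C != 0 :> C by rewrite -normc_gt0 normc_real normr_gt0 gt_eqF.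
    apply: (taylor_dilation L1C K0 _ (disc_holo_taylor hL bL) (disc_holo_taylor h1 b1)) => l.
    by rewrite mul1r mulrA (mulfV LC) mul1r.
  have c0 k : (d < k)%N -> c k = 0.
    move=> dk; apply/eqP; rewrite -normc_eq0 eq_le normc_ge0 andbT.
    (* [B * L] dominates the denominator of the scale for every [L >= 1], so [K] is independent of
       [L]; letting [L] grow in [K / L] makes the coefficient vanish. *)
    pose B := nrm z + 2; pose K := 4 * M * (B / (rho / 2)) ^+ d.
    have B0 : 0 < B by have := nrm_ge0 z; rewrite /B; lra.
    have K0 : 0 <= K by rewrite !mulr_ge0// exprn_ge0// divr_ge0// ltW.
    have bnd (L : R) : 1 <= L -> normc (c k) <= K / L.
      move=> L1; have L0 : 0 < L by lra.
      have [hL bL] := Qline z v L L0.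
      have := normc_tcoef k hL bL; rewrite cL// normcM normcX normc_real gtr0_norm// => h.
      rewrite ler_pdivlMr//.
      have Lk : L ^+ d * L <= L ^+ k by rewrite -exprSr; apply: ler_weXn2l.
      have h2 : 2 * (2 * M / (rho / 2 / (nrm z + L * nrm v + 1)) ^+ d) <= K * L ^+ d.
        have -> : K * L ^+ d = 2 * (2 * M * (B * L / (rho / 2)) ^+ d).
          by rewrite /K !exprMn; ring.
        rewrite ler_pM2l// -exprVn ler_wpM2l ?mulr_ge0// lerXn2r ?nnegrE//.
        - rewrite invf_div divr_ge0 ?(ltW r20)//.
          by have := nrm_ge0 z; have := mulr_ge0 (ltW L0) (nrm_ge0 v); lra.
        - by rewrite divr_ge0 ?(ltW r20)// mulr_ge0// ltW.
        rewrite invf_div ler_wpM2r ?invr_ge0 ?(ltW r20)//.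
        have := nrm_ge0 z; rewrite /B; nra.
      have h3 := le_trans h h2.
      rewrite -(ler_pM2l (exprn_gt0 d L0)) mulrA mulrAC.
      have := normc_ge0 (c k); have := exprn_gt0 d L0; nra.
    rewrite leNgt; apply/negP => ck0.
    have := bnd (1 + K / normc (c k)); rewrite lerDl divr_ge0 ?normc_ge0// => /(_ isT).
    rewrite ler_pdivlMr; last by rewrite ltr_pwDl// divr_ge0// normc_ge0.
    rewrite mulrDr mulr1 mulrCA mulfV ?gt_eqF// mulr1; lra.
  exists c => x.
  (* [x] is brought into the half disc, where the expansion on the rescaled line is valid. *)
  have [L L2 xL] : exists2 L : R, 1 <= L & normc x / L <= 1 / 2.
    exists (1 + 2 * normc x); first by have := normc_ge0 x; lra.
    by rewrite ler_pdivrMr; have := normc_ge0 x; lra.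
  have L0 : 0 < L by lra.
  have [hL bL] := Qline z v L L0.
  have TL := disc_holo_taylor hL bL; set K := 4 * _ in TL.
  pose l : C := x / L%:C.
  have nl : normc l = normc x / L by rewrite normcM normcV normc_real gtr0_norm.
  have LC : L%:C != 0 :> C by rewrite -normc_gt0 normc_real normr_gt0 gt_eqF.
  have xE : x = L%:C * l by rewrite /l mulrC divfK.
  clearbody l.
  apply/eqP; rewrite -subr_eq0 -normc_eq0 eq_le normc_ge0 andbT.
  apply: (@le0_geo _ _ (K * normc l ^+ d.+1) (normc l) (normc_ge0 _)); first by rewrite nl; lra.
  move=> N; have := TL (d.+1 + N)%N l; rewrite nl xL => /(_ isT).
  rewrite -nl exprD mulrA -xE; congr (_ <= _); congr normc; congr (_ - _).
  rewrite big_split_ord /= [X in _ + X]big1 ?addr0; last first.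
    by move=> k _; rewrite cL// c0 ?mulr0// leq_addr.
  by apply: eq_bigr => k _; rewrite cL// mulrA -exprMn (mulrC l) -xE.
have [p pE] := sep_poly_mpoly Qsep.
have hom c z : normc c <= 1 -> Q d (c *: z) = c ^+ d * Q d z.
  move=> c1; pose s := rho / (nrm z + 1).
  have z1 : 0 < nrm z + 1 by rewrite ltr_wpDl// nrm_ge0.
  have s0 : 0 < s by rewrite divr_gt0.
  have sz : s * nrm z <= rho.
    rewrite /s mulrAC ler_pdivrMr//; have := nrm_ge0 z; nra.
  have scz : s * nrm (c *: z) <= rho.
    by rewrite nrmZ (le_trans _ sz)// ler_wpM2l ?(ltW s0)// ler_piMl// nrm_ge0.
  have sz' : nrm (s%:C *: z) <= rho by rewrite nrmZ normc_real gtr0_norm.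
  have E : s%:C *: (c *: z) = c *: (s%:C *: z) by rewrite scalerA mulrC -scalerA.
  rewrite (@QE d _ s s0 scz) (@QE d _ s s0 sz) E (hpart_scale d c1 sz').
  exact: mulrCA.
have [q qh qE] : exists2 q, homog_poly d q & forall z, peval q z = peval p z.
  apply: homogeneous_peval => c z; rewrite -!pE.
  have [c1|c1] := leP (normc c) 1; first exact: hom.
  have c0 : c != 0 by rewrite -normc_gt0; lra.
  have cV : normc c^-1 <= 1 by rewrite normcV invf_le1 ?ltW//; lra.
  rewrite -[z in RHS](scale1r) -(mulVf c0) -scalerA (hom _ _ cV) mulrA -exprMn mulfV//.
  by rewrite expr1n mul1r.
by exists q => // z; rewrite qE -pE.
Qed.

Lemma hpart_polynomial d : exists2 p, homog_poly d p &
  forall z, nrm z <= rho -> peval p z = hpart f d z.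
Proof.
have [p ph pE] := Q_poly d; exists p => // z zr.
by rewrite pE (@QE d z 1) ?mul1r// rmorph1 expr1n invr1 mul1r scale1r.
Qed.

End at_origin.

End homogeneous_expansion.

(** * Homogeneous expansions on balanced domains *)

Section balanced_expansion.
Context (R : realType) (n : nat).
Local Notation C := R[i].
Implicit Types (f g : 'rV[C]_n -> C) (z w v : 'rV[C]_n) (D : set 'rV[C]_n).

(** The disc is the image under [clamp] of a square, which is compact as a product of segments. *)
Lemma compact_disc : compact [set c : C | normc c <= 1].
Proof.
pose sq := [set xy : R * R | -1 <= xy.1 <= 1 /\ -1 <= xy.2 <= 1].
have csq : compact sq.
  rewrite (_ : sq = `[-1, 1]%classic `*` `[-1, 1]%classic); last first.
    by apply/seteqP; split => -[x y] /=; rewrite !in_itv/=.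
  by apply: compact_setX; exact: segment_compact.
pose k (xy : R * R) : C := @clamp R (xy.1 +i* xy.2).
have kc : continuous k.
  move=> xy; apply: continuous_comp; last exact: continuous_clamp.
  apply/(@cvg_complexP _ _ (nbhs xy)) => e e0.
  have e20 : 0 < e / 2 by rewrite divr_gt0.
  have /cvgrPdistC_lt/(_ _ e20) h1 : fst t @[t --> xy] --> xy.1 by exact: cvg_fst.
  have /cvgrPdistC_lt/(_ _ e20) h2 : snd t @[t --> xy] --> xy.2 by exact: cvg_snd.
  apply: filterS2 h1 h2 => t h1 h2.
  by rewrite (le_lt_trans (normc_le_ReIm _))//= [e]splitr ltrD.
have -> : [set c : C | normc c <= 1] = k @` sq.
  apply/seteqP; split => [c /= c1|_ [xy _ <-]]; last exact: normc_clamp.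
  exists (Re c, Im c); last by rewrite /k/=; case: c c1 => a b c1; rewrite clamp_id.
  have h1 := le_trans (normc_Re c) c1; have h2 := le_trans (normc_Im c) c1.
  by rewrite /sq/= -!ler_norml.
by apply: continuous_compact => //; exact: continuous_subspaceT.
Qed.

Definition balanced D := forall z c, D z -> normc c <= 1 -> D (c *: z).

(** By compactness of the disc of all [c], the local bounds at the points [c *: z] become uniform.
    This gives Cauchy estimates on the discs of all [c *: w], with one bound for all [w] near
    [z]. *)
Lemma bounded_near_disc D f z : open D -> balanced D -> holomorphic D f -> D z ->
  exists r M, [/\ 0 < r, forall w c, nrm (w - z) < r -> normc c <= 1 -> D (c *: w) &
    forall w c, nrm (w - z) < r -> normc c <= 1 -> normc (f (c *: w)) <= M].
Proof.
move=> oD bD fD Dz.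
have /compact_near_coveringP cov := compact_disc.
(* The neighbour [w] and the bound [M] form one parameter, as the near-covering form of compactness
   involves a single filter. *)
pose P (wM : 'rV[C]_n * R) (c : C) := D (c *: wM.1) /\ normc (f (c *: wM.1)) <= wM.2.
have {cov} := @cov _ (filter_prod (nbhs z) (pinfty_nbhs R)) P _ => cov.
have H : forall x, [set c : C | normc c <= 1] x ->
   \forall x' \near x & i \near filter_prod (nbhs z) (pinfty_nbhs R), P i x'.
  move=> c c1; have Dcz := bD z c Dz c1.
  have [d1 d10 h1] := iffLR (open_polydiscP D) oD _ Dcz.
  have [d2 d20 h2] := holomorphic_cont fD Dcz (@ltr01 R).
  pose d := Num.min d1 d2; have d0 : 0 < d by rewrite lt_min d10.
  have dd1 : d <= d1 by rewrite ge_min lexx.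
  have dd2 : d <= d2 by rewrite ge_min lexx orbT.
  clearbody d.
  have nz : 0 < 2 * (nrm z + 1) by have := nrm_ge0 z; lra.
  exists ([set c' | normc (c' - c) < Num.min 1 (d / (2 * (nrm z + 1)))],
          [set wM : 'rV[C]_n * R | nrm (wM.1 - z) < Num.min 1 (d / 4) /\
             normc (f (c *: z)) + 1 <= wM.2]).
    split.
      apply/nbhs_complexP; exists (Num.min 1 (d / (2 * (nrm z + 1)))) => //.
      by rewrite lt_min ltr01 divr_gt0.
    exists ([set w | nrm (w - z) < Num.min 1 (d / 4)], [set M | normc (f (c *: z)) + 1 <= M]).
      split => /=; first by apply: nbhs_polydisc; rewrite lt_min ltr01 divr_gt0.
      by apply: nbhs_pinfty_ge; rewrite num_real.
    by move=> [w M] [].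
  move=> [c' [w M]] /= [] c'c [wz hM].
  have wd : nrm (c' *: w - c *: z) < d.
    have -> : c' *: w - c *: z = c' *: (w - z) + (c' - c) *: z.
      by rewrite scalerBr scalerBl addrA subrK.
    rewrite (le_lt_trans (nrmD _ _))// !nrmZ.
    move: c'c wz; rewrite !lt_min !ltr_pdivlMr// => /andP[a1 a2] /andP[b1 b2].
    have : normc c' < 2 by have := normcD (c' - c) c; rewrite subrK; move: c1 => /=; lra.
    have := nrm_ge0 z; have := nrm_ge0 (w - z); have := normc_ge0 (c' - c).
    have := normc_ge0 c'; nra.
  split => /=; first exact: h1 _ (lt_le_trans wd dd1).
  have := h2 _ (lt_le_trans wd dd2) => h3; have := normcD (f (c' *: w) - f (c *: z)) (f (c *: z)); rewrite subrK; lra.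
have FF : Filter (filter_prod (nbhs z) (pinfty_nbhs R)) by exact: filter_prod_filter.
have [[A B]] := cov FF H; move=> /= [/nbhs_polydiscP[r r0 rA] [M0 [_ MB]]] AB.
exists r, (M0 + 1); split => // w c wr c1.
  by have [] := AB (w, M0 + 1) (conj (rA w wr) (MB _ (ltr_pwDr ltr01 (lexx _)))) c c1.
by have [] := AB (w, M0 + 1) (conj (rA w wr) (MB _ (ltr_pwDr ltr01 (lexx _)))) c c1.
Qed.

Lemma balanced0 D : balanced D -> D !=set0 -> D 0.
Proof. by move=> bD [z Dz]; rewrite -(scale0r z); apply: bD => //; rewrite normc0. Qed.

Lemma dilate_in D z : open D -> D z -> exists2 t : R, 1 < t & D (t%:C *: z).
Proof.
move=> oD Dz; have [r r0 rD] := iffLR (open_polydiscP D) oD _ Dz.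
have z1 : 0 < nrm z + 1 by rewrite ltr_wpDl// nrm_ge0.
exists (1 + r / (nrm z + 1)); first by rewrite ltrDl divr_gt0.
apply: rD; rewrite rmorphD rmorph1 scalerDl scale1r addrAC subrr add0r nrmZ normc_real.
by rewrite gtr0_norm ?divr_gt0// mulrAC ltr_pdivrMr//; have := nrm_ge0 z; nra.
Qed.

Lemma uniform_cvgP (U : set 'rV[C]_n) (F : nat -> 'rV[C]_n -> C) f :
  {uniform U, F @ \oo --> f} <-> forall e : R, 0 < e -> exists N, forall k w, (N <= k)%N -> U w ->
    normc (F k w - f w) < e.
Proof.
split=> [H e e0|H P /uniform_nbhs[E [entE EP]]].
  have : nbhs (f : uniform_fun U C) [set h | forall y, U y -> ball (f y) e%:C (h y)].
    apply/uniform_nbhs; exists [set xy | ball xy.1 e%:C xy.2]; split => //.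
    have e0C : 0 < e%:C by rewrite ltcR.
    by rewrite -entourage_ballE; exists e%:C.
  move=> /H[N _ NP]; exists N => k w Nk Uw; have := NP k Nk w Uw.
  by rewrite -ball_normE/= normc_norm ltcR normc_distC.
have [e /= e0 eE] : exists2 e : C, 0 < e & [set xy | ball xy.1 e xy.2] `<=` E.
  by move: entE; rewrite -entourage_ballE => -[e e0 h]; exists e.
have er : e = (Re e)%:C by rewrite RRe_real// gtr0_real.
have e0' : 0 < Re e by move: e0; rewrite er ltcR.
have [N NP] := H _ e0'; exists N => // k Nk; apply: EP => w Uw; apply: eE => /=.
by rewrite -ball_normE/= normc_norm er ltcR normc_distC; exact: NP.
Qed.

Local Opaque tcoef.

(** The parts are defined near 0. At [z] the room for a dilation by [t > 1] is used: the remainder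
    of the Taylor series on the disc through [t *: w], taken at [1 / t], is geometric uniformly in
    [w]. *)
Lemma homog_expansion_exists D f : open D -> balanced D -> D !=set0 -> holomorphic D f ->
  exists P, homog_expansion D f P.
Proof.
move=> oD bD /(balanced0 bD) D0 fD.
have [r [M [r0 rD rM]]] := bounded_near_disc oD bD fD D0.
pose rho := r / 2; have rho0 : 0 < rho by rewrite divr_gt0.
have in0 z : nrm z <= rho -> nrm (z - 0) < r by rewrite subr0 /rho => ?; lra.
have fd z : nrm z <= rho -> cdiff f z.
  move=> zr; apply/differentiableE/fD; rewrite -(scale1r z); apply: rD; first exact: in0.
  by rewrite normc1.
have fM z : nrm z <= rho -> normc (f z) <= M.
  by move=> zr; rewrite -(scale1r z); apply: rM; [exact: in0|rewrite normc1].
have H d : exists p : mpoly.mpoly n C, homog_poly d p /\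
    forall z, nrm z <= rho -> peval p z = hpart f d z.
  by have [p p1 p2] := hpart_polynomial rho0 fd fM d; exists p.
have [P PP] := choice H.
exists P; split=> [d|z Dz]; first by have [] := PP d.
have PE d w : nrm w <= rho -> peval (P d) w = hpart f d w by move=> wr; have [_ ->] := PP d.
have [t t1 Dtz] := dilate_in oD Dz; have t0 : 0 < t by lra.
have [r1 [M1 [r10 r1D r1M]]] := bounded_near_disc oD bD fD Dtz.
exists [set w | nrm (w - z) < r1 / t]; first by apply: nbhs_polydisc; rewrite divr_gt0.
apply/uniform_cvgP => e e0.
have M10 : 0 <= M1.
  by rewrite (le_trans (normc_ge0 _) (r1M (t%:C *: z) 0 _ _))// ?subrr ?nrm0// normc0.
have tV : t^-1 < 1 by rewrite invf_lt1.
have tV0 : 0 <= t^-1 by rewrite invr_ge0 ltW.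
have [N NP] := geo_small (2 * M1 / (1 - t^-1)) tV0 tV e0.
exists N => k w /NP kN; rewrite /= ltr_pdivlMr// => wz; apply: le_lt_trans kN.
have tw : nrm (t%:C *: w - t%:C *: z) < r1 by rewrite -scalerBr nrmZ normc_real gtr0_norm// mulrC.
pose g c := f (c *: (t%:C *: w)).
have gh : disc_holo g.
  have := @disc_holoP _ _ f 0 (t%:C *: w); rewrite (_ : (fun c => _) = g); last first.
    by apply/funext => c; rewrite add0r.
  by apply=> c c1; rewrite add0r; apply/differentiableE/fD; exact: r1D.
have gM c : normc c <= 1 -> normc (g c) <= M1 by move=> c1; exact: r1M.
have cE d : tcoef g d = t%:C ^+ d * peval (P d) w.
  (* [s] shrinks [t *: w] into the polydisc of radius [rho], where [P d] is known to coincide with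
     [hpart]. *)
  pose s := Num.max 1 (t * nrm w / rho).
  have s1 : 1 <= s by rewrite le_max lexx.
  have s0 : 0 < s by lra.
  have st : nrm ((s^-1)%:C *: (t%:C *: w)) <= rho.
    rewrite !nrmZ !normc_real !gtr0_norm ?invr_gt0// ler_pdivrMl//.
    by rewrite -ler_pdivrMr// le_max lexx orbT.
  pose g1 c := f (c *: ((s^-1)%:C *: (t%:C *: w))).
  have g1h : disc_holo g1.
    have := @disc_holoP _ _ f 0 ((s^-1)%:C *: (t%:C *: w)); rewrite (_ : (fun c => _) = g1); last first.
      by apply/funext => c; rewrite add0r.
    by apply=> c c1; rewrite add0r; apply: fd; rewrite nrmZ (le_trans _ st)// ler_piMl// nrm_ge0.
  have g1M c : normc c <= 1 -> normc (g1 c) <= M.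
    by move=> c1; apply: fM; rewrite nrmZ (le_trans _ st)// ler_piMl// nrm_ge0.
  have ns : 1 <= normc s%:C by rewrite normc_real gtr0_norm.
  have M40 : 0 <= 4 * M1 by rewrite mulr_ge0.
  rewrite (taylor_dilation ns M40 _ (disc_holo_taylor gh gM) (disc_holo_taylor g1h g1M)); last first.
    by move=> l; rewrite /g1 /g !scalerA fmorphV (mulrC l).
  have -> : tcoef g1 d = hpart f d ((s^-1)%:C *: (t%:C *: w)) by [].
  rewrite -PE// !(peval_homog _ _ (PP d).1) mulrA -exprMn -rmorphM/= mulfV ?gt_eqF//.
  by rewrite rmorph1 expr1n mul1r.
have tC1 : normc (t^-1)%:C < 1 by rewrite normc_real ger0_norm.
have := taylor_remainder gh tC1 k gM.
have tt : (t^-1)%:C * t%:C = 1 :> C by rewrite -rmorphM/= mulVf ?gt_eqF.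
rewrite normc_real ger0_norm// {1}/g scalerA tt scale1r (mulrAC (2 * M1)) normc_distC.
congr (normc (_ - _) <= _); apply: eq_bigr => d _.
by rewrite cE mulrA -exprMn tt expr1n mul1r.
Qed.

Lemma homog_partP D f : open D -> balanced D -> D !=set0 -> holomorphic D f ->
  homog_expansion D f (homog_part D f).
Proof.
move=> oD bD D0 fD; have [P PP] := homog_expansion_exists oD bD D0 fD.
exact: (@xgetPex _ (fun=> 0) [set P | homog_expansion D f P]) (ex_intro _ P PP).
Qed.

Lemma homog_expansion_cvg D f P z : homog_expansion D f P -> D z ->
  forall e : R, 0 < e -> exists N, forall k, (N <= k)%N ->
    normc (\sum_(d < k) peval (P d) z - f z) < e.
Proof.
move=> [_ h] /h[U Uz /uniform_cvgP H] e e0; have [N NP] := H e e0.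
by exists N => k Nk; apply: NP => //; exact: nbhs_singleton.
Qed.

End balanced_expansion.

(** * Integration on C^n *)

Section measure_preserving.
Context (R : realType).
Local Open Scope ereal_scope.

Definition mpres d (T : measurableType d) (m : set T -> \bar R) (f : T -> T) :=
  measurable_fun setT f /\ forall A, measurable A -> m (f @^-1` A) = m A.

Lemma mpres_comp d (T : measurableType d) (m : set T -> \bar R) f g :
  mpres m f -> mpres m g -> mpres m (f \o g).
Proof.
move=> [mf f1] [mg g1]; split; first exact: measurableT_comp.
move=> A mA; rewrite comp_preimage g1 ?f1//.
by rewrite -[X in measurable X]setTI; exact: mf.
Qed.

Lemma measurable_preimageT d1 d2 (T1 : measurableType d1) (T2 : measurableType d2)
  (f : T1 -> T2) A : measurable_fun setT f -> measurable A -> measurable (f @^-1` A).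
Proof. by move=> mf mA; rewrite -[X in measurable X]setTI; exact: mf. Qed.

Definition pushm d1 d2 (T1 : measurableType d1) (T2 : measurableType d2)
    (m : {measure set T1 -> \bar R}) (f : T1 -> T2) (mf : measurable_fun setT f) :
  {measure set T2 -> \bar R} := measure_function_pushforward__canonical__measure_function_Measure m mf.

Lemma prod_unique d1 d2 (T1 : measurableType d1) (T2 : measurableType d2)
   (m1 : {sigma_finite_measure set T1 -> \bar R}) (m2 : {sigma_finite_measure set T2 -> \bar R})
   (f : T1 * T2 -> T1 * T2) : measurable_fun setT f ->
   (forall A B, measurable A -> measurable B ->
      prod_measure m1 m2 (f @^-1` (A `*` B)) = m1 A * m2 B) ->
   mpres (prod_measure m1 m2) f.
Proof.
move=> mf H; split => // A mA.
exact: esym (@product_measure_unique _ _ _ _ _ m1 m2 (pushm (prod_measure m1 m2) mf) H A mA).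
Qed.

Lemma prod_measureE d1 d2 (T1 : measurableType d1) (T2 : measurableType d2)
   (m1 : {sigma_finite_measure set T1 -> \bar R}) (m2 : {sigma_finite_measure set T2 -> \bar R}) A B :
  measurable A -> measurable B -> prod_measure m1 m2 (A `*` B) = m1 A * m2 B.
Proof. exact: product_measure1E. Qed.

Lemma mpres_prod d1 d2 (T1 : measurableType d1) (T2 : measurableType d2)
   (m1 : {sigma_finite_measure set T1 -> \bar R}) (m2 : {sigma_finite_measure set T2 -> \bar R})
   (f1 : T1 -> T1) (f2 : T2 -> T2) : mpres m1 f1 -> mpres m2 f2 ->
   mpres (prod_measure m1 m2) (fun x => (f1 x.1, f2 x.2)).
Proof.
move=> [mf1 p1] [mf2 p2]; apply: prod_unique.
  by apply/measurable_fun_pair; exact: measurableT_comp.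
move=> A B mA mB.
rewrite (_ : _ @^-1` _ = (f1 @^-1` A) `*` (f2 @^-1` B)) ?prod_measureE ?p1 ?p2//;
  exact: measurable_preimageT.
Qed.

Section tuples.
Context d (T : measurableType d) (m : {sigma_finite_measure set T -> \bar R}).

Definition tmap n (f : nat -> T -> T) (t : n.-tuple T) : n.-tuple T :=
  [tuple f k (tnth t k) | k < n].

Lemma measurable_tmap n f : (forall k, measurable_fun setT (f k)) ->
  measurable_fun setT (@tmap n f).
Proof.
move=> mf; apply/measurable_fun_tnthP => i.
rewrite (_ : _ \o _ = f i \o (fun t => tnth t i)); last first.
  by apply/funext => t /=; rewrite tnth_mktuple.
by apply: measurableT_comp => //; exact: measurable_tnth.
Qed.

Lemma tmap_cons n f (x : T) (t : n.-tuple T) :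
  tmap f (cons_pair (x, t)) = cons_pair (f 0%N x, tmap (fun k => f k.+1) t).
Proof.
apply: eq_from_tnth => i; rewrite tnth_mktuple /cons_pair /=.
have [j ->|->] := unliftP ord0 i; first by rewrite !tnthS tnth_mktuple.
by rewrite !tnth0.
Qed.

Lemma mpres_tuple n f : (forall k, mpres m (f k)) -> mpres (tuple_measure m n) (@tmap n f).
Proof.
elim: n f => [|n ih] f mf.
  split; first by apply: measurable_tmap => k; case: (mf k).
  move=> A mA; congr dirac; rewrite (_ : tmap f = id) ?preimage_id//.
  by apply/funext => t; rewrite [RHS]tuple0 [LHS]tuple0.
split; first by apply: measurable_tmap => k; case: (mf k).
move=> A mA.
have [_ pA] := mpres_prod (mf 0%N) (ih (fun k => f k.+1) (fun k => mf k.+1)).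
have mcA : measurable (@cons_pair _ T n @^-1` A).
  by apply: measurable_preimageT => //; exact: measurable_cons_pair.
rewrite -[RHS](pA _ mcA) /= /cons_measure /pushforward; congr (prod_measure _ _ _).
by apply/seteqP; split => -[x t] /=; rewrite tmap_cons.
Qed.

Lemma tuple_measure_box n (A : nat -> set T) : (forall k, measurable (A k)) ->
  (forall k, 0 < m (A k)) ->
  0 < tuple_measure m n [set t | forall k : 'I_n, A k (tnth t k)].
Proof.
elim: n A => [|n ih] A mA A0.
  by rewrite /= (_ : [set _ | _] = setT) ?diracT ?lte01//; apply/seteqP; split => // t _ [].
rewrite /= /cons_measure /pushforward.
rewrite (_ : _ @^-1` _ = A 0%N `*` [set t | forall k : 'I_n, A k.+1 (tnth t k)]).
  rewrite prod_measureE//.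
    by rewrite mule_gt0//; exact: (ih (fun k => A k.+1)).
  rewrite (_ : [set _ | _] = \bigcap_(k in [set: 'I_n]) ((@tnth n T)^~ k @^-1` A k.+1)); last first.
    by apply/seteqP; split => [t h k _|t h k]; exact: h.
  apply: fin_bigcap_measurable => // k _.
  by apply: measurable_preimageT => //; exact: measurable_tnth.
apply/seteqP; split => [[x t] /= h|[x t] /= [h0 h] k].
  split; first by have := h ord0; rewrite tnth0.
  by move=> k; have := h (lift ord0 k); rewrite tnthS.
have [j ->|->] := unliftP ord0 k; first by rewrite tnthS; exact: h.
by rewrite tnth0.
Qed.

End tuples.

Section plane.
Local Notation mu := (@lebesgue_measure R).
Local Notation mu2 := (prod_measure mu mu).
Local Notation Rm := (measurableTypeR R).

Lemma mpres_translation (a : R) : mpres mu (fun x : Rm => x + a : Rm)%R.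
Proof.
have mf : measurable_fun setT (fun x : Rm => x + a : Rm)%R.
  by apply: measurable_funD; [exact: measurable_id|exact: measurable_cst].
split => // A mA; apply/esym.
apply: (@lebesgue_measure_unique R (pushm mu mf)) => //= _ [[b c]] _ <-.
rewrite /pushforward (_ : _ @^-1` _ = `](b - a)%R, (c - a)%R]%classic); last first.
  by apply/seteqP; split => x /=; rewrite !in_itv/= ltrBlDr lerBrDr.
rewrite !lebesgue_measure_itv/= !lte_fin ltrD2r; case: ifP => // _.
by rewrite -!EFinB opprB addrA subrK.
Qed.

(** On each section with fixed first coordinate a shear is a translation. *)
Lemma mpres_shear (t : R) : mpres mu2 (fun x : Rm * Rm => (x.1, x.2 + t * x.1) : Rm * Rm)%R.
Proof.
have mf : measurable_fun setT (fun x : Rm * Rm => (x.1, x.2 + t * x.1) : Rm * Rm)%R.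
  apply/measurable_fun_pair; first exact: measurable_fst.
  apply: measurable_funD; first exact: measurable_snd.
  by apply: measurable_funM; [exact: measurable_cst|exact: measurable_fst].
apply: prod_unique => // A B mA mB.
rewrite {1}/prod_measure /product_measure1.
rewrite (eq_integral (fun x => mu B * (\1_A x)%:E)); last first.
  move=> x _ /=; rewrite indicE; case: (pselect (A x)) => Ax.
    rewrite mem_set// mule1; have [_ h] := mpres_translation (t * x).
    by rewrite -(h _ mB); congr mu; apply/seteqP; split => y; rewrite /xsection/= inE/=; tauto.
  rewrite memNset// mule0 (_ : xsection _ _ = set0) ?measure0//.
  by apply/seteqP; split => y //; rewrite /xsection/= inE/=; tauto.
rewrite ge0_integralZl//; first by rewrite integral_indic// setIT muleC.
by apply/measurable_EFinP; exact: measurable_indic.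
Qed.

Lemma mpres_swap : mpres mu2 (fun x : Rm * Rm => (x.2, x.1) : Rm * Rm)%R.
Proof.
apply: prod_unique.
  by apply/measurable_fun_pair; [exact: measurable_snd|exact: measurable_fst].
move=> A B mA mB; rewrite (_ : _ @^-1` _ = B `*` A) ?prod_measureE 1?muleC//.
by apply/seteqP; split => -[x y] /= [].
Qed.

Lemma mpres_shear2 (t : R) : mpres mu2 (fun x : Rm * Rm => (x.1 + t * x.2, x.2) : Rm * Rm)%R.
Proof. exact: (mpres_comp mpres_swap (mpres_comp (mpres_shear t) mpres_swap)). Qed.

Definition rot (c s : R) (x : Rm * Rm) : Rm * Rm :=
  ((c * x.1 - s * x.2, s * x.1 + c * x.2) : Rm * Rm)%R.

(* a rotation by an angle different from pi is a product of three shears *)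
Lemma mpres_rot (c s : R) : (c ^+ 2 + s ^+ 2 = 1)%R -> mpres mu2 (rot c s).
Proof.
have main (c' s' : R) : (c' ^+ 2 + s' ^+ 2 = 1)%R -> (1 + c' != 0)%R -> mpres mu2 (rot c' s').
  move=> cs c1; pose a := (- s' / (1 + c'))%R.
  rewrite (_ : rot c' s' = (fun x : Rm * Rm => (x.1 + a * x.2, x.2) : Rm * Rm)%R \o
    ((fun x : Rm * Rm => (x.1, x.2 + s' * x.1) : Rm * Rm)%R \o
     (fun x : Rm * Rm => (x.1 + a * x.2, x.2) : Rm * Rm)%R)).
    exact: (mpres_comp (mpres_shear2 a) (mpres_comp (mpres_shear s') (mpres_shear2 a))).
  have s2 : (s' ^+ 2 = (1 - c') * (1 + c'))%R by rewrite (_ : (1 - c') * (1 + c') = 1 - c' ^+ 2)%R; [lra|ring].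
  have as' : (a * s' = c' - 1)%R.
    by rewrite /a mulrAC mulNr -expr2 s2 -mulNr mulfK// opprB.
  have a2 : (a * (1 + c') = - s')%R by rewrite /a divfK.
  apply/funext => -[x y]; rewrite /rot /=; congr pair.
    have -> : (x + a * y + a * (y + s' * (x + a * y)) =
       (1 + a * s') * x + (a * (1 + (1 + a * s'))) * y)%R by ring.
    by rewrite as' (_ : 1 + (1 + (c' - 1)) = 1 + c')%R ?a2; ring.
  have -> : (y + s' * (x + a * y) = s' * x + (1 + a * s') * y)%R by ring.
  by rewrite as'; ring.
(* The remaining case, the half turn, is the square of the quarter turn. *)
have [c1|] := eqVneq (1 + c)%R 0%R; last by move=> c1 cs; exact: main.
move=> cs; have cE : (c = -1)%R by lra.
have sE : (s = 0)%R by apply/eqP; rewrite -sqrf_eq0; apply/eqP; move: cs; rewrite cE sqrrN expr1n; lra.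
have h : mpres mu2 (rot 0%R 1%R) by apply: main; rewrite ?expr0n ?expr1n ?add0r ?addr0 ?oner_eq0.
have -> : rot c s = rot 0%R 1%R \o rot 0%R 1%R.
  by apply/funext => -[x y]; rewrite /rot /= cE sE; congr pair; ring.
exact: (mpres_comp h h).
Qed.

End plane.

End measure_preserving.

(** * Integration in complex coordinates *)

Section integration.
Context (R : realType) (n : nat).
Local Notation C := R[i].
Local Notation Rm := (measurableTypeR R).
Local Notation mu := (@lebesgue_Cn R n).
Local Notation oc := (@of_coords R n).
Implicit Types (D U : set 'rV[C]_n) (f g : 'rV[C]_n -> C) (z : 'rV[C]_n).
Local Notation nrm := (@nrm R n).

Lemma normc_lt_coords (x y : Rm * Rm) (e : R) : `|x.1 - y.1| < e -> `|x.2 - y.2| < e ->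
  normc ((x.1 +i* x.2) - (y.1 +i* y.2) : C) < e + e.
Proof.
move=> h1 h2; apply: le_lt_trans (normc_le_ReIm _) _.
exact: (ltrD h1 h2).
Qed.

(** The sigma-algebra is that of a product of real lines: an open set is the union of the countably
    many rational boxes contained in it. *)
Lemma measurable_coords_open U : open U -> measurable (oc @^-1` U).
Proof.
move=> /open_polydiscP oU.
pose e (k : nat) : R := k.+1%:R^-1.
pose box (p : n.-tuple (rat * rat) * nat) : set (n.-tuple (Rm * Rm)) :=
  \bigcap_(i in [set: 'I_n]) ((@tnth n (Rm * Rm)%type)^~ i @^-1`
    ([set x | `|x - ratr (tnth p.1 i).1| < e p.2] `*`
     [set x | `|x - ratr (tnth p.1 i).2| < e p.2])).
pose good (p : n.-tuple (rat * rat) * nat) := box p `<=` oc @^-1` U.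
have mabs (q : R) k : measurable ([set x | `|x - q| < e k] : set Rm).
  rewrite (_ : [set _ | _] = `](q - e k)%R, (q + e k)%R[%classic :> set Rm).
    exact: measurable_itv.
  by apply/seteqP; split => x /=; rewrite in_itv/= ltr_distl.
have mbox p : measurable (box p).
  apply: fin_bigcap_measurable => // i _; apply: measurable_preimageT.
    exact: measurable_tnth.
  by apply: measurableX; exact: mabs.
(* Boxes that do not fit into [U] are replaced by the empty set, so that the union runs over a whole
   countable type. *)
rewrite (_ : oc @^-1` U = \bigcup_p (if `[< good p >] then box p else set0)).
  apply: countable_bigcupT_measurable => [|p]; last by case: ifP.
  exact: countableP.
apply/seteqP; split => [t Ut|t [p _]]; last by case: ifP => // /asboolP; exact.
have [r r0 rU] := oU _ Ut.
have [k kr] : exists k, e k < r / 4.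
  have r4 : 0 < r / 4 by lra.
  have [k _ hk] := near_infty_natSinv_lt (PosNum r4).
  by exists k; apply: hk => /=.
have ek0 : 0 < e k by rewrite invr_gt0.
have Q (x : R) : exists q : rat, `|x - ratr q| < e k.
  have [q] := @rat_in_itvoo R (x - e k) (x + e k) ltac:(lra).
  by rewrite in_itv/= -ltr_distl distrC; exists q.
have [q hq] := choice Q.
exists ([tuple (q (tnth t i).1, q (tnth t i).2) | i < n], k) => //.
have tin : box ([tuple (q (tnth t i).1, q (tnth t i).2) | i < n], k) t.
  by move=> i _ /=; rewrite tnth_mktuple; split; exact: hq.
case: ifP => // /asboolPn; case=> s sb; apply: rU.
apply/(nrm_lt _ r0) => i; rewrite !mxE.
have [/= s1 s2] := sb i Logic.I; have [/= t1 t2] := tin i Logic.I.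
have tri (x y z : R) : `|x - z| < e k -> `|y - z| < e k -> `|x - y| < e k + e k.
  by move=> h1 h2; rewrite (le_lt_trans (ler_distD z _ _))// [X in _ + X]distrC ltrD.
apply: lt_trans (normc_lt_coords (tri _ _ _ s1 t1) (tri _ _ _ s2 t2)) _; lra.
Qed.

Definition econt (D : set 'rV[C]_n) (F : 'rV[C]_n -> R) := forall z, D z -> forall e : R, 0 < e ->
  exists2 d : R, 0 < d & forall w, nrm (w - z) < d -> `|F w - F z| < e.

Lemma measurable_econt D F : open D -> econt D F ->
  measurable_fun (oc @^-1` D) (F \o oc : _ -> Rm).
Proof.
move=> oD cF; apply: (measurability (@RGenOInfty.G R)).
  exact: RGenOInfty.measurableE.
move=> _ [_ [a ->] <-].
rewrite (_ : _ `&` _ = oc @^-1` (D `&` [set z | a < F z])); last first.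
  by apply/seteqP; split => t /=; rewrite in_itv/= andbT.
apply: measurable_coords_open; apply/open_polydiscP => z [Dz az].
have [d d0 dF] := cF z Dz (F z - a) ltac:(by rewrite subr_gt0).
have [r r0 rD] := (open_polydiscP D).1 oD z Dz.
exists (Num.min d r); first by rewrite lt_min d0.
move=> w; rewrite lt_min => /andP[wd wr]; split => /=; first exact: rD.
have := dF w wd; rewrite ltr_distlC => /andP[h1 h2]; lra.
Qed.

(** Carried separately, because [square_integrable] says nothing of measurability. *)
Definition cmeas D f := measurable_fun (oc @^-1` D) (Re \o f \o oc : _ -> Rm) /\
  measurable_fun (oc @^-1` D) (Im \o f \o oc : _ -> Rm).

Lemma cmeas_holo D f : open D -> holomorphic D f -> cmeas D f.
Proof.
move=> oD hf; split; apply: measurable_econt => // z Dz e e0;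
  have [d d0 dP] := holomorphic_cont hf Dz e0; exists d => // w /dP; apply: le_lt_trans.
- by have := normc_Re (f w - f z); rewrite /=; case: (f w) => ? ?; case: (f z).
- by have := normc_Im (f w - f z); rewrite /=; case: (f w) => ? ?; case: (f z).
Qed.

Lemma cmeas_peval D p : open D -> cmeas D (peval p).
Proof. by move=> oD; apply: cmeas_holo => // z _; exact: peval_differentiable. Qed.

Lemma cmeasD D f g : cmeas D f -> cmeas D g -> cmeas D (fun z => f z + g z).
Proof.
move=> [f1 f2] [g1 g2]; split.
  rewrite (_ : _ \o _ = fun t => (Re \o f \o oc) t + (Re \o g \o oc) t).
    exact: measurable_funD.
  by apply/funext => t /=; case: (f _) => ? ?; case: (g _).
rewrite (_ : _ \o _ = fun t => (Im \o f \o oc) t + (Im \o g \o oc) t).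
  exact: measurable_funD.
by apply/funext => t /=; case: (f _) => ? ?; case: (g _).
Qed.

Lemma cmeasM D f g : cmeas D f -> cmeas D g -> cmeas D (fun z => f z * g z).
Proof.
move=> [f1 f2] [g1 g2]; split.
  rewrite (_ : _ \o _ = fun t => (Re \o f \o oc) t * (Re \o g \o oc) t
    - (Im \o f \o oc) t * (Im \o g \o oc) t).
    by apply: measurable_funB; exact: measurable_funM.
  by apply/funext => t /=; case: (f _) => ? ?; case: (g _).
rewrite (_ : _ \o _ = fun t => (Re \o f \o oc) t * (Im \o g \o oc) t
    + (Im \o f \o oc) t * (Re \o g \o oc) t).
  by apply: measurable_funD; exact: measurable_funM.
by apply/funext => t /=; case: (f _) => ? ?; case: (g _).
Qed.

Lemma cmeas_cst D (c : C) : open D -> cmeas D (fun=> c).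
Proof. by move=> oD; split; exact: measurable_cst. Qed.

Lemma cmeas_conj D f : cmeas D f -> cmeas D (fun z => (f z)^*).
Proof.
move=> [f1 f2]; split.
  by rewrite (_ : _ \o _ = (Re \o f \o oc))//; apply/funext => t /=; case: (f _).
rewrite (_ : _ \o _ = fun t => - (Im \o f \o oc) t).
  exact: measurable_funN.
by apply/funext => t /=; case: (f _).
Qed.

Lemma cmeasZ D f (c : C) : open D -> cmeas D f -> cmeas D (fun z => c * f z).
Proof. by move=> oD mf; apply: cmeasM => //; exact: cmeas_cst. Qed.

Lemma cmeas_sum D (I : Type) (s : seq I) (f : I -> 'rV[C]_n -> C) : open D ->
  (forall i, cmeas D (f i)) -> cmeas D (fun z => \sum_(i <- s) f i z).
Proof.
move=> oD mf; elim: s => [|i s ih].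
  by rewrite (_ : (fun z => _) = fun=> 0); [exact: cmeas_cst|apply/funext => z; rewrite big_nil].
rewrite (_ : (fun z => _) = fun z => f i z + \sum_(i <- s) f i z).
  exact: cmeasD.
by apply/funext => z; rewrite big_cons.
Qed.

Lemma measurable_sqr D f : cmeas D f ->
  measurable_fun (oc @^-1` D) (fun t => (normc (f (oc t)) ^+ 2)%:E).
Proof.
move=> [f1 f2]; apply/measurable_EFinP.
rewrite (_ : (fun t => _) = fun t => (Re \o f \o oc) t * (Re \o f \o oc) t +
  (Im \o f \o oc) t * (Im \o f \o oc) t).
  by apply: measurable_funD; exact: measurable_funM.
by apply/funext => t; rewrite sqr_normcE !expr2.
Qed.

(* A unitary scalar acts on each coordinate plane as a rotation about a point. *)
Lemma integral_Cn_rot D (a : 'rV[C]_n) (u : C) (F : 'rV[C]_n -> \bar R) : normc u = 1 ->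
  open D -> (forall w, D w <-> D (a + u *: (w - a))) ->
  measurable_fun (oc @^-1` D) (F \o oc) ->
  integral_Cn D (fun w => F (a + u *: (w - a))) = integral_Cn D F.
Proof.
move=> u1 oD aD mF.
have cs : Re u ^+ 2 + Im u ^+ 2 = 1 by rewrite -sqr_normcE u1 expr1n.
pose b (k : nat) : C := if insub k is Some i then a ord0 i else 0.
pose tr (c : C) (x : Rm * Rm) : Rm * Rm := (x.1 + Re c, x.2 + Im c).
have ptr c : mpres (prod_measure (@lebesgue_measure R) (@lebesgue_measure R)) (tr c).
  exact: (mpres_prod (mpres_translation (Re c)) (mpres_translation (Im c))).
pose phi0 (k : nat) := tr (b k) \o (rot (Re u) (Im u) \o tr (- b k)).
have p0 k : mpres (prod_measure (@lebesgue_measure R) (@lebesgue_measure R)) (phi0 k).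
  exact: (mpres_comp (ptr _) (mpres_comp (mpres_rot cs) (ptr _))).
have [mphi pphi] := mpres_tuple n p0.
pose phi := @tmap _ (Rm * Rm)%type n phi0.
have ocphi t : oc (phi t) = a + u *: (oc t - a).
  apply/rowP => k; rewrite !mxE tnth_mktuple /phi0 /tr /rot /b /= insubT//= => kn.
  rewrite (_ : Sub _ _ = k); last exact: val_inj.
  case: (tnth t k) => x y; case: (a ord0 k) => a1 a2; case: (u) => u1' u2' /=.
  by apply/eqP; rewrite eq_complex /=; apply/andP; split; apply/eqP; ring.
have preD : phi @^-1` (oc @^-1` D) = oc @^-1` D.
  by apply/seteqP; split => t /=; rewrite ocphi -aD.
have mD : measurable (oc @^-1` D) by exact: measurable_coords_open.
have main (G : n.-tuple (Rm * Rm) -> \bar R) : measurable_fun (oc @^-1` D) G ->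
    (forall t, (0 <= G t)%E) ->
    (\int[mu]_(t in oc @^-1` D) G (phi t) = \int[mu]_(t in oc @^-1` D) G t)%E.
  move=> mG G0.
  rewrite -[in LHS]preD -(ge0_integral_pushforward mphi mu mD mG)//.
  by apply: eq_measure_integral => A mA _; exact: pphi.
rewrite /integral_Cn.
rewrite (eq_integral ((F \o oc) \o phi)); last by move=> t _ /=; rewrite ocphi.
(* Positive and negative parts are transported separately, [main] being stated for nonnegative
   functions. *)
rewrite [LHS]integralE [RHS]integralE; congr (_ - _)%E.
  rewrite -[RHS](main ((F \o oc)^\+)%E) => [| |t].
  - by apply: eq_integral => t _; rewrite !funeposE.
  - exact: measurable_funepos.
  - exact: funepos_ge0.
rewrite -[RHS](main ((F \o oc)^\-)%E) => [| |t].
- by apply: eq_integral => t _; rewrite !funenegE.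
- exact: measurable_funeneg.
- exact: funeneg_ge0.
Qed.

(** The polydisc contains a product of squares of side [r]. *)
Lemma polydisc_measure_gt0 z (r : R) : 0 < r ->
  (0 < mu (oc @^-1` [set w | (nrm (w - z) < r)%R]))%E.
Proof.
move=> r0; pose b (k : nat) : C := if insub k is Some i then z ord0 i else 0.
pose I (c : R) : set Rm := `]c - r / 2, c + r / 2[%classic.
have muI c : (0 < @lebesgue_measure R (I c))%E.
  rewrite lebesgue_measure_itv/= lte_fin ifT; last lra.
  rewrite -EFinB lte_fin; lra.
have mI c : measurable (I c) by exact: measurable_itv.
have := @tuple_measure_box R _ (Rm * Rm)%type (prod_measure (@lebesgue_measure R)
  (@lebesgue_measure R)) n (fun k => I (Re (b k)) `*` I (Im (b k))).
have mB k : measurable (I (Re (b k)) `*` I (Im (b k))) by exact: measurableX.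
move=> /(_ mB) H; apply: lt_le_trans (H _) _.
  move=> k; have := mule_gt0 (muI (Re (b k))) (muI (Im (b k))); rewrite -prod_measureE//.
apply: le_measure.
- rewrite inE (_ : [set _ | _] = \bigcap_(k in [set: 'I_n]) ((@tnth n (Rm * Rm)%type)^~ k @^-1`
    (I (Re (b k)) `*` I (Im (b k))))).
    apply: fin_bigcap_measurable => // k _; apply: measurable_preimageT => //.
    exact: measurable_tnth.
  by apply/seteqP; split => [t h k _|t h k]; exact: h.
- by rewrite inE; apply: measurable_coords_open; exact: polydisc_open.
move=> t H' /=; apply/(nrm_lt _ r0) => i; rewrite !mxE.
have := H' i; rewrite /b insubT//= => iln.
rewrite (_ : Sub _ _ = i); last exact: val_inj.
rewrite /I /= !in_itv/= -!ltr_distl; case: (z ord0 i) => x y [h1 h2].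
have := @normc_lt_coords (tnth t i) (x, y) _ h1 h2.
by move/lt_le_trans; apply; lra.
Qed.

End integration.

(** * Square-integrable functions *)

Section L2.
Context (R : realType) (n : nat).
Local Notation C := R[i].
Local Notation Rm := (measurableTypeR R).
Local Notation mu := (@lebesgue_Cn R n).
Local Notation oc := (@of_coords R n).
Variables (D : set 'rV[C]_n) (oD : open D).
Implicit Types (f g : 'rV[C]_n -> C) (z : 'rV[C]_n) (F G : 'rV[C]_n -> R).
Let mD : measurable (oc @^-1` D) := measurable_coords_open oD.

(** Kept in the extended reals, so that inequalities such as Bessel's prove finiteness; [L2norm2] is
    its real value. *)
Definition sqint f := integral_Cn D (fun z => (normc (f z) ^+ 2)%:E).
Definition L2 f := cmeas D f /\ (sqint f < +oo)%E.
Definition L2norm2 f : R := fine (sqint f).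
Definition Rint F : R := fine (integral_Cn D (fun z => (F z)%:E)).
Definition Rintegrable F := mu.-integrable (oc @^-1` D) (fun t => (F (oc t))%:E).

Lemma sqint_ge0 f : (0 <= sqint f)%E.
Proof. by apply: integral_ge0 => t _; rewrite lee_fin sqr_ge0. Qed.

Lemma L2norm2_ge0 f : 0 <= L2norm2 f.
Proof. exact/fine_ge0/sqint_ge0. Qed.

Lemma L2normE f : L2 f -> sqint f = (L2norm2 f)%:E.
Proof. by move=> [_ ff]; rewrite fineK// ge0_fin_numE// sqint_ge0. Qed.

Lemma eq_sqint f g : (forall z, D z -> f z = g z) -> sqint f = sqint g.
Proof. by move=> fg; apply: eq_integral => t; rewrite inE /= => Dt; rewrite fg. Qed.

Lemma eq_cmeas f g : (forall z, D z -> f z = g z) -> cmeas D f -> cmeas D g.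
Proof.
move=> fg [f1 f2]; split.
  by apply: eq_measurable_fun f1 => t; rewrite inE /= => Dt; rewrite fg.
by apply: eq_measurable_fun f2 => t; rewrite inE /= => Dt; rewrite fg.
Qed.

Lemma sqintZ (c : C) f : cmeas D f -> sqint (fun z => c * f z) = ((normc c ^+ 2)%:E * sqint f)%E.
Proof.
move=> mf; rewrite /sqint /integral_Cn -ge0_integralZl_EFin ?sqr_ge0//.
- by apply: eq_integral => t _; rewrite normcM exprMn EFinM.
- by move=> t _; rewrite lee_fin sqr_ge0.
- exact: measurable_sqr.
Qed.

Lemma sqr_normcD (x y : C) : normc (x + y) ^+ 2 <= 2 * normc x ^+ 2 + 2 * normc y ^+ 2.
Proof.
rewrite (le_trans (lerXn2r 2 _ _ (normcD x y))) ?nnegrE ?addr_ge0 ?normc_ge0//.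
have := sqr_ge0 (normc x - normc y); move: (normc x) (normc y) => a b; nra.
Qed.

Lemma sqintD f g : cmeas D f -> cmeas D g ->
  (sqint (fun z => (f z + g z)%R) <= 2%:E * sqint f + 2%:E * sqint g)%E.
Proof.
move=> mf mg; rewrite /sqint /integral_Cn.
have mf2 := measurable_sqr mf; have mg2 := measurable_sqr mg.
have f0 t : (oc @^-1` D) t -> (0 <= (normc (f (oc t)) ^+ 2)%:E)%E.
  by rewrite lee_fin sqr_ge0.
have g0 t : (oc @^-1` D) t -> (0 <= (normc (g (oc t)) ^+ 2)%:E)%E.
  by rewrite lee_fin sqr_ge0.
rewrite -!ge0_integralZl_EFin// -ge0_integralD//; last 4 first.
- by move=> t Dt; rewrite mule_ge0// f0.
- exact: measurable_funeM.
- by move=> t Dt; rewrite mule_ge0// g0.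
- exact: measurable_funeM.
apply: ge0_le_integral => //.
- by move=> t _; rewrite lee_fin sqr_ge0.
- exact: (measurable_sqr (cmeasD mf mg)).
- by apply: emeasurable_funD; exact: measurable_funeM.
- by move=> t _; rewrite -!EFinM -EFinD lee_fin sqr_normcD.
Qed.

Lemma L2D f g : L2 f -> L2 g -> L2 (fun z => f z + g z).
Proof.
move=> fL gL; have [mf _] := fL; have [mg _] := gL.
split; first exact: cmeasD.
apply: le_lt_trans (sqintD mf mg) _.
by rewrite !L2normE// -!EFinM -EFinD ltry.
Qed.

Lemma L2Z (c : C) f : L2 f -> L2 (fun z => c * f z).
Proof.
move=> fL; have [mf _] := fL; split; first exact: cmeasZ.
by rewrite sqintZ// L2normE// -EFinM ltry.
Qed.

Lemma L2_eq f g : (forall z, D z -> f z = g z) -> L2 f -> L2 g.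
Proof. by move=> fg [mf f2]; split; [exact: eq_cmeas mf|rewrite -(eq_sqint fg)]. Qed.

Lemma L2B f g : L2 f -> L2 g -> L2 (fun z => f z - g z).
Proof.
move=> fL gL; have := L2D fL (L2Z (-1) gL).
by apply: L2_eq => z _; rewrite mulN1r.
Qed.

Lemma L2_0 : L2 (fun=> 0).
Proof.
split; first exact: cmeas_cst.
rewrite /sqint /integral_Cn (eq_integral (fun=> 0%E)) ?integral0//.
by move=> t _; rewrite normc0 expr0n.
Qed.

Lemma L2_sum (I : Type) (s : seq I) (f : I -> 'rV[C]_n -> C) : (forall i, L2 (f i)) ->
  L2 (fun z => \sum_(i <- s) f i z).
Proof.
move=> fL; elim: s => [|i s ih].
  by apply: L2_eq L2_0 => z _; rewrite big_nil.
by apply: L2_eq (L2D (fL i) ih) => z _; rewrite big_cons.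
Qed.

Lemma L2_sum_in (I : eqType) (s : seq I) (f : I -> 'rV[C]_n -> C) :
  (forall i, i \in s -> L2 (f i)) -> L2 (fun z => \sum_(i <- s) f i z).
Proof.
move=> fL; elim: s fL => [|i s ih] fL.
  by apply: L2_eq L2_0 => z _; rewrite big_nil.
have := L2D (fL i (mem_head _ _)) (ih (fun j js => fL j (mem_behead (s := _ :: _) js))).
by apply: L2_eq => z _; rewrite big_cons.
Qed.

Lemma L2norm2Z (c : C) f : L2 f -> L2norm2 (fun z => c * f z) = normc c ^+ 2 * L2norm2 f.
Proof. by move=> fL; apply: EFin_inj; rewrite EFinM -!L2normE ?sqintZ//; [case: fL|exact: L2Z]. Qed.

Lemma RintD F G : Rintegrable F -> Rintegrable G -> Rint (fun z => F z + G z) = Rint F + Rint G.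
Proof.
move=> iF iG; rewrite /Rint /integral_Cn -fineD; try exact: integrable_fin_num.
by rewrite -integralD.
Qed.

Lemma RintZ (r : R) F : Rintegrable F -> Rint (fun z => r * F z) = r * Rint F.
Proof.
move=> iF; apply: EFin_inj; rewrite /Rint /integral_Cn.
rewrite fineK; last exact: (integrable_fin_num mD (integrableZl mD r iF)).
rewrite EFinM fineK; last exact: (integrable_fin_num mD iF).
by rewrite -integralZl.
Qed.

Lemma eq_Rint F G : (forall z, D z -> F z = G z) -> Rint F = Rint G.
Proof.
by move=> FG; congr fine; apply: eq_integral => t; rewrite inE /= => Dt; rewrite FG.
Qed.

Lemma cmeas_prod_conj f g : cmeas D f -> cmeas D g -> cmeas D (fun z => f z * (g z)^*).
Proof. by move=> mf mg; apply: cmeasM => //; exact: cmeas_conj. Qed.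

Lemma L2_integrable f : L2 f -> Rintegrable (fun z => normc (f z) ^+ 2).
Proof.
move=> [mf fo]; apply/integrableP; split; first exact: measurable_sqr.
apply: le_lt_trans fo; rewrite le_eqVlt; apply/orP; left; apply/eqP.
by apply: eq_integral => t _; rewrite gee0_abs// lee_fin sqr_ge0.
Qed.

Lemma L2_prod_integrable f g : L2 f -> L2 g ->
  Rintegrable (fun z => Re (f z * (g z)^*)) /\ Rintegrable (fun z => Im (f z * (g z)^*)).
Proof.
move=> fL gL; have [mf _] := fL; have [mg _] := gL.
have [m1 m2] := cmeas_prod_conj mf mg.
have I := integrableD mD (L2_integrable fL) (L2_integrable gL).
have bd (a b c : R) : `|c| <= a * b -> `|c| <= `|a ^+ 2 + b ^+ 2|.
  move=> cab; rewrite (le_trans cab)// ger0_norm ?addr_ge0 ?sqr_ge0//.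
  by have := sqr_ge0 (a - b); have := sqr_ge0 (a + b); nra.
split; apply: le_integrable I => //.
- exact/measurable_EFinP.
- move=> t _; rewrite -EFinD !abse_EFin lee_fin; apply: bd.
  by rewrite (le_trans (normc_Re _))// normcM normc_conj.
- exact/measurable_EFinP.
- move=> t _; rewrite -EFinD !abse_EFin lee_fin; apply: bd.
  by rewrite (le_trans (normc_Im _))// normcM normc_conj.
Qed.

Lemma innerE f g : inner D f g = Rint (fun z => Re (f z * (g z)^*)) +i*
  Rint (fun z => Im (f z * (g z)^*)).
Proof. by []. Qed.

Lemma innerD f1 f2 g : L2 f1 -> L2 f2 -> L2 g ->
  inner D (fun z => f1 z + f2 z) g = inner D f1 g + inner D f2 g.
Proof.
move=> f1L f2L gL; have [a1 b1] := L2_prod_integrable f1L gL.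
have [a2 b2] := L2_prod_integrable f2L gL.
rewrite !innerE; apply/eqP; rewrite eq_complex /= -!RintD//; apply/andP; split; apply/eqP.
  by apply: eq_Rint => z _; rewrite mulrDl; case: (f1 z * _) => ? ?; case: (f2 z * _).
by apply: eq_Rint => z _; rewrite mulrDl; case: (f1 z * _) => ? ?; case: (f2 z * _).
Qed.

Lemma RintegrableZ r F : Rintegrable F -> Rintegrable (fun z => r * F z).
Proof. exact: integrableZl. Qed.

Lemma innerZ (c : C) f g : L2 f -> L2 g -> inner D (fun z => c * f z) g = c * inner D f g.
Proof.
move=> fL gL; have [a1 b1] := L2_prod_integrable fL gL.
rewrite !innerE; case: c => c d; apply/eqP; rewrite eq_complex /=.
rewrite -mulNr -!RintZ// -!RintD//; try exact: RintegrableZ.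
apply/andP; split; apply/eqP; apply: eq_Rint => z _.
  by rewrite -mulrA; case: (f z * _) => x y /=; rewrite mulNr.
by rewrite -mulrA; case: (f z * _) => x y /=.
Qed.

Lemma inner_conj f g : L2 f -> L2 g -> inner D g f = (inner D f g)^*.
Proof.
move=> fL gL; have [a1 b1] := L2_prod_integrable fL gL.
rewrite !innerE; apply/eqP; rewrite eq_complex /= -mulN1r -RintZ//.
apply/andP; split; apply/eqP; apply: eq_Rint => z _.
  by case: (f z) => a b; case: (g z) => c d /=; ring.
by case: (f z) => a b; case: (g z) => c d /=; ring.
Qed.

Lemma eq_inner f1 f2 g1 g2 : (forall z, D z -> f1 z = f2 z) -> (forall z, D z -> g1 z = g2 z) ->
  inner D f1 g1 = inner D f2 g2.
Proof. by move=> e1 e2; rewrite !innerE; congr Complex; apply: eq_Rint => z Dz; rewrite e1// e2. Qed.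

Lemma inner_self f : inner D f f = (L2norm2 f)%:C.
Proof.
rewrite innerE /real_complex_def; congr Complex.
  by apply: eq_Rint => z _; rewrite mulc_conj.
rewrite (@eq_Rint _ (fun=> 0)); first by rewrite /Rint /integral_Cn integral0.
by move=> z _; rewrite mulc_conj.
Qed.

Lemma inner_sum (I : eqType) (s : seq I) (f : I -> 'rV[C]_n -> C) g :
  (forall i, i \in s -> L2 (f i)) -> L2 g ->
  inner D (fun z => \sum_(i <- s) f i z) g = \sum_(i <- s) inner D (f i) g.
Proof.
move=> fL gL; elim: s fL => [|i s ih] fL.
  rewrite big_nil (@eq_inner _ (fun z => 0 * g z) _ g)//; first by rewrite innerZ// mul0r.
  by move=> z _; rewrite big_nil mul0r.
have fL' j (js : j \in s) : L2 (f j) by apply: fL; rewrite inE js orbT.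
rewrite big_cons -ih// -innerD//; [|exact: fL (mem_head _ _)|exact: L2_sum_in].
by apply: eq_inner => // z _; rewrite big_cons.
Qed.

Lemma innerDr f g1 g2 : L2 f -> L2 g1 -> L2 g2 ->
  inner D f (fun z => g1 z + g2 z) = inner D f g1 + inner D f g2.
Proof.
move=> fL g1L g2L; rewrite (inner_conj (L2D g1L g2L) fL) (inner_conj g1L fL) (inner_conj g2L fL).
by rewrite innerD// rmorphD.
Qed.

Lemma innerZr (c : C) f g : L2 f -> L2 g -> inner D f (fun z => c * g z) = c^* * inner D f g.
Proof.
by move=> fL gL; rewrite (inner_conj (L2Z c gL) fL) (inner_conj gL fL) innerZ// rmorphM.
Qed.

Lemma inner_sumr (I : eqType) (s : seq I) (f : I -> 'rV[C]_n -> C) g :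
  (forall i, i \in s -> L2 (f i)) -> L2 g ->
  inner D g (fun z => \sum_(i <- s) f i z) = \sum_(i <- s) inner D g (f i).
Proof.
move=> fL gL; rewrite (inner_conj (L2_sum_in fL) gL) inner_sum// rmorph_sum.
by rewrite !big_seq; apply: eq_bigr => i js; exact: esym (inner_conj (fL i js) gL).
Qed.

Lemma L2norm2D f g : L2 f -> L2 g ->
  L2norm2 (fun z => f z + g z) = L2norm2 f + L2norm2 g + 2 * Re (inner D f g).
Proof.
move=> fL gL.
have : (L2norm2 (fun z => f z + g z))%:C = inner D f f + inner D f g + (inner D g f + inner D g g).
  rewrite -inner_self innerD//; last exact: L2D.
  by rewrite !innerDr.
rewrite (inner_conj fL gL) !inner_self; case: (inner D f g) => x y /(congr1 Re) /= ->; ring.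
Qed.

(** Minkowski's inequality in squared form, with bounds [a], [b] in place of square roots. The
    Cauchy-Schwarz inequality comes from the polynomial [cs] in [s]. *)
Lemma L2_triangle f g (a b : R) : 0 <= a -> 0 <= b -> L2 f -> L2 g ->
  L2norm2 f <= a ^+ 2 -> L2norm2 g <= b ^+ 2 -> L2norm2 (fun z => f z + g z) <= (a + b) ^+ 2.
Proof.
move=> a0 b0 fL gL fa gb.
have cs (s : R) : 0 <= L2norm2 f + s ^+ 2 * L2norm2 g - 2 * s * Re (inner D f g).
  have := L2norm2_ge0 (fun z => f z + (- s)%:C * g z).
  rewrite L2norm2D//; last exact: L2Z.
  rewrite L2norm2Z// innerZr// normc_real normrN real_normK ?num_real//.
  by case: (inner D f g) => x y /=; rewrite oppr0 mul0r; lra.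
rewrite L2norm2D//.
suff : Re (inner D f g) <= a * b by move: (Re _) => x; nra.
rewrite leNgt; apply/negP => ab.
have f0 := L2norm2_ge0 f; have g0 := L2norm2_ge0 g.
move: (Re _) ab cs => x ab cs.
have x0 : 0 < x by rewrite (le_lt_trans _ ab)// mulr_ge0.
have [g00|gn0] := eqVneq (L2norm2 g) 0.
  (* For [g] of norm 0 the polynomial is affine in [s] and negative at this value. *)
  by have := cs ((L2norm2 f + 1) / x); rewrite g00 mulr0 addr0 -mulrA divfK ?gt_eqF//; lra.
have gpos : 0 < L2norm2 g by rewrite lt_neqAle eq_sym gn0.
(* The minimum of the quadratic polynomial is attained here. *)
have := cs (x / L2norm2 g).
have -> : (x / L2norm2 g) ^+ 2 * L2norm2 g = x ^+ 2 / L2norm2 g.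
  by rewrite expr2; field.
have -> : 2 * (x / L2norm2 g) * x = 2 * (x ^+ 2 / L2norm2 g) by rewrite expr2; field.
suff : L2norm2 f < x ^+ 2 / L2norm2 g by move: (x ^+ 2 / _) => y; lra.
rewrite ltr_pdivlMr//; apply: (@le_lt_trans _ _ (a ^+ 2 * b ^+ 2)).
  exact: ler_pM.
by rewrite -exprMn ltrXn2r// ?nnegrE ?mulr_ge0// ltW.
Qed.

End L2.

(** * Discrete Fourier analysis at roots of unity *)

Section roots_of_unity.
Context (R : realType).
Local Notation C := R[i].

Definition uroot (K : nat) : C := ecirc (K%:R^-1).

Lemma normc_uroot K j : normc (uroot K ^+ j) = 1.
Proof. by rewrite normcX normc_ecirc expr1n. Qed.

Lemma conj_norm1 (u : C) : normc u = 1 -> u * u^* = 1.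
Proof. by move=> u1; rewrite mulc_conj u1 expr1n. Qed.

Lemma ecirc_neq1 (x : R) : 0 < x < 1 -> ecirc x != 1.
Proof.
move=> /andP[x0 x1]; apply/eqP => /(congr1 Re) /=.
rewrite (_ : 2 * pi * x = (pi * x) *+ 2); last by rewrite mulr2n; ring.
rewrite cos_mulr2n cos2sin2 => h.
have s0 : 0 < sin (pi * x).
  by apply: sin_gt0_pi; rewrite mulr_gt0 ?pi_gt0//= gtr_pMr ?pi_gt0.
have : 0 < sin (pi * x) ^+ 2 by rewrite exprn_gt0.
by move: h; rewrite mulr2n; lra.
Qed.

Lemma uroot_orth K d e : (d < K)%N -> (e < K)%N ->
  \sum_(j < K) (uroot K ^+ j) ^+ d * ((uroot K ^+ j) ^+ e)^* = (K * (d == e))%:R.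
Proof.
move=> dK eK; set w := uroot K; pose z := w ^+ d * (w ^+ e)^*.
have K0 : (0 < K)%N by case: K dK {eK w z}.
have wK : w ^+ K = 1.
  by rewrite /w /uroot -ecircMn -[_ *+ K]mulr_natr mulVf ?ecirc1// pnatr_eq0 -lt0n.
have -> : \sum_(j < K) (w ^+ j) ^+ d * ((w ^+ j) ^+ e)^* = \sum_(j < K) z ^+ j.
  by apply: eq_bigr => j _; rewrite /z exprMn -rmorphXn /= -!exprM ![(j * _)%N]mulnC.
have [de|de] := eqVneq d e.
  have -> : z = 1 by rewrite /z de conj_norm1// normc_uroot.
  by rewrite (eq_bigr (fun=> 1)) ?sumr_const ?card_ord ?muln1// => j _; rewrite expr1n.
rewrite muln0; have zK : z ^+ K = 1.
  by rewrite /z exprMn -rmorphXn -!exprM ![(_ * K)%N]mulnC !exprM wK !expr1n rmorph1 mulr1.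
have small m : (0 < m)%N -> (m < K)%N -> w ^+ m != 1.
  move=> m0 mK; rewrite /w /uroot -ecircMn -[_ *+ m]mulr_natr mulrC.
  apply: ecirc_neq1; rewrite divr_gt0 ?ltr0n//= ltr_pdivrMr ?ltr0n// mul1r ltr_nat.
  exact: mK.
have wd m : w ^+ m != 0 by rewrite -normc_gt0 normc_uroot.
have z1 : z != 1.
  apply/eqP => /(congr1 (fun x => x * w ^+ e)).
  rewrite /z mul1r -mulrA [_^* * _]mulrC conj_norm1 ?normc_uroot// mulr1 => E.
  case: (ltngtP d e) de => // h _.
    have /eqP := small (e - d)%N ltac:(by rewrite subn_gt0) (leq_ltn_trans (leq_subr _ _) eK).
    by apply; apply: (mulIf (wd d)); rewrite -exprD subnK ?mul1r ?E// ltnW.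
  have /eqP := small (d - e)%N ltac:(by rewrite subn_gt0) (leq_ltn_trans (leq_subr _ _) dK).
  by apply; apply: (mulIf (wd e)); rewrite -exprD subnK ?mul1r ?E// ltnW.
apply/eqP; have /eqP := subrX1 z K; rewrite zK subrr eq_sym mulf_eq0 subr_eq0 (negbTE z1).
by [].
Qed.

(** Fourier coefficients of [K] samples. Finite averages commute with integrals over [D] by
    linearity alone; the circle is recovered as [K] tends to infinity. *)
Definition dft K (a : nat -> C) d : C := K%:R^-1 * \sum_(j < K) ((uroot K ^+ j) ^+ d)^* * a j.

(** [b] is what remains of the samples after subtracting their first [N] Fourier modes; it is
    orthogonal to those modes, so its square sum is, up to the factor [K], the difference of the two
    sides. *)
Lemma dft_bessel K N a : (0 < K)%N -> (N <= K)%N ->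
  \sum_(d < N) normc (dft K a d) ^+ 2 <= K%:R^-1 * \sum_(j < K) normc (a j) ^+ 2.
Proof.
move=> K0 NK; pose w (j : nat) := uroot K ^+ j.
have Kn0 : (K%:R : C) != 0 by rewrite pnatr_eq0 -lt0n.
pose b j := a j - \sum_(d < N) dft K a d * w j ^+ d.
have sa d : \sum_(j < K) (w j ^+ d)^* * a j = K%:R * dft K a d.
  by rewrite /dft mulrA divff// mul1r.
have cj (x y : C) : (x^* * y)^* = x * y^*.
  case: x => p q; case: y => r s; apply/eqP; rewrite eq_complex /=.
  by apply/andP; split; apply/eqP; ring.
have b0 (d : nat) : (d < N)%N -> \sum_(j < K) (w j ^+ d)^* * b j = 0.
  move=> dN; rewrite (eq_bigr (fun j : 'I_K => (w j ^+ d)^* * a j -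
    \sum_(e < N) dft K a e * (w j ^+ e * (w j ^+ d)^*))); last first.
    move=> j _; rewrite /b mulrBr mulr_sumr; congr (_ - _); apply: eq_bigr => e _.
    by rewrite mulrCA [_^* * _]mulrC.
  rewrite sumrB sa exchange_big /=.
  rewrite (eq_bigr (fun e : 'I_N => dft K a e * (K * (e == d :> nat))%:R)); last first.
    move=> e _; rewrite -mulr_sumr uroot_orth//; last exact: leq_trans NK.
    exact: leq_trans (ltn_ord e) NK.
  rewrite (bigD1 (Ordinal dN))//= eqxx muln1 big1 ?addr0.
    by rewrite mulrC subrr.
  by move=> e; rewrite -val_eqE /= => /negbTE ->; rewrite muln0 mulr0.
have E : \sum_(j < K) b j * (b j)^* = \sum_(j < K) a j * (a j)^* -
    K%:R * \sum_(d < N) dft K a d * (dft K a d)^*.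
  transitivity (\sum_(j < K) (b j * (a j)^* - \sum_(d < N) (dft K a d)^* * ((w j ^+ d)^* * b j))).
    apply: eq_bigr => j _; rewrite {2}/b rmorphB mulrBr rmorph_sum mulr_sumr; congr (_ - _).
    by apply: eq_bigr => d _; rewrite rmorphM; rewrite /= mulrCA [b j * _]mulrC.
  rewrite sumrB [X in _ - X]exchange_big /= [X in _ - X]big1 ?subr0; last first.
    by move=> d _; rewrite -mulr_sumr b0// mulr0.
  rewrite /b (eq_bigr (fun j : 'I_K => a j * (a j)^* -
    \sum_(d < N) dft K a d * ((w j ^+ d)^* * a j)^*)); last first.
    move=> j _; rewrite mulrBl mulr_suml; congr (_ - _); apply: eq_bigr => d _.
    by rewrite -mulrA; congr (_ * _); exact: (esym (cj _ _)).
  rewrite sumrB exchange_big /=; congr (_ - _); rewrite mulr_sumr; apply: eq_bigr => d _.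
  by rewrite -mulr_sumr -rmorph_sum sa rmorphM rmorph_nat; rewrite /= mulrCA.
have norms (I : finType) (x : I -> C) :
    \sum_i x i * (x i)^* = (\sum_i normc (x i) ^+ 2)%:C.
  by rewrite rmorph_sum; apply: eq_bigr => i _; rewrite mulc_conj.
move: E; rewrite (norms _ (fun j : 'I_K => b j)) (norms _ (fun j : 'I_K => a j)).
rewrite (norms _ (fun d : 'I_N => dft K a d)) -(rmorph_nat (real_complex R)) -rmorphM -rmorphB.
move=> /(congr1 Re) /= E.
have : 0 <= \sum_(j < K) normc (b j) ^+ 2 by apply: sumr_ge0 => j _; exact: sqr_ge0.
by rewrite E ler_pdivlMl ?ltr0n// subr_ge0.
Qed.

(** The transform averages against factors of modulus 1 and reproduces the coefficients of
    polynomials of degree less than [K], so a uniform error is not amplified. *)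
Lemma dft_approx K d (a c : nat -> C) (e : R) : (d < K)%N ->
  (forall j, (j < K)%N -> normc (a j - \sum_(k < K) (uroot K ^+ j) ^+ k * c k) <= e) ->
  normc (dft K a d - c d) <= e.
Proof.
move=> dK ac; have K0 : (0 < K)%N by case: K dK {ac}.
have Kn0 : (K%:R : C) != 0 by rewrite pnatr_eq0 -lt0n.
have -> : dft K a d - c d = K%:R^-1 * \sum_(j < K) ((uroot K ^+ j) ^+ d)^* *
    (a j - \sum_(k < K) (uroot K ^+ j) ^+ k * c k).
  rewrite (eq_bigr (fun j : 'I_K => ((uroot K ^+ j) ^+ d)^* * a j -
    \sum_(k < K) c k * ((uroot K ^+ j) ^+ k * ((uroot K ^+ j) ^+ d)^*))); last first.
    move=> j _; rewrite mulrBr mulr_sumr; congr (_ - _); apply: eq_bigr => k _.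
    by rewrite mulrCA mulrA mulrC.
  rewrite sumrB mulrBr; congr (_ - _); rewrite exchange_big /=.
  rewrite (eq_bigr (fun k : 'I_K => c k * (K * (k == d :> nat))%:R)); last first.
    by move=> k _; rewrite -mulr_sumr uroot_orth.
  rewrite (bigD1 (Ordinal dK))//= eqxx muln1 big1 ?addr0 1?mulrCA ?mulVf ?mulr1//.
  by move=> k; rewrite -val_eqE /= => /negbTE ->; rewrite muln0 mulr0.
rewrite normcM normcV normc_nat ler_pdivrMl ?ltr0n//.
rewrite (le_trans (normc_sum _ _ _))// (le_trans (ler_sum _ (G := fun=> e) _))//.
  by move=> j _; rewrite normcM normc_conj normcX normc_uroot expr1n mul1r; exact: ac.
by rewrite sumr_const card_ord mulr_natl.
Qed.

End roots_of_unity.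

(** * Bessel's inequality by averaging over rotations *)

Section bessel.
Context (R : realType) (n : nat).
Local Notation C := R[i].
Local Notation Rm := (measurableTypeR R).
Local Notation mu := (@lebesgue_Cn R n).
Local Notation oc := (@of_coords R n).
Implicit Types (D : set 'rV[C]_n) (f g : 'rV[C]_n -> C) (z : 'rV[C]_n) (F G : 'rV[C]_n -> R).

Lemma fatou_bound D (G : nat -> 'rV[C]_n -> R) F (B : \bar R) : open D ->
  (forall k, measurable_fun (oc @^-1` D) (fun t => (G k (oc t))%:E)) ->
  (forall k z, D z -> 0 <= G k z) ->
  (forall z, D z -> forall e : R, 0 < e -> exists N, forall k, (N <= k)%N -> `|G k z - F z| < e) ->
  (forall k, (integral_Cn D (fun z => (G k z)%:E) <= B)%E) ->
  (integral_Cn D (fun z => (F z)%:E) <= B)%E.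
Proof.
move=> oD mG G0 GF GB.
have mD := measurable_coords_open oD.
have G0' k t : (oc @^-1` D) t -> (0 <= (G k (oc t))%:E)%E by move=> Dt; rewrite lee_fin; exact: G0.
have H := @fatou _ _ _ mu _ mD (fun k t => (G k (oc t))%:E) mG G0'.
rewrite /integral_Cn (eq_integral (fun t => limn_einf (fun k => (G k (oc t))%:E))); last first.
  move=> t; rewrite inE /= => Dt; apply/esym.
  have /cvg_limn_einf_sup[//] : (fun k => (G k (oc t))%:E) @ \oo --> (F (oc t))%:E.
  apply: cvg_EFin; first exact: nearW.
  apply/cvgrPdistC_lt => e /(GF _ Dt)[N hN]; exists N => // k /= Nk; exact: hN.
apply: le_trans H _; rewrite limn_einf_lim; apply: lime_le; first exact: is_cvg_einfs.
apply: nearW => k; apply: le_trans (GB k).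
by apply: ereal_inf_lbound; exists k => /=.
Qed.

Lemma sume_const (x : \bar R) K : (0 <= x)%E -> (\sum_(i < K) x = K%:R%:E * x)%E.
Proof.
move=> x0; elim: K => [|K ih]; first by rewrite big_ord0 mul0e.
by rewrite big_ord_recr /= ih -natr1 EFinD ge0_muleDl ?mul1e ?lee_fin.
Qed.

Lemma cdiff_affine f (b z : 'rV[C]_n) (c : C) : cdiff f (b + c *: z) ->
  cdiff (fun w => f (b + c *: w)) z.
Proof.
move=> [l H]; apply: (@cdiff_scale _ _ (fun w => f (b + w))).
exists l => e /H[d d0 dP]; exists d => // w wz.
have -> : w - c *: z = (b + w) - (b + c *: z) by rewrite opprD addrACA subrr add0r.
by apply: dP; rewrite opprD addrACA subrr add0r.
Qed.

(** The discrete Bessel inequality at each point, integrated with the invariance of [D] under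
    rotations about [a], bounds the transforms of order [K] by [sqint D f]; they converge to the
    [c d], and Fatou's lemma concludes. The centre is 0 for balanced domains and arbitrary for the
    mean value property on polydiscs. *)
Lemma bessel_rot D (a : 'rV[C]_n) f (c : nat -> 'rV[C]_n -> C) N : open D ->
  (forall u w, normc u = 1 -> D w <-> D (a + u *: (w - a))) ->
  holomorphic D f -> (forall d, cmeas D (c d)) ->
  (forall w, D w -> forall e : R, 0 < e -> exists K0, forall K u, (K0 <= K)%N -> normc u = 1 ->
     normc (f (a + u *: (w - a)) - \sum_(k < K) u ^+ k * c k w) <= e) ->
  (\sum_(d < N) sqint D (c d) <= sqint D f)%E.
Proof.
move=> oD aD hf mc fc.
have mD := measurable_coords_open oD.
have mrot u : normc u = 1 -> cmeas D (fun w => f (a + u *: (w - a))).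
  move=> u1; apply: (cmeas_holo oD) => w Dw; apply/differentiableE.
  have e v : a + u *: (v - a) = (a - u *: a) + u *: v by rewrite scalerBr addrA addrAC.
  under eq_fun do rewrite e.
  by apply: cdiff_affine; rewrite -e; apply/differentiableE; apply: hf; exact: (aD u w u1).1.
pose g K d w := dft K (fun j => f (a + uroot R K ^+ j *: (w - a))) d.
have mg K d : cmeas D (g K d).
  apply: cmeasZ => //; apply: (@cmeas_sum _ _ _ _ _ (fun (j : 'I_K) w =>
    ((uroot R K ^+ j) ^+ d)^* * f (a + uroot R K ^+ j *: (w - a)))) => // j.
  by apply: cmeasZ => //; apply: mrot; exact: normc_uroot.
have msum (F : nat -> 'rV[C]_n -> C) : (forall d, cmeas D (F d)) -> forall M,
   measurable_fun (oc @^-1` D) (fun t => (\sum_(d < M) normc (F d (oc t)) ^+ 2)%:E).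
  move=> mF M; apply/measurable_EFinP; apply: measurable_sum => d.
  by apply/measurable_EFinP; exact: (measurable_sqr (mF d)).
have isum (F : nat -> 'rV[C]_n -> C) : (forall d, cmeas D (F d)) -> forall M,
   (integral_Cn D (fun z => (\sum_(d < M) normc (F d z) ^+ 2)%:E) = \sum_(d < M) sqint D (F d))%E.
  move=> mF M; rewrite /integral_Cn /sqint -ge0_integral_sum//.
  - by apply: eq_integral => t _; rewrite sumEFin.
  - by move=> d; exact: measurable_sqr.
  - by move=> d t _; rewrite lee_fin sqr_ge0.
rewrite -isum//.
(* Taking [K0 + k] samples ensures that there are always more samples than modes. *)
pose K0 := N.+1.
apply: (@fatou_bound _ (fun k z => \sum_(d < N) normc (g (K0 + k)%N d z) ^+ 2)) => //.
- by move=> k; exact: msum.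
- by move=> k z _; apply: sumr_ge0 => d _; exact: sqr_ge0.
- move=> z Dz.
  have cv (d : nat) : (fun k => normc (g (K0 + k)%N d z) ^+ 2) @ \oo --> normc (c d z) ^+ 2.
    have cvd : (fun k => normc (g (K0 + k)%N d z)) @ \oo --> normc (c d z).
      apply/cvgrPdistC_lt => e e0; have e20 : 0 < e / 2 by rewrite divr_gt0.
      have [k0 hk] := fc z Dz _ e20; exists (maxn k0 d) => // k /=; rewrite geq_max => /andP[k0k dk].
      have h : normc (g (K0 + k)%N d z - c d z) <= e / 2.
        apply: (@dft_approx _ _ d _ (fun k => c k z)) => [|j _].
          by rewrite /K0 addSn ltnS (leq_trans dk)// leq_addl.
        by apply: hk; [rewrite (leq_trans k0k)// leq_addl|exact: normc_uroot].
      have h2 : `|normc (g (K0 + k)%N d z) - normc (c d z)| <= normc (g (K0 + k)%N d z - c d z).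
        by rewrite ler_norml normcB_ge andbT lerNl opprB normc_distC normcB_ge.
      by apply: le_lt_trans h2 _; lra.
    by rewrite expr2; apply: cvgM.
  have /cvgrPdistC_lt H : (fun k => \sum_(d < N) normc (g (K0 + k)%N d z) ^+ 2) @ \oo -->
     \sum_(d < N) normc (c d z) ^+ 2.
    elim: (N) => [|M ih].
      by rewrite big_ord0; under eq_fun do rewrite big_ord0; exact: cvg_cst.
    by rewrite big_ord_recr; under eq_fun do rewrite big_ord_recr; exact: cvgD.
  by move=> e /H[k0 _ hk]; exists k0 => k /hk.
move=> k; set K := (K0 + k)%N.
have K00 : (0 < K)%N by [].
have KR0 : 0 <= K%:R^-1 :> R by rewrite invr_ge0.
apply: (@le_trans _ _ (integral_Cn D (fun z =>
    (K%:R^-1)%:E * (\sum_(j < K) normc (f (a + uroot R K ^+ j *: (z - a))) ^+ 2)%:E)%E)).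
  have ms := msum (fun j w => f (a + uroot R K ^+ j *: (w - a))) (fun j => mrot _ (normc_uroot _ K j)) K.
  apply: ge0_le_integral => //.
  - by move=> t _; rewrite lee_fin; apply: sumr_ge0 => d _; exact: sqr_ge0.
  - exact: msum.
  - exact: measurable_funeM.
  - move=> t _; rewrite -EFinM lee_fin; apply: dft_bessel => //.
    by rewrite /K /K0 addSn ltnW// ltnS leq_addr.
rewrite /integral_Cn ge0_integralZl_EFin//; last 2 first.
- by move=> t _; rewrite lee_fin; apply: sumr_ge0 => d _; exact: sqr_ge0.
- exact: (msum (fun j w => f (a + uroot R K ^+ j *: (w - a))) (fun j => mrot _ (normc_uroot _ K j)) K).
have := isum (fun j w => f (a + uroot R K ^+ j *: (w - a))) (fun j => mrot _ (normc_uroot _ K j)) K.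
rewrite /integral_Cn => ->.
rewrite (eq_bigr (fun=> sqint D f)); last first.
  move=> j _; apply: (@integral_Cn_rot _ _ D a _ (fun z => (normc (f z) ^+ 2)%:E)) => //.
  - exact: normc_uroot.
  - by move=> w; apply: aD; exact: normc_uroot.
  - by apply: measurable_sqr; exact: cmeas_holo.
rewrite sume_const ?sqint_ge0// muleA -EFinM mulVf ?mul1e//.
by rewrite pnatr_eq0 -lt0n.
Qed.

End bessel.

(** * The Bergman space of a balanced domain *)

Section bergman_balanced.
Context (R : realType) (n : nat).
Local Notation C := R[i].
Local Notation mu := (@lebesgue_Cn R n).
Local Notation oc := (@of_coords R n).
Implicit Types (D : set 'rV[C]_n) (f g : 'rV[C]_n -> C) (z w : 'rV[C]_n).
Local Notation nrm := (@nrm R n).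

(** At [t *: z] with [t > 1] the terms of the convergent series are bounded; homogeneity turns this
    into decay like [t^-d] at [z]. *)
Lemma expansion_geometric D f P z : open D -> homog_expansion D f P -> D z ->
  exists c r : R, [/\ 0 <= c, 0 <= r, r < 1 & forall d, normc (peval (P d) z) <= c * r ^+ d].
Proof.
move=> oD hP Dz; have [t t1 Dtz] := dilate_in oD Dz.
have [N hN] := homog_expansion_cvg hP Dtz (@ltr01 R).
have t0 : 0 < t by apply: lt_trans t1.
pose c := \sum_(k < N) normc (peval (P k) (t%:C *: z)) + 2.
exists c, t^-1; split; [|by rewrite invr_ge0 ltW|by rewrite invf_lt1|].
  by rewrite addr_ge0// sumr_ge0// => k _; exact: normc_ge0.
move=> d; have Pd : normc (peval (P d) (t%:C *: z)) <= c.
  have [Nd|dN] := leqP N d.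
    rewrite -[leLHS]add0r lerD//.
      by apply: sumr_ge0 => k _; exact: normc_ge0.
    have h1 := hN d Nd; have h2 := hN d.+1 (leqW Nd).
    have -> : peval (P d) (t%:C *: z) = (\sum_(k < d.+1) peval (P k) (t%:C *: z) - f (t%:C *: z))
       - (\sum_(k < d) peval (P k) (t%:C *: z) - f (t%:C *: z)).
      by rewrite big_ord_recr/= opprB addrA subrK addrAC subrr add0r.
    by rewrite (le_trans (normcB _ _))//; move: h1 h2; lra.
  rewrite /c (bigD1 (Ordinal dN))//= -addrA lerDl addr_ge0//.
  by apply: sumr_ge0 => k _; exact: normc_ge0.
rewrite (peval_homog _ _ (hP.1 d)) normcM normcX normc_real gtr0_norm// in Pd.
by rewrite exprVn ler_pdivlMr ?exprn_gt0// mulrC.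
Qed.

(** The geometric majorant at [z] does not depend on [u], so one truncation serves for all [u] in
    the disc; this is the uniformity that [bessel_rot] requires. *)
Lemma expansion_circle D f P z : open D -> balanced D -> homog_expansion D f P -> D z ->
  forall e : R, 0 < e -> exists K0, forall K u, (K0 <= K)%N -> normc u <= 1 ->
     normc (f (u *: z) - \sum_(k < K) u ^+ k * peval (P k) z) <= e.
Proof.
move=> oD bD hP Dz e e0; have [c [r [c0 r0 r1 hc]]] := expansion_geometric oD hP Dz.
have e20 : 0 < e / 2 by rewrite divr_gt0.
have r10 : 0 < 1 - r by rewrite subr_gt0.
have [K0 hK0] := geo_small (c / (1 - r)) r0 r1 e20.
exists K0 => K u KK u1.
have [N hN] := homog_expansion_cvg hP (bD _ _ Dz u1) e20.
have E M : \sum_(d < M) peval (P d) (u *: z) = \sum_(d < M) u ^+ d * peval (P d) z.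
  by apply: eq_bigr => d _; rewrite (peval_homog _ _ (hP.1 d)).
have := hN (K + N)%N (leq_addl _ _); rewrite E => h1.
have h2 : normc (\sum_(d < K + N) u ^+ d * peval (P d) z - \sum_(k < K) u ^+ k * peval (P k) z)
    <= c * r ^+ K / (1 - r).
  rewrite big_split_ord/= addrAC subrr add0r (le_trans (normc_sum _ _ _))//.
  apply: (@le_trans _ _ (\sum_(i < N) c * r ^+ K * r ^+ i)).
    apply: ler_sum => i _; rewrite normcM normcX -mulrA -exprD.
    rewrite -[leRHS]mul1r ler_pM ?exprn_ge0 ?normc_ge0//.
    by rewrite exprn_ile1// normc_ge0.
  rewrite -mulr_sumr ler_wpM2l ?mulr_ge0 ?exprn_ge0//.
  rewrite -[leRHS]mul1r ler_pdivlMr// mulrC -opprB mulNr -subrX1 opprB gerBl exprn_ge0//.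
have h3 : c * r ^+ K / (1 - r) < e / 2 by rewrite mulrAC; exact: hK0.
rewrite normc_distC in h1.
rewrite -(subrKA (\sum_(d < K + N) u ^+ d * peval (P d) z)) (le_trans (normcD _ _))//.
by move: h1 h2 h3; lra.
Qed.

Lemma bergman_L2 D f : open D -> bergman D f -> L2 D f.
Proof. by move=> oD [hf sf]; split => //; exact: cmeas_holo. Qed.

Lemma L2_peval_bergman D p : L2 D (peval p) -> bergman D (peval p).
Proof. by move=> [_ sp]; split => // z _; exact: peval_differentiable. Qed.

Lemma bessel D f N : open D -> balanced D -> D !=set0 -> holomorphic D f ->
  (\sum_(d < N) sqint D (peval (homog_part D f d)) <= sqint D f)%E.
Proof.
move=> oD bD D0 hf; apply: (@bessel_rot _ _ _ 0 _ (fun d => peval (homog_part D f d))) => //.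
- move=> u w u1; rewrite add0r subr0; split=> [Dw|Duw]; first by apply: bD => //; rewrite u1.
  have un0 : u != 0 by rewrite -normc_gt0 u1.
  have -> : w = u^-1 *: (u *: w) by rewrite scalerA mulVf// scale1r.
  by apply: bD => //; rewrite normcV u1 invr1.
- by move=> d; exact: cmeas_peval.
move=> w Dw e e0; have hP := homog_partP oD bD D0 hf.
have [K0 hK] := expansion_circle oD bD hP Dw e0.
by exists K0 => K u KK u1; rewrite add0r subr0; apply: hK => //; rewrite u1.
Qed.

Lemma balanced_polydisc (r : R) : balanced [set w | nrm w < r].
Proof.
move=> z c /= zr c1; rewrite nrmZ (le_lt_trans _ zr)// ler_piMl//.
exact: nrm_ge0.
Qed.

(** Bessel's inequality about [z] with the single term of degree 0, which is the constant [f z]. *)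
Lemma mean_value z (r : R) f : 0 < r -> holomorphic [set w | nrm (w - z) < r] f ->
  ((normc (f z) ^+ 2)%:E * mu (oc @^-1` [set w | (nrm (w - z) < r)%R]) <=
    sqint [set w | (nrm (w - z) < r)%R] f)%E.
Proof.
move=> r0 hf; pose D0 := [set w | nrm w < r]; pose f0 w := f (z + w).
pose E := [set w | nrm (w - z) < r].
have oE : open E by exact: polydisc_open.
have oD0 : open D0.
  by have := @polydisc_open R n 0 r; congr open; apply/seteqP; split => w /=; rewrite subr0.
have bD0 : balanced D0 by exact: balanced_polydisc.
have D00 : D0 0 by rewrite /D0/= nrm0.
have hf0 : holomorphic D0 f0.
  move=> w Dw; apply/differentiableE.
  have := @cdiff_affine _ _ f z w 1; rewrite scale1r => H.
  have := H (iffLR (differentiableE _ _) (hf (z + w) _)).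
  rewrite /= addrAC subrr add0r => /(_ Dw).
  by rewrite /f0; under eq_fun do rewrite scale1r.
have hP := homog_partP oD0 bD0 (ex_intro _ _ D00) hf0.
set P := homog_part D0 f0 in hP *.
have P0 w : D0 w -> peval (P 0%N) w = f z.
  move=> Dw; apply/eqP; rewrite -subr_eq0 -normc_eq0 eq_le normc_ge0 andbT.
  apply/ler_addgt0Pl => e e0; rewrite addr0.
  have [K0 hK] := expansion_circle oD0 bD0 hP Dw e0.
  have := hK K0.+1 0 (leqnSn _); rewrite normc0 => /(_ ler01).
  rewrite scale0r /f0 addr0 big_ord_recl/= expr0 mul1r big1 ?addr0; first by rewrite normc_distC.
  by move=> i _; rewrite expr0n mul0r.
have := @bessel_rot _ _ E z f (fun d w => peval (P d) (w - z)) 1 oE.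
have aE (u : C) w : normc u = 1 -> E w <-> E (z + u *: (w - z)).
  by move=> u1; rewrite /E/= addrAC subrr add0r nrmZ u1 mul1r.
move=> /(_ aE hf).
have mc d : cmeas E (fun w => peval (P d) (w - z)).
  apply: (cmeas_holo oE) => w _; apply/differentiableE.
  have := @cdiff_affine _ _ (peval (P d)) (- z) w 1 (peval_cdiff _ _).
  by under eq_fun do rewrite scale1r addrC.
move=> /(_ mc) H; have {H} : (\sum_(d < 1) sqint E (fun w => peval (P d) (w - z)) <= sqint E f)%E.
  apply: H => w Ew e e0; have [K0 hK] := expansion_circle oD0 bD0 hP Ew e0.
  by exists K0 => K u KK u1; apply: hK => //; rewrite u1.
rewrite big_ord_recl big_ord0 adde0 => /(le_trans _); apply.
rewrite (@eq_sqint _ _ _ _ (fun=> f z)); last by move=> w Ew; rewrite P0.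
by rewrite /sqint /integral_Cn integral_cst//; exact: measurable_coords_open.
Qed.

Lemma le_sqint_subset U D f : open U -> open D -> U `<=` D -> cmeas D f ->
  (sqint U f <= sqint D f)%E.
Proof.
move=> oU oD UD mf; apply: ge0_subset_integral.
- exact: measurable_coords_open.
- exact: measurable_coords_open.
- exact: measurable_sqr.
- by move=> t _; rewrite lee_fin sqr_ge0.
- by move=> t; exact: UD.
Qed.

(** For [w] within [r / 4] of [z], the polydisc of radius [r / 2] about [w] lies in [D] and contains
    the one of radius [r / 4] about [z], whose volume gives a constant independent of [w] in the
    mean value inequality. *)
Lemma local_bound D z : open D -> D z -> exists r c : R, [/\ 0 < r, 0 < c,
  forall w, nrm (w - z) < r -> D w &
  forall f, bergman D f -> forall w, nrm (w - z) < r -> normc (f w) ^+ 2 <= c * L2norm2 D f].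
Proof.
move=> oD Dz; have [r r0 rD] := iffLR (open_polydiscP D) oD z Dz.
have r20 : 0 < r / 2 by rewrite divr_gt0.
have r40 : 0 < r / 4 by rewrite divr_gt0.
pose v := mu (oc @^-1` [set w | (nrm (w - z) < r / 4)%R]).
have v0 : (0 < v)%E by exact: polydisc_measure_gt0.
(* [v] is an extended real; any positive real below it will do. *)
have [v1 v10 v1v] : exists2 v1 : R, 0 < v1 & (v1%:E <= v)%E.
  by case: v v0 => [x|_|//]; [rewrite lte_fin; exists x|exists 1; rewrite ?leey].
exists (r / 4), v1^-1; split => //; first by rewrite invr_gt0.
  by move=> w wz; apply: rD; move: wz; lra.
move=> f bf w wz; have [hf _] := bf.
have wD : [set w' | nrm (w' - w) < r / 2] `<=` D.
  move=> w' /= h; apply: rD; rewrite -(subrKA w) (le_lt_trans (nrmD _ _))//.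
  by move: h wz; lra.
have := @mean_value w _ f r20 (fun w' h => hf w' (wD _ h)).
move=> /le_trans/(_ (le_sqint_subset (@polydisc_open R n w (r / 2)) oD wD (cmeas_holo oD hf))).
rewrite (L2normE (bergman_L2 oD bf)) => H.
rewrite mulrC ler_pdivlMr// -lee_fin EFinM; apply: le_trans H.
apply: lee_wpmul2l; first by rewrite lee_fin sqr_ge0.
apply: le_trans v1v _; apply: le_measure; rewrite ?inE; try
  by apply: measurable_coords_open; exact: polydisc_open.
move=> t /= h; rewrite -(subrKA z) (le_lt_trans (nrmD _ _))//.
by move: h wz; rewrite (nrm_distC z w); lra.
Qed.

End bergman_balanced.

(** * Homogeneous polynomials in the Bergman space *)

Section homogeneous_basis.
Context (R : realType) (n : nat).
Local Notation C := R[i].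
Local Notation mu := (@lebesgue_Cn R n).
Local Notation oc := (@of_coords R n).
Variables (D : set 'rV[C]_n) (oD : open D) (bD : balanced D) (D0 : D !=set0).
Implicit Types (f g : 'rV[C]_n -> C) (z w : 'rV[C]_n) (p q : mpoly n C).
Local Notation nrm := (@nrm R n).

Definition homL2 d p := homog_poly d p /\ square_integrable D (peval p).

Lemma homL2_L2 d p : homL2 d p -> L2 D (peval p).
Proof. by move=> [_ sp]; split => //; exact: cmeas_peval. Qed.

Lemma homL2_bergman d p : homL2 d p -> bergman D (peval p).
Proof. by move=> /homL2_L2/L2_peval_bergman. Qed.

Lemma balanced_rot u w : normc u = 1 -> D w <-> D (0 + u *: (w - 0)).
Proof.
move=> u1; rewrite add0r subr0; split=> [Dw|Duw]; first by apply: bD => //; rewrite u1.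
have un0 : u != 0 by rewrite -normc_gt0 u1.
have -> : w = u^-1 *: (u *: w) by rewrite scalerA mulVf// scale1r.
by apply: bD => //; rewrite normcV u1 invr1.
Qed.

Lemma inner_rot (u : C) f g : normc u = 1 -> cmeas D f -> cmeas D g ->
  inner D (fun w => f (u *: w)) (fun w => g (u *: w)) = inner D f g.
Proof.
move=> u1 mf mg; have [m1 m2] := cmeas_prod_conj mf mg.
have e w : 0 + u *: (w - 0) = u *: w by rewrite add0r subr0.
rewrite !innerE; congr Complex; congr fine.
  rewrite -[RHS](@integral_Cn_rot _ _ D 0 u (fun z => (Re (f z * (g z)^*))%:E) u1 oD
    (fun w => balanced_rot w u1) ltac:(by apply/measurable_EFinP)).
  by congr integral_Cn; apply/funext => w; rewrite e.
rewrite -[RHS](@integral_Cn_rot _ _ D 0 u (fun z => (Im (f z * (g z)^*))%:E) u1 oD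
  (fun w => balanced_rot w u1) ltac:(by apply/measurable_EFinP)).
by congr integral_Cn; apply/funext => w; rewrite e.
Qed.

(** A rotation by [u] preserves the inner product and also multiplies it by [u^d] times the
    conjugate of [u^e]; averaging over the roots of unity of order [d + e + 1] gives 0. *)
Lemma homL2_orth d e p q : homL2 d p -> homL2 e q -> d != e ->
  inner D (peval p) (peval q) = 0.
Proof.
move=> pd qe de; have pL := homL2_L2 pd; have qL := homL2_L2 qe.
pose K := (d + e).+1; pose I := inner D (peval p) (peval q).
have Kn0 : (K%:R : C) != 0 by rewrite pnatr_eq0.
have rotI (u : C) : normc u = 1 -> u ^+ d * (u ^+ e)^* * I = I.
  move=> u1; rewrite /I -[RHS](inner_rot u1 pL.1 qL.1) -mulrA -innerZr// -innerZ//; last exact: L2Z.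
  by apply: eq_inner => z _; rewrite (peval_homog _ _ pd.1, peval_homog _ _ qe.1).
have : \sum_(j < K) ((uroot R K ^+ j) ^+ d * ((uroot R K ^+ j) ^+ e)^*) * I = K%:R * I.
  rewrite (eq_bigr (fun=> I)); first by rewrite sumr_const card_ord mulr_natl.
  by move=> j _; rewrite rotI// normc_uroot.
rewrite -mulr_suml uroot_orth ?(negbTE de) ?muln0 ?mul0r.
- by move/eqP; rewrite eq_sym mulf_eq0 (negbTE Kn0) => /eqP.
- by rewrite /K ltnS leq_addr.
- by rewrite /K ltnS leq_addl.
Qed.

Lemma homog_polyD d p q : homog_poly d p -> homog_poly d q -> homog_poly d (p + q).
Proof. exact: rpredD. Qed.

Lemma homog_polyZ d (c : C) p : homog_poly d p -> homog_poly d (c *: p).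
Proof. exact: rpredZ. Qed.

Lemma pevalZ (c : C) p z : peval (c *: p) z = c * peval p z.
Proof. exact: mevalZ. Qed.

Lemma pevalB p q z : peval (p - q) z = peval p z - peval q z.
Proof. exact: mevalB. Qed.

Lemma peval_sum (I : Type) (s : seq I) (F : I -> mpoly n C) z :
  peval (\sum_(i <- s) F i) z = \sum_(i <- s) peval (F i) z.
Proof. exact: raddf_sum. Qed.

Lemma homL2_comb d (B : seq (mpoly n C)) (c : nat -> C) :
  (forall p, p \in B -> homL2 d p) -> homL2 d (\sum_(j < size B) c j *: B`_j).
Proof.
move=> BL; have BL' (j : 'I_(size B)) : homL2 d B`_j by apply/BL/mem_nth.
split; first by apply: rpred_sum => j _; apply: homog_polyZ; exact: (BL' j).1.
have h : L2 D (fun z => \sum_(j < size B) c j * peval B`_j z).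
  by apply: L2_sum => // j; apply: L2Z => //; exact: homL2_L2 (BL' j).
suff [] : L2 D (peval (\sum_(j < size B) c j *: B`_j)) by [].
by apply: L2_eq h => // z _; rewrite peval_sum; apply: eq_bigr => j _; rewrite pevalZ.
Qed.

Lemma homog_part_homL2 f d : bergman D f -> homL2 d (homog_part D f d).
Proof.
move=> bf; split; first exact: (homog_partP oD bD D0 bf.1).1.
have := @bessel R n D f d.+1 oD bD D0 bf.1.
move=> H; apply: le_lt_trans bf.2; apply: le_trans H; rewrite big_ord_recr/=.
by rewrite leeDr// sume_ge0// => i _; exact: sqint_ge0.
Qed.

Lemma homog_part_norm f d : bergman D f -> L2norm2 D (peval (homog_part D f d)) <= L2norm2 D f.
Proof.
move=> bf; rewrite -lee_fin -!L2normE; first last.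
- exact: homL2_L2 (homog_part_homL2 d bf).
- exact: bergman_L2.
apply: le_trans (bessel d.+1 oD bD D0 bf.1); rewrite big_ord_recr/=.
by rewrite leeDr// sume_ge0// => i _; exact: sqint_ge0.
Qed.

(* Partial sums of the homogeneous expansion converge in L2: by Fatou, the squared norm of a
   remainder is at most the tail of the Bessel series. *)
Lemma homog_expansion_L2 f (e : R) : bergman D f -> 0 < e ->
  exists N, (sqint D (fun z => (f z - \sum_(d < N) peval (homog_part D f d) z)%R) < e%:E)%E.
Proof.
move=> bf e0; set P := homog_part D f.
have PL d : homL2 d (P d) by exact: homog_part_homL2.
pose a d := L2norm2 D (peval (P d)); pose s N := \sum_(d < N) a d.
have a0 d : 0 <= a d by exact: L2norm2_ge0.
have sf N : s N <= L2norm2 D f.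
  rewrite -lee_fin -L2normE; last exact: bergman_L2.
  apply: le_trans (bessel N oD bD D0 bf.1); rewrite /s -sumEFin lee_sum// => d _.
  by rewrite L2normE//; exact: homL2_L2 (PL d).
have smono N k : s N <= s (N + k)%N.
  by rewrite /s big_split_ord/= lerDl sumr_ge0.
have e20 : 0 < e / 2 by rewrite divr_gt0.
have hs : has_sup (range s).
  by split; [exists (s 0%N); exists 0%N|exists (L2norm2 D f) => _ [N _ <-]].
have [_ [N _ <-] hN] := sup_adherent e20 hs.
have tail k : \sum_(i < k) a (N + i)%N <= e / 2.
  have : s (N + k)%N <= sup (range s) by apply: (sup_upper_bound hs); exists (N + k)%N.
  by rewrite {1}/s big_split_ord/= -/(s N); move: hN; lra.
exists N; apply: (@le_lt_trans _ _ (e / 2)%:E); last by rewrite lte_fin; lra.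
pose T k z := \sum_(i < k) peval (P (N + i)%N) z.
have TL k : L2 D (T k) by apply: L2_sum => // i; exact: homL2_L2 (PL _).
have Tn k : L2norm2 D (T k) = \sum_(i < k) a (N + i)%N.
  elim: k => [|k ih].
    rewrite big_ord0; apply/eqP; rewrite -(inj_eq (@EFin_inj R)) -L2normE//.
    rewrite /sqint /integral_Cn (eq_integral (fun=> 0%E)) ?integral0//.
    by move=> t _; rewrite /T big_ord0 normc0 expr0n.
  rewrite big_ord_recr/= -ih.
  have -> : T k.+1 = (fun z => T k z + peval (P (N + k)%N) z).
    by apply/funext => z; rewrite /T big_ord_recr.
  have PLk := homL2_L2 (PL (N + k)%N).
  rewrite L2norm2D// (_ : inner D _ _ = 0) ?mulr0 ?addr0//.
  have E := @inner_sum R n D oD _ (index_enum _) (fun i : 'I_k => peval (P (N + i)%N))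
    (peval (P (N + k)%N)) (fun i _ => homL2_L2 (PL (N + i)%N)) PLk.
  rewrite [LHS]E {E}.
  rewrite big1// => i _; apply: (homL2_orth (PL _) (PL _)).
  by rewrite eqn_add2l neq_ltn ltn_ord.
apply: (@fatou_bound _ _ _ (fun k z => normc (T k z) ^+ 2)) => //.
- by move=> k; exact: measurable_sqr (TL k).1.
- by move=> k z _; exact: sqr_ge0.
- move=> z Dz.
  have H (u : nat -> C) (l : C) : (forall e1 : R, 0 < e1 -> exists K0, forall k, (K0 <= k)%N ->
     normc (u k - l) < e1) -> forall e1 : R, 0 < e1 -> exists K0, forall k, (K0 <= k)%N ->
     `|normc (u k) ^+ 2 - normc l ^+ 2| < e1.
    move=> ul e1 e10.
    have /cvgrPdistC_lt : (fun k => normc (u k) ^+ 2) @ \oo --> normc l ^+ 2.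
      have cu : (fun k => normc (u k)) @ \oo --> normc l.
        apply/cvgrPdistC_lt => e2 e20'; have [K0 hK] := ul _ e20'; exists K0 => // k /= /hK.
        apply: le_lt_trans.
        by rewrite ler_norml normcB_ge andbT lerNl opprB normc_distC normcB_ge.
      by rewrite expr2; apply: cvgM.
    by move=> /(_ _ e10)[K0 _ hK]; exists K0 => k /hK.
  apply: H => e1 e10.
  have [K0 hK] := homog_expansion_cvg (homog_partP oD bD D0 bf.1) Dz e10.
  exists K0 => k Kk; have := hK (N + k)%N (leq_trans Kk (leq_addl _ _)).
  by rewrite big_split_ord/= opprB addrA -/P [T k z + _]addrC.
- move=> k; have := L2normE (TL k); rewrite /sqint => ->.
  by rewrite lee_fin Tn.
Qed.

(** The value at a small multiple of [z], inside the polydisc of [local_bound] about 0, vanishes,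
    and homogeneity carries this to [z]. *)
Lemma homL2_norm0 d p : homL2 d p -> L2norm2 D (peval p) = 0 -> forall z, peval p z = 0.
Proof.
move=> pL p0 z; have D00 := balanced0 bD D0.
have [r [c [r0 c0 rD rc]]] := local_bound oD D00.
have nz : 0 < nrm z + 1 by have := nrm_ge0 z; lra.
pose s := r / 2 / (nrm z + 1); have s0 : 0 < s by rewrite !divr_gt0.
have sn0 : s%:C != 0 by rewrite -normc_gt0 normc_real gtr0_norm.
have := rc _ (homL2_bergman pL) (s%:C *: z).
rewrite p0 mulr0 subr0 nrmZ normc_real gtr0_norm// => H.
have : normc (peval p (s%:C *: z)) ^+ 2 <= 0.
  apply: H; rewrite /s mulrAC ltr_pdivrMr//.
  by have := nrm_ge0 z; nra.
rewrite exprn_even_le0//= normc_eq0 (peval_homog _ _ pL.1) mulf_eq0 expf_eq0 (negbTE sn0) andbF.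
by move/eqP.
Qed.

Definition onl d (B : seq (mpoly n C)) := (forall p, p \in B -> homL2 d p) /\
  forall i j, (i < size B)%N -> (j < size B)%N ->
    inner D (peval B`_i) (peval B`_j) = (i == j)%:R.

Lemma onl_coord d B (c : nat -> C) j : onl d B -> (j < size B)%N ->
  inner D (peval (\sum_(i < size B) c i *: B`_i)) (peval B`_j) = c j.
Proof.
move=> [BL Bo] jB; have BL' i : (i < size B)%N -> L2 D (peval B`_i).
  by move=> iB; exact: homL2_L2 (BL _ (mem_nth _ iB)).
rewrite (@eq_inner _ _ _ _ (fun z => \sum_(i < size B) c i * peval B`_i z) _ (peval B`_j))//; last first.
  by move=> z _; rewrite peval_sum; apply: eq_bigr => i _; rewrite pevalZ.
rewrite inner_sum//; [|by move=> i _; apply: L2Z => //; exact: BL'|exact: BL'].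
have E (i : 'I_(size B)) : inner D (fun z => c i * peval B`_i z) (peval B`_j) = c i * (i == j :> nat)%:R.
  by rewrite innerZ; [rewrite Bo|exact: oD|exact: BL'|exact: BL'].
rewrite (eq_bigr _ (fun i _ => E i)) (bigD1 (Ordinal jB))//= eqxx mulr1 big1 ?addr0// => i.
by rewrite -val_eqE /= => /negbTE ->; rewrite mulr0.
Qed.

(** Otherwise the matrix of coefficients over the monomials of degree at most [d] has a left kernel
    vector [v]; the corresponding combination [p] is 0, yet its inner products with the list recover
    [v]. *)
Lemma onl_size d B : onl d B -> (size B <= #|{: bmultinom n d.+1}|)%N.
Proof.
move=> Bo; have [BL _] := Bo; rewrite leqNgt; apply/negP => lt.
pose A : 'M[C]_(size B, #|{: bmultinom n d.+1}|) :=
  \matrix_(i, k) mcoeff (bmnm (enum_val k)) (B`_i).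
have : kermx A != 0.
  rewrite kermx_eq0 /row_free neq_ltn; apply/orP; left.
  exact: leq_ltn_trans (rank_leq_col A) lt.
case/rowV0Pn => v /sub_kermxP vA v0.
(* [insub] turns the row vector into a function on [nat], the form that [onl_coord] expects. *)
pose p := \sum_(i < size B) (fun i : nat => if insub i is Some i' then v ord0 i' else 0) i *: B`_i.
have cE (i : 'I_(size B)) : (if insub (i : nat) is Some i' then v ord0 i' else 0) = v ord0 i.
  by rewrite valK.
have p0 : p = 0.
  apply/mpolyP => m; rewrite mcoeff0 /p (raddf_sum (mcoeff m)).
  have [md|md] := boolP (mdeg m < d.+1)%N.
    have := congr1 (fun M : 'rV_ _ => M ord0 (enum_rank (BMultinom md))) vA.
    rewrite !mxE => E; rewrite -[RHS]E; apply: eq_bigr => i _.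
    by rewrite mxE enum_rankK /= mcoeffZ cE.
  rewrite big1// => i _; rewrite /= mcoeffZ (_ : mcoeff m _ = 0) ?mulr0//.
  apply/memN_msupp_eq0/negP => /((homog_polyP _ _).1 (BL _ (mem_nth 0 (ltn_ord i))).1) mE.
  by rewrite mE ltnSn in md.
case/eqP: v0; apply/rowP => i; rewrite mxE -cE.
have := onl_coord (fun i : nat => if insub i is Some i' then v ord0 i' else 0) Bo (ltn_ord i).
rewrite -/p p0 => <-.
have z0 z : peval (0 : mpoly n C) z = 0 by exact: meval0.
rewrite (@eq_inner _ _ _ _ (fun z => 0 * peval B`_i z) _ (peval B`_i))//.
  have BiL : L2 D (peval B`_i) by exact: homL2_L2 (BL _ (mem_nth 0 (ltn_ord i))).
  by rewrite innerZ// mul0r.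
by move=> z _; rewrite z0 mul0r.
Qed.

End homogeneous_basis.

(** * The homogeneous orthonormal basis *)

Section orthonormal_basis.
Context (R : realType) (n : nat).
Local Notation C := R[i].
Variables (D : set 'rV[C]_n) (oD : open D) (bD : balanced D) (D0 : D !=set0).
Implicit Types (f g : 'rV[C]_n -> C) (z w : 'rV[C]_n) (p q : mpoly n C).
Local Notation nrm := (@nrm R n).
Local Notation homL2 := (homL2 D).
Local Notation onl := (onl D).

Lemma L2norm2_eq0 f : L2 D f -> (forall z, D z -> f z = 0) -> L2norm2 D f = 0.
Proof.
move=> fL f0; apply: EFin_inj; rewrite -L2normE//.
rewrite (@eq_sqint _ _ _ _ (fun=> 0))// /sqint /integral_Cn (eq_integral (fun=> 0%E)) ?integral0//.
by move=> t _; rewrite normc0 expr0n.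
Qed.

Lemma homog_eq d p q : homog_poly d p -> homog_poly d q ->
  (forall z, D z -> peval p z = peval q z) -> forall z, peval p z = peval q z.
Proof.
move=> pd qd pq z; have [r r0 rD] := iffLR (open_polydiscP D) oD _ (balanced0 bD D0).
have nz : 0 < nrm z + 1 by have := nrm_ge0 z; lra.
pose s := r / 2 / (nrm z + 1); have s0 : 0 < s by rewrite !divr_gt0.
have sn0 : s%:C ^+ d != 0 by rewrite expf_neq0// -normc_gt0 normc_real gtr0_norm.
apply: (mulfI sn0); rewrite -(peval_homog _ _ pd) -(peval_homog _ _ qd); apply/pq/rD.
rewrite subr0 nrmZ normc_real gtr0_norm// /s mulrAC ltr_pdivrMr//.
by have := nrm_ge0 z; nra.
Qed.

Lemma homL2B d p q : homL2 d p -> homL2 d q -> homL2 d (p - q).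
Proof.
move=> pd qd; split; first by rewrite -scaleN1r; apply: homog_polyD pd.1 (homog_polyZ _ qd.1).
suff [] : L2 D (peval (p - q)) by [].
apply: (L2_eq _ (L2B oD (homL2_L2 oD pd) (homL2_L2 oD qd))) => z _.
by rewrite pevalB.
Qed.

Lemma homL2Z d (c : C) p : homL2 d p -> homL2 d (c *: p).
Proof.
move=> pd; split; first exact: homog_polyZ pd.1.
suff [] : L2 D (peval (c *: p)) by [].
by apply: (L2_eq _ (L2Z oD c (homL2_L2 oD pd))) => z _; rewrite pevalZ.
Qed.

(** The Gram-Schmidt remainder of [p]. *)
Definition onl_rest B p := p - \sum_(j < size B) inner D (peval p) (peval B`_j) *: B`_j.

Lemma onl_rest_homL2 d B p : onl d B -> homL2 d p -> homL2 d (onl_rest B p).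
Proof.
move=> [BL Bo] pd.
exact: (homL2B pd (homL2_comb oD (fun j => inner D (peval p) (peval B`_j)) BL)).
Qed.

Lemma onl_rest_orth d B p j : onl d B -> homL2 d p -> (j < size B)%N ->
  inner D (peval (onl_rest B p)) (peval B`_j) = 0.
Proof.
move=> Bo pd jB; have [BL _] := Bo.
have BjL : L2 D (peval B`_j) by exact: (homL2_L2 oD (BL _ (mem_nth 0 jB))).
set s := \sum_(j < size B) inner D (peval p) (peval B`_j) *: B`_j.
have sL : L2 D (peval s).
  exact: (homL2_L2 oD (homL2_comb oD (fun j => inner D (peval p) (peval B`_j)) BL)).
have pL := homL2_L2 oD pd.
have -> : inner D (peval (onl_rest B p)) (peval B`_j) =
   inner D (fun z => peval p z + (-1) * peval s z) (peval B`_j).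
  by apply: eq_inner => // z _; rewrite /onl_rest pevalB mulN1r.
rewrite (innerD oD pL (L2Z oD (-1) sL) BjL) (innerZ oD (-1) sL BjL) (onl_coord oD (fun j => inner D (peval p) (peval B`_j)) Bo jB).
by rewrite mulN1r subrr.
Qed.

(** Take an orthonormal list of maximal length, which exists by [onl_size]: if some remainder had
    positive norm, its normalisation would lengthen the list. *)
Lemma onl_max d : exists B, onl d B /\ forall p, homL2 d p -> forall z, peval (onl_rest B p) z = 0.
Proof.
pose P k := `[< exists2 B, onl d B & size B = k >].
have P0 : exists k, P k by exists 0%N; apply/asboolP; exists [::].
have Pub k : P k -> (k <= #|{: bmultinom n d.+1}|)%N.
  by move=> /asboolP[B oB <-]; exact: (onl_size oD oB).
have [k /asboolP[B oB Bk] kmax] := ex_maxnP P0 Pub.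
exists B; split => // p pd; have [BL Bo] := oB.
have rL := onl_rest_homL2 oB pd; set r := onl_rest B p in rL *.
have [r0|rn0] := eqVneq (L2norm2 D (peval r)) 0; first exact: (homL2_norm0 oD bD D0 rL).
have rpos : 0 < L2norm2 D (peval r) by rewrite lt_neqAle eq_sym rn0 L2norm2_ge0.
pose c : R := (Num.sqrt (L2norm2 D (peval r)))^-1; pose r' := c%:C *: r.
have r'L : homL2 d r' by exact: homL2Z.
have r'1 : inner D (peval r') (peval r') = 1.
  rewrite inner_self (_ : L2norm2 D (peval r') = 1)//.
  have -> : L2norm2 D (peval r') = L2norm2 D (fun z => c%:C * peval r z).
    by congr fine; apply: eq_sqint => z _; rewrite pevalZ.
  rewrite (L2norm2Z oD c%:C (homL2_L2 oD rL)).
  by rewrite normc_real real_normK ?num_real// exprVn sqr_sqrtr ?L2norm2_ge0// mulVf.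
have BjL j : (j < size B)%N -> L2 D (peval B`_j).
  by move=> jB; exact: (homL2_L2 oD (BL _ (mem_nth 0 jB))).
have r'B j : (j < size B)%N -> inner D (peval r') (peval B`_j) = 0.
  move=> jB; have -> : inner D (peval r') (peval B`_j) =
     inner D (fun z => c%:C * peval r z) (peval B`_j).
    by apply: eq_inner => // z _; rewrite pevalZ.
  by rewrite (innerZ oD c%:C (homL2_L2 oD rL) (BjL _ jB)) (onl_rest_orth oB pd jB) mulr0.
have : P (size B).+1.
  apply/asboolP; exists (r' :: B); last exact: erefl.
  split.
    by move=> q; rewrite inE => /orP[/eqP ->|/BL].
  move=> [|i] [|j] //=; rewrite ?ltnS => iB jB.
  - by rewrite r'B.
  - rewrite (inner_conj oD (homL2_L2 oD r'L) (BjL _ iB)) r'B//.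
    by rewrite rmorph0.
  - by rewrite Bo// eqSS.
by move=> /kmax; rewrite -Bk ltnn.
Qed.

(** The lists of different degrees are orthogonal to each other by [homL2_orth], and together
    complete because partial sums of homogeneous expansions converge in norm. *)
Lemma homog_onb_exists : exists B, homog_onb D B.
Proof.
have [B hB] := choice onl_max; exists B.
have Bo d : onl d (B d) by exact: (hB d).1.
split.
- by move=> d p /((Bo d).1 p).
- move=> d e i j iB jB; have [de|de] := eqVneq d e; first by subst e; exact: (Bo d).2.
  exact: (homL2_orth oD bD ((Bo d).1 _ (mem_nth 0 iB)) ((Bo e).1 _ (mem_nth 0 jB)) de).
move=> f bf e e0; have [N hN] := homog_expansion_L2 oD bD D0 bf e0.
pose P := homog_part D f.
exists N, (fun d j => inner D (peval (P d)) (peval (B d)`_j)).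
rewrite (_ : integral_Cn _ _ = sqint D (fun z => (f z - \sum_(d < N) peval (P d) z)%R)); first exact: hN.
apply: (@eq_sqint _ _ D (fun z => f z -
  \sum_(d < N) \sum_(j < size (B d)) inner D (peval (P d)) (peval (B d)`_j) * peval (B d)`_j z)) => z _; congr (_ - _); apply: eq_bigr => d _.
have := (hB d).2 _ (homog_part_homL2 oD bD D0 d bf) z.
rewrite /onl_rest pevalB => /eqP; rewrite subr_eq0 => /eqP ->.
by rewrite peval_sum; apply: eq_bigr => j _; rewrite pevalZ.
Qed.

Lemma homog_basisP : homog_onb D (homog_basis D).
Proof. exact: (xgetPex (fun=> [::]) homog_onb_exists). Qed.

Definition Sq d z : R := \sum_(q <- homog_basis D d) normc (peval q z) ^+ 2.

Lemma homog_basis_onl d : onl d (homog_basis D d).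
Proof.
have [B1 B2 _] := homog_basisP; split; first exact: B1.
by move=> i j iB jB; rewrite B2// eqxx.
Qed.

(* A polynomial approximated by the span of the basis lies in it, as its orthogonal component is
   no longer than the error of the approximation. *)
Lemma homog_basis_expand d p z : homL2 d p ->
  peval p z = \sum_(j < size (homog_basis D d))
    inner D (peval p) (peval (homog_basis D d)`_j) * peval (homog_basis D d)`_j z.
Proof.
move=> pd; have [_ _ B3] := homog_basisP; set B := homog_basis D in B3 *.
have oB e : onl e (B e) by exact: homog_basis_onl.
have rL := onl_rest_homL2 (oB d) pd; set r := onl_rest (B d) p in rL.
have rL2 := homL2_L2 oD rL.
have qL e j : (j < size (B e))%N -> homL2 e (B e)`_j by move=> jB; apply: (oB e).1; exact: mem_nth.
have ro e j : (j < size (B e))%N -> inner D (peval r) (peval (B e)`_j) = 0.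
  move=> jB; have [de|de] := eqVneq d e; first by subst e; exact: (onl_rest_orth (oB d)).
  exact: (homL2_orth oD bD rL (qL e j jB) de).
have comb e (c : nat -> C) : L2 D (fun z => \sum_(j < size (B e)) c j * peval (B e)`_j z) /\
    inner D (peval r) (fun z => \sum_(j < size (B e)) c j * peval (B e)`_j z) = 0.
  have cL (j : 'I_(size (B e))) : L2 D (fun z => c j * peval (B e)`_j z).
    exact: (L2Z oD (c j) (homL2_L2 oD (qL e j (ltn_ord j)))).
  split; first exact: (L2_sum oD (index_enum _) cL).
  have E := @inner_sumr R n D oD _ (index_enum _) (fun (j : 'I_(size (B e))) z =>
     c j * peval (B e)`_j z) (peval r) (fun j _ => cL j) rL2.
  rewrite E big1// => j _; rewrite (innerZr oD (c j) rL2 (homL2_L2 oD (qL e j (ltn_ord j)))).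
  by rewrite ro// mulr0.
have small (eps : R) : 0 < eps -> L2norm2 D (peval r) < eps.
  move=> eps0; have [N [c hc]] := B3 _ (L2_peval_bergman (homL2_L2 oD pd)) eps eps0.
  pose s1 z := \sum_(j < size (B d)) inner D (peval p) (peval (B d)`_j) * peval (B d)`_j z.
  pose s2 z := \sum_(e < N) \sum_(j < size (B e)) c e j * peval (B e)`_j z.
  have [s1L s10] := comb d (fun j => inner D (peval p) (peval (B d)`_j)).
  have s2L : L2 D s2.
    exact: (L2_sum oD (index_enum _) (fun e : 'I_N => (comb e (c e)).1)).
  have s20 : inner D (peval r) s2 = 0.
    have E := @inner_sumr R n D oD _ (index_enum _) (fun (e : 'I_N) z =>
      \sum_(j < size (B e)) c e j * peval (B e)`_j z) (peval r) (fun e _ => (comb e (c e)).1) rL2.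
    by rewrite [LHS]E big1// => e _; exact: (comb e (c e)).2.
  pose s z := s1 z + (-1) * s2 z.
  have s2L' := L2Z oD (-1) s2L.
  have sL : L2 D s by exact: (L2D oD s1L s2L').
  have s0 : inner D (peval r) s = 0.
    rewrite /s (innerDr oD rL2 s1L s2L') (innerZr oD (-1) rL2 s2L) s20 mulr0 addr0.
    exact: s10.
  have : (sqint D (fun z => peval r z + s z)%R < eps%:E)%E.
    rewrite (_ : sqint _ _ = integral_Cn D (fun z => (normc (peval p z -
      \sum_(d < N) \sum_(j < size (B d)) c d j * peval (B d)`_j z) ^+ 2)%:E)); first exact: hc.
    apply: (@eq_sqint _ _ D _ (fun z => peval p z -
      \sum_(d < N) \sum_(j < size (B d)) c d j * peval (B d)`_j z)) => w _.
    rewrite /r /onl_rest pevalB peval_sum /s mulN1r.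
    rewrite (eq_bigr (fun j : 'I_(size (B d)) =>
      inner D (peval p) (peval (B d)`_j) * peval (B d)`_j w)); last by move=> j _; rewrite pevalZ.
    by rewrite addrA -/(s1 w) subrK.
  rewrite (L2normE (L2D oD rL2 sL)) lte_fin (L2norm2D oD rL2 sL) s0 /= mulr0 addr0.
  by have := L2norm2_ge0 D s; move: (L2norm2 D s) => x; lra.
have r0 : L2norm2 D (peval r) = 0.
  apply/eqP; rewrite eq_le L2norm2_ge0 andbT leNgt; apply/negP => /small.
  by rewrite ltxx.
have := homL2_norm0 oD bD D0 rL r0 z.
rewrite /r /onl_rest pevalB => /eqP; rewrite subr_eq0 => /eqP ->.
by rewrite peval_sum; apply: eq_bigr => j _; rewrite pevalZ.
Qed.

Lemma homog_basis_norm d (c : nat -> C) : let B := homog_basis D d in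
  L2norm2 D (peval (\sum_(j < size B) c j *: B`_j)) = \sum_(j < size B) normc (c j) ^+ 2.
Proof.
move=> B; have oB := homog_basis_onl d; set p := \sum_(j < size B) _.
have pd : homL2 d p by exact: (homL2_comb oD c oB.1).
have qL (j : 'I_(size B)) : L2 D (peval B`_j).
  by exact: (homL2_L2 oD (oB.1 _ (mem_nth 0 (ltn_ord j)))).
have E := @inner_sum R n D oD _ (index_enum _) (fun (j : 'I_(size B)) z =>
     c j * peval B`_j z) (peval p) (fun j _ => L2Z oD (c j) (qL j)) (homL2_L2 oD pd).
have : (L2norm2 D (peval p))%:C = (\sum_(j < size B) normc (c j) ^+ 2)%:C.
  rewrite -inner_self -(@eq_inner _ _ _ (fun z => \sum_(j < size B) c j * peval B`_j z) _ (peval p))//.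
    rewrite E rmorph_sum; apply: eq_bigr => j _.
    rewrite (innerZ oD (c j) (qL j) (homL2_L2 oD pd)) (inner_conj oD (homL2_L2 oD pd) (qL j)) (onl_coord oD c oB (ltn_ord j)).
    by rewrite mulc_conj.
  by move=> z _; rewrite peval_sum; apply: eq_bigr => j _; rewrite pevalZ.
by move/(congr1 Re).
Qed.

End orthonormal_basis.

(** * Extremal polynomials and series in the Bergman space *)

Section extremal.
Context (R : realType) (n : nat).
Local Notation C := R[i].
Local Notation oc := (@of_coords R n).
Variables (D : set 'rV[C]_n) (oD : open D) (bD : balanced D) (D0 : D !=set0).
Implicit Types (f g : 'rV[C]_n -> C) (z w : 'rV[C]_n) (p q : mpoly n C).
Local Notation nrm := (@nrm R n).
Local Notation homL2 := (homL2 D).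
Local Notation B := (homog_basis D).

Lemma cauchy_schwarz_sum m (x y : 'I_m -> R) :
  (\sum_i x i * y i) ^+ 2 <= (\sum_i x i ^+ 2) * (\sum_i y i ^+ 2).
Proof.
set A := \sum_i x i * y i; set X := \sum_i x i ^+ 2; set Y := \sum_i y i ^+ 2.
have H (s t : R) : 0 <= s ^+ 2 * X - 2 * s * t * A + t ^+ 2 * Y.
  have -> : s ^+ 2 * X - 2 * s * t * A + t ^+ 2 * Y = \sum_i (s * x i - t * y i) ^+ 2.
    rewrite /X /A /Y !mulr_sumr -sumrB -big_split /=; apply: eq_bigr => i _; ring.
  by apply: sumr_ge0 => i _; exact: sqr_ge0.
have Y0 : 0 <= Y by apply: sumr_ge0 => i _; exact: sqr_ge0.
have X0 : 0 <= X by apply: sumr_ge0 => i _; exact: sqr_ge0.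
(* [h1] settles the case [Y > 0]; for [Y = 0], [h2] forces [A] to vanish. *)
have h1 := H Y A; have h2 := H A (X + 1); have h3 := H 1 A.
have [Y00|Yn0] := eqVneq Y 0.
  rewrite Y00 mulr0; have : A ^+ 2 * (X + 2) <= 0 by move: h2; rewrite Y00 !expr2; lra.
  by rewrite pmulr_lle0//; lra.
have Yp : 0 < Y by rewrite lt_neqAle eq_sym Yn0.
have : 0 <= Y * (X * Y - A ^+ 2) by move: h1; rewrite !expr2; lra.
by rewrite pmulr_rge0// subr_ge0.
Qed.

(** Parseval's identity and the Cauchy-Schwarz inequality in the coordinates of [p]. *)
Lemma homog_basis_bound d p z : homL2 d p ->
  normc (peval p z) ^+ 2 <= L2norm2 D (peval p) * Sq D d z.
Proof.
move=> pd; pose c j := inner D (peval p) (peval (B d)`_j).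
have pc w : peval p w = peval (\sum_(j < size (B d)) c j *: (B d)`_j) w.
  rewrite (homog_basis_expand oD bD D0 w pd) peval_sum.
  by apply: eq_bigr => j _; rewrite pevalZ.
have -> : L2norm2 D (peval p) = \sum_(j < size (B d)) normc (c j) ^+ 2.
  transitivity (L2norm2 D (peval (\sum_(j < size (B d)) c j *: (B d)`_j))).
    exact: (congr1 fine (eq_sqint (fun w _ => pc w))).
  exact: (homog_basis_norm oD bD D0 d c).
rewrite (homog_basis_expand oD bD D0 z pd) /Sq (big_nth 0) big_mkord.
apply: le_trans (cauchy_schwarz_sum _ _).
rewrite lerXn2r ?nnegrE ?normc_ge0 ?sumr_ge0//.
  by move=> j _; rewrite mulr_ge0 ?normc_ge0.
by apply: le_trans (normc_sum _ _ _) _; apply: ler_sum => j _; rewrite normcM.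
Qed.

(** The case of equality in the Cauchy-Schwarz inequality. When [S = 0] the inverse [s^-1] is 0 and
    so is the polynomial, in accordance with the claim. *)
Lemma homog_basis_extremal d z : exists Q, [/\ homL2 d Q, L2norm2 D (peval Q) <= 1 &
  normc (peval Q z) ^+ 2 = Sq D d z].
Proof.
pose S := Sq D d z; pose s := Num.sqrt S.
have S0 : 0 <= S by apply: sumr_ge0 => q _; exact: sqr_ge0.
have SE : \sum_(j < size (B d)) normc (peval (B d)`_j z) ^+ 2 = S.
  by rewrite /S /Sq (big_nth 0) big_mkord.
pose c j := (s^-1)%:C * (peval (B d)`_j z)^*.
exists (\sum_(j < size (B d)) c j *: (B d)`_j); split.
- exact: (homL2_comb oD c (homog_basis_onl oD bD D0 d).1).
- rewrite (homog_basis_norm oD bD D0 d c).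
  rewrite (eq_bigr (fun j : 'I_(size (B d)) => S^-1 * normc (peval (B d)`_j z) ^+ 2)).
    rewrite -mulr_sumr SE; have [->|Sn0] := eqVneq S 0; first by rewrite mulr0.
    by rewrite mulVf.
  move=> j _; rewrite /c normcM normc_conj normc_real exprMn real_normK ?num_real//.
  by rewrite exprVn sqr_sqrtr.
rewrite peval_sum (eq_bigr (fun j : 'I_(size (B d)) =>
  (s^-1)%:C * (normc (peval (B d)`_j z) ^+ 2)%:C)).
  rewrite -mulr_sumr -(rmorph_sum (real_complex R)) SE -rmorphM normc_real real_normK ?num_real//.
  rewrite -/S; have [S00|Sn0] := eqVneq S 0; first by rewrite S00 mulr0 expr0n.
  by rewrite exprMn exprVn sqr_sqrtr// expr2 mulKf.
by move=> j _; rewrite pevalZ /c -mulrA [_^* * _]mulrC mulc_conj.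
Qed.

Lemma Sq_ge0 d z : 0 <= Sq D d z.
Proof. by apply: sumr_ge0 => q _; exact: sqr_ge0. Qed.

Lemma Sq_homog d (c : C) z : Sq D d (c *: z) = (normc c ^+ d) ^+ 2 * Sq D d z.
Proof.
rewrite /Sq mulr_sumr !big_seq; apply: eq_bigr => q qB.
have [qd _] := (homog_basis_onl oD bD D0 d).1 q qB.
by rewrite (peval_homog _ _ qd) normcM exprMn normcX.
Qed.

(** At a point [z] of [D], both [P d] and [Q d] are limits of the same discrete Fourier coefficients
    of [f] on the circle through [z]; homogeneity carries equality from [D] to all points. *)
Lemma homog_expansion_unique f P Q : homog_expansion D f P -> homog_expansion D f Q ->
  forall d z, peval (P d) z = peval (Q d) z.
Proof.
move=> hP hQ d; apply: (homog_eq oD bD D0 (hP.1 d) (hQ.1 d)) => z Dz.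
apply/eqP; rewrite -subr_eq0 -normc_eq0 eq_le normc_ge0 andbT.
apply/ler_addgt0Pl => e e0; rewrite addr0; have e20 : 0 < e / 2 by rewrite divr_gt0.
have [K1 h1] := expansion_circle oD bD hP Dz e20.
have [K2 h2] := expansion_circle oD bD hQ Dz e20.
pose K := (d + (K1 + K2)).+1.
have dK : (d < K)%N by rewrite ltnS leq_addr.
pose a j := f (uroot R K ^+ j *: z).
have u1 j : normc (uroot R K ^+ j) <= 1 by rewrite normc_uroot.
have c1 := @dft_approx _ K d a (fun k => peval (P k) z) _ dK (fun j jK => h1 K _
  (leqW (leq_trans (leq_addr _ _) (leq_addl _ _))) (u1 j)).
have c2 := @dft_approx _ K d a (fun k => peval (Q k) z) _ dK (fun j jK => h2 K _
  (leqW (leq_trans (leq_addl _ _) (leq_addl _ _))) (u1 j)).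
rewrite -(subrKA (dft K a d)) (le_trans (normcD _ _))//.
by rewrite normc_distC; move: c1 c2; lra.
Qed.

(** Comparison with a telescoping series: [1/t^2] is at most twice [1/t - 1/(t+1)] for [t >= 1]. *)
Lemma telescope_tail N k : \sum_(i < k) ((N + i).+1%:R ^- 2 : R) <= 2 * (N.+1%:R^-1 - (N + k).+1%:R^-1).
Proof.
elim: k => [|k ih]; first by rewrite big_ord0 addn0 subrr mulr0.
rewrite big_ord_recr/= addnS; move: ih; set x := \sum_(i < k) _; move: x => x.
set y := N.+1%:R^-1; move: y => y; set m := (N + k)%N => ih.
have m0 : 0 < m.+1%:R :> R by rewrite ltr0n.
have m1 : 1 <= m.+1%:R :> R by rewrite ler1n.
have -> : m.+2%:R = m.+1%:R + 1 :> R by rewrite -[m.+2]addn1 natrD.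
have : m.+1%:R ^- 2 <= 2 * (m.+1%:R^-1 - (m.+1%:R + 1)^-1) :> R.
  move: (m.+1%:R) m0 m1 => t t0 t1.
  have -> : 2 * (t^-1 - (t + 1)^-1) = 2 / (t * (t + 1)).
    by field; rewrite !gt_eqF//; lra.
  rewrite ler_pdivlMr ?mulr_gt0//; last lra.
  have -> : t ^- 2 * (t * (t + 1)) = 1 + t^-1 by rewrite expr2; field; rewrite gt_eqF.
  have : t^-1 <= 1 by rewrite invf_le1.
  lra.
have aux (x' y' a q b : R) : x' <= 2 * (y' - a) -> q <= 2 * (a - b) -> x' + q <= 2 * (y' - b) by lra.
exact: aux.
Qed.

Lemma telescope_tail_le N k : \sum_(i < k) ((N + i).+1%:R ^- 2 : R) <= 2 / N.+1%:R.
Proof.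
apply: le_trans (telescope_tail N k) _; rewrite ler_pM2l// gerBl.
by rewrite invr_ge0.
Qed.

Lemma cvg_sqr_normc (u : nat -> C) (l : C) :
  (forall e : R, 0 < e -> exists N, forall k, (N <= k)%N -> normc (u k - l) <= e) ->
  forall e : R, 0 < e -> exists N, forall k, (N <= k)%N -> `|normc (u k) ^+ 2 - normc l ^+ 2| < e.
Proof.
move=> ul e e0.
have /cvgrPdistC_lt : (fun k => normc (u k) ^+ 2) @ \oo --> normc l ^+ 2.
  have cu : (fun k => normc (u k)) @ \oo --> normc l.
    apply/cvgrPdistC_lt => e2 e20; have e22 : 0 < e2 / 2 by rewrite divr_gt0.
    have [K0 hK] := ul _ e22; exists K0 => // k /= /hK h.
    apply: (@le_lt_trans _ _ (e2 / 2)); last lra.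
    apply: le_trans h.
    by rewrite ler_norml normcB_ge andbT lerNl opprB normc_distC normcB_ge.
  by rewrite expr2; apply: cvgM.
by move=> /(_ _ e0)[K0 _ hK]; exists K0 => k /hK.
Qed.

(** Completeness of the Bergman space in the form used for [series_bergman] and for the gliding
    hump. [b] bounds the norms, hence the square on it, and [t] bounds the tails. [local_bound]
    gives locally uniform convergence, Weierstrass' theorem a holomorphic limit, and Fatou's lemma
    the norm of the remainders. *)
Lemma bergman_series (g : nat -> 'rV[C]_n -> C) (b t : nat -> R) :
  (forall m, bergman D (g m)) -> (forall m, 0 <= b m) ->
  (forall m, L2norm2 D (g m) <= b m ^+ 2) ->
  (forall N k, \sum_(i < k) b (N + i)%N <= t N) ->
  (forall e, 0 < e -> exists N0, forall N, (N0 <= N)%N -> t N < e) ->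
  exists f, [/\ bergman D f,
    forall z, D z -> exists r c : R, [/\ 0 < r, 0 < c, forall w, nrm (w - z) < r -> D w &
      forall N w, nrm (w - z) < r -> normc (\sum_(m < N) g m w - f w) <= c * t N] &
    forall N, L2norm2 D (fun z => f z - \sum_(m < N) g m z) <= t N ^+ 2].
Proof.
move=> gB b0 gb bt t0; pose S N z := \sum_(m < N) g m z.
have gL m : L2 D (g m) by exact: (bergman_L2 oD (gB m)).
have tge0 N : 0 <= t N by apply: le_trans (bt N 0%N); rewrite big_ord0.
have SD N k z : S (N + k)%N z - S N z = \sum_(i < k) g (N + i)%N z.
  by rewrite /S big_split_ord/= addrAC subrr add0r.
have bd z : D z -> exists r c : R, [/\ 0 < r, 0 < c, forall w, nrm (w - z) < r -> D w &
   forall N k w, nrm (w - z) < r -> normc (S (N + k)%N w - S N w) <= c * t N].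
  move=> Dz; have [r [c [r0 c0 rD hc]]] := local_bound oD Dz.
  exists r, (Num.sqrt c); split => //; first by rewrite sqrtr_gt0.
  move=> N k w wz; rewrite SD (le_trans (normc_sum _ _ _))//.
  apply: (@le_trans _ _ (\sum_(i < k) Num.sqrt c * b (N + i)%N)).
    apply: ler_sum => i _; have := hc _ (gB (N + i)%N) w wz.
    move=> /le_trans/(_ (ler_wpM2l (ltW c0) (gb _))) h.
    rewrite -(ler_pXn2r (n := 2))// ?nnegrE ?normc_ge0 ?mulr_ge0 ?sqrtr_ge0//.
    by rewrite exprMn sqr_sqrtr// ltW.
  by rewrite -mulr_sumr ler_wpM2l ?sqrtr_ge0.
have small (c e : R) : 0 < c -> 0 < e -> exists N0, forall N, (N0 <= N)%N -> c * t N < e.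
  move=> c0 e0; have [N0 hN] := t0 (e / c) (divr_gt0 e0 c0); exists N0 => N /hN.
  by rewrite ltr_pdivlMr// mulrC.
have lim z : exists l, D z -> forall e : R, 0 < e ->
    exists N, forall k, (N <= k)%N -> normc (S k z - l) <= e.
  case: (pselect (D z)) => [Dz|nD]; last by exists 0.
  have [r [c [r0 c0 _ hc]]] := bd z Dz.
  have zz : nrm (z - z) < r by rewrite subrr nrm0.
  have cau (e : R) : 0 < e -> exists N, forall j k, (N <= j)%N -> (N <= k)%N ->
      normc (S j z - S k z) <= e.
    move=> e0; have e20 : 0 < e / 2 by rewrite divr_gt0.
    have [N hN] := small c _ c0 e20; exists N => j k Nj Nk.
    have hj := hc N (j - N)%N z zz; have hk := hc N (k - N)%N z zz.
    rewrite !subnKC// in hj hk.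
    have hNN := ltW (hN N (leqnn _)).
    rewrite -(subrKA (S N z)) (le_trans (normcD _ _))// [normc (S N z - _)]normc_distC.
    by rewrite [leRHS]splitr lerD//; [exact: le_trans hj hNN|exact: le_trans hk hNN].
  have [l hl] := @complex_cauchy R (fun k => S k z) cau; by exists l.
have [f hf] := choice lim.
have unif z : D z -> exists r c : R, [/\ 0 < r, 0 < c, forall w, nrm (w - z) < r -> D w &
   forall N w, nrm (w - z) < r -> normc (S N w - f w) <= c * t N].
  move=> Dz; have [r [c [r0 c0 rD hc]]] := bd z Dz; exists r, c; split => // N w wz.
  apply/ler_addgt0Pl => e e0; have [M hM] := hf w (rD w wz) e e0.
  have := hM (N + M)%N (leq_addl _ _); have := hc N M w wz.
  rewrite -(subrKA (S (N + M)%N w) (S N w)) => h1 h2; apply: le_trans (normcD _ _) _.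
  by rewrite [leRHS]addrC lerD// normc_distC.
have holf : holomorphic D f.
  move=> z Dz; apply/differentiableE; have [r [c [r0 c0 rD hc]]] := unif z Dz.
  apply: (@cdiff_uniform_limit _ _ S f z (r / 2)); first by rewrite divr_gt0.
    move=> N w wr; have Dw : D w by apply: rD; move: wr; lra.
    rewrite /S; elim: N => [|N ih].
      exists (fun=> 0); under eq_fun do rewrite big_ord0; exact: cdiff_with_cst.
    have [l1 h1] := ih; have [l2 h2] := iffLR (differentiableE _ _) ((gB N).1 w Dw).
    exists (fun k => l1 k + l2 k).
    under eq_fun do rewrite big_ord_recr/=.
    exact: (cdiff_withD h1 h2).
  move=> e e0; have [N0 hN0] := small c e c0 e0; exists N0 => N w NN wr.
  apply: le_trans (hc N w _) _; first by move: wr; lra.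
  exact/ltW/hN0.
pose T N k z := \sum_(i < k) g (N + i)%N z.
have TL N k : L2 D (T N k) by apply: (L2_sum oD (index_enum _)) => i; exact: gL.
have normT N k : L2norm2 D (T N k) <= (\sum_(i < k) b (N + i)%N) ^+ 2.
  elim: k => [|k ih].
    rewrite big_ord0 expr0n /= (L2norm2_eq0 (TL N 0%N))// => z _.
    by rewrite /T big_ord0.
  have -> : T N k.+1 = (fun z => T N k z + g (N + k)%N z).
    by apply/funext => z; rewrite /T big_ord_recr.
  rewrite big_ord_recr/=.
  apply: (L2_triangle oD _ (b0 _) (TL N k) (gL _) ih (gb _)).
  exact: sumr_ge0.
have SL N : L2 D (S N) by apply: (L2_sum oD (index_enum _)) => d; exact: gL.
have tail N : (sqint D (fun z => (f z - S N z)%R) <= (t N ^+ 2)%:E)%E.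
  apply: (@fatou_bound _ _ D (fun k z => normc (T N k z) ^+ 2)) => //.
  - by move=> k; exact: (measurable_sqr (TL N k).1).
  - by move=> k z _; exact: sqr_ge0.
  - move=> z Dz; apply: cvg_sqr_normc => e e0; have [K hK] := hf z Dz e e0.
    exists K => k Kk; have := hK (N + k)%N (leq_trans Kk (leq_addl _ _)).
    by rewrite -[T N k z]/(\sum_(i < k) g (N + i)%N z) -SD opprB addrA subrK.
  - move=> k; have := L2normE (TL N k); rewrite /sqint => ->; rewrite lee_fin.
    apply: le_trans (normT N k) _; rewrite lerXn2r ?nnegrE// sumr_ge0//.
have sqf : square_integrable D f.
  apply: (@le_lt_trans _ _ (t 0%N ^+ 2)%:E); last exact: ltry.
  apply: le_trans (tail 0%N); rewrite le_eqVlt; apply/orP; left; apply/eqP.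
  by apply: eq_sqint => z _; rewrite /S big_ord0 subr0.
exists f; split => // N; have bf : bergman D f by [].
by rewrite -lee_fin -(L2normE (L2B oD (bergman_L2 oD bf) (SL N))); exact: tail.
Qed.

Lemma harmonic_small (c e : R) : 0 < c -> 0 < e ->
  exists N0, forall N, (N0 <= N)%N -> c / N.+1%:R < e.
Proof.
move=> c0 e0; exists (Num.truncn (c / e)) => N hN.
rewrite ltr_pdivrMr// mulrC -ltr_pdivrMr//.
by apply: lt_le_trans (truncnS_gt _) _; rewrite ler_nat ltnS.
Qed.

(** The weights [(d+1)^-2] are summable, and their [d]-th roots tend to 1. Uniqueness of the
    expansion identifies the homogeneous parts of the sum. *)
Lemma series_bergman (Q : nat -> mpoly n C) :
  (forall d, homL2 d (Q d)) -> (forall d, L2norm2 D (peval (Q d)) <= 1) ->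
  exists2 f, bergman D f & forall d z,
    peval (homog_part D f d) z = (d.+1%:R ^- 2)%:C * peval (Q d) z.
Proof.
move=> QL Q1; pose b (d : nat) : R := d.+1%:R ^- 2.
have b0 d : 0 <= b d by rewrite invr_ge0 exprn_ge0.
pose P d := (b d)%:C *: Q d.
have PL d : homL2 d (P d) := homL2Z oD (b d)%:C (QL d).
have Pb d : L2norm2 D (peval (P d)) <= b d ^+ 2.
  have -> : L2norm2 D (peval (P d)) = L2norm2 D (fun z => (b d)%:C * peval (Q d) z).
    exact: (congr1 fine (eq_sqint (fun z _ => pevalZ (b d)%:C (Q d) z))).
  rewrite (L2norm2Z oD _ (homL2_L2 oD (QL d))) normc_real real_normK ?num_real//.
  by rewrite ler_piMr ?sqr_ge0.
have [e e0|f [bf unif _]] := bergman_series (fun d => homL2_bergman oD (PL d)) b0 Pb telescope_tail_le.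
  exact: harmonic_small.
exists f => // d z.
have hP : homog_expansion D f P.
  split; first by move=> e; exact: (PL e).1.
  move=> w Dw; have [r [c [r0 c0 rD hc]]] := unif w Dw.
  exists [set w' | nrm (w' - w) < r]; first exact: nbhs_polydisc.
  apply/uniform_cvgP => e e0.
  have [N0 hN0] := @harmonic_small (c * 2) e ltac:(by rewrite mulr_gt0) e0.
  exists N0 => N w' NN wr; apply: le_lt_trans (hc N w' wr) _.
  by rewrite mulrA; exact: hN0.
rewrite (homog_expansion_unique (homog_partP oD bD D0 bf.1) hP d z) /P pevalZ.
by [].
Qed.

End extremal.

(** * Hartogs' lemma *)

Section iterated_sqrt.
Context (R : realType).
Local Notation C := R[i].

(** The power [2^-j]. Iterating the square root calls for holomorphic roots of one kind only, the
    principal branch on the right half-plane, which [crt] iterates. *)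
Definition rt j (x : R) : R := iter j Num.sqrt x.
Definition crt j (x : C) : C := iter j (@sqrtc R) x.

Lemma rt_ge0 j (x : R) : 0 <= x -> 0 <= rt j x.
Proof. by case: j => [|j] //= _; exact: sqrtr_ge0. Qed.

Lemma rtM j (x y : R) : 0 <= x -> 0 <= y -> rt j (x * y) = rt j x * rt j y.
Proof. by move=> x0 y0; elim: j => //= j ->; rewrite sqrtrM// rt_ge0. Qed.

Lemma le_rt j (x y : R) : x <= y -> rt j x <= rt j y.
Proof. by move=> xy; elim: j => //= j; exact: ler_wsqrtr. Qed.

Lemma rtX j (x : R) : 0 <= x -> rt j x ^+ (2 ^ j) = x.
Proof.
move=> x0; elim: j => [|j ih] /=; first by rewrite expr1.
by rewrite expnS exprM sqr_sqrtr ?rt_ge0.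
Qed.

Lemma rtKX j (x : R) : 0 <= x -> rt j (x ^+ (2 ^ j)) = x.
Proof.
move=> x0; elim: j => [|j ih] /=; first by rewrite expn0 expr1.
have -> : rt j (x ^+ (2 ^ j.+1)) = rt j (x ^+ (2 ^ j)) ^+ 2.
  by rewrite expnSr exprM expr2 rtM ?exprn_ge0// -expr2.
by rewrite ih sqrtr_sqr ger0_norm.
Qed.

(** Iterated from the inequality for one square root; with [rt_small] it provides a modulus of
    continuity valid up to 0. *)
Lemma rt_subadd j (x y : R) : 0 <= x -> 0 <= y -> `|rt j x - rt j y| <= rt j `|x - y|.
Proof.
move=> x0 y0; elim: j => //= j ih.
have sq (a b : R) : 0 <= a -> 0 <= b -> `|Num.sqrt a - Num.sqrt b| <= Num.sqrt `|a - b|.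
  wlog ab : a b / b <= a.
    move=> H a0 b0; case/orP: (le_total b a) => h; first exact: H.
    by rewrite distrC (distrC a b); exact: H.
  move=> a0 b0; rewrite !ger0_norm ?subr_ge0 ?ler_wsqrtr//.
  rewrite -(ler_pXn2r (n := 2))// ?nnegrE ?sqrtr_ge0 ?subr_ge0 ?ler_wsqrtr//.
  rewrite sqr_sqrtr ?subr_ge0//.
  have := sqr_sqrtr a0; have := sqr_sqrtr b0; have := ler_wsqrtr ab; have := sqrtr_ge0 b.
  by move: (Num.sqrt a) (Num.sqrt b) => u v; nra.
apply: le_trans (sq _ _ (rt_ge0 _ x0) (rt_ge0 _ y0)) _.
exact: ler_wsqrtr.
Qed.

Lemma rt_small j (e : R) : 0 < e -> exists2 d : R, 0 < d & forall x, x < d -> rt j x < e.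
Proof.
move=> e0; exists (e ^+ (2 ^ j)); first by rewrite exprn_gt0.
move=> x xd; rewrite -(rtKX j (ltW e0)) ltNge; apply/negP => h.
have [x0|x0] := leP 0 x.
  have := lerXn2r (2 ^ j) (rt_ge0 _ (exprn_ge0 (2 ^ j) (ltW e0))) (rt_ge0 j x0) h.
  rewrite !rtX ?exprn_ge0 ?(ltW e0)// leNgt xd //.
have e20 : 0 < e ^+ (2 ^ j) by rewrite exprn_gt0.
have e1 : 0 < rt j (e ^+ (2 ^ j)) by rewrite rtKX// ltW.
have : rt j x <= rt j 0 by apply: le_rt; exact: ltW.
have -> : rt j 0 = 0 :> R by elim: (j) => //= k ->; rewrite sqrtr0.
by move: h e1; lra.
Qed.

Lemma normc_sqrtc (x : C) : normc (sqrtc x) = Num.sqrt (normc x).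
Proof.
apply/eqP; rewrite -(@eqrXn2 _ 2)// ?normc_ge0 ?sqrtr_ge0// sqr_sqrtr ?normc_ge0//.
by rewrite -normcX sqr_sqrtc.
Qed.

Lemma normc_crt j (x : C) : normc (crt j x) = rt j (normc x).
Proof. by elim: j => //= j ih; rewrite normc_sqrtc ih. Qed.

(** The right half-plane is stable under the principal root, so that the root can be iterated. *)
Lemma Re_sqrtc_gt0 (x : C) : 0 < Re x -> 0 < Re (sqrtc x).
Proof.
by case: x => a b /= a0; rewrite sqrtr_gt0 divr_gt0// ltr_wpDl// sqrtr_ge0.
Qed.

(** The difference [u - v] is computed from [(u - v) (u + v) = g w - g z]; denominators stay away
    from 0 because [u] and [v] have positive real parts, so that [|u + v| >= Re v]. *)
Lemma disc_holo_sqrtc (g : C -> C) : disc_holo g -> (forall z, normc z <= 1 -> 0 < Re (g z)) ->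
  disc_holo (fun z => sqrtc (g z)).
Proof.
move=> hg g0 z z1; have [b hb] := hg z z1; set v := sqrtc (g z).
have v0 : 0 < Re v by exact/Re_sqrtc_gt0/g0.
have rv : Re v <= normc v by apply: le_trans (normc_Re v); exact: ler_norm.
have nv : 0 < normc v by exact: lt_le_trans rv.
have vn0 : v != 0 by rewrite -normc_gt0.
exists (b / (2 * v)) => e e0.
have B0 : 0 <= normc b by exact: normc_ge0.
pose m := Re v; have m0 : 0 < m by [].
pose e1 := Num.min 1 (e * m / 2).
have e10 : 0 < e1 by rewrite lt_min ltr01 !divr_gt0 ?mulr_gt0.
have [d1 d10 h1] := hb e1 e10.
pose K := normc b + 1.
have K0 : 0 < K by rewrite /K; lra.
(* [K * |x|] bounds [|y|], and [2 * m^3] bounds the cubic denominator from below; this radius makes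
   the quadratic error at most [e / 2 * |x|]. *)
exists (Num.min d1 (e * m ^+ 3 / K ^+ 2)).
  by rewrite lt_min d10 /= divr_gt0 ?mulr_gt0 ?exprn_gt0.
move=> w w1; rewrite lt_min => /andP[wd1 wd2]; have := h1 w w1 wd1.
have e11 : e1 <= 1 by rewrite /e1 ge_min lexx.
have e12 : e1 <= e * m / 2 by rewrite /e1 ge_min lexx orbT.
clearbody e1; set u := sqrtc (g w) => H.
have u0 : 0 < Re u by exact/Re_sqrtc_gt0/g0.
pose x := w - z; pose y := g w - g z.
have yx : normc (y - b * x) <= e1 * normc x by exact: H.
have x0 : 0 <= normc x by exact: normc_ge0.
have yK : normc y <= K * normc x.
  rewrite -[y](subrK (b * x)) (le_trans (normcD _ _))// normcM /K.
  have := ler_wpM2r x0 e11; move: yx; clear; lra.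
have nuv : m <= normc (u + v).
  apply: le_trans (normc_Re (u + v)); apply: le_trans (ler_norm _).
  rewrite /m; move: u0 v0; case: (u) => ? ?; case: (v) => ? ? /=; clear; lra.
have uv0 : u + v != 0 by rewrite -normc_gt0; exact: lt_le_trans nuv.
have E0 : (u - v) * (u + v) = y by rewrite -subr_sqr /u /v !sqr_sqrtc.
have E1 : u - v = y / (u + v) by rewrite -E0 mulfK.
have E2 : (u - v - b / (2 * v) * x) = (y - b * x) / (2 * v) - y * (u - v) / ((u + v) * (2 * v)).
  by rewrite -E0; field; rewrite vn0 uv0.
rewrite -/x E2 (le_trans (normcB _ _))//.
have n2v : m <= normc (2 * v).
  rewrite normcM (_ : normc 2 = 2); last exact: (normc_nat R 2).
  by move: rv nv; rewrite /m; clear; lra.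
have t1 : normc ((y - b * x) / (2 * v)) <= e / 2 * normc x.
  rewrite normcM normcV ler_pdivrMr; last exact: lt_le_trans n2v.
  apply: le_trans yx _; apply: le_trans (ler_wpM2r x0 e12) _.
  rewrite [leRHS]mulrAC; apply: ler_wpM2r => //; rewrite mulrAC; apply: ler_wpM2l => //.
  lra.
have t2 : normc (y * (u - v) / ((u + v) * (2 * v))) <= e / 2 * normc x.
  have n4 : 2 * m ^+ 3 <= normc ((u + v) * (u + v) * (2 * v)).
    rewrite !normcM (_ : normc 2 = 2); last exact: (normc_nat R 2).
    have a1 : m * m <= normc (u + v) * normc (u + v) by apply: ler_pM => //; exact: ltW.
    have a2 : m * m * m <= normc (u + v) * normc (u + v) * normc v.
      by apply: ler_pM => //; [rewrite mulr_ge0// ltW|exact: ltW].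
    by rewrite exprS expr2 mulrA; move: a2; clear; lra.
  have m3 : 0 < m ^+ 3 by rewrite exprn_gt0.
  rewrite E1 mulrA -mulrA -invfM [(u + v) * ((u + v) * _)]mulrA normcM normcV.
  rewrite ler_pdivrMr; last by apply: lt_le_trans n4; rewrite mulr_gt0.
  apply: (@le_trans _ _ (e / 2 * normc x * (2 * m ^+ 3))); last first.
    by apply: ler_wpM2l n4; rewrite mulr_ge0// divr_ge0// ltW.
  rewrite normcM; apply: (@le_trans _ _ ((K * normc x) * (K * normc x))).
    by apply: ler_pM => //; exact: normc_ge0.
  have : K ^+ 2 * normc x <= e * m ^+ 3.
    by rewrite mulrC -ler_pdivlMr ?exprn_gt0// ltW.
  move=> h; have := ler_wpM2l x0 h; rewrite expr2.
  move: (m ^+ 3) => q; clear; lra.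
have -> : e * normc x = e / 2 * normc x + e / 2 * normc x by rewrite -mulrDl -splitr.
exact: lerD.
Qed.

Lemma disc_holoM (f g : C -> C) : disc_holo f -> disc_holo g -> disc_holo (fun z => f z * g z).
Proof.
move=> hf hg z z1; have [a ha] := hf z z1; have [b hb] := hg z z1.
exists (a * g z + f z * b) => e e0.
pose F := normc (f z) + 1; pose G := normc (g z) + normc b + 1.
have nf := normc_ge0 (f z); have ng := normc_ge0 (g z); have nb := normc_ge0 b.
have F0 : 0 < F by rewrite /F; lra.
have G0 : 0 < G by rewrite /G; move: ng nb; clear; lra.
have na := normc_ge0 a.
pose e1 := Num.min 1 (e / (4 * (F + G))).
have FG0 : 0 < 4 * (F + G) by lra.
have e10 : 0 < e1 by rewrite lt_min ltr01 divr_gt0.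
have e11 : e1 <= 1 by rewrite /e1 ge_min lexx.
have e12 : e1 * (4 * (F + G)) <= e by rewrite -ler_pdivlMr// /e1 ge_min lexx orbT.
clearbody e1.
have [d1 d10 h1] := ha e1 e10; have [d2 d20 h2] := hb e1 e10.
pose q := 2 * (normc a + 1) * (normc b + 1).
have q0 : 0 < q by rewrite /q !mulr_gt0//; clear -na nb; lra.
exists (Num.min (Num.min d1 d2) (e / q)); first by rewrite !lt_min d10 d20 divr_gt0.
move=> w w1; rewrite !lt_min => /andP[/andP[wd1 wd2] wd3].
have H1 := h1 w w1 wd1; have H2 := h2 w w1 wd2.
set x := w - z in H1 H2 wd3 *; set r1 := f w - f z - a * x in H1; set r2 := g w - g z - b * x in H2.
have x0 := normc_ge0 x.
have -> : f w * g w - f z * g z - (a * g z + f z * b) * x =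
   r1 * (g z + b * x + r2) + (a * x) * (b * x + r2) + f z * r2.
  by rewrite /r1 /r2; ring.
have xq : normc x * q < e by rewrite -ltr_pdivlMr.
have nr2 : normc (b * x + r2) <= (normc b + 1) * normc x.
  rewrite (le_trans (normcD _ _))// normcM mulrDl mul1r lerD2l.
  by apply: le_trans H2 _; rewrite -[leRHS]mul1r; exact: ler_wpM2r.
have x2 : normc x <= 2.
  by rewrite /x (le_trans (normcB _ _))//; clear -w1 z1; lra.
have T1 : normc (r1 * (g z + b * x + r2)) <= e1 * normc x * (2 * G).
  rewrite normcM; apply: ler_pM => //; try exact: normc_ge0.
  rewrite -addrA (le_trans (normcD _ _))//.
  apply: le_trans (lerD (lexx _) nr2) _; rewrite /G.
  have bx : (normc b + 1) * normc x <= (normc b + 1) * 2.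
    by apply: ler_wpM2l => //; clear -nb; lra.
  by clear -bx ng nb; lra.
have T2 : normc ((a * x) * (b * x + r2)) <= e / 2 * normc x.
  rewrite !normcM; apply: (@le_trans _ _ (normc a * normc x * ((normc b + 1) * normc x))).
    by apply: ler_wpM2l => //; exact: mulr_ge0.
  have -> : normc a * normc x * ((normc b + 1) * normc x) =
     (normc a * (normc b + 1) * normc x) * normc x by ring.
  apply: ler_wpM2r => //.
  have : normc a * (normc b + 1) <= q / 2.
    have t0 : 0 <= normc b + 1 by clear -nb; lra.
    by rewrite /q; move: (normc b + 1) t0 => t t0; clear -t0; lra.
  by move=> /(ler_wpM2r x0); move: xq; clear; lra.
have T3 : normc (f z * r2) <= F * (e1 * normc x).
  rewrite normcM; apply: ler_pM => //; try exact: normc_ge0.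
  by rewrite /F; clear; lra.
rewrite (le_trans (normcD _ _))//.
have := le_trans (normcD _ _) (lerD T1 T2) => T12.
apply: le_trans (lerD T12 T3) _.
have Fx : 0 <= F * (e1 * normc x) by rewrite !mulr_ge0// ltW.
have := ler_wpM2r x0 e12; move: Fx; clear; move: (normc x) => t; clearbody F G; lra.
Qed.

Lemma disc_holo_affine (a b : C) : disc_holo (fun z => a + b * z).
Proof.
move=> z z1; exists b => e e0; exists 1 => // w _ _.
have -> : a + b * w - (a + b * z) - b * (w - z) = 0 by ring.
by rewrite normc0 mulr_ge0 ?normc_ge0// ltW.
Qed.

Lemma disc_holo_cst (a : C) : disc_holo (fun=> a).
Proof.
have := disc_holo_affine a 0; rewrite (_ : (fun z => _) = fun=> a)//.
by apply/funext => z; rewrite mul0r addr0.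
Qed.

(** For [|b| < 1] the values of [1 - b * z] have positive real part on the disc, hence so have all
    their iterated roots. *)
Lemma disc_holo_crt j (b : C) : normc b < 1 -> disc_holo (fun z => crt j (1 - b * z)).
Proof.
move=> b1.
have pos k z : normc z <= 1 -> 0 < Re (crt k (1 - b * z)).
  move=> z1; elim: k => [|k ih] /=; last exact: Re_sqrtc_gt0.
  have : `|Re (b * z)| < 1.
    apply: le_lt_trans (normc_Re _) _; rewrite normcM.
    by apply: le_lt_trans b1; rewrite -[leRHS]mulr1 ler_wpM2l// normc_ge0.
  by rewrite ltr_norml => /andP[_]; case: (b * z) => p q /=; lra.
elim: j => [|j ih].
  have := disc_holo_affine 1 (- b); congr disc_holo; apply/funext => z.
  by rewrite mulNr.
by apply: disc_holo_sqrtc => // z; exact: pos.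
Qed.

End iterated_sqrt.

(** * A sub-mean value inequality for fractional powers of moduli of polynomials *)

Section subharmonic.
Context (R : realType).
Local Notation C := R[i].

Lemma continuous_rt (u : R -> R) j : (forall x, 0 <= u x) -> continuous u ->
  continuous (fun x => rt j (u x)).
Proof.
move=> u0 cu x; apply/cvgrPdistC_lt => e e0; have [d d0 hd] := rt_small j e0.
have /cvgrPdistC_lt/(_ _ d0) := cu x; apply: filterS => y h.
by apply: le_lt_trans (rt_subadd j (u0 _) (u0 _)) _; exact: hd.
Qed.

Lemma continuous_horner_ecirc (p : {poly C}) : continuous (fun x => p.[ecirc x]).
Proof.
elim/poly_ind: p => [|p c ih].
  by under eq_fun do rewrite horner0; exact: continuous_cst_.
under eq_fun do rewrite hornerMXaddC.
apply: continuous_cD; last exact: continuous_cst_.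
exact: (continuous_cM ih (@continuous_ecirc R)).
Qed.

Lemma continuous_rt_poly j (p : {poly C}) : continuous (fun x => rt j (normc p.[ecirc x])).
Proof.
apply: (continuous_rt (u := fun x => normc p.[ecirc x])) => [x|].
  exact: normc_ge0.
by apply: continuous_normcC; exact: continuous_horner_ecirc.
Qed.

(* Blaschke reflection of the roots inside the disc *)
Lemma blaschke_factor (a : C) : normc a != 1 -> exists (k : R) (b : C), [/\ 0 <= k, normc b < 1,
  forall l, normc l <= 1 -> normc (l - a) <= k * normc (1 - b * l) &
  forall l, normc l = 1 -> normc (l - a) = k * normc (1 - b * l)].
Proof.
rewrite neq_lt => /orP[a1|a1].
  exists 1, a^*; rewrite normc_conj; split => // l l1; rewrite mul1r.
    rewrite -(ler_pXn2r (n := 2))// ?nnegrE ?normc_ge0//.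
    have : 0 <= (1 - normc a ^+ 2) * (1 - normc l ^+ 2).
      by rewrite mulr_ge0// subr_ge0 expr_le1 ?normc_ge0// ltW.
    rewrite !sqr_normcE; case: (a) => p q; case: (l) => x y /=; lra.
  apply/eqP; rewrite -(@eqrXn2 _ 2)// ?normc_ge0//; apply/eqP.
  have : normc l ^+ 2 = 1 by rewrite l1 expr1n.
  rewrite !sqr_normcE; case: (a) => p q; case: (l) => x y /= h.
  have -> : (x - p) ^+ 2 + (y - q) ^+ 2 = (x ^+ 2 + y ^+ 2) - 2 * (x * p + y * q) + (p ^+ 2 + q ^+ 2).
    by ring.
  have -> : (1 - (p * x - - q * y)) ^+ 2 + (0 - (p * y + - q * x)) ^+ 2 =
     1 - 2 * (x * p + y * q) + (p ^+ 2 + q ^+ 2) * (x ^+ 2 + y ^+ 2) by ring.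
  by rewrite h mulr1.
have a0 : a != 0 by rewrite -normc_gt0; lra.
exists (normc a), a^-1; split.
- exact: normc_ge0.
- by rewrite normcV invf_lt1//; lra.
- by move=> l _; rewrite -normcM mulrBr mulr1 mulrA divff// mul1r normc_distC.
- by move=> l _; rewrite -normcM mulrBr mulr1 mulrA divff// mul1r normc_distC.
Qed.

(** Each linear factor is replaced by one without zeros in the disc, with the same modulus on the
    circle and at least as large a modulus inside; its root of order [2^j] is holomorphic.
    [normc_le_mean] is applied to the product [G] of these roots. *)
Lemma submean_roots j (c : C) (s : seq C) (zeta : C) : all (fun a => normc a != 1) s ->
  normc zeta < 1 ->
  rt j (normc (c *: \prod_(a <- s) ('X - a%:P)).[zeta]) <= 2 / (1 - normc zeta) *
    rint 0 1 (fun x => rt j (normc (c *: \prod_(a <- s) ('X - a%:P)).[ecirc x])).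
Proof.
move=> s1 z1.
have [k [G [k0 hG Gle Geq]]] : exists (k : R) (G : C -> C), [/\ 0 <= k, disc_holo G,
  forall l, normc l <= 1 -> rt j (normc (c *: \prod_(a <- s) ('X - a%:P)).[l]) <= k * normc (G l) &
  forall l, normc l = 1 -> rt j (normc (c *: \prod_(a <- s) ('X - a%:P)).[l]) = k * normc (G l)].
  have E l : rt j (normc (c *: \prod_(a <- s) ('X - a%:P)).[l]) =
      rt j (normc c) * rt j (normc (\prod_(a <- s) ('X - a%:P)).[l]).
    by rewrite hornerZ normcM rtM// normc_ge0.
  have c0 : 0 <= rt j (normc c) by rewrite rt_ge0 ?normc_ge0.
  suff [k [G [k0 hG Gle Geq]]] : exists (k : R) (G : C -> C), [/\ 0 <= k, disc_holo G,
    forall l, normc l <= 1 -> rt j (normc (\prod_(a <- s) ('X - a%:P)).[l]) <= k * normc (G l) &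
    forall l, normc l = 1 -> rt j (normc (\prod_(a <- s) ('X - a%:P)).[l]) = k * normc (G l)].
    exists (rt j (normc c) * k), G; split => //; first exact: mulr_ge0.
      by move=> l l1; rewrite E -mulrA ler_wpM2l// Gle.
    by move=> l l1; rewrite E -mulrA Geq.
  elim: s s1 {E} => [|a s ih] /=.
    move=> _; exists 1, (fun=> 1); rewrite big_nil; split => //.
    - exact: disc_holo_cst.
    - by move=> l _; rewrite hornerC normc1 mul1r; elim: (j) => //= i /ler_wsqrtr; rewrite sqrtr1.
    - by move=> l _; rewrite hornerC normc1 mul1r; elim: (j) => //= i ->; rewrite sqrtr1.
  move=> /andP[a1 /ih[k [G [k0 hG Gle Geq]]]].
  have [k' [b [k'0 b1 h1 h2]]] := blaschke_factor a1.
  have E l : rt j (normc (\prod_(a <- a :: s) ('X - a%:P)).[l]) =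
      rt j (normc (l - a)) * rt j (normc (\prod_(a <- s) ('X - a%:P)).[l]).
    by rewrite big_cons hornerM hornerXsubC normcM rtM// normc_ge0.
  exists (rt j k' * k), (fun z => crt j (1 - b * z) * G z); split.
  - by rewrite mulr_ge0// rt_ge0.
  - by apply: disc_holoM => //; exact: disc_holo_crt.
  - move=> l l1; rewrite E normcM mulrACA; apply: ler_pM; rewrite ?rt_ge0 ?normc_ge0 ?Gle//.
    by rewrite normc_crt -rtM ?normc_ge0//; apply: le_rt; exact: h1.
  - move=> l l1; rewrite E normcM mulrACA Geq//; congr (_ * _).
    by rewrite normc_crt -rtM ?normc_ge0// h2.
apply: le_trans (Gle _ (ltW z1)) _.
apply: le_trans (ler_wpM2l k0 (normc_le_mean hG z1)) _.
rewrite mulrCA; apply: ler_wpM2l.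
  by rewrite divr_ge0// subr_ge0 ltW.
rewrite le_eqVlt; apply/orP; left; apply/eqP.
have cG : continuous (fun x => normc ((G \o @clamp R) (ecirc x))).
  apply: continuous_normcC; apply: (continuous_compC (@continuous_ecirc R)).
  exact: disc_holo_clamp.
rewrite (@eq_rint _ _ _ (fun x => normc (G (ecirc x))) (fun x => normc ((G \o @clamp R) (ecirc x)))).
  rewrite -rintZ//; apply: eq_rint => x _ /=; rewrite clamp_id ?normc_ecirc//.
  by rewrite Geq ?normc_ecirc.
by move=> x _ /=; rewrite clamp_id ?normc_ecirc.
Qed.

(** A Lipschitz bound along radii, from [1 - s^k <= k * (1 - s)]. *)
Lemma bernoulli_scale (p : {poly C}) : exists2 L : R, 0 < L & forall (s : R) (z : C), 0 <= s <= 1 ->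
  normc z <= 1 -> normc (p.[s%:C * z] - p.[z]) <= L * (1 - s).
Proof.
exists (\sum_(k < size p) normc p`_k * k%:R + 1).
  by rewrite ltr_wpDl// sumr_ge0// => k _; rewrite mulr_ge0 ?normc_ge0.
move=> s z /andP[s0 s1] z1; rewrite !horner_coef -sumrB (le_trans (normc_sum _ _ _))//.
apply: (@le_trans _ _ ((\sum_(k < size p) normc p`_k * k%:R) * (1 - s))); last first.
  by apply: ler_wpM2r; [lra|rewrite lerDl].
rewrite mulr_suml; apply: ler_sum => k _.
have -> : p`_k * (s%:C * z) ^+ k - p`_k * z ^+ k = p`_k * (((s ^+ k - 1)%:C) * z ^+ k).
  by rewrite exprMn rmorphB rmorphXn rmorph1; ring.
rewrite normcM -mulrA; apply: ler_wpM2l; first exact: normc_ge0.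
rewrite normcM normc_real normcX distrC ger0_norm; last by rewrite subr_ge0 exprn_ile1.
apply: (@le_trans _ _ (1 - s ^+ k)).
  by rewrite -[leRHS]mulr1 ler_wpM2l ?subr_ge0 ?exprn_ile1 ?normc_ge0.
elim: (k : nat) => [|m ih]; first by rewrite expr0 subrr mul0r.
rewrite exprS -natr1 mulrDl mul1r.
have -> : 1 - s * s ^+ m = (1 - s) + s * (1 - s ^+ m) by ring.
rewrite addrC lerD2r; apply: le_trans ih; rewrite -[leRHS]mul1r ler_wpM2r//.
by rewrite subr_ge0 exprn_ile1.
Qed.

(** Zeros on the circle are moved off it by replacing [p] with [p (s z)] for [s < 1] close to 1, at
    a cost controlled by [bernoulli_scale] and the modulus of continuity of [rt j]. *)
Lemma submean j (p : {poly C}) (zeta : C) : normc zeta < 1 ->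
  rt j (normc p.[zeta]) <= 2 / (1 - normc zeta) * rint 0 1 (fun x => rt j (normc p.[ecirc x])).
Proof.
move=> z1; set K := 2 / _.
have K0 : 0 < K by rewrite divr_gt0// subr_gt0.
have [rs pE] := closed_field_poly_normal p.
have [L L0 hL] := bernoulli_scale p.
apply/ler_addgt0Pl => e e0.
(* The error enters once at zeta and once inside the mean, where it is multiplied by [K]. *)
have e10 : 0 < e / (K + 1) by rewrite divr_gt0//; lra.
have [d d0 hd] := rt_small j e10.
(* The largest modulus of a zero in the open disc, or 0. For [m < s < 1] the zeros [a / s] of the
   scaled polynomial avoid the circle: those with [|a| >= 1] move outside, the others stay
   inside. *)
pose m := \big[Num.max/0]_(a <- rs | normc a < 1) normc a.
have m1 : m < 1 by apply: bigmax_lt.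
have [s [s0 s1 ms sd]] : exists s : R, [/\ 0 < s, s < 1, m < s & L * (1 - s) < d].
  pose t := Num.max m (1 - d / (2 * L)).
  have t1 : t < 1 by rewrite gt_max m1 /= ltrBlDr ltrDl divr_gt0// mulr_gt0.
  have m0 : 0 <= m by apply: bigmax_ge_id.
  have mt : m <= t by rewrite le_max lexx.
  have dt : 1 - d / (2 * L) <= t by rewrite le_max lexx orbT.
  exists ((t + 1) / 2); split; try (clear -t1 m0 mt; lra).
  have : (1 - (t + 1) / 2) <= d / (2 * L) / 2 by lra.
  have -> : d / (2 * L) / 2 = d / 4 / L by field; rewrite gt_eqF.
  by rewrite ler_pdivlMr// mulrC; lra.
have sn0 : s%:C != 0 :> C by rewrite -normc_gt0 normc_real gtr0_norm.
pose q := (lead_coef p * s%:C ^+ size rs) *: \prod_(a <- [seq a / s%:C | a <- rs]) ('X - a%:P).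
have qE l : q.[l] = p.[s%:C * l].
  rewrite /q {2}pE !hornerZ -mulrA; congr (_ * _); rewrite big_map.
  elim: (rs) => [|a r ih]; first by rewrite !big_nil !hornerC expr0 mulr1.
  rewrite !big_cons !hornerM !hornerXsubC /= exprS -ih; field.
  exact: sn0.
have close x : `|rt j (normc p.[s%:C * x]) - rt j (normc p.[x])| <= e / (K + 1) \/ 1 < normc x.
  have [x1|x1] := leP (normc x) 1; [left|by right].
  apply: le_trans (rt_subadd j (normc_ge0 _) (normc_ge0 _)) _.
  apply/ltW/hd; apply: le_lt_trans sd.
  apply: (@le_trans _ _ (normc (p.[s%:C * x] - p.[x]))).
    by rewrite ler_norml normcB_ge andbT lerNl opprB normc_distC normcB_ge.
  by apply: hL => //; rewrite !ltW.
have q1 : all (fun a => normc a != 1) [seq a / s%:C | a <- rs].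
  apply/allP => _ /mapP[a ars ->]; rewrite normcM normcV normc_real gtr0_norm//.
  have [a1|a1] := ltP (normc a) 1; last first.
    by rewrite gt_eqF// ltr_pdivlMr//; lra.
  rewrite lt_eqF// ltr_pdivrMr// mul1r; apply: le_lt_trans ms.
  exact: le_bigmax_seq.
have := submean_roots j (lead_coef p * s%:C ^+ size rs) q1 z1; rewrite -/q -/K qE.
under eq_fun do rewrite -/q.
move=> H.
have h1 : rint 0 1 (fun x => rt j (normc q.[ecirc x])) <=
    rint 0 1 (fun x => rt j (normc p.[ecirc x])) + e / (K + 1).
  have cst : rint 0 1 (fun=> e / (K + 1)) = e / (K + 1) :> R by rewrite rint_cst// subr0 mulr1.
  rewrite -[in leRHS]cst -rintD.
  - apply: le_rint.
    + exact: continuous_rt_poly.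
    + move=> x; apply: cvgD; [exact: continuous_rt_poly|exact: cvg_cst].
    + move=> x _; rewrite qE; have [|] := close (ecirc x); last by rewrite normc_ecirc ltxx.
      by rewrite ler_norml => /andP[_]; clear; lra.
  - exact: continuous_rt_poly.
  - exact: continuous_cst_.
have h2 : rt j (normc p.[zeta]) <= rt j (normc p.[s%:C * zeta]) + e / (K + 1).
  have [|] := close zeta; last by move=> h; clear -h z1; lra.
  by rewrite ler_norml => /andP[+ _]; clear; lra.
have h3 := le_trans H (ler_wpM2l (ltW K0) h1).
have eK : e = K * (e / (K + 1)) + e / (K + 1) by field; rewrite gt_eqF//; clear -K0; lra.
by rewrite {1}eK; move: h2 h3; rewrite mulrDr; clear; lra.
Qed.

End subharmonic.

(** * Iterated means over the distinguished boundary *)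

Section hartogs.
Context (R : realType) (n : nat).
Local Notation C := R[i].
Local Notation nrm := (@nrm R n).
Implicit Types (w : 'rV[C]_n) (V : 'rV[C]_n -> R) (k : 'I_n).
Variables (z0 : 'rV[C]_n) (r : R).
Hypothesis r0 : 0 < r.

Let inD w := nrm (w - z0) <= r.
Definition torus_point w k (x : R) := setc w k (z0 ord0 k + r%:C * ecirc x).
Definition tmean k V w := rint 0 1 (fun x => V (torus_point w k x)).
Definition unif_cont V := forall e : R, 0 < e -> exists2 d : R, 0 < d &
  forall w w', inD w -> inD w' -> nrm (w - w') < d -> `|V w - V w'| <= e.

Lemma normB_le (p q e : R) : `|p - q| <= e <-> p <= q + e /\ q <= p + e.
Proof. by rewrite ler_norml; split => [/andP[]|[h1 h2]]; [|apply/andP; split]; lra. Qed.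

Lemma torus_point_in w k x : inD w -> inD (torus_point w k x).
Proof.
move=> wD; apply/(nrm_le _ (ltW r0)) => i; rewrite !mxE -/(setc _ _ _ _ _).
have := setcE w k (z0 ord0 k + r%:C * ecirc x) i; rewrite !mxE => ->.
case: eqP => [->|_].
  by rewrite addrAC subrr add0r normcM normc_ecirc mulr1 normc_real gtr0_norm.
by have := iffLR (nrm_le _ (ltW r0)) wD i; rewrite !mxE.
Qed.

Lemma torus_point_dist w w' k x : nrm (torus_point w k x - torus_point w' k x) <= nrm (w - w').
Proof.
apply/(nrm_le _ (nrm_ge0 _)) => i.
have := setcE w k (z0 ord0 k + r%:C * ecirc x) i.
have := setcE w' k (z0 ord0 k + r%:C * ecirc x) i; rewrite /torus_point !mxE => -> ->.
case: eqP => _; first by rewrite subrr normc0 nrm_ge0.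
by have := normc_le_nrm (w - w') i; rewrite !mxE.
Qed.

Lemma torus_point_lip w k x y :
  nrm (torus_point w k x - torus_point w k y) <= r * (4 * pi * `|x - y|).
Proof.
have b0 : 0 <= r * (4 * pi * `|x - y|).
  by rewrite mulr_ge0 ?(ltW r0)// !mulr_ge0// pi_ge0.
apply/(nrm_le _ b0) => i.
have := setcE w k (z0 ord0 k + r%:C * ecirc x) i.
have := setcE w k (z0 ord0 k + r%:C * ecirc y) i; rewrite /torus_point !mxE => -> ->.
case: eqP => _; last by rewrite subrr normc0.
rewrite opprD addrACA subrr add0r -mulrBr normcM normc_real gtr0_norm//.
by apply: ler_wpM2l; [exact: ltW|exact: ecirc_lip].
Qed.

Lemma continuous_torus V w k : unif_cont V -> inD w ->
  continuous (fun x => V (torus_point w k x)).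
Proof.
move=> cV wD x; apply/cvgrPdistC_lt => e e0; have e20 : 0 < e / 2 by rewrite divr_gt0.
have [d d0 hd] := cV _ e20.
pose c := r * (4 * pi); have c0 : 0 < c by rewrite !mulr_gt0// pi_gt0.
exists (d / c); first by rewrite /= divr_gt0.
move=> y /= xy; apply: (@le_lt_trans _ _ (e / 2)); last lra.
apply: hd; try exact: torus_point_in.
apply: le_lt_trans (torus_point_lip w k y x) _.
by rewrite mulrA -/c mulrC -ltr_pdivlMr// distrC.
Qed.

Lemma unif_cont_tmean k V : unif_cont V -> unif_cont (tmean k V).
Proof.
move=> cV e e0; have [d d0 hd] := cV e e0; exists d => // w w' wD w'D ww'.
have c1 := continuous_torus (k := k) cV wD; have c2 := continuous_torus (k := k) cV w'D.
have cst : rint 0 1 (fun=> e) = e by rewrite rint_cst// subr0 mulr1.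
have bd u u' : continuous u -> continuous u' -> (forall x : R, u x <= u' x + e) ->
    rint 0 1 u <= rint 0 1 u' + e.
  move=> cu cu' uu'; rewrite -[in leRHS]cst -rintD//; last exact: continuous_cst_.
  by apply: le_rint => // x; apply: cvgD; [exact: cu'|exact: cvg_cst].
have close x : `|V (torus_point w k x) - V (torus_point w' k x)| <= e.
  apply: hd; try exact: torus_point_in.
  exact: le_lt_trans (torus_point_dist _ _ _ _) _.
have h1 := bd _ _ c1 c2; have h2 := bd _ _ c2 c1.
have a1 : tmean k V w <= tmean k V w' + e := h1 (fun x => (iffLR (normB_le _ _ _) (close x)).1).
have a2 : tmean k V w' <= tmean k V w + e := h2 (fun x => (iffLR (normB_le _ _ _) (close x)).2).
exact/normB_le.
Qed.

Lemma tmean_ge0_le k V (B : R) : unif_cont V -> (forall w, inD w -> 0 <= V w <= B) ->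
  forall w, inD w -> 0 <= tmean k V w <= B.
Proof.
move=> cV hV w wD; have c1 := continuous_torus (k := k) cV wD.
have cst (e : R) : rint 0 1 (fun=> e) = e by rewrite rint_cst// subr0 mulr1.
have b x := hV _ (torus_point_in k x wD).
have c0 (e : R) : continuous (fun _ : R => e) by exact: continuous_cst_.
have b1 := @le_rint R 0 1 _ _ (c0 0) c1 (fun x _ => proj1 (andP (b x))).
have b2 := @le_rint R 0 1 _ _ c1 (c0 B) (fun x _ => proj2 (andP (b x))).
rewrite cst in b1; rewrite cst in b2.
by apply/andP; split; [exact: b1|exact: b2].
Qed.

Lemma rint_cvg0 (u : nat -> R -> R) (B : R) : (forall d, continuous (u d)) ->
  (forall d x, 0 <= u d x <= B) ->
  (forall x e, 0 < e -> exists N, forall d, (N <= d)%N -> u d x <= e) ->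
  forall e, 0 < e -> exists N, forall d, (N <= d)%N -> rint 0 1 (u d) <= e.
Proof.
move=> cu uB ucv e e0.
have iu d := rint_integrable 0 1 (cu d).
have mu_ d : measurable_fun (`[0, 1]%classic : set (measurableTypeR R)) (EFin \o u d).
  exact: measurable_int (iu d).
have ptw (x : R) : (fun d => (u d x)%:E) @ \oo --> 0%E.
  apply: cvg_EFin; first exact: nearW.
  apply/cvgrPdistC_lt => e1 e10; have e20 : 0 < e1 / 2 by rewrite divr_gt0.
  have [N hN] := ucv x _ e20; exists N => // d /= Nd.
  rewrite subr0 ger0_norm; last by have /andP[] := uB d x.
  by apply: le_lt_trans (hN d Nd) _; lra.
have := @dominated_convergence _ _ _ (@lebesgue_measure R) `[0, 1]%classic _
  (fun d x => (u d x)%:E) (fun=> 0%E) (fun=> B%:E) mu_ (measurable_cst _) _ _ _.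
have h1 : {ae (@lebesgue_measure R), forall x, `[0, 1]%classic x -> (fun d => (u d x)%:E) @ \oo --> 0%E}.
  by apply: aeW => x _; exact: ptw.
have h2 : (@lebesgue_measure R).-integrable `[0, 1] (fun=> B%:E).
  by apply: (rint_integrable 0 1 (u := fun=> B)); exact: continuous_cst_.
have h3 : {ae (@lebesgue_measure R), forall x d, `[0, 1]%classic x -> (`|(u d x)%:E| <= B%:E)%E}.
  apply: aeW => x d _; rewrite abse_EFin lee_fin ger0_norm; first by have /andP[] := uB d x.
  by have /andP[] := uB d x.
move=> /(_ (measurable_itv _) h1 h2 h3)[_ _].
rewrite integral0 => /fine_cvgP[_ /cvgrPdistC_lt/(_ _ e0)[N _ hN]].
exists N => d Nd; have := hN d Nd; rewrite /= subr0 => h.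
by apply/ltW; apply: le_lt_trans h; rewrite ler_norm.
Qed.

Fixpoint iter_tmean (s : seq 'I_n) V : 'rV[C]_n -> R :=
  if s is k :: s' then tmean k (iter_tmean s' V) else V.

Lemma unif_cont_iter s V : unif_cont V -> unif_cont (iter_tmean s V).
Proof. by move=> cV; elim: s => //= k s; exact: unif_cont_tmean. Qed.

Lemma iter_tmean_bd s V (B : R) : unif_cont V -> (forall w, inD w -> 0 <= V w <= B) ->
  forall w, inD w -> 0 <= iter_tmean s V w <= B.
Proof.
move=> cV hV; elim: s => //= k s; apply: tmean_ge0_le.
exact: unif_cont_iter.
Qed.

Lemma iter_tmean_cvg0 s (V : nat -> 'rV[C]_n -> R) (B : R) : (forall d, unif_cont (V d)) ->
  (forall d w, inD w -> 0 <= V d w <= B) ->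
  (forall w, inD w -> forall e, 0 < e -> exists N, forall d, (N <= d)%N -> V d w <= e) ->
  forall w, inD w -> forall e, 0 < e -> exists N, forall d, (N <= d)%N -> iter_tmean s (V d) w <= e.
Proof.
move=> cV hV hc; elim: s => //= k s ih w wD e e0.
apply: (@rint_cvg0 (fun d x => iter_tmean s (V d) (torus_point w k x)) B) => //.
- by move=> d; apply: continuous_torus => //; exact: unif_cont_iter.
- by move=> d x; apply: (iter_tmean_bd s (cV d) (hV d)); exact: torus_point_in.
- by move=> x e1 e10; apply: ih => //; exact: torus_point_in.
Qed.

(** Each mean overwrites its coordinate, so the mean over all coordinates does not depend on the
    point. This turns pointwise convergence into a uniform bound. *)
Lemma iter_tmean_indep s V w w' : (forall i, i \notin s -> w ord0 i = w' ord0 i) ->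
  iter_tmean s V w = iter_tmean s V w'.
Proof.
elim: s w w' => [|k s ih] w w' ww' /=; first by congr V; apply/rowP => i; exact: ww'.
apply: eq_rint => x _; apply: ih => i ins.
rewrite /torus_point !setcE; case: eqP => // /eqP ik; apply: ww'.
by rewrite inE negb_or ik.
Qed.

(** One factor 4 per variable, namely [2 / (1 - |zeta|)] at [|zeta| = 1/2]. The comparison
    [V <= 1 + V'] is made innermost; in the application the excess [V'] is what tends to 0. *)
Lemma iter_submean s V V' w : uniq s -> unif_cont V -> unif_cont V' ->
  (forall w, inD w -> V w <= 1 + V' w) ->
  (forall k w, inD w -> normc (w ord0 k - z0 ord0 k) <= r / 2 -> V w <= 4 * tmean k V w) ->
  inD w -> (forall i, i \in s -> normc (w ord0 i - z0 ord0 i) <= r / 2) ->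
  V w <= 4 ^+ size s * (1 + iter_tmean s V' w).
Proof.
move=> us cV cV' VV' sub; elim: s us w => [|k s ih] /=.
  by move=> _ w wD _; rewrite expr0 mul1r; exact: VV'.
move=> /andP[ks us] w wD wr; apply: le_trans (sub k w wD (wr k (mem_head _ _))) _.
rewrite exprS -mulrA ler_pM2l//.
have c1 := continuous_torus (k := k) cV wD.
have c2 := continuous_torus (k := k) (unif_cont_iter s cV') wD.
have c3 : continuous (fun x => 1 + iter_tmean s V' (torus_point w k x)).
  by move=> x; apply: cvgD; [exact: cvg_cst|exact: c2].
have c4 : continuous (fun x => 4 ^+ size s * (1 + iter_tmean s V' (torus_point w k x))).
  by move=> x; apply: cvgM; [exact: cvg_cst|exact: c3].
have -> : 4 ^+ size s * (1 + tmean k (iter_tmean s V') w) =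
    rint 0 1 (fun x => 4 ^+ size s * (1 + iter_tmean s V' (torus_point w k x))).
  by rewrite rintZ// rintD// ?rint_cst// ?subr0 ?mulr1//; exact: continuous_cst_.
apply: le_rint => // x _; apply: ih => //; first exact: torus_point_in.
move=> i ins; rewrite /torus_point setcE; case: eqP => [ik|_].
  by rewrite -ik ins in ks.
by apply: wr; rewrite inE ins orbT.
Qed.

End hartogs.

(** * Hartogs' lemma for sequences of polynomials *)

Section hartogs_lemma.
Context (R : realType) (n : nat).
Local Notation C := R[i].
Local Notation nrm := (@nrm R n).
Implicit Types (w : 'rV[C]_n) (k : 'I_n) (p : mpoly n C).

Lemma line_poly p w k (a b : C) : exists q : {poly C}, forall l, q.[l] = peval p (setc w k (a + b * l)).
Proof.
exists (\sum_(m <- msupp p) mcoeff m p *: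
  \prod_(i < n) (if i == k then a%:P + b *: 'X else (w ord0 i)%:P) ^+ m i) => l.
rewrite horner_sum pevalE; apply: eq_bigr => m _.
rewrite hornerZ horner_prod; congr (_ * _); apply: eq_bigr => i _.
rewrite horner_exp setcE; case: eqP => _; last by rewrite hornerC.
by rewrite hornerD hornerC hornerZ hornerX.
Qed.

(** Boundedness is carried along because the Lipschitz estimate of a product uses it. *)
Definition bounded_lip (F : 'rV[C]_n -> C) := forall rho : R, exists2 L : R, 0 < L &
  (forall w, nrm w <= rho -> normc (F w) <= L) /\
  (forall w w', nrm w <= rho -> nrm w' <= rho -> normc (F w - F w') <= L * nrm (w - w')).

Lemma bounded_lip_cst (c : C) : bounded_lip (fun=> c).
Proof.
move=> rho; exists (normc c + 1); first by rewrite ltr_wpDl// normc_ge0.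
split=> [w _|w w' _ _]; first by rewrite lerDl.
by rewrite subrr normc0 mulr_ge0 ?nrm_ge0// addr_ge0// normc_ge0.
Qed.

Lemma bounded_lipD F G : bounded_lip F -> bounded_lip G -> bounded_lip (fun w => F w + G w).
Proof.
move=> hF hG rho; have [L L0 [a1 a2]] := hF rho; have [M M0 [b1 b2]] := hG rho.
exists (L + M); first exact: addr_gt0.
split=> [w wr|w w' wr wr']; first by rewrite (le_trans (normcD _ _))// lerD ?a1 ?b1.
by rewrite opprD addrACA (le_trans (normcD _ _))// mulrDl lerD ?a2 ?b2.
Qed.

Lemma bounded_lipM F G : bounded_lip F -> bounded_lip G -> bounded_lip (fun w => F w * G w).
Proof.
move=> hF hG rho; have [L L0 [a1 a2]] := hF rho; have [M M0 [b1 b2]] := hG rho.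
exists (2 * L * M); first by rewrite !mulr_gt0.
split=> [w wr|w w' wr wr'].
  rewrite normcM; apply: (@le_trans _ _ (L * M)).
    by apply: ler_pM; rewrite ?normc_ge0 ?a1 ?b1.
  by rewrite ler_wpM2r ?(ltW M0)//; lra.
have -> : F w * G w - F w' * G w' = (F w - F w') * G w + F w' * (G w - G w') by ring.
rewrite (le_trans (normcD _ _))// !normcM.
have h1 : normc (F w - F w') * normc (G w) <= L * nrm (w - w') * M.
  by apply: ler_pM; rewrite ?normc_ge0 ?a2 ?b1.
have h2 : normc (F w') * normc (G w - G w') <= L * (M * nrm (w - w')).
  by apply: ler_pM; rewrite ?normc_ge0 ?a1 ?b2.
by move: h1 h2; lra.
Qed.

Lemma bounded_lip_peval p : bounded_lip (peval p).
Proof.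
rewrite (_ : peval p = fun w =>
  \sum_(m <- msupp p) mcoeff m p * \prod_(i < n) w ord0 i ^+ m i); last exact/funext/pevalE.
elim: (msupp p : seq _) => [|m s ih].
  by under eq_fun do rewrite big_nil; exact: bounded_lip_cst.
under eq_fun do rewrite big_cons; apply: bounded_lipD => //.
apply: bounded_lipM; first exact: bounded_lip_cst.
elim: (index_enum _ : seq 'I_n) => [|i t iht].
  by under eq_fun do rewrite big_nil; exact: bounded_lip_cst.
under eq_fun do rewrite big_cons; apply: bounded_lipM => //.
elim: (m i) => [|k ihk]; first by under eq_fun do rewrite expr0; exact: bounded_lip_cst.
under eq_fun do rewrite exprS; apply: bounded_lipM => //.
move=> rho; exists (`|rho| + 1); first by rewrite ltr_wpDl.
split=> [w wr|w w' wr wr'].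
  by apply: le_trans (normc_le_nrm w i) _; apply: le_trans wr _; have := ler_norm rho; lra.
have := normc_le_nrm (w - w') i; rewrite !mxE => h; apply: le_trans h _.
by rewrite -[leLHS]mul1r ler_wpM2r ?nrm_ge0// lerDr.
Qed.

(** [2^j] is comparable to [d / A]: the upper bound on [d] keeps the powers [2^-j] uniformly
    bounded, the lower one lets the constant be absorbed when [d >= A]. *)
Lemma dyadic_scale (A d : nat) : (0 < A)%N -> exists j,
  (d <= 2 * A * 2 ^ j)%N /\ ((A <= d)%N -> (A * 2 ^ j <= d)%N).
Proof.
move=> A0; have [dA|Ad] := ltnP d A.
  exists 0%N; split; last by move=> h; rewrite expn0 muln1.
  by rewrite expn0 muln1 (leq_trans (ltnW dA))// leq_pmull.
have t0 : (0 < d %/ A)%N by rewrite divn_gt0.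
have /andP[h1 h2] := @trunc_log_bounds 2 (d %/ A) isT t0.
exists (trunc_log 2 (d %/ A)); split=> [|_]; last by rewrite mulnC -leq_divRL.
have := ltn_ceil d A0 => h3; apply: (leq_trans (ltnW h3)).
by rewrite mulnC (mulnC 2%N) -mulnA leq_pmul2l// -expnS.
Qed.

Lemma exp_ge (b Q : R) : 1 < b -> exists A : nat, (0 < A)%N /\ Q <= b ^+ A.
Proof.
move=> b1; have b0 : 0 < b by lra.
have bi0 : 0 <= b^-1 by rewrite invr_ge0 ltW.
have bi1 : b^-1 < 1 by rewrite invf_lt1.
have [N hN] := geo_small Q bi0 bi1 (@ltr01 R).
exists N.+1; split => //; have := hN N.+1 (leqnSn N).
by rewrite exprVn ltr_pdivrMr ?exprn_gt0// mul1r => /ltW.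
Qed.

Lemma excess_lip (x y e : R) : `|x - y| <= e ->
  `|Num.max (x - 1) 0 - Num.max (y - 1) 0| <= e.
Proof.
move=> /normB_le[h1 h2]; apply/normB_le.
by case: (leP (x - 1) 0) => ?; case: (leP (y - 1) 0) => ?; split; lra.
Qed.

(* Hartogs' lemma: the functions |P_d / a1^d|^(2^-j), with 2^j comparable to d, are uniformly
   bounded and satisfy a sub-mean value inequality over the distinguished boundary, where the
   excess over 1 tends to 0 by dominated convergence. *)
Lemma hartogs (P : nat -> mpoly n C) z0 (r M a1 a : R) : 0 < r -> 0 < a1 -> a1 < a ->
  (forall d w, nrm (w - z0) <= r -> normc (peval (P d) w) <= M ^+ d) ->
  (forall w, nrm (w - z0) <= r -> exists N, forall d, (N <= d)%N ->
     normc (peval (P d) w) <= a1 ^+ d) ->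
  exists b : R, [/\ 0 < b, b < a & exists N, forall d w, (N <= d)%N -> nrm (w - z0) <= r / 2 ->
     normc (peval (P d) w) <= b ^+ d].
Proof.
move=> r0 a10 a1a hM ha1.
wlog Ma : M hM / a1 <= M.
  move=> H; apply: (H (Num.max `|M| a1)); last by rewrite le_max lexx orbT.
  move=> d w wr; apply: le_trans (hM d w wr) _; apply: le_trans (ler_norm _) _.
  by rewrite normrX lerXn2r ?nnegrE// le_max ?lexx ?normr_ge0.
pose b := (a1 + a) / 2; have ba : b < a by rewrite /b; lra.
have a1b : a1 < b by rewrite /b; lra.
have b0 : 0 < b by lra.
have q1 : 1 < b / a1 by rewrite ltr_pdivlMr// mul1r.
(* [4^n] comes from [iter_submean], and the 2 is 1 plus a mean of the excess that is at most 1; both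
   are absorbed by [(b / a1)^A]. *)
have [A [A0 hA]] := exp_ge (4 ^+ n * 2) q1.
have [j hj] := choice (fun d => dyadic_scale d A0).
pose v d w := rt (j d) (normc (peval (P d) w) / a1 ^+ d).
pose v' d w := Num.max (v d w - 1) 0.
have arg0 d w : 0 <= normc (peval (P d) w) / a1 ^+ d.
  by rewrite divr_ge0 ?normc_ge0// exprn_ge0// ltW.
have v0 d w : 0 <= v d w by exact: rt_ge0.
have ucv d : unif_cont z0 r (v d).
  move=> e e0; have [s s0 hs] := rt_small (j d) e0.
  have [L L0 [_ hL]] := bounded_lip_peval (P d) (nrm z0 + r).
  have ad0 : 0 < a1 ^+ d by rewrite exprn_gt0.
  exists (s * a1 ^+ d / L); first by rewrite divr_gt0// mulr_gt0.
  have bd w : nrm (w - z0) <= r -> nrm w <= nrm z0 + r.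
    by move=> wr; rewrite -[w](subrK z0) (le_trans (nrmD _ _))// addrC lerD2l.
  move=> w w' /bd wD /bd w'D ww'; apply: le_trans (rt_subadd _ (arg0 _ _) (arg0 _ _)) _.
  apply/ltW/hs; rewrite -mulrBl normrM [X in _ * X]ger0_norm ?invr_ge0 ?(ltW ad0)//.
  rewrite ltr_pdivrMr//; apply: (@le_lt_trans _ _ (normc (peval (P d) w - peval (P d) w'))).
    by rewrite ler_norml normcB_ge andbT lerNl opprB normc_distC normcB_ge.
  by apply: le_lt_trans (hL w w' wD w'D) _; rewrite mulrC -ltr_pdivlMr.
have vle d w : v d w - 1 <= v' d w by rewrite /v' le_max lexx.
have ucv' d : unif_cont z0 r (v' d).
  move=> e e0; have [s s0 hs] := ucv d e e0; exists s => // w w' wD w'D ww'.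
  exact: excess_lip (hs w w' wD w'D ww').
(* Since [d <= 2 * A * 2^j], the bound [(M / a1)^d] becomes this one after a root of order [2^j]. *)
pose B := (M / a1) ^+ (2 * A).
have Ma1 : 1 <= M / a1 by rewrite ler_pdivlMr// mul1r.
have vB d w : nrm (w - z0) <= r -> v d w <= B.
  move=> wr; rewrite -(@rtKX _ (j d) B); last by rewrite exprn_ge0//; lra.
  apply: le_rt; rewrite /B -exprM.
  apply: (@le_trans _ _ ((M / a1) ^+ d)).
    by rewrite expr_div_n ler_pM2r ?invr_gt0 ?exprn_gt0//; exact: hM.
  by apply: ler_weXn2l => //; exact: (hj d).1.
have v'B d w : nrm (w - z0) <= r -> 0 <= v' d w <= B.
  move=> wr; rewrite /v' le_max lexx orbT /= ge_max; apply/andP; split.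
    by have := vB d w wr; lra.
  by rewrite exprn_ge0//; lra.
have v'0 w : nrm (w - z0) <= r -> forall e, 0 < e -> exists N, forall d, (N <= d)%N -> v' d w <= e.
  move=> wr e e0; have [N hN] := ha1 w wr; exists N => d Nd.
  rewrite /v' ge_max (ltW e0) andbT; apply: (@le_trans _ _ 0); last exact: ltW.
  rewrite subr_le0 -[leRHS](@rtKX _ (j d) 1)// expr1n; apply: le_rt.
  by rewrite ler_pdivrMr ?exprn_gt0// mul1r hN.
have vv' d w : v d w <= 1 + v' d w.
  by have := vle d w; lra.
have sub d k w : nrm (w - z0) <= r -> normc (w ord0 k - z0 ord0 k) <= r / 2 ->
    v d w <= 4 * tmean z0 r k (v d) w.
  move=> wr wk.
  have [q hq] := line_poly (P d) w k (z0 ord0 k) r%:C.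
  have rn0 : r%:C != 0 :> C by rewrite -normc_gt0 normc_real gtr0_norm.
  pose zeta := (w ord0 k - z0 ord0 k) / r%:C.
  have z1 : normc zeta <= 1 / 2.
    by rewrite normcM normcV normc_real gtr0_norm// ler_pdivrMr//; lra.
  have zw : setc w k (z0 ord0 k + r%:C * zeta) = w.
    apply/rowP => i; rewrite setcE; case: eqP => // ->.
    by rewrite /zeta mulrC divfK// addrC subrK.
  pose q' := (a1 ^- d)%:C *: q.
  have ad0 : 0 < a1 ^+ d by rewrite exprn_gt0.
  have qE l : normc q'.[l] = normc (peval (P d) (setc w k (z0 ord0 k + r%:C * l))) / a1 ^+ d.
    by rewrite hornerZ normcM hq normc_real gtr0_norm ?invr_gt0// mulrC.
  have := @submean R (j d) q' zeta; rewrite qE zw => /(_ ltac:(clear -z1; lra)) h.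
  apply: le_trans h _; apply: (@le_trans _ _ (2 / (1 - normc zeta) * tmean z0 r k (v d) w)).
    rewrite le_eqVlt; apply/orP; left; apply/eqP; congr (_ * _).
    by apply: eq_rint => x _; rewrite qE.
  have t0 : 0 <= tmean z0 r k (v d) w.
    have vB' w' : nrm (w' - z0) <= r -> 0 <= v d w' <= B by move=> h'; rewrite v0 vB.
    by have /andP[] := tmean_ge0_le r0 k (ucv d) vB' wr.
  apply: ler_wpM2r => //; rewrite ler_pdivrMr; last by clear -z1; lra.
  by clear -z1; lra.
have z0r : nrm (z0 - z0) <= r by rewrite subrr nrm0 ltW.
have [N hN] := iter_tmean_cvg0 r0 (enum 'I_n) ucv' v'B v'0 z0r (@ltr01 R).
exists b; split => //; exists (maxn N A) => d w; rewrite geq_max => /andP[Nd Ad] wr2.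
have wr : nrm (w - z0) <= r by clear -wr2 r0; lra.
have us : uniq (enum 'I_n) by exact: enum_uniq.
have := iter_submean r0 us (ucv d) (ucv' d) (fun w _ => vv' d w) (fun k w => sub d k w) wr.
have wk i : i \in enum 'I_n -> normc (w ord0 i - z0 ord0 i) <= r / 2.
  move=> _; have r20 : 0 <= r / 2 by lra.
  by have := iffLR (nrm_le _ r20) wr2 i; rewrite !mxE.
move=> /(_ wk); rewrite (@iter_tmean_indep _ _ z0 r (enum 'I_n) (v' d) w z0); last first.
  by move=> i; rewrite mem_enum.
have -> : size (enum 'I_n) = n by exact: size_enum_ord.
move=> h; have {}h : v d w <= (b / a1) ^+ A.
  apply: le_trans h _; apply: le_trans hA; rewrite ler_pM2l ?exprn_gt0//.
  by have := hN d Nd; clear; lra.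
have ad0 : 0 < a1 ^+ d by rewrite exprn_gt0.
have : normc (peval (P d) w) / a1 ^+ d <= (b / a1) ^+ d.
  rewrite -(rtX (j d) (arg0 d w)); apply: (@le_trans _ _ (((b / a1) ^+ A) ^+ (2 ^ j d))).
    by rewrite lerXn2r ?nnegrE ?v0// exprn_ge0//; clear -q1; lra.
  rewrite -exprM; apply: ler_weXn2l; first exact: ltW.
  exact: (hj d).2.
by rewrite expr_div_n ler_pM2r ?invr_gt0.
Qed.

End hartogs_lemma.

(** * Boundedness of extensions *)

Section uniform_boundedness.
Context (R : realType) (n : nat).
Local Notation C := R[i].
Local Notation fn := ('rV[C]_n -> C).
Variables (D : set 'rV[C]_n) (oD : open D).
(** [Pr f F] is to be read as: [F] extends [f]. As a relation it is linear without any choice of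
    extensions; the seminorms [q i] are evaluated on [F], while the norm [nu] is that of [f]. *)
Variables (Pr : fn -> fn -> Prop) (I : Type) (q : I -> fn -> R).
Let nu (f : fn) : R := Num.sqrt (L2norm2 D f).
Hypothesis Pr_bergman : forall f F, Pr f F -> bergman D f.
Hypothesis Pr0 : Pr (fun=> 0) (fun=> 0).
Hypothesis PrD : forall f F g G, Pr f F -> Pr g G -> Pr (fun z => f z + g z) (fun z => F z + G z).
Hypothesis PrZ : forall c f F, Pr f F -> Pr (fun z => c * f z) (fun z => c * F z).
Hypothesis Pr_ex : forall f, bergman D f -> exists F, Pr f F.
Hypothesis qD : forall i f F g G, Pr f F -> Pr g G -> q i (fun z => F z + G z) <= q i F + q i G.
Hypothesis qZ : forall i c f F, Pr f F -> q i (fun z => c * F z) = normc c * q i F.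
Hypothesis q_cont : forall i, exists A, forall f F, Pr f F -> q i F <= A * nu f.
Hypothesis q_bounded : forall f F, Pr f F -> exists M, forall i, q i F <= M.

Let nuZ c f F : Pr f F -> nu (fun z => c * f z) = normc c * nu f.
Proof.
move=> /Pr_bergman/(bergman_L2 oD) fL.
by rewrite /nu (L2norm2Z oD c fL) sqrtrM ?sqr_ge0// sqrtr_sqr ger0_norm ?normc_ge0.
Qed.

(** [N] is the norm of the seminorm [q i] relative to [nu], and [i] is such that it is at least
    [4^m]. A function attaining [N] up to the factor 9/10 is scaled to size [3^-m]: the sizes are
    summable, while the values [3^-m * N] grow at least like [(4/3)^m]. *)
Let near_norming (m : nat) :
  (forall K : R, 0 <= K -> exists i f F, Pr f F /\ K * nu f < q i F) ->
  exists i f F (N : R), [/\ Pr f F, nu f <= 3 ^- m, 4 ^+ m <= N,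
    9 / 10 * 3 ^- m * N <= q i F & forall g G, Pr g G -> q i G <= N * nu g].
Proof.
have m4 : 0 <= (4 : R) ^+ m by exact: exprn_ge0.
move=> H; have [i [f0 [F0 [P0 q0]]]] := H _ m4.
have [A hA] := q_cont i.
pose E := [set x | exists f F, [/\ Pr f F, nu f <= 1 & x = q i F]].
have hE : has_sup E.
  split; first by exists (q i (fun=> 0)), (fun=> 0), (fun=> 0); split => //;
    rewrite /nu (L2norm2_eq0 (L2_0 oD))// sqrtr0.
  exists `|A| => _ [f [F [PfF f1 ->]]]; apply: le_trans (hA _ _ PfF) _.
  apply: le_trans (ler_norm _) _; rewrite normrM [`|nu f|]ger0_norm ?sqrtr_ge0//.
  by rewrite ler_piMr.
pose N := sup E.
have hN g G : Pr g G -> q i G <= N * nu g.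
  move=> PgG; have [g0|gn0] := eqVneq (nu g) 0.
    by have := hA _ _ PgG; rewrite g0 !mulr0.
  have gp : 0 < nu g by rewrite lt_neqAle eq_sym gn0 sqrtr_ge0.
  rewrite -ler_pdivrMr//; apply: (sup_upper_bound hE).
  exists (fun z => (nu g)^-1%:C * g z), (fun z => (nu g)^-1%:C * G z); split.
  - exact: PrZ.
  - by rewrite (nuZ _ PgG) normc_real gtr0_norm ?invr_gt0// mulVf.
  - by rewrite (qZ _ _ PgG) normc_real gtr0_norm ?invr_gt0// mulrC.
have N4 : 4 ^+ m < N.
  have := lt_le_trans q0 (hN _ _ P0); rewrite ltNge => h; rewrite ltNge; apply/negP => h2.
  by move/negP: h; apply; apply: ler_wpM2r h2; exact: sqrtr_ge0.
have N0 : 0 < N by apply: le_lt_trans N4; exact: exprn_ge0.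
have [_ [f [F [PfF f1 ->]]] hf] := sup_adherent (divr_gt0 N0 (ltr0Sn _ 9)) hE.
have t0 : 0 < (3 ^- m : R) by rewrite invr_gt0 exprn_gt0.
exists i, (fun z => (3 ^- m)%:C * f z), (fun z => (3 ^- m)%:C * F z), N; split => //.
- exact: PrZ.
- by rewrite (nuZ _ PfF) normc_real gtr0_norm// -[leRHS]mulr1 ler_wpM2l// ltW.
- exact: ltW.
rewrite (qZ _ _ PfF) normc_real gtr0_norm// mulrAC mulrC; apply: ler_wpM2l; first exact: ltW.
by move: hf; rewrite -/N; lra.
Qed.

Lemma geometric_third N k : \sum_(i < k) (3 ^- (N + i) : R) <= 3 / 2 * 3 ^- N.
Proof.
suff : \sum_(i < k) (3 ^- (N + i) : R) <= 3 / 2 * (3 ^- N - 3 ^- (N + k)).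
  move=> /le_trans; apply; rewrite ler_pM2l// gerBl.
  by rewrite invr_ge0 exprn_ge0.
elim: k => [|k ih]; first by rewrite big_ord0 addn0 subrr mulr0.
rewrite big_ord_recr/= addnS exprS invfM; move: ih.
by move: (\sum_(i < k) _) (3 ^- N) (3 ^- (N + k)) => x y z; lra.
Qed.

(* Sokal's gliding hump: one of [X + F], [X - F] is at least as large as F for a seminorm, so signs
   can be chosen to make the partial sums large for the m-th seminorm, almost normed by F m. *)
Lemma uniform_boundedness : exists2 K, 0 <= K & forall i f F, Pr f F -> q i F <= K * nu f.
Proof.
apply: contrapT => nK.
have H K : 0 <= K -> exists i f F, Pr f F /\ K * nu f < q i F.
  move=> K0; apply: contrapT => nE; apply: nK; exists K => // i f F PfF.
  by rewrite leNgt; apply/negP => h; apply: nE; exists i, f, F.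
have [i hi] := choice (fun m => near_norming m H).
have [f hf] := choice hi; have [F hF] := choice hf; have [N hN] := choice hF.
have PF m : Pr (f m) (F m) by case: (hN m).
pose sg m (X : fn) : C := if q (i m) (F m) <= q (i m) (fun z => X z + F m z) then 1 else -1.
pose fix X (m : nat) : fn * fn := if m is m'.+1 then
  (fun z => (X m').1 z + sg m' (X m').2 * f m' z, fun z => (X m').2 z + sg m' (X m').2 * F m' z)
  else (fun=> 0, fun=> 0).
pose g m z := sg m (X m).2 * f m z.
have PX m : Pr (X m).1 (X m).2 by elim: m => //= m ih; exact: PrD ih (PrZ _ (PF m)).
have Xg m : (X m).1 = fun z => \sum_(l < m) g l z.
  elim: m => [|m ih]; apply/funext => z; first by rewrite big_ord0.
  by rewrite big_ord_recr /= ih.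
have qX m : q (i m) (F m) <= q (i m) (X m.+1).2.
  rewrite /= /sg; case: ifPn => h.
    rewrite (_ : (fun z => _) = fun z => (X m).2 z + F m z)//.
    by apply/funext => z; rewrite mul1r.
  rewrite -ltNge in h.
  have e : (fun z => 2 * F m z) = fun z => ((X m).2 z + F m z) + (-1) * ((X m).2 z + (-1) * F m z).
    by apply/funext => z; ring.
  have p1 := PrD (PX m) (PF m); have p2 := PrD (PX m) (PrZ (-1) (PF m)).
  have := qD (i m) p1 (PrZ (-1) p2); rewrite -e (qZ _ _ (PF m)) (qZ _ _ p2) normcN normc1 mul1r.
  rewrite (_ : normc 2 = 2); last exact: (normc_nat R 2).
  by move: h; lra.
have nsg m Y : normc (sg m Y) = 1 by rewrite /sg; case: ifP; rewrite ?normcN normc1.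
have gB m : bergman D (g m) by apply: (Pr_bergman (PrZ (sg m (X m).2) (PF m))).
have b0 m : 0 <= (3 ^- m : R) by rewrite invr_ge0 exprn_ge0.
have gb m : L2norm2 D (g m) <= (3 ^- m) ^+ 2.
  have -> : L2norm2 D (g m) = nu (g m) ^+ 2 by rewrite sqr_sqrtr// L2norm2_ge0.
  rewrite lerXn2r ?nnegrE ?sqrtr_ge0// (nuZ _ (PF m)) nsg mul1r.
  by case: (hN m).
have t0 e : 0 < e -> exists N0, forall N, (N0 <= N)%N -> 3 / 2 * (3 ^- N : R) < e.
  move=> e0; have [||N0 h] := @geo_small R (3 / 2) (1 / 3) e _ _ e0; [lra|lra|].
  by exists N0 => M /h; rewrite expr_div_n expr1n mul1r.
have [x [bx _ xt]] := bergman_series oD gB b0 gb geometric_third t0.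
have [x' Px] := Pr_ex bx; have [M hM] := q_bounded Px.
(* For the [m]-th seminorm the partial sum is worth at least [9/10] of [3^-m * N m]; the tail has
   norm at most [3/2 * 3^-(m+1) = 1/2 * 3^-m] and is worth at most [1/2] of it. The difference is
   [2/5]. *)
have key m : 2 / 5 * (4 / 3) ^+ m <= M.
  have [_ _ N4 hq hn] := hN m.
  have p := PrD Px (PrZ (-1) (PX m.+1)).
  have h1 := hn _ _ p.
  have h2 : nu (fun z => x z + (-1) * (X m.+1).1 z) <= 1 / 2 * 3 ^- m.
    rewrite -(ler_pXn2r (n := 2))// ?nnegrE ?sqrtr_ge0 ?mulr_ge0//.
    rewrite sqr_sqrtr ?L2norm2_ge0//.
    have -> : (fun z => x z + (-1) * (X m.+1).1 z) = fun z => x z - \sum_(l < m.+1) g l z.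
      by apply/funext => z; rewrite Xg mulN1r.
    apply: le_trans (xt m.+1) _; rewrite [3 ^+ m.+1]exprS invfM.
    rewrite le_eqVlt; apply/orP; left; apply/eqP; congr (_ ^+ 2).
    by move: (3 ^- m : R) => y; field.
  have N0 : 0 <= N m by apply: le_trans N4; exact: exprn_ge0.
  have h3 := le_trans h1 (ler_wpM2l N0 h2).
  have h4 : q (i m) (X m.+1).2 <= q (i m) x' + q (i m) (fun z => x' z + (-1) * (X m.+1).2 z).
    have := qD (i m) Px (PrZ (-1) p); rewrite (qZ _ _ p) normcN normc1 mul1r.
    rewrite (_ : (fun z => _) = (X m.+1).2)//; apply/funext => z; ring.
  have h5 : 2 / 5 * (3 ^- m * N m) <= M.
    have := hM (i m); have := qX m; move: hq h3 h4.
    have -> : 9 / 10 * 3 ^- m * N m = 9 / 10 * (3 ^- m * N m) by rewrite mulrA.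
    have -> : N m * (1 / 2 * 3 ^- m) = 1 / 2 * (3 ^- m * N m) by ring.
    move: (3 ^- m * N m) (q (i m) (X m.+1).2) (q (i m) (F m)) (q _ _) (q _ _) => a b c d e.
    lra.
  apply: le_trans h5; rewrite ler_pM2l; last lra.
  by rewrite expr_div_n mulrC ler_wpM2l.
have [A [_ hA]] := @exp_ge R (4 / 3) (5 / 2 * M + 1) ltac:(lra).
by have := key A; move: hA; lra.
Qed.

End uniform_boundedness.

(** * Bounds for extensions *)

Section extension.
Context (R : realType) (n : nat).
Local Notation C := R[i].
Local Notation fn := ('rV[C]_n -> C).
Local Notation nrm := (@nrm R n).
Implicit Types (z w v : 'rV[C]_n) (f F : fn).

Lemma holo_bounded_disc (U : set 'rV[C]_n) F w (s : R) : holomorphic U F ->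
  (forall v, nrm v <= 1 -> U (w + s%:C *: v)) ->
  exists2 M, 0 <= M & forall v, nrm v <= 1 -> normc (F (w + s%:C *: v)) <= M.
Proof.
move=> hF hU.
have /compact_near_coveringP cov : compact [set v : 'rV[C]_n | forall i, normc (v ord0 i) <= 1].
  exact: (@rV_compact C n (fun=> [set c : C | normc c <= 1]) (fun=> @compact_disc R)).
have {cov} := @cov _ (pinfty_nbhs R) (fun M v => normc (F (w + s%:C *: v)) <= M) _ => cov.
have H : forall v, [set v : 'rV[C]_n | forall i, normc (v ord0 i) <= 1] v ->
    \forall v' \near v & M \near pinfty_nbhs R, normc (F (w + s%:C *: v')) <= M.
  move=> v /= /(nrm_le _ (ler01)) v1; have [d d0 hd] := holomorphic_cont hF (hU v v1) (@ltr01 R).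
  have s0 : 0 < `|s| + 1 by rewrite ltr_wpDl.
  exists ([set v' | nrm (v' - v) < d / (`|s| + 1)], [set M | normc (F (w + s%:C *: v)) + 1 <= M]).
    split => /=; first by apply: nbhs_polydisc; rewrite divr_gt0.
    by exists (normc (F (w + s%:C *: v)) + 1); split; rewrite ?num_real// => M /ltW.
  move=> [v' M] [/= vv' hM]; apply: le_trans hM.
  rewrite -lerBlDl; apply: le_trans (normcB_ge _ _) _; apply/ltW/hd.
  have -> : w + s%:C *: v' - (w + s%:C *: v) = s%:C *: (v' - v).
    by rewrite opprD addrACA subrr add0r -scalerBr.
  rewrite nrmZ normc_real; move: vv'; rewrite ltr_pdivlMr//.
  by have := nrm_ge0 (v' - v); have := normr_ge0 s; nra.
have [A [_ hA]] := cov _ H.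
exists (Num.max (A + 1) 0); first by rewrite le_max lexx orbT.
move=> v v1; have := hA (Num.max (A + 1) 0).
have AA : A < Num.max (A + 1) 0 by rewrite lt_max ltrDl ltr01.
by move=> /(_ AA v); apply; exact/(nrm_le _ ler01).
Qed.

Lemma continuous_tcoef (g : C -> C) k : disc_holo g ->
  continuous (fun x => (g \o @clamp R) (ecirc x) * ecj x ^+ k).
Proof.
move=> hg; apply: continuous_cM.
  exact: (continuous_compC (@continuous_ecirc R) (disc_holo_clamp hg)).
by apply: continuous_cX; exact: continuous_ecj.
Qed.

Lemma tcoefD (g h : C -> C) k : disc_holo g -> disc_holo h ->
  tcoef (fun l => g l + h l) k = tcoef g k + tcoef h k.
Proof.
move=> hg hh; rewrite /tcoef -cintD; try exact: continuous_tcoef.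
by apply: eq_cint => x _ /=; rewrite mulrDl.
Qed.

Lemma tcoefZ (c : C) (g : C -> C) k : disc_holo g -> tcoef (fun l => c * g l) k = c * tcoef g k.
Proof.
move=> hg; rewrite /tcoef -cintZ; last exact: continuous_tcoef.
by apply: eq_cint => x _ /=; rewrite mulrA.
Qed.

Variables (D D0 D1 : set 'rV[C]_n).
Hypotheses (oD : open D) (dD0 : domain D0) (dD1 : domain D1) (sub : D0 `<=` D1 `&` D).
Hypothesis ext : forall f, bergman D f ->
  exists2 F, holomorphic D1 F & forall z, D0 z -> F z = f z.

Definition ext_pair f F := [/\ bergman D f, holomorphic D1 F & forall z, D0 z -> F z = f z].
Local Notation nu := (fun f => Num.sqrt (L2norm2 D f)).

Lemma bergmanD f g : bergman D f -> bergman D g -> bergman D (fun z => f z + g z).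
Proof.
move=> bf bg; split.
  by move=> z Dz; apply: differentiableD; [exact: bf.1|exact: bg.1].
by have [] := L2D oD (bergman_L2 oD bf) (bergman_L2 oD bg).
Qed.

Lemma holomorphicZ (U : set 'rV[C]_n) c f : holomorphic U f -> holomorphic U (fun z => c * f z).
Proof.
move=> hf z Uz; apply/differentiableE.
by have [a ha] := iffLR (differentiableE _ _) (hf z Uz); exists (fun k => c * a k); exact: cdiff_withZ.
Qed.

Lemma bergmanZ c f : bergman D f -> bergman D (fun z => c * f z).
Proof.
move=> bf; split; first exact: holomorphicZ bf.1.
by have [] := L2Z oD c (bergman_L2 oD bf).
Qed.

Lemma ext_pairD f F g G : ext_pair f F -> ext_pair g G ->
  ext_pair (fun z => f z + g z) (fun z => F z + G z).
Proof.
move=> [bf hF fF] [bg hG gG]; split; first exact: bergmanD.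
  by move=> z Dz; apply: differentiableD; [exact: hF|exact: hG].
by move=> z Dz; rewrite fF// gG.
Qed.

Lemma ext_pairZ c f F : ext_pair f F -> ext_pair (fun z => c * f z) (fun z => c * F z).
Proof.
move=> [bf hF fF]; split; [exact: bergmanZ|exact: holomorphicZ|].
by move=> z Dz; rewrite fF.
Qed.

Lemma ext_pair0 : ext_pair (fun=> 0) (fun=> 0).
Proof.
split; last by [].
  by split; [move=> z _; exact: differentiable_cst|have [] := @L2_0 R n D oD].
by move=> z _; exact: differentiable_cst.
Qed.

Definition controlled z (r c : R) := forall f F, ext_pair f F ->
  forall w, nrm (w - z) < r -> normc (F w) <= c * nu f.

(* The Taylor coefficients of the extensions along the lines through w are continuous functionals,
   to which uniform boundedness applies. *)
Lemma controlled_spread w (r c rho : R) : 0 < r -> 0 <= c -> controlled w r c -> 0 < rho ->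
  (forall v, nrm v <= 1 -> D1 (w + (2 * rho)%:C *: v)) ->
  exists2 K, 0 <= K & forall f F, ext_pair f F -> forall w', nrm (w' - w) <= rho ->
    normc (F w') <= K * nu f.
Proof.
move=> r0 c0 hw rho0 hD1; pose s := 2 * rho; have s0 : 0 < s by rewrite /s; lra.
pose line F v := fun l : C => F (w + l *: (s%:C *: v)).
have lineE F v (l : C) : line F v l = F (w + s%:C *: (l *: v)).
  by rewrite /line !scalerA mulrC.
have nlv v (l : C) : nrm v <= 1 -> normc l <= 1 -> nrm (l *: v) <= 1.
  by move=> v1 l1; rewrite nrmZ mulr_ile1 ?normc_ge0 ?nrm_ge0.
have dh F v : holomorphic D1 F -> nrm v <= 1 -> disc_holo (line F v).
  move=> hF v1; apply: (holomorphic_line hF) => l l1.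
  by have := hD1 _ (nlv v l v1 l1); rewrite !scalerA mulrC.
(* Directions outside the closed unit polydisc get the value 0, so that the index ranges over a
   whole type. *)
pose q (i : nat * 'rV[C]_n) F : R :=
  if nrm i.2 <= 1 then normc (tcoef (line F i.2) i.1) else 0.
have qE k v F : nrm v <= 1 -> q (k, v) F = normc (tcoef (line F v) k).
  by move=> v1; rewrite /q (v1 : is_true (nrm (k, v).2 <= 1)).
have qE0 k v F : ~~ (nrm v <= 1) -> q (k, v) F = 0.
  by move=> v1; rewrite /q (negbTE (v1 : is_true (~~ (nrm (k, v).2 <= 1)))).
clearbody q.
have bdd F : holomorphic D1 F -> exists2 M, 0 <= M & forall v l, nrm v <= 1 -> normc l <= 1 ->
    normc (line F v l) <= M.
  move=> hF; have [M M0 hM] := holo_bounded_disc hF hD1; exists M => // v l v1 l1.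
  by rewrite lineE; apply: hM; exact: nlv.
have q_cont i : exists A, forall f F, ext_pair f F -> q i F <= A * nu f.
  case: i => k v; case: (boolP (nrm v <= 1)) => v1; last first.
    by exists 0 => f F _; rewrite qE0// mul0r.
  (* On the disc of radius [t] the line stays within [r] of [w], where [F] is controlled; Cauchy's
     estimate there bounds the coefficient by a multiple of [nu f]. *)
  pose t := Num.min 1 (r / (2 * s)).
  have t0 : 0 < t by rewrite lt_min ltr01 divr_gt0// mulr_gt0.
  have t1 : t <= 1 by rewrite ge_min lexx.
  have ts : t * s < r.
    apply: (@le_lt_trans _ _ (r / (2 * s) * s)).
      by apply: ler_wpM2r; [exact: ltW|rewrite ge_min lexx orbT].
    have -> : r / (2 * s) * s = r / 2 by field; rewrite gt_eqF.
    lra.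
  exists (2 * c / t ^+ k) => f F PfF; rewrite qE//; have [_ hF _] := PfF.
  have [M M0 hM] := bdd F hF; have dF := dh F v hF v1.
  have nt : normc (t%:C : C) <= 1 by rewrite normc_real gtr0_norm.
  have T1 := taylor_scale nt (mulr_ge0 (ler0n _ 4) M0) (disc_holo_taylor dF (fun l => hM v l v1)).
  have tv : nrm (t%:C *: v) <= 1 by exact: nlv.
  have dFt : disc_holo (fun l => line F v (t%:C * l)).
    have := dh F _ hF tv; congr disc_holo; apply/funext => l.
    by rewrite /line; congr F; congr (_ + _); rewrite !scalerA; congr (_ *: _); ring.
  have bFt l : normc l <= 1 -> normc (line F v (t%:C * l)) <= c * nu f.
    move=> l1; apply: (hw _ _ PfF); rewrite addrC addrA addNr add0r.
    rewrite !nrmZ normcM !normc_real !gtr0_norm//.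
    apply: le_lt_trans ts; rewrite -mulrA; apply: ler_wpM2l; first exact: ltW.
    rewrite mulrCA; apply: ler_piMr; first exact: ltW.
    by rewrite mulr_ile1 ?normc_ge0 ?nrm_ge0.
  have T2 := disc_holo_taylor dFt bFt.
  have := taylor_unique T1 T2 k => E.
  have := normc_tcoef k dFt bFt; rewrite -E normcM normcX normc_real gtr0_norm// => h.
  rewrite mulrAC ler_pdivlMr ?exprn_gt0// mulrC.
  by apply: le_trans h _; rewrite mulrA.
have qb f F : ext_pair f F -> exists M, forall i, q i F <= M.
  move=> [_ hF _]; have [M M0 hM] := bdd F hF; exists (2 * M) => -[k v].
  case: (boolP (nrm v <= 1)) => v1; last by rewrite qE0// mulr_ge0.
  rewrite qE//; exact: (normc_tcoef k (dh F v hF v1) (fun l => hM v l v1)).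
have qD i f F g G : ext_pair f F -> ext_pair g G -> q i (fun z => F z + G z) <= q i F + q i G.
  move=> [_ hF _] [_ hG _]; case: i => k v; case: (boolP (nrm v <= 1)) => v1; last by rewrite !qE0// addr0.
  rewrite !qE//; apply: le_trans (normcD _ _); rewrite le_eqVlt; apply/orP; left; apply/eqP.
  by congr normc; exact: (tcoefD k (dh F v hF v1) (dh G v hG v1)).
have qZ i cc f F : ext_pair f F -> q i (fun z => cc * F z) = normc cc * q i F.
  move=> [_ hF _]; case: i => k v; case: (boolP (nrm v <= 1)) => v1; last by rewrite !qE0// mulr0.
  rewrite !qE// -normcM; congr normc.
  exact: (tcoefZ cc k (dh F v hF v1)).
have Pex f : bergman D f -> exists F, ext_pair f F.
  by move=> bf; have [F hF fF] := ext bf; exists F.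
have [K K0 hK] := @uniform_boundedness R n D oD ext_pair _ q (fun f F PfF => let: And3 b _ _ := PfF in b)
   ext_pair0 ext_pairD ext_pairZ Pex qD qZ q_cont qb.
exists (2 * K); first by rewrite mulr_ge0.
move=> f F PfF w' ww'; have [_ hF _] := PfF; have [M M0 hM] := bdd F hF.
pose v := rho^-1%:C *: (w' - w).
have v1 : nrm v <= 1.
  by rewrite nrmZ normc_real gtr0_norm ?invr_gt0// mulrC ler_pdivrMr// mul1r.
(* As [s = 2 * rho], the point [w'] is reached at parameter 1/2, where terms with coefficients
   bounded by [K * nu f] sum to at most [2 * K * nu f]. *)
have half : line F v (2^-1)%:C = F w'.
  rewrite /line /v !scalerA -!rmorphM.
  have -> : 2^-1 * s / rho = 1 :> R by rewrite /s; field; rewrite gt_eqF.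
  by rewrite rmorph1 scale1r addrC subrK.
have h2 : normc ((2^-1)%:C : C) = 1 / 2 by rewrite normc_real gtr0_norm ?invr_gt0// div1r.
have nu0 : 0 <= nu f by exact: sqrtr_ge0.
rewrite -subr_le0; apply: (@le0_geo _ _ (4 * M) (1 / 2)); [lra|lra|move=> N].
have := disc_holo_taylor (dh F v hF v1) (fun l => hM v l v1) N (l := (2^-1)%:C).
rewrite half h2 => /(_ (lexx _)) T.
have S : normc (\sum_(k < N) (2^-1)%:C ^+ k * tcoef (line F v) k) <= 2 * K * nu f.
  apply: le_trans (normc_sum _ _ _) _.
  apply: (@le_trans _ _ (\sum_(k < N) (K * nu f) * (1 / 2) ^+ k)).
    apply: ler_sum => k _; rewrite normcM normcX h2 mulrC; apply: ler_wpM2r.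
      by apply: exprn_ge0; lra.
    by have := hK (k : nat, v) f F PfF; rewrite qE.
  rewrite -mulr_sumr -[leRHS]mulrA [leRHS]mulrC; apply: ler_wpM2l; first exact: mulr_ge0.
  have : \sum_(k < N) (1 / 2) ^+ k = 2 - 2 * (1 / 2) ^+ N :> R.
    elim: (N) => [|m ih]; first by rewrite big_ord0 expr0; lra.
    by rewrite big_ord_recr /= ih exprS; lra.
  by move=> ->; rewrite gerBl mulr_ge0// exprn_ge0//; lra.
have := normcB_ge (F w') (\sum_(k < N) (2^-1)%:C ^+ k * tcoef (line F v) k).
by move: S T; lra.
Qed.

(** The set [V] of controlled points is open, meets [D0] by [local_bound], and is closed in [D1]:
    close to a limit point lies some [w] in [V], from which [controlled_spread] reaches a polydisc
    containing the limit point. *)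
Lemma controlled_all z : D1 z -> exists r c, [/\ 0 < r, 0 <= c & controlled z r c].
Proof.
pose V := [set z | D1 z /\ exists r c, [/\ 0 < r, 0 <= c & controlled z r c]].
have [_ oD1 cD1] := dD1; have [[x0 D0x0] oD0 _] := dD0.
suff -> : D1 = V by case.
apply/esym; apply: cD1.
- exists x0; have [D1x Dx] := sub D0x0; split => //.
  have [r [c [r0 c0 rD hc]]] := local_bound oD Dx.
  have [r' r'0 rD0] := iffLR (open_polydiscP D0) oD0 _ D0x0.
  exists (Num.min r r'), (Num.sqrt c); split => //; first by rewrite lt_min r0.
  move=> f F [bf hF fF] w; rewrite lt_min => /andP[wr wr'].
  rewrite fF; last exact: rD0.
  rewrite -sqrtrM ?(ltW c0)// -[leLHS]ger0_norm ?normc_ge0// -sqrtr_sqr.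
  by apply: ler_wsqrtr; exact: hc.
- exists V; last by apply/seteqP; split => [y Vy|y []//]; split => //; case: Vy.
  apply/open_polydiscP => y [D1y [r [c [r0 c0 hy]]]].
  have [r' r'0 rD1] := iffLR (open_polydiscP D1) oD1 _ D1y.
  exists (Num.min (r / 2) r'); first by rewrite lt_min divr_gt0.
  move=> w; rewrite lt_min => /andP[wr wr']; split; first exact: rD1.
  exists (r / 2), c; split => //; first by rewrite divr_gt0.
  move=> f F PfF w' ww'; apply: (hy _ _ PfF); rewrite -(subrKA w) (le_lt_trans (nrmD _ _))//.
  by move: wr ww'; lra.
exists (closure V); first exact: closed_closure.
apply/seteqP; split => [y Vy|y [D1y cVy]]; first by split; [case: Vy|exact: subset_closure].
split => //; have [r rr0 rD1] := iffLR (open_polydiscP D1) oD1 _ D1y.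
(* With [w] within [rho] of [y], the polydisc of radius [2 * rho] about [w] lies in [D1], and the
   one of radius [rho] contains [y]. *)
pose rho := r / 4; have rho0 : 0 < rho by rewrite divr_gt0.
have [w [[D1w [r1 [c1 [r10 c10 hw]]]] wy]] := cVy _ (nbhs_polydisc y rho0).
rewrite /= in wy.
have hD1 v : nrm v <= 1 -> D1 (w + (2 * rho)%:C *: v).
  move=> v1; apply: rD1; rewrite addrAC (le_lt_trans (nrmD _ _))// nrmZ normc_real.
  rewrite gtr0_norm ?mulr_gt0//.
  have : 2 * rho * nrm v <= 2 * rho by rewrite ler_piMr// mulr_ge0// ltW.
  by move: wy; rewrite /rho; lra.
have [K K0 hK] := controlled_spread r10 c10 hw rho0 hD1.
exists (rho - nrm (w - y)), K; split => //; first by rewrite subr_gt0.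
move=> f F PfF w' w'y; apply: (hK _ _ PfF); rewrite -(subrKA y) (le_trans (nrmD _ _))//.
by rewrite (nrm_distC y w); move: w'y; lra.
Qed.

Lemma Sq_bounded_ext : balanced D -> D !=set0 -> forall z, D1 z ->
  exists r c, [/\ 0 < r, 0 <= c & forall d w, nrm (w - z) < r -> Sq D d w <= c].
Proof.
move=> bD Dn z D1z; have [r [c [r0 c0 hc]]] := controlled_all D1z.
exists r, (c ^+ 2); split => //; first exact: sqr_ge0.
move=> d w wz; have [Q [QL Q1 <-]] := homog_basis_extremal oD bD Dn d w.
rewrite lerXn2r ?nnegrE ?normc_ge0//.
have PQ : ext_pair (peval Q) (peval Q).
  by split => //; [exact: (homL2_bergman oD QL)|move=> y _; exact: peval_differentiable].
apply: le_trans (hc _ _ PQ w wz) _; rewrite -[leRHS]mulr1 ler_wpM2l//.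
by rewrite -[leRHS]sqrtr1 ler_wsqrtr.
Qed.

End extension.

(** * Limits superior of roots *)

Section limsups.
Context (R : realType) (T : choiceType) (X : filteredType T).
Implicit Types (u v : X -> \bar R) (F : set (set X)).
Local Open Scope ereal_scope.

Lemma esup_le u F V l : F V -> (forall x, V x -> u x <= l) -> limf_esup u F <= l.
Proof.
move=> FV ul; rewrite limf_esupE; apply: (@le_trans _ _ (ereal_sup (u @` V))).
  by apply: ereal_inf_lbound; exists V.
by apply: ge_ereal_sup => _ [x Vx <-]; exact: ul.
Qed.

Lemma esup_lt u F a : limf_esup u F < a ->
  exists V b, [/\ F V, b < a & forall x, V x -> u x <= b].
Proof.
rewrite limf_esupE => /ereal_inf_lt[_ [V FV <-] h]; exists V, (ereal_sup (u @` V)); split => //.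
by move=> x Vx; apply: ereal_sup_ubound; exists x.
Qed.

Lemma esup_gt u F V a : F V -> a < limf_esup u F -> exists2 x, V x & a < u x.
Proof.
move=> FV au; apply: contrapT => nE; move: au; rewrite ltNge => /negP; apply.
apply: (esup_le FV) => x Vx; rewrite leNgt; apply/negP => h; apply: nE; by exists x.
Qed.

Lemma esup_ge u F l : (forall V, F V -> exists2 x, V x & l <= u x) -> l <= limf_esup u F.
Proof.
move=> H; rewrite leNgt; apply/negP => /esup_lt[V [b [FV bl ub]]].
have [x Vx lx] := H V FV; have := le_lt_trans (le_trans lx (ub x Vx)) bl.
by rewrite ltxx.
Qed.

Lemma le_esup u v F : F setT -> (forall x, u x <= v x) -> limf_esup u F <= limf_esup v F.
Proof.
move=> FT uv; rewrite leNgt; apply/negP => /esup_lt[V [b [FV bl ub]]].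
have := esup_le FV (fun x Vx => le_trans (uv x) (ub x Vx)).
by move=> /le_lt_trans/(_ bl); rewrite ltxx.
Qed.

End limsups.

Section extended_order.
Context (R : realType).
Local Open Scope ereal_scope.

Lemma lee_lt_real (x y : \bar R) : (forall a : R, x < a%:E -> y <= a%:E) -> y <= x.
Proof.
case: x => [x| |] H; last 2 first.
- by rewrite leey.
- case: y H => [y| |] H //.
    by exfalso; have := H _ (ltNyr (y - 1)%R); rewrite lee_fin; lra.
  by have := H _ (ltNyr 0%R).
case: y H => [y| |] H; last 2 first.
- by have := H (x + 1)%R; rewrite lte_fin ltrDl ltr01 => /(_ isT).
- exact: leNye.
rewrite lee_fin; apply/ler_addgt0Pl => e e0; have := H (e + x)%R.
by rewrite lte_fin ltrDr e0 lee_fin; exact.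
Qed.

End extended_order.

Section roots.
Context (R : realType).

Lemma root_powR (x : R) d : (0 < d)%N -> 0 <= x -> (x `^ d%:R^-1) ^+ d = x.
Proof.
move=> d0 x0; rewrite -powR_mulrn ?powR_ge0// -powRrM mulVf ?powRr1//.
by rewrite pnatr_eq0 -lt0n.
Qed.

Lemma root_le (x b : R) d : (0 < d)%N -> 0 <= x -> 0 <= b -> (x `^ d%:R^-1 <= b) = (x <= b ^+ d).
Proof.
by move=> d0 x0 b0; rewrite -{2}(root_powR d0 x0) ler_pXn2r// nnegrE ?powR_ge0.
Qed.

Lemma root_ge (x b : R) d : (0 < d)%N -> 0 <= x -> 0 <= b -> (b <= x `^ d%:R^-1) = (b ^+ d <= x).
Proof.
by move=> d0 x0 b0; rewrite -{2}(root_powR d0 x0) ler_pXn2r// nnegrE ?powR_ge0.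
Qed.

Lemma exp_dominates (c b b' : R) : 0 <= b -> b < b' ->
  exists N, forall d, (N <= d)%N -> c * b ^+ d <= b' ^+ d.
Proof.
move=> b0 bb'; have b'0 : 0 < b' by lra.
have [||N hN] := @geo_small R c (b / b') 1 _ _ ltr01.
- by rewrite divr_ge0// ltW.
- by rewrite ltr_pdivrMr// mul1r.
exists N => d /hN; rewrite expr_div_n mulrA ltr_pdivrMr ?exprn_gt0// mul1r.
exact: ltW.
Qed.

(** The multiplier [m] is 1 for [h_f] and 2 for [h_BK]. *)
Lemma limn_esup_root_le (x : nat -> R) (m : nat) (b : R) : (0 < m)%N -> (forall d, 0 <= x d) -> 0 <= b ->
  (forall b', b < b' -> exists N, forall d, (N <= d)%N -> x d <= b' ^+ (m * d)) ->
  (limn_esup (fun d => (x d `^ (m * d)%:R^-1)%:E) <= b%:E)%E.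
Proof.
move=> m0 x0 b0 H; apply: lee_lt_real => a; rewrite lte_fin => ba.
have [N hN] := H a ba; have a0 : 0 <= a by lra.
(* Degree 0 is left out: its exponent is the inverse of 0, that is 0, which would make the root
   equal to 1. *)
apply: (esup_le (V := [set d | (N.+1 <= d)%N])); first by exists N.+1.
move=> d /= Nd; rewrite lee_fin root_le//; first by apply: hN; exact: ltnW.
by rewrite muln_gt0 m0 (leq_trans _ Nd).
Qed.

Lemma limn_esup_root_lt (x : nat -> R) (m : nat) (b : R) : (0 < m)%N -> (forall d, 0 <= x d) -> 0 <= b ->
  (limn_esup (fun d => (x d `^ (m * d)%:R^-1)%:E) < b%:E)%E ->
  exists N, forall d, (N <= d)%N -> x d <= b ^+ (m * d).
Proof.
move=> m0 x0 b0 /esup_lt[V [a [[N _ NV] ab xa]]].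
exists N.+1 => d Nd; have := le_trans (xa d (NV d (ltnW Nd))) (ltW ab).
rewrite lee_fin root_le// muln_gt0 m0.
by rewrite (leq_trans _ Nd).
Qed.

End roots.

(** * Growth of the homogeneous parts *)

Section growth.
Context (R : realType) (n : nat).
Local Notation C := R[i].
Local Notation nrm := (@nrm R n).
Variables (D : set 'rV[C]_n) (oD : open D) (bD : balanced D) (D0 : D !=set0).
Implicit Types (f : 'rV[C]_n -> C) (z w : 'rV[C]_n).

Lemma h_fE f z : h_f D f z =
  limn_esup (fun d => (normc (peval (homog_part D f d) z) `^ (1 * d)%:R^-1)%:E).
Proof. by rewrite /h_f; congr limn_esup; apply/funext => d; rewrite mul1n. Qed.

Lemma h_BKE z : h_BK D z = limn_esup (fun d => (Sq D d z `^ (2 * d)%:R^-1)%:E).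
Proof. by []. Qed.

Lemma Sq_locally_bounded z : D z -> exists r c, [/\ 0 < r, 0 < c,
  forall w, nrm (w - z) < r -> D w & forall d w, nrm (w - z) < r -> Sq D d w <= c].
Proof.
move=> Dz; have [r [c [r0 c0 rD hc]]] := local_bound oD Dz; exists r, c; split => // d w wz.
have [Q [QL Q1 <-]] := homog_basis_extremal oD bD D0 d w.
apply: le_trans (hc _ (homL2_bergman oD QL) w wz) _.
by rewrite -[leRHS]mulr1 ler_wpM2l// ltW.
Qed.

Lemma h_BK_le1 z c : (forall d, Sq D d z <= c) -> (h_BK D z <= 1%:E)%E.
Proof.
move=> hc; rewrite h_BKE; apply: limn_esup_root_le => // [d|b b1]; first exact: Sq_ge0.
have [N hN] := @exp_dominates R c 1 b ler01 b1; exists N => d Nd; apply: le_trans (hc d) _.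
have := hN (2 * d)%N; rewrite expr1n mulr1; apply.
by rewrite (leq_trans Nd)// leq_pmull.
Qed.

Lemma homog_part_Sq f d z : bergman D f ->
  normc (peval (homog_part D f d) z) ^+ 2 <= L2norm2 D f * Sq D d z.
Proof.
move=> bf; apply: le_trans (homog_basis_bound oD bD D0 z (homog_part_homL2 oD bD D0 d bf)) _.
apply: ler_wpM2r; first exact: Sq_ge0.
exact: (homog_part_norm oD bD D0).
Qed.

Lemma h_BK_ge0 z : (0 <= h_BK D z)%E.
Proof.
rewrite h_BKE; apply: esup_ge => V [N _ NV]; exists N; first exact: (NV N (leqnn N)).
by rewrite lee_fin powR_ge0.
Qed.

Lemma h_f_ge0 f z : (0 <= h_f D f z)%E.
Proof. by apply: esup_ge => V [N _ NV]; exists N; [exact: (NV N (leqnn N))|rewrite lee_fin powR_ge0]. Qed.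

Lemma h_f_le_h_BK f z : bergman D f -> (h_f D f z <= h_BK D z)%E.
Proof.
move=> bf; apply: lee_lt_real => a ha.
have a0 : 0 <= a by rewrite -lee_fin (le_trans (h_BK_ge0 z))// ltW.
have [N hN] := @limn_esup_root_lt R (Sq D ^~ z) 2 a isT (fun d => Sq_ge0 D d z) a0 ha.
rewrite h_fE; apply: limn_esup_root_le => // [d|b ab]; first exact: normc_ge0.
have [M hM] := @exp_dominates R (L2norm2 D f) (a ^+ 2) (b ^+ 2) (sqr_ge0 a)
  ltac:(by rewrite ltr_pXn2r// ?nnegrE//; lra).
exists (maxn N M) => d; rewrite geq_max => /andP[Nd Md].
have b0 : 0 <= b by lra.
rewrite -(ler_pXn2r (n := 2))// ?nnegrE ?normc_ge0 ?exprn_ge0// mul1n.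
apply: le_trans (homog_part_Sq d z bf) _.
rewrite -exprM [(d * 2)%N]mulnC exprM; apply: le_trans (hM d Md).
by apply: ler_wpM2l; [exact: L2norm2_ge0|rewrite -exprM; exact: hN].
Qed.

End growth.

(** * Comparison with the gauge *)

Section gauge.
Context (R : realType) (n : nat).
Local Notation C := R[i].
Local Notation nrm := (@nrm R n).
Variables (h : 'rV[C]_n -> R) (hh : balanced_gauge h).
Implicit Types (f : 'rV[C]_n -> C) (z w : 'rV[C]_n).
Local Notation D := (balanced_domain h).

Lemma gauge0 : h 0 = 0.
Proof. by case: hh => _ hZ _; have := hZ 0 0; rewrite scale0r normc0 mul0r. Qed.

Lemma gauge_open : open D.
Proof. by case: hh => _ _ hu; rewrite openE => z /hu. Qed.

Lemma gauge_balanced : balanced D.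
Proof.
case: hh => h0 hZ _ z c; rewrite /balanced_domain/= hZ => z1 c1.
by apply: le_lt_trans z1; rewrite ler_piMl.
Qed.

Lemma gauge_nonempty : D !=set0.
Proof. by exists 0; rewrite /balanced_domain/= gauge0. Qed.

Let oD := gauge_open. Let bD := gauge_balanced. Let Dn := gauge_nonempty.

(** For [a > h z] the point [z / a] lies in [D], where [Sq] is bounded in all degrees; homogeneity
    gives growth at most like [a^(2 d)] at [z]. *)
Lemma h_BK_le_gauge z : (h_BK D z <= (h z)%:E)%E.
Proof.
case: hh => h0 hZ _; rewrite h_BKE; apply: limn_esup_root_le => // [d|b hb]; first exact: Sq_ge0.
pose a := (h z + b) / 2; have hza : h z < a by rewrite /a; lra.
have ab : a < b by rewrite /a; lra.
have a0 : 0 < a by apply: le_lt_trans hza.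
have Da : D (a^-1%:C *: z).
  by rewrite /balanced_domain/= hZ normc_real gtr0_norm ?invr_gt0// mulrC ltr_pdivrMr// mul1r.
have [r [c [r0 c0 _ hc]]] := Sq_locally_bounded oD bD Dn Da.
have [N hN] := @exp_dominates R c a b (ltW a0) ab; exists N => d Nd.
apply: le_trans (hN (2 * d)%N _); last by rewrite (leq_trans Nd)// leq_pmull.
have -> : z = a%:C *: (a^-1%:C *: z).
  by rewrite scalerA -rmorphM divff ?gt_eqF// rmorph1 scale1r.
rewrite (Sq_homog oD bD Dn) normc_real gtr0_norm// -exprM mulnC mulrC.
rewrite mulnC; apply: ler_wpM2r; first by rewrite exprn_ge0// ltW.
by apply: hc; rewrite subrr nrm0.
Qed.

Lemma usc_reg_le_gauge (u : 'rV[C]_n -> \bar R) z : (forall w, (u w <= (h w)%:E)%E) ->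
  (usc_reg u z <= (h z)%:E)%E.
Proof.
case: hh => _ _ hu uh; apply: lee_lt_real => a; rewrite lte_fin => /hu za.
by apply: (esup_le za) => w wa; apply: le_trans (uh w) _; rewrite lee_fin ltW.
Qed.

Lemma usc_reg_mono (u v : 'rV[C]_n -> \bar R) z : (forall w, (u w <= v w)%E) ->
  (usc_reg u z <= usc_reg v z)%E.
Proof. by move=> uv; apply: le_esup => //; exact: filterT. Qed.

Lemma gauge_2_3 f : bergman D f -> (forall z, (h z)%:E = usc_reg (h_f D f) z) ->
  forall z, (h z)%:E = usc_reg (h_BK D) z.
Proof.
move=> bf hf z; apply/eqP; rewrite eq_le (usc_reg_le_gauge _ h_BK_le_gauge) andbT hf.
by apply: usc_reg_mono => w; exact: h_f_le_h_BK.
Qed.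

Lemma gauge_3_1 : (forall z, (h z)%:E = usc_reg (h_BK D) z) -> L2h_domain_of_holomorphy D.
Proof.
move=> h3 [D0 [D1 [dD0 dD1 sub nsub ext]]]; case: hh => h0 hZ _.
have h1 z : D1 z -> h z <= 1.
  move=> D1z; have [r [c [r0 c0 hc]]] := Sq_bounded_ext oD dD0 dD1 sub ext bD Dn D1z.
  rewrite -lee_fin h3; apply: (esup_le (nbhs_polydisc z r0)) => w wz.
  by apply: (h_BK_le1 (c := c)) => d; exact: hc.
apply: nsub => z D1z; rewrite /balanced_domain/= ltNge; apply/negP => hz.
have [_ oD1 _] := dD1; have [t t1 D1t] := dilate_in oD1 D1z.
have := h1 _ D1t; rewrite hZ normc_real gtr0_norm; last lra.
by nra.
Qed.

End gauge.

(** Degrees are chosen in increasing order; step [k] serves the condition [tau k], where the 2-adic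
    valuation [tau] takes each value infinitely often. [s] assigns to a chosen degree the condition
    it was chosen for. *)
Lemma disjoint_selection (G : nat -> nat -> Prop) : exists s : nat -> nat, forall i,
  (forall N, exists2 d, (N <= d)%N & G i d) -> forall N, exists d, [/\ (N <= d)%N, s d = i & G i d].
Proof.
pose tau k := logn 2 k.+1.
have next (p : nat * nat) : exists d, (p.2 <= d)%N /\
    ((exists2 d, (p.2 <= d)%N & G (tau p.1) d) -> G (tau p.1) d).
  case: (pselect (exists2 d, (p.2 <= d)%N & G (tau p.1) d)) => [[d pd Gd]|nE].
    by exists d.
  by exists p.2.
have [nx hnx] := choice next.
pose fix d k := if k is k'.+1 then nx (k, (d k').+1) else nx (0%N, 0%N).
have dS k : (d k < d k.+1)%N by exact: (hnx (k.+1, (d k).+1)).1.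
have dmono : {homo d : j k / (j < k)%N} by apply: homo_ltn => //; exact: ltn_trans.
have dge k : (k <= d k)%N by elim: k => // k ih; exact: leq_ltn_trans (dS k).
have dinj j k : d j = d k -> j = k.
  by move=> e; case: (ltngtP j k) => // /dmono; rewrite e ltnn.
pose P e k := d k = e.
exists (fun e => tau (xget 0%N [set k | d k = e])) => i Gi N.
(* A step at or beyond [N] at which [tau] equals [i]: [k + 1] is [2^i] times an odd number. *)
pose k := (2 ^ i * (2 * N).+1).-1.
have kE : k.+1 = (2 ^ i * (2 * N).+1)%N by rewrite prednK// muln_gt0 expn_gt0.
have tk : tau k = i.
  rewrite /tau kE lognM ?expn_gt0// pfactorK// [X in (_ + X)%N](_ : _ = 0%N) ?addn0//.
  by apply: logn_coprime; rewrite coprime2n /= oddM.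
have Nk : (N <= k)%N.
  rewrite -ltnS kE; apply: (@leq_trans (2 * N).+1); last by rewrite leq_pmull ?expn_gt0.
  by rewrite ltnS leq_pmull.
exists (d k); split; first exact: leq_trans (dge k).
  rewrite (_ : xget _ _ = k)//; apply: dinj.
  exact: (@xgetPex _ 0%N [set k' | d k' = d k] (ex_intro _ k erefl)).
case: k kE tk Nk => [|k] _ tk _.
  by have := (hnx (0%N, 0%N)).2; rewrite /= tk; apply; exact: Gi.
by have := (hnx (k.+1, (d k).+1)).2; rewrite /= tk; apply; exact: Gi.
Qed.

(** * Rational polydiscs *)

Section rational_points.
Context (R : realType) (n : nat).
Local Notation C := R[i].
Local Notation nrm := (@nrm R n).

Definition rat_point (t : n.-tuple (rat * rat)) : 'rV[C]_n :=
  \row_k (ratr (tnth t k).1 +i* ratr (tnth t k).2).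

Lemma rat_point_dense (w : 'rV[C]_n) (e : R) : 0 < e -> exists t, nrm (w - rat_point t) < e.
Proof.
move=> e0; have e20 : 0 < e / 2 by rewrite divr_gt0.
have Q (x : R) : exists q : rat, `|x - ratr q| < e / 2.
  have [q] := @rat_in_itvoo R (x - e / 2) (x + e / 2) ltac:(lra).
  by rewrite in_itv/= -ltr_distl distrC; exists q.
have [q hq] := choice Q.
exists [tuple (q (Re (w ord0 k)), q (Im (w ord0 k))) | k < n].
apply/(nrm_lt _ e0) => k; rewrite !mxE tnth_mktuple /= [ltRHS]splitr.
have := hq (Re (w ord0 k)); have := hq (Im (w ord0 k)); case: (w ord0 k) => x y /= h1 h2.
exact: (@normc_lt_coords R (x, y) (ratr (q x), ratr (q y)) _ h2 h1).
Qed.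

Lemma rat_polydisc_between (z w : 'rV[C]_n) (e : R) : nrm (w - z) < e ->
  exists t (k : nat), nrm (w - rat_point t) < k.+1%:R^-1 /\
    forall y, nrm (y - rat_point t) < k.+1%:R^-1 -> nrm (y - z) < e.
Proof.
move=> wz; pose d := (e - nrm (w - z)) / 2; have d0 : 0 < d by rewrite divr_gt0// subr_gt0.
have [k _ hk] := near_infty_natSinv_lt (PosNum d0).
have kd : k.+1%:R^-1 < d by apply: hk => /=.
have k0 : 0 < (k.+1%:R^-1 : R) by rewrite invr_gt0.
have [t ht] := rat_point_dense w k0; exists t, k; split => // y hy.
have -> : y - z = (y - rat_point t) + ((rat_point t - w) + (w - z)).
  by rewrite (subrKA w) subrKA.
apply: le_lt_trans (nrmD _ _) _; have := nrmD (rat_point t - w) (w - z).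
have := lt_trans hy kd; have := lt_trans ht kd; rewrite (nrm_distC w) /d; lra.
Qed.

End rational_points.

(** * A function of maximal growth *)

Section large_function.
Context (R : realType) (n : nat).
Local Notation C := R[i].
Local Notation nrm := (@nrm R n).
Variables (D : set 'rV[C]_n) (oD : open D) (bD : balanced D) (D0 : D !=set0).

(** The factor [(d+1)^2] undoes the weights of [series_bergman]; being subexponential, it does not
    change the limit superior of the roots. *)
Lemma h_f_ge f z (l : R) : 0 < l -> (forall N, exists2 d, (N <= d)%N &
    l ^+ d <= d.+1%:R ^+ 2 * normc (peval (homog_part D f d) z)) -> (l%:E <= h_f D f z)%E.
Proof.
move=> l0 H; apply: lee_lt_real => a ha; rewrite lee_fin leNgt; apply/negP => al.
have a0 : 0 <= a by rewrite -lee_fin (le_trans (h_f_ge0 D f z))// ltW.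
pose b := (a + l) / 2; have ab : a < b by rewrite /b; lra.
have bl : b < l by rewrite /b; lra.
have b0 : 0 < b by lra.
rewrite h_fE in ha; have [N hN] := limn_esup_root_lt (m := 1) isT (fun d => normc_ge0 _) a0 ha.
(* (d+1)^2 a^d < l^d eventually: split the square over two geometric comparisons *)
pose s := Num.sqrt (b / l); have bl0 : 0 < b / l by rewrite divr_gt0.
have s0 : 0 < s by rewrite sqrtr_gt0.
have s1 : s < 1 by rewrite -[ltRHS]sqrtr1 ltr_sqrt// ltr_pdivrMr// mul1r.
have lin : exists2 K : R, 0 < K & forall d : nat, d.+1%:R * s ^+ d <= K.
  (* Bernoulli's inequality for [1 + x = 1 / s] bounds [(d+1) * s^d]. *)
  pose x := s^-1 - 1; have x0 : 0 < x by rewrite subr_gt0 invf_gt1.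
  exists (Num.max 1 x^-1); first by rewrite lt_max ltr01.
  move=> d; have : 1 + x *+ d <= (1 + x) ^+ d.
    elim: d => [|d ih]; first by rewrite mulr0n addr0 expr0.
    rewrite exprS mulrS; have xd : 0 <= x *+ d by rewrite mulrn_wge0// ltW.
    have := ler_wpM2l (_ : 0 <= 1 + x) ih; move: (x *+ d) xd => y y0 h.
    apply: le_trans (h _); nra.
  have -> : 1 + x = s^-1 by rewrite /x addrC subrK.
  rewrite exprVn => h; rewrite -ler_pdivlMr ?exprn_gt0//; apply: le_trans (ler_wpM2l _ h); last first.
    by rewrite le_max ler01.
  set m := Num.max 1 x^-1; have m1 : 1 <= m by rewrite le_max lexx.
  have mx : 1 <= m * x by rewrite -ler_pdivrMr// div1r le_max lexx orbT.
  rewrite mulrDr mulr1 -natr1 -(mulr_natr x) mulrA; have := ler_wpM2r (ler0n R d) mx.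
  by move: m1; move: (m * x * _) => y; lra.
have [K K0 hK] := lin.
have [M hM] := @exp_dominates R (K ^+ 2 + 1) a b a0 ab.
have [d Nd hd] := H (maxn N M); rewrite geq_max in Nd; have /andP[Nd' Md] := Nd.
have P1 := hN d Nd'; rewrite mul1n in P1.
have sd : (d.+1%:R * s ^+ d) ^+ 2 <= K ^+ 2.
  by rewrite lerXn2r ?nnegrE ?(ltW K0)// mulr_ge0// exprn_ge0// ltW.
have s2 : (s ^+ d) ^+ 2 = b ^+ d / l ^+ d.
  by rewrite -exprM mulnC exprM sqr_sqrtr ?(ltW bl0)// expr_div_n.
have ld0 : 0 < l ^+ d by rewrite exprn_gt0.
have bd0 : 0 < b ^+ d by rewrite exprn_gt0.
have e1 : d.+1%:R ^+ 2 * b ^+ d <= K ^+ 2 * l ^+ d.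
  by move: sd; rewrite exprMn s2 mulrA ler_pdivrMr.
have e2 : l ^+ d <= d.+1%:R ^+ 2 * a ^+ d.
  by apply: le_trans hd _; rewrite ler_wpM2l ?sqr_ge0.
have e3 := hM d Md.
have q0 : 0 < (d.+1%:R : R) ^+ 2 by rewrite exprn_gt0.
have e4 : (K ^+ 2 + 1) * (d.+1%:R ^+ 2 * a ^+ d) <= d.+1%:R ^+ 2 * b ^+ d.
  by rewrite mulrCA ler_wpM2l// ltW.
have K20 : 0 <= K ^+ 2 by exact: sqr_ge0.
have e5 : (K ^+ 2 + 1) * l ^+ d <= K ^+ 2 * l ^+ d.
  by apply: le_trans e1; apply: le_trans e4; rewrite ler_wpM2l// addr_ge0.
by move: e5; rewrite mulrDl mul1r gerDl leNgt ld0.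
Qed.

(* In every rational polydisc where h_BK exceeds a rational level, some point is chosen; the degrees
   are distributed so that f follows an extremal polynomial at each of these points infinitely often. *)
Lemma large_bergman : exists2 f, bergman D f &
  forall z, (usc_reg (h_BK D) z <= usc_reg (h_f D f) z)%E.
Proof.
pose idx := (n.-tuple (rat * rat) * nat * rat)%type.
pose inbox (i : idx) (y : 'rV[C]_n) := nrm (y - rat_point R i.1.1) < i.1.2.+1%:R^-1.
have pts (i : idx) : exists a, (exists y, inbox i y /\ ((ratr i.2 : R)%:E < h_BK D y)%E) ->
    inbox i a /\ ((ratr i.2 : R)%:E < h_BK D a)%E.
  case: (pselect (exists y, inbox i y /\ ((ratr i.2 : R)%:E < h_BK D y)%E)) => [[y hy]|nE].
    by exists y.
  by exists 0.
have [a ha] := choice pts.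
pose b (j : nat) : 'rV[C]_n := if @unpickle idx j is Some i then a i else 0.
pose lev (j : nat) : R := if @unpickle idx j is Some i then ratr i.2 else 0.
have [s hs] := disjoint_selection (fun j d => lev j ^+ (2 * d) <= Sq D d (b j)).
have [Q hQ] := choice (fun d => homog_basis_extremal oD bD D0 d (b (s d))).
have QL d : homL2 D d (Q d) by case: (hQ d).
have Q1 d : L2norm2 D (peval (Q d)) <= 1 by case: (hQ d).
have [f bf hf] := series_bergman oD bD D0 QL Q1.
exists f; first exact: bf.
move=> z; rewrite leNgt; apply/negP => lt.
have [V [l0 [Vz l0l Vl]]] := esup_lt lt.
have [e e0 eV] := iffLR (nbhs_polydiscP z V) Vz.
have z00 : (0 <= l0)%E by apply: le_trans (Vl z (nbhs_singleton Vz)); exact: h_f_ge0.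
(* A rational level between a bound of [h_f] near [z] and the regularization of [h_BK] at [z]. *)
have [l [l0l' lz]] : exists l : rat, (l0 < (ratr l : R)%:E)%E /\ ((ratr l : R)%:E < usc_reg (h_BK D) z)%E.
  case: l0 z00 l0l {Vl} => [x| |] //=; last by move=> _; rewrite ltNge leey.
  rewrite lee_fin => x0.
  case: (usc_reg (h_BK D) z) => [y| |] //.
    by rewrite lte_fin => /rat_in_itvoo[q]; rewrite in_itv/= => /andP[h1 h2]; exists q; rewrite !lte_fin.
  move=> _; have [q] := @rat_in_itvoo R x (x + 1) ltac:(lra).
  by rewrite in_itv/= => /andP[h1 h2]; exists q; rewrite lte_fin ltry.
have lpos : 0 < (ratr l : R) by rewrite -lte_fin; exact: le_lt_trans l0l'.
have [w wz lw] := esup_gt (nbhs_polydisc z e0) lz.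
have [t [k [wt tk]]] := rat_polydisc_between wz.
pose i : idx := (t, k, l).
have [bi li] := ha i (ex_intro _ w (conj wt lw)).
have bE : b (pickle i) = a i by rewrite /b pickleK.
have lE : lev (pickle i) = ratr l by rewrite /lev pickleK.
have inf N : exists2 d, (N <= d)%N & lev (pickle i) ^+ (2 * d) <= Sq D d (b (pickle i)).
  rewrite bE lE; rewrite h_BKE in li.
  have NV : (\oo : set (set nat)) [set d | (N.+1 <= d)%N] by exists N.+1.
  have [d Nd hd] := esup_gt NV li.
  exists d; first exact: ltnW.
  rewrite -root_ge ?Sq_ge0 ?(ltW lpos)//; first by move: hd; rewrite lte_fin => /ltW.
  by rewrite muln_gt0 /= (leq_trans _ Nd).
have : ((ratr l : R)%:E <= h_f D f (a i))%E.
  apply: h_f_ge => // N; have [d [Nd sd Gd]] := hs _ inf N; exists d => //.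
  rewrite hf normcM normc_real ger0_norm ?invr_ge0 ?exprn_ge0//.
  rewrite mulrA divff ?mul1r; last by rewrite expf_neq0// pnatr_eq0.
  rewrite -(ler_pXn2r (n := 2))// ?nnegrE ?normc_ge0 ?exprn_ge0 ?(ltW lpos)//.
  have [_ _] := hQ d; rewrite sd bE => ->.
  by move: Gd; rewrite lE bE mulnC exprM.
move=> h; have := Vl (a i) (eV _ (tk _ bi)) => h2.
by have := lt_le_trans l0l' (le_trans h h2); rewrite ltxx.
Qed.

End large_function.

(** * Balanced domains of holomorphy *)

Section star_shaped.
Context (R : realType) (n : nat).
Local Notation C := R[i].
Local Notation nrm := (@nrm R n).

Lemma continuous_dilation (z : 'rV[C]_n) : continuous (fun t : R => t%:C *: z).
Proof.
move=> t U /nbhs_polydiscP[e e0 eU].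
have z0 : 0 < nrm z + 1 by have := nrm_ge0 z; lra.
exists (e / (nrm z + 1)); first by rewrite /= divr_gt0.
move=> s /= ts; apply: eU; rewrite -scalerBl -rmorphB nrmZ normc_real distrC.
by move: ts; rewrite ltr_pdivlMr//; have := normr_ge0 (t - s); nra.
Qed.

(** The set is a union of segments that share the point 0. *)
Lemma star_shaped_connected (U : set 'rV[C]_n) : U 0 ->
  (forall z (t : R), U z -> 0 <= t <= 1 -> U (t%:C *: z)) -> connected U.
Proof.
move=> U0 hU; pose seg (z : 'rV[C]_n) := (fun t : R => t%:C *: z) @` `[0, 1]%classic.
have -> : U = \bigcup_(z in U) seg z.
  apply/seteqP; split=> [z Uz|w [z Uz [t]]].
    exists z => //; exists 1; first by rewrite /= in_itv/= ler01 lexx.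
    by rewrite rmorph1 scale1r.
  by rewrite /= in_itv/= => t01 <-; exact: hU.
apply: bigcup_connected.
  exists 0 => z _; exists 0; first by rewrite /= in_itv/= ler01 lexx.
  by rewrite rmorph0 scale0r.
move=> z _; apply: connected_continuous_connected.
  exact: (@segment_connected R 0 1).
apply: continuous_subspaceT; exact: continuous_dilation.
Qed.

End star_shaped.

(** * Extension across a boundary point *)

Section domain_of_holomorphy.
Context (R : realType) (n : nat).
Local Notation C := R[i].
Local Notation nrm := (@nrm R n).
Variables (h : 'rV[C]_n -> R) (hh : balanced_gauge h).
Local Notation D := (balanced_domain h).
Let oD : open D := gauge_open hh.
Let bD : balanced D := gauge_balanced hh.
Let Dn : D !=set0 := gauge_nonempty hh.

Lemma gauge_domain : domain D.
Proof.
split => //; apply: star_shaped_connected; first exact: balanced0.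
move=> z t Dz /andP[t0 t1]; apply: bD => //.
by rewrite normc_real ger0_norm.
Qed.

(** Provides the exponential bound assumed in [hartogs]: [s] scales the polydisc about [z0] into one
    about 0 where [Sq] is bounded. The degree is positive because the constant term may exceed
    [M^0 = 1]. *)
Lemma homog_part_growth z0 (r : R) g : bergman D g -> exists M : R, forall d w, (0 < d)%N ->
  nrm (w - z0) <= r -> normc (peval (homog_part D g d) w) <= M ^+ d.
Proof.
move=> bg; have D00 := balanced0 bD Dn.
have [rho [c [rho0 c0 _ hc]]] := Sq_locally_bounded oD bD Dn D00.
pose s := rho / 2 / (nrm z0 + `|r| + 1).
have q0 : 0 < nrm z0 + `|r| + 1 by have := nrm_ge0 z0; have := normr_ge0 r; lra.
have s0 : 0 < s by rewrite !divr_gt0.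
(* As [G >= 1], the bound [G] on a square is at most [(G^d)^2] for [d > 0], which spares a square
   root. *)
pose G := L2norm2 D g * c + 1.
have G0 : 1 <= G by rewrite lerDr mulr_ge0 ?L2norm2_ge0// ltW.
exists (G / s) => d w d0 wr.
have sw : nrm (s%:C *: w - 0) < rho.
  rewrite subr0 nrmZ normc_real gtr0_norm// /s mulrAC ltr_pdivrMr//.
  have : nrm w <= nrm z0 + `|r| + 1.
    rewrite -[w](subrK z0) (le_trans (nrmD _ _))//.
    by have := ler_norm r; lra.
  by have := nrm_ge0 w; nra.
have sd0 : 0 < s ^+ d by rewrite exprn_gt0.
have := homog_part_Sq oD bD Dn d (s%:C *: w) bg.
move=> /le_trans/(_ (ler_wpM2l (L2norm2_ge0 D g) (hc d _ sw))).
rewrite (peval_homog _ _ (homog_part_homL2 oD bD Dn d bg).1) normcM normcX normc_real gtr0_norm// => H.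
rewrite expr_div_n ler_pdivlMr// mulrC.
have Gd : G <= G ^+ d by rewrite ler_eXnr.
have : (s ^+ d * normc (peval (homog_part D g d) w)) ^+ 2 <= (G ^+ d) ^+ 2.
  apply: le_trans H _; apply: (@le_trans _ _ G); first by rewrite lerDl.
  apply: le_trans Gd _; rewrite ler_eXnr//.
  by rewrite exprn_ege1.
by rewrite ler_pXn2r// ?nnegrE ?exprn_ge0 ?mulr_ge0 ?normc_ge0//; lra.
Qed.

Lemma homog_part_hartogs z0 (r a : R) g : 0 < r -> 0 < a -> bergman D g ->
  (exists2 b : R, b < a & forall w, nrm (w - z0) <= r -> (h_BK D w <= b%:E)%E) ->
  exists b : R, [/\ 0 < b, b < a & exists N, forall d w, (N <= d)%N -> nrm (w - z0) <= r / 2 ->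
    normc (peval (homog_part D g d) w) <= b ^+ d].
Proof.
move=> r0 a0 bg [b ba hb]; have [M hM] := homog_part_growth z0 r bg.
pose a1 := (Num.max b 0 + a) / 2.
have m0 : 0 <= Num.max b 0 by rewrite le_max lexx orbT.
have ma : Num.max b 0 < a by rewrite gt_max ba.
have bm : b <= Num.max b 0 by rewrite le_max lexx.
have a10 : 0 < a1 by rewrite /a1; lra.
have a1a : a1 < a by rewrite /a1; lra.
have ba1 : b < a1 by rewrite /a1; lra.
have peval0 w : peval (0 : mpoly n C) w = 0 by exact: meval0.
(* The constant term may exceed [M^0 = 1]; it is replaced by 0, and the conclusion is drawn in
   positive degrees. *)
pose P d := if d is 0 then 0 else homog_part D g d.
have [|w wr|b' [b'0 b'a [N hN]]] := @hartogs R n P z0 r M a1 a r0 a10 a1a.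
- by case=> [|d] w wr; [rewrite /P peval0 normc0 expr0|exact: hM].
- have lt : (h_f D g w < a1%:E)%E.
    apply: le_lt_trans (h_f_le_h_BK oD bD Dn w bg) _.
    by apply: le_lt_trans (hb w wr) _; rewrite lte_fin.
  rewrite h_fE in lt; have [N hN] := limn_esup_root_lt (m := 1) isT (fun d => normc_ge0 _) (ltW a10) lt.
  exists N => -[|d] Nd; first by rewrite /P peval0 normc0 expr0.
  by have := hN _ Nd; rewrite mul1n.
exists b'; split => //; exists N.+1 => -[|d] w // Nd wr.
exact: (hN d.+1 w (ltnW Nd) wr).
Qed.

Lemma cdiff_psum (P : nat -> mpoly n C) N w : cdiff (fun z => \sum_(d < N) peval (P d) z) w.
Proof.
elim: N => [|N [l1 h1]].
  exists (fun=> 0); under eq_fun do rewrite big_ord0; exact: cdiff_with_cst.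
have [l2 h2] := peval_cdiff (P N) w; exists (fun k => l1 k + l2 k).
under eq_fun do rewrite big_ord_recr/=.
exact: (cdiff_withD h1 h2).
Qed.

(* If h_f^* is smaller than h at a point, all functions extend past the corresponding boundary point,
   through the dilates of the polydisc provided by Hartogs' lemma. *)
Lemma gauge_1_2 : L2h_domain_of_holomorphy D ->
  exists2 f, bergman D f & forall z, (h z)%:E = usc_reg (h_f D f) z.
Proof.
move=> hD; have [f bf hf] := large_bergman oD bD Dn.
exists f; first exact: bf.
move=> z0; apply/eqP; rewrite eq_le andbC.
have hfh w : (h_f D f w <= (h w)%:E)%E.
  by apply: le_trans (h_f_le_h_BK oD bD Dn w bf) _; exact: h_BK_le_gauge.
rewrite (usc_reg_le_gauge hh _ hfh) /= leNgt; apply/negP => lt.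
pose a := h z0; have [h0 hZ _] := hh.
have [V [b0 [Vz b0a hb0]]] := esup_lt (le_lt_trans (hf z0) lt).
have [r1 r10 rV] := iffLR (nbhs_polydiscP z0 V) Vz.
have b00 : (0 <= b0)%E by apply: le_trans (hb0 z0 (nbhs_singleton Vz)); exact: h_BK_ge0.
have [b [bb ba hb]] : exists b : R, [/\ 0 <= b, b < a & forall w, nrm (w - z0) <= r1 / 2 ->
    (h_BK D w <= b%:E)%E].
  case: b0 b00 b0a hb0 => [b| |] //; rewrite lee_fin lte_fin => b0 ba hb.
  by exists b; split => // w wr; apply/hb/rV; move: wr; lra.
have a0 : 0 < a by lra.
pose r := r1 / 2; have r0 : 0 < r by rewrite divr_gt0.
(* The second set consists of dilates of a polydisc about [z0], the largest being centred at the
   boundary point [z0 / h z0]. Taking all smaller dilates makes [D1] star-shaped, hence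
   connected. *)
pose D1 := D `|` [set w | exists s v, [/\ 0 < s, s <= a^-1, nrm (v - z0) < r / 2 & w = s%:C *: v]].
have D1a : D1 (a^-1%:C *: z0).
  by right; exists a^-1, z0; rewrite invr_gt0 lexx subrr nrm0 divr_gt0.
have key g : bergman D g -> exists b' : R, [/\ 0 < b', b' < a & exists N, forall d w, (N <= d)%N ->
    nrm (w - z0) <= r / 2 -> normc (peval (homog_part D g d) w) <= b' ^+ d].
  by move=> bg; apply: homog_part_hartogs => //; exists b.
have hom g d (s : R) v : bergman D g -> 0 < s ->
    normc (peval (homog_part D g d) (s%:C *: v)) = s ^+ d * normc (peval (homog_part D g d) v).
  move=> bg s0; rewrite (peval_homog _ _ (homog_part_homL2 oD bD Dn d bg).1).
  by rewrite normcM normcX normc_real gtr0_norm.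
pose S g N w := \sum_(d < N) peval (homog_part D g d) w.
(* Locally uniform Cauchy estimates rather than convergence, because the limit is constructed from
   them afterwards. *)
have unif g z : bergman D g -> D1 z -> exists2 e, 0 < e & forall eps : R, 0 < eps ->
    exists N, forall j k w, (N <= j)%N -> (N <= k)%N -> nrm (w - z) < e ->
      normc (S g j w - S g k w) <= eps.
  move=> bg [Dz|[s [v [s0 sa vr ->]]]].
    have [U /nbhs_polydiscP[e e0 eU] cU] := (homog_partP oD bD Dn bg.1).2 z Dz.
    exists e => // eps eps0; have eps20 : 0 < eps / 2 by rewrite divr_gt0.
    have [N hN] := iffLR (uniform_cvgP _ _ _) cU _ eps20.
    exists N => j k w Nj Nk wz; rewrite -(subrKA (g w)) (le_trans (normcD _ _))//.
    have := hN j w Nj (eU w wz); have := hN k w Nk (eU w wz).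
    by rewrite [normc (g w - _)]normc_distC -/(S g j w) -/(S g k w); lra.
  have [b' [b'0 b'a [N0 hN0]]] := key g bg.
  pose e := s * (r / 2 - nrm (v - z0)).
  exists e; first by rewrite mulr_gt0// subr_gt0.
  (* [s <= 1 / a] and [b' < a] make the ratio [t] smaller than 1. *)
  move=> eps eps0; pose t := s * b'.
  have t0 : 0 <= t by rewrite mulr_ge0// ltW.
  have t1 : t < 1.
    apply: (@le_lt_trans _ _ (a^-1 * b')); first by rewrite ler_wpM2r// ltW.
    by rewrite mulrC ltr_pdivrMr// mul1r.
  have [N hN] := geo_small (1 - t)^-1 t0 t1 eps0.
  have main j k w : (maxn N N0 <= k)%N -> (k <= j)%N -> nrm (w - s%:C *: v) < e ->
      normc (S g j w - S g k w) <= eps.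
    rewrite geq_max => /andP[Nk N0k] kj wz.
    pose v' := s^-1%:C *: w.
    have wE : w = s%:C *: v' by rewrite scalerA -rmorphM divff ?gt_eqF// rmorph1 scale1r.
    have v'r : nrm (v' - z0) <= r / 2.
      rewrite -(subrKA v) (le_trans (nrmD _ _))//; move: wz; rewrite wE -scalerBr nrmZ normc_real.
      by rewrite gtr0_norm// /e ltr_pM2l//; clear; lra.
    rewrite /S -(subnKC kj) big_split_ord/= addrAC subrr add0r (le_trans (normc_sum _ _ _))//.
    apply: (@le_trans _ _ (\sum_(i < j - k) t ^+ k * t ^+ i)).
      apply: ler_sum => i _; rewrite wE hom// -exprD /t exprMn; apply: ler_wpM2l.
        by rewrite exprn_ge0// ltW.
      by apply: hN0 => //; rewrite (leq_trans N0k)// leq_addr.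
    rewrite -mulr_sumr; apply: (@le_trans _ _ (t ^+ k * (1 - t)^-1)).
      apply: ler_wpM2l; first exact: exprn_ge0.
      rewrite -[leRHS]mul1r ler_pdivlMr ?subr_gt0// mulrC -opprB mulNr -subrX1 opprB gerBl.
      exact: exprn_ge0.
    by rewrite mulrC; exact/ltW/hN.
  exists (maxn N N0) => j k w Nj Nk wz; case/orP: (leq_total k j) => h'; first exact: main.
  by rewrite normc_distC; exact: main.
have oD1 : open D1.
  apply/open_polydiscP => z [Dz|[s [v [s0 sa vr ->]]]].
    have [e e0 eD] := iffLR (open_polydiscP D) oD z Dz.
    by exists e => // w /eD; left.
  exists (s * (r / 2 - nrm (v - z0))); first by rewrite mulr_gt0// subr_gt0.
  move=> w wz; right; exists s, (s^-1%:C *: w); split => //; last first.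
    by rewrite scalerA -rmorphM divff ?gt_eqF// rmorph1 scale1r.
  rewrite -(subrKA v) (le_lt_trans (nrmD _ _))//.
  have -> : s^-1%:C *: w - v = s^-1%:C *: (w - s%:C *: v).
    by rewrite scalerBr scalerA -rmorphM mulVf ?gt_eqF// rmorph1 scale1r.
  rewrite nrmZ normc_real gtr0_norm ?invr_gt0//.
  have : s^-1 * nrm (w - s%:C *: v) < r / 2 - nrm (v - z0) by rewrite mulrC ltr_pdivrMr// mulrC.
  by lra.
apply: hD; exists D, D1; split.
- exact: gauge_domain.
- split; [by exists (a^-1%:C *: z0)|exact: oD1|].
  apply: star_shaped_connected; first by left; exact: (balanced0 bD Dn).
  move=> z t [Dz|[s [v [s0 sa vr ->]]]] /andP[t0 t1].
    by left; apply: bD => //; rewrite normc_real ger0_norm.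
  have [->|tn0] := eqVneq t 0; first by left; rewrite rmorph0 scale0r; exact: (balanced0 bD Dn).
  right; exists (t * s), v; split => //.
  + by rewrite mulr_gt0// lt_neqAle eq_sym tn0.
  + by apply: le_trans sa; rewrite ler_piMl// ltW.
  + by rewrite scalerA -rmorphM.
- by move=> z Dz; split => //; left.
- move=> /(_ _ D1a); rewrite /balanced_domain/= hZ normc_real gtr0_norm ?invr_gt0//.
  by rewrite mulVf ?gt_eqF// ltxx.
move=> g bg.
have lim z : exists l, D1 z -> forall e : R, 0 < e -> exists N, forall k, (N <= k)%N ->
    normc (S g k z - l) <= e.
  case: (pselect (D1 z)) => [D1z|nD]; last by exists 0.
  have [e e0 he] := unif g z bg D1z.
  have zz : nrm (z - z) < e by rewrite subrr nrm0.
  have cau (eps : R) : 0 < eps -> exists N, forall j k, (N <= j)%N -> (N <= k)%N ->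
      normc (S g j z - S g k z) <= eps.
    by move=> /he[N hN]; exists N => j k Nj Nk; exact: hN.
  have [l hl] := @complex_cauchy R (fun k => S g k z) cau; by exists l.
have [F hF] := choice lim; exists F.
  move=> z D1z; apply/differentiableE; have [e e0 he] := unif g z bg D1z.
  have [e' e'0 eD1] := iffLR (open_polydiscP D1) oD1 z D1z.
  pose q := Num.min e e'; have qe : q <= e by rewrite ge_min lexx.
  have qe' : q <= e' by rewrite ge_min lexx orbT.
  have q0 : 0 < q by rewrite lt_min e0.
  clearbody q.
  apply: (@cdiff_uniform_limit _ _ (S g) F z (q / 2)); first by rewrite divr_gt0.
    by move=> N w _; exact: cdiff_psum.
  move=> eps eps0; have eps20 : 0 < eps / 2 by rewrite divr_gt0.
  have [N hN] := he _ eps20; exists N => k w Nk wq.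
  have D1w : D1 w by apply: eD1; clear -wq qe' q0; lra.
  have we : nrm (w - z) < e by clear -wq qe q0; lra.
  have [M hM] := hF w D1w _ eps20.
  have := hM (N + M)%N (leq_addl _ _); have := hN k (N + M)%N w Nk (leq_addr _ _) we.
  have -> : S g k w - F w = (S g k w - S g (N + M)%N w) + (S g (N + M)%N w - F w) by rewrite subrKA.
  move=> h1 h2; apply: le_trans (normcD _ _) _.
  by rewrite [leRHS]splitr lerD.
move=> z Dz; have D1z : D1 z by left.
apply/eqP; rewrite -subr_eq0 -normc_eq0 eq_le normc_ge0 andbT.
apply/ler_addgt0Pl => e e0; rewrite addr0; have e20 : 0 < e / 2 by rewrite divr_gt0.
have [N1 h1] := hF z D1z _ e20.
have [N2 h2] := homog_expansion_cvg (homog_partP oD bD Dn bg.1) Dz e20.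
have := h1 (N1 + N2)%N (leq_addr _ _); have := h2 (N1 + N2)%N (leq_addl _ _).
rewrite -/(S g (N1 + N2)%N z) => g1 g2.
have -> : F z - g z = (S g (N1 + N2)%N z - g z) - (S g (N1 + N2)%N z - F z) by ring.
by apply: le_trans (normcB _ _) _; rewrite [leRHS]splitr lerD// ltW.
Qed.

End domain_of_holomorphy.
Theorem theorem2 (R : realType) (n : nat) (hn : (0 < n)%N)
    (h : 'rV[R[i]]_n -> R) (hh : balanced_gauge h) :
  let D := balanced_domain h in
  [<-> L2h_domain_of_holomorphy D;
       exists2 f : 'rV[R[i]]_n -> R[i],
         bergman D f & forall z, (h z)%:E = usc_reg (h_f D f) z;
       forall z, (h z)%:E = usc_reg (h_BK D) z].
Proof.
move=> D; tfae.
- exact: gauge_1_2.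
- by move=> [f bf hf]; exact: (gauge_2_3 hh bf hf).
- exact: gauge_3_1.
Qed.
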